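(* Let $0<|q|<1$, $n>s\ge1$ with $n\ge2$, $\underline{a}=(a_1,\dots,a_n)\in(q^{\mathbb{R}})^n$, $\underline{b}=(b_1,\dots,b_s)\in(q^{\mathbb{R}}\setminus q^{-\mathbb{N}})^s$, $\lambda\in\mathbb{C}^\times$, and let $\alpha_i,\beta_j\in\mathbb{R}$ be such that $a_i=q^{\alpha_i}$ and $b_j=q^{\beta_j}$. Consider the $q$-difference operator $$\mathcal{H}=z\lambda\prod_{i=1}^n(a_i\sigma_q-1)-\prod_{j=1}^s\left(\tfrac{b_j}{q}\sigma_q-1\right)$$ and let $G^\delta$ be its $(\sigma_q,\delta)$-Galois group over $\mathbf{L}$. Assume that $\alpha_i-\beta_j\notin\mathbb{Z}$ for all $(i,j)\in\{1,\dots,n\}\times\{1,\dots,s\}$, and that the algebraic group generated by $\mathrm{Diag}(e^{2i\pi\alpha_1},\dots,e^{2i\pi\alpha_n})$ is connected. Then $G^\delta=\mathrm{GL}_n(\widetilde{\mathbb{C}})$. Furthermore, if $b_1=q$, then the series ${}_n\Phi_s(\underline{a},\underline{b},\lambda,q;z),\dots,\sigma_q^{n-1}\left({}_n\Phi_s(\underline{a},\underline{b},\lambda,q;z)\right)$ are $\delta$-algebraically independent over $\mathbb{C}(z)$.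
   Context: Fix a determination $\log q$; for $\alpha\in\mathbb{C}$ put $q^\alpha=e^{\alpha\log q}$, and $q^{\mathbb{R}}=\{q^\alpha:\alpha\in\mathbb{R}\}$, $q^{-\mathbb{N}}=\{q^{-m}:m\in\mathbb{N}\}$ with $0\in\mathbb{N}$. $\sigma_q(f(z))=f(qz)$. The basic hypergeometric series is the formal power series $${}_n\Phi_s(\underline{a},\underline{b},\lambda,q;z)=\sum_{m\ge0}\frac{\prod_{i=1}^n(1-a_i)(1-a_iq)\cdots(1-a_iq^{m-1})}{\prod_{j=1}^s(1-b_j)(1-b_jq)\cdots(1-b_jq^{m-1})}\lambda^mz^m .$$ The Galois group of $\mathcal{H}$ is that of its companion system: expanding $\mathcal{H}=\sum_{k=0}^n c_k(z)\sigma_q^k$, this is $\sigma_q(Y)=AY$ where $A\in\mathrm{GL}_n(\mathbb{C}(z))$ has $1$'s on the superdiagonal, last row $(-c_0/c_n,\dots,-c_{n-1}/c_n)$, zeros elsewhere. The algebraic group generated by a matrix is the Zariski closure in $\mathrm{GL}_n(\mathbb{C})$ of the group it generates. Let $\overline{\mathbb{C}(z)}$ be the algebraic closure of $\mathbb{C}(z)$ in $\bigcup_{j\ge1}\mathbb{C}((z^{1/j}))$, with $\sigma_q$ extended by $z^{1/j}\mapsto q_jz^{1/j}$ for a fixed sequence with $q_j^j=q$ and $q_j^l=q_k$ if $j=lk$, and $\delta=z\frac{d}{dz}$. Let $\widetilde{\mathbb{C}}$ be a $\delta$-closed field containing $\mathbb{C}$ (with zero derivation on $\mathbb{C}$): every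 system of $\delta$-polynomial equations over $\widetilde{\mathbb C}$ with a solution in some $\delta$-field extension has one in $\widetilde{\mathbb C}$. Let $\sigma_q$ act trivially on $\widetilde{\mathbb{C}}$, and let $\mathbf{L}=\mathrm{Frac}(\widetilde{\mathbb{C}}\otimes_{\mathbb{C}}\overline{\mathbb{C}(z)})$, a $(\sigma_q,\delta)$-field with $\mathbf{L}^{\sigma_q}=\widetilde{\mathbb{C}}$. A $(\sigma_q,\delta)$-Picard-Vessiot ring for $\sigma_q(Y)=AY$ over $\mathbf{L}$ is an $\mathbf{L}$-algebra $S$ with a compatible automorphism $\sigma_q$ and derivation $\delta$ commuting with each other, generated as $\mathbf{L}$-$\delta$-algebra by the entries of some $U\in\mathrm{GL}_n(S)$ with $\sigma_q(U)=AU$ and by $\det(U)^{-1}$, and with no ideals stable under $\sigma_q$ and $\delta$ except $\{0\}$ and $S$. With $\mathcal{Q}_S$ its total ring of quotients, the $(\sigma_q,\delta)$-Galois group $G^\delta$ is the group of $\mathbf{L}$-automorphisms of $\mathcal{Q}_S$ commuting with $\sigma_q,\delta$, embedded in $\mathrm{GL}_n(\widetilde{\mathbb{C}})$ by $\phi\mapsto U^{-1}\phi(U)$. Elements $f_1,\dots,f_m$ are $\delta$-algebraically independent over $\mathbb{C}(z)$ if the family of all $\delta^k(f_i)$, $k\ge0$, $1\le i\le m$, is algebraically independent over $\mathbb{C}(z)$. *)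

(* Defs.v *)
From HB Require Import structures.
From mathcomp Require Import all_boot all_order all_algebra complex.
From mathcomp Require Import boolp classical_sets functions cardinality fsbigop.
From mathcomp Require Import reals topology sequences exp trigo.
From mathcomp Require Import -(notations) mpoly.
From mathcomp Require Import ring lra.

Set Implicit Arguments.
Unset Strict Implicit.
Unset Printing Implicit Defensive.

Import Order.TTheory GRing.Theory Num.Theory.

Local Open Scope classical_set_scope.
Local Open Scope ring_scope.

Section PuiseuxSupport.
Variable F : fieldType.
Implicit Types (f g h : rat -> F) (r s t : rat) (j N : nat).

(* [f] stands for the formal sum of the [f r * z^r]; its support lies in
   (1/j)Z and is bounded below. *)
Definition psupp j N f :=
  forall r, f r != 0 -> (j%:R * r \is a Num.int) /\ - N%:R <= r.

Definition is_puiseux f := exists j N, (0 < j)%N /\ psupp j N f.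

Definition puiseux_pred : {pred rat -> F} := fun f => `[< is_puiseux f >].

Lemma puiseux_predP f : reflect (is_puiseux f) (f \in puiseux_pred).
Proof. exact: asboolP. Qed.

Lemma psuppW j k N M f : (0 < k)%N -> (N <= M)%N ->
  psupp j N f -> psupp (k * j) M f.
Proof.
move=> k0 NM H r /H[Hi Hb]; split.
  by rewrite natrM -mulrA rpredM // intr_nat.
by apply: le_trans Hb; rewrite lerN2 ler_nat.
Qed.

Lemma puiseux_common2 f g : is_puiseux f -> is_puiseux g ->
  exists j N, [/\ (0 < j)%N, psupp j N f & psupp j N g].
Proof.
move=> [j [N [j0 Hf]]] [k [M [k0 Hg]]].
exists (j * k)%N, (N + M)%N; split; first by rewrite muln_gt0 j0.
  by rewrite mulnC; apply: (psuppW _ _ Hf) => //; apply: leq_addr.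
by apply: (psuppW _ _ Hg) => //; apply: leq_addl.
Qed.

Lemma puiseux_common3 f g h : is_puiseux f -> is_puiseux g -> is_puiseux h ->
  exists j N, [/\ (0 < j)%N, psupp j N f, psupp j N g & psupp j N h].
Proof.
move=> Hf Hg [k [M [k0 Hh]]].
have [j [N [j0 Hjf Hjg]]] := puiseux_common2 Hf Hg.
exists (j * k)%N, (N + M)%N; split; first by rewrite muln_gt0 j0.
- by rewrite mulnC; apply: (psuppW _ _ Hjf) => //; apply: leq_addr.
- by rewrite mulnC; apply: (psuppW _ _ Hjg) => //; apply: leq_addr.
by apply: (psuppW _ _ Hh) => //; apply: leq_addl.
Qed.

Lemma puiseux_zmod_closed : zmod_closed puiseux_pred.
Proof.
split.
  by apply/puiseux_predP; exists 1%N, 0%N; split=> // r; rewrite eqxx.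
move=> f g /puiseux_predP Hf /puiseux_predP Hg; apply/puiseux_predP.
have [j [N [j0 Hjf Hjg]]] := puiseux_common2 Hf Hg.
exists j, N; split=> // r Hr.
have [f0|/Hjf//] := eqVneq (f r) 0.
have [g0|/Hjg//] := eqVneq (g r) 0.
by move: Hr; rewrite !fctE /= f0 g0 subr0 eqxx.
Qed.

HB.instance Definition _ :=
  GRing.isZmodClosed.Build (rat -> F) puiseux_pred puiseux_zmod_closed.

Definition pconv f g : rat -> F :=
  fun r => \sum_(s \in [set: rat]) f s * g (r - s).

Lemma pconv_seq f g r (W : seq rat) : uniq W ->
  (forall s, f s != 0 -> g (r - s) != 0 -> s \in W) ->
  pconv f g r = \sum_(s <- W) f s * g (r - s).
Proof.
move=> uW HW; rewrite /pconv [RHS]fsbig_seq //; apply/esym/(fsbig_widen [set` W] setT) => //.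
move=> s [_ /= /negP sW]; apply/eqP; rewrite mulf_eq0.
by apply: contraNT sW; rewrite negb_or => /andP[]; apply: HW.
Qed.

Lemma pconv_neq0 f g r : pconv f g r != 0 ->
  exists s, f s != 0 /\ g (r - s) != 0.
Proof.
move=> H; apply: contrapT => /forallNP Hn; move/eqP: H; apply.
rewrite /pconv fsbig1 // => s _; apply/eqP; rewrite mulf_eq0.
by apply: contra_notT (Hn s); rewrite negb_or => /andP[].
Qed.

Lemma pconv_supp j N M f g : psupp j N f -> psupp j M g ->
  psupp j (N + M) (pconv f g).
Proof.
move=> Hf Hg r /pconv_neq0[s [/Hf[fi fb] /Hg[gi gb]]]; split.
  by rewrite -[r](subrK s) mulrDr rpredD.
by rewrite natrD; lra.
Qed.

Definition pwindow j N M : seq rat :=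
  [seq k%:R / j%:R - N%:R | k <- iota 0 (j * (N + M)).+1].

Lemma pwindow_uniq j N M : (0 < j)%N -> uniq (pwindow j N M).
Proof.
move=> j0; rewrite map_inj_uniq ?iota_uniq // => x y /addIr.
have jn0 : j%:R != 0 :> rat by rewrite pnatr_eq0 -lt0n.
by move/(mulIf (invr_neq0 jn0))/eqP; rewrite eqr_nat => /eqP.
Qed.

Lemma pwindowP j N M r : (0 < j)%N -> j%:R * r \is a Num.int ->
  - N%:R <= r -> r <= M%:R -> r \in pwindow j N M.
Proof.
move=> j0 Hi Hb HM.
have jp : 0 < j%:R :> rat by rewrite ltr0n.
have Hn : j%:R * (r + N%:R) \is a Num.nat.
  rewrite natrEint; apply/andP; split.
    by rewrite mulrDr; apply: rpredD => //; rewrite -natrM intr_nat.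
  by apply: mulr_ge0; [exact: ltW | lra].
have [k Hk] : exists k, j%:R * (r + N%:R) = k%:R by apply/natrP.
apply/mapP; exists k.
  rewrite mem_iota /= add0n ltnS -(ler_nat rat) -Hk natrM natrD.
  by rewrite ler_pM2l //; lra.
by rewrite -Hk mulrAC mulfV ?lt0r_neq0 // mul1r addrK.
Qed.

Lemma pwindow_le j N M r : (0 < j)%N -> r \in pwindow j N M -> r <= M%:R.
Proof.
move=> j0 /mapP[k]; rewrite mem_iota add0n /= ltnS => Hk ->.
have jp : 0 < j%:R :> rat by rewrite ltr0n.
have : k%:R <= (j * (N + M))%:R :> rat by rewrite ler_nat.
rewrite lerBlDr ler_pdivrMr // natrM natrD => H; apply: (le_trans H).
by rewrite mulrC [_ + N%:R]addrC.
Qed.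

Definition rbound r : nat := Num.bound r.
Lemma rboundP r : r <= (rbound r)%:R.
Proof.
have [r0|/ltW r0] := leP 0 r; first exact/ltW/archi_boundP.
by apply: le_trans r0 _; rewrite ler0n.
Qed.

Lemma pconvC f g : is_puiseux f -> is_puiseux g -> pconv f g = pconv g f.
Proof.
move=> Hf Hg; have [j [N [j0 Hjf Hjg]]] := puiseux_common2 Hf Hg.
apply/funext => r; pose W := pwindow j N (rbound r + N).
have HW s : f s != 0 -> g (r - s) != 0 -> s \in W.
  move=> /Hjf[fi fb] /Hjg[gi gb]; apply: pwindowP => //.
  by rewrite natrD; have := rboundP r; lra.
rewrite (pconv_seq (pwindow_uniq _ _ j0) HW).
rewrite (@pconv_seq g f r [seq r - s | s <- W]).
- rewrite [RHS]big_map; apply: eq_bigr => s _; rewrite mulrC.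
  by congr (_ * f _); lra.
- by rewrite map_inj_uniq ?pwindow_uniq // => x y /addrI/oppr_inj.
move=> s gs frs; apply/mapP; exists (r - s); last by lra.
by apply: HW => //; rewrite opprB addrCA subrr addr0.
Qed.

Lemma pconvA f g h : is_puiseux f -> is_puiseux g -> is_puiseux h ->
  pconv f (pconv g h) = pconv (pconv f g) h.
Proof.
move=> Hf Hg Hh; have [j [N [j0 Hjf Hjg Hjh]]] := puiseux_common3 Hf Hg Hh.
apply/funext => r.
have Hfg := pconv_supp Hjf Hjg.
have Hgh := pconv_supp Hjg Hjh.
have Hb := rboundP r.
pose W := pwindow j (N + N) (rbound r + N).
pose W' := pwindow j N (rbound r + N + N).
have uW : uniq W by apply: pwindow_uniq.
have uW' : uniq W' by apply: pwindow_uniq.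
rewrite [RHS](@pconv_seq _ _ _ W) //; last first.
  move=> s /Hfg[? ?] /Hjh[? ?]; apply: pwindowP => //.
  by rewrite natrD; lra.
rewrite [LHS](@pconv_seq _ _ _ W') //; last first.
  move=> s /Hjf[? ?] /Hgh[? gb]; apply: pwindowP => //.
  by move: gb; rewrite !natrD; lra.
transitivity (\sum_(s <- W) \sum_(t <- W') f t * g (s - t) * h (r - s)).
  rewrite exchange_big; apply: eq_bigr => t _.
  have [ft0|ft0] := eqVneq (f t) 0.
    by rewrite ft0 mul0r big1 // => s _; rewrite !mul0r.
  rewrite (@pconv_seq _ _ _ [seq s - t | s <- W]).
  - rewrite [in LHS]big_map mulr_sumr; apply: eq_bigr => s _; rewrite mulrA.
    by congr (_ * h _); lra.
  - by rewrite map_inj_uniq // => x y /addIr.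
  move=> u /Hjg[gi gb] /Hjh[hi hb]; apply/mapP; exists (u + t); last by lra.
  have [fi fb] := Hjf _ ft0; apply: pwindowP => //.
  - by rewrite mulrDr rpredD.
  - by rewrite natrD; lra.
  by rewrite natrD; lra.
rewrite [LHS]big_seq [RHS]big_seq; apply: eq_bigr => s sW; rewrite -mulr_suml; congr (_ * _).
rewrite (@pconv_seq _ _ _ W') // => t /Hjf[? ?] /Hjg[? ?].
apply: pwindowP => //; have := pwindow_le j0 sW; rewrite !natrD; lra.
Qed.

Lemma pconv_puiseux f g : is_puiseux f -> is_puiseux g ->
  is_puiseux (pconv f g).
Proof.
move=> Hf Hg; have [j [N [j0 Hjf Hjg]]] := puiseux_common2 Hf Hg.
by exists j, (N + N)%N; split=> //; apply: pconv_supp.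
Qed.

Definition pmono_fun (c : F) (r0 : rat) : rat -> F :=
  fun r => if r == r0 then c else 0.

Lemma pmono_puiseux c r0 : pmono_fun c r0 \in puiseux_pred.
Proof.
apply/puiseux_predP; exists `|denq r0|%N, (rbound (- r0)); split.
  by rewrite absz_gt0 denq_neq0.
move=> r; rewrite /pmono_fun; case: (eqVneq r r0) => [->|_]; last by rewrite eqxx.
move=> _; split; last by rewrite lerNl rboundP.
by rewrite pmulrn absz_denq mulrC -numqE intr_int.
Qed.

Lemma pconv_mono c r0 g r : pconv (pmono_fun c r0) g r = c * g (r - r0).
Proof.
rewrite (@pconv_seq _ _ _ [:: r0]) //; first by rewrite big_seq1 /pmono_fun eqxx.
by move=> s; rewrite /pmono_fun inE; case: (eqVneq s r0); rewrite ?eqxx.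
Qed.

Lemma pconvDl f1 f2 g : is_puiseux f1 -> is_puiseux f2 -> is_puiseux g ->
  pconv (f1 \+ f2) g = pconv f1 g \+ pconv f2 g.
Proof.
move=> H1 H2 Hg; have [j [N [j0 Hj1 Hj2 Hjg]]] := puiseux_common3 H1 H2 Hg.
apply/funext => r /=; pose W := pwindow j N (rbound r + N).
have HW s f : psupp j N f -> f s != 0 -> g (r - s) != 0 -> s \in W.
  move=> Hjf /Hjf[fi fb] /Hjg[gi gb]; apply: pwindowP => //.
  by rewrite natrD; have := rboundP r; lra.
have uW : uniq W by apply: pwindow_uniq.
have Hj12 : psupp j N (f1 \+ f2).
  move=> u /= fu; have [f0|/Hj1//] := eqVneq (f1 u) 0.
  by apply: Hj2; move: fu; rewrite f0 add0r.
rewrite (pconv_seq uW (fun s => HW s _ Hj12)).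
rewrite (pconv_seq uW (fun s => HW s _ Hj1)) (pconv_seq uW (fun s => HW s _ Hj2)).
by rewrite -big_split; apply: eq_bigr => s _ /=; rewrite mulrDl.
Qed.

End PuiseuxSupport.

(* The field of Puiseux series, i.e. the union over j of the F((z^(1/j))). *)
Record puiseux (F : fieldType) :=
  Puiseux { pcoef :> rat -> F; _ : pcoef \in @puiseux_pred F }.

HB.instance Definition _ (F : fieldType) := [isSub for @pcoef F].
HB.instance Definition _ (F : fieldType) := [Choice of puiseux F by <:].
HB.instance Definition _ (F : fieldType) :=
  [SubChoice_isSubZmodule of puiseux F by <:].

Section PuiseuxRing.
Variable F : fieldType.
Implicit Types (f g h : puiseux F) (r s : rat).

Lemma puiseuxP f : is_puiseux f.
Proof. exact/puiseux_predP/(valP f). Qed.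

Lemma puiseux_eqP f g : (forall r, f r = g r) <-> f = g.
Proof. by split=> [fg|->//]; apply/val_inj/funext. Qed.

Definition pmul f g : puiseux F :=
  Puiseux (introT (puiseux_predP _) (pconv_puiseux (puiseuxP f) (puiseuxP g))).

(* the monomial c * z^r *)
Definition pmono (c : F) r : puiseux F := Puiseux (pmono_puiseux c r).

Lemma pmulA : associative pmul.
Proof. by move=> f g h; apply/val_inj/pconvA; exact: puiseuxP. Qed.
Lemma pmulC : commutative pmul.
Proof. by move=> f g; apply/val_inj/pconvC; exact: puiseuxP. Qed.
Lemma pmul1 : left_id (pmono 1 0) pmul.
Proof. by move=> f; apply/puiseux_eqP => r; rewrite /= pconv_mono mul1r subr0. Qed.
Lemma pmulDl : left_distributive pmul +%R.
Proof. by move=> f g h; apply/val_inj/pconvDl; exact: puiseuxP. Qed.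
Lemma pone_neq0 : pmono 1 0 != 0.
Proof.
apply/eqP => /(congr1 (fun f : puiseux F => f 0)) /=.
by rewrite /pmono_fun eqxx => /eqP; rewrite oner_eq0.
Qed.

HB.instance Definition _ := GRing.Zmodule_isComNzRing.Build (puiseux F)
  pmulA pmulC pmul1 pmulDl pone_neq0.

Lemma pcoef0 r : (0 : puiseux F) r = 0. Proof. by []. Qed.
Lemma pcoefD f g r : (f + g) r = f r + g r. Proof. by []. Qed.
Lemma pcoefN f r : (- f) r = - f r. Proof. by []. Qed.
Lemma pcoefB f g r : (f - g) r = f r - g r. Proof. by []. Qed.
Lemma pcoefM f g r : (f * g) r = pconv f g r. Proof. by []. Qed.
Lemma pcoef1 r : (1 : puiseux F) r = (r == 0)%:R.
Proof. by rewrite -[1]/(pmono 1 0) /= /pmono_fun; case: eqP. Qed.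
Lemma pcoef_mono c r0 r : pmono c r0 r = if r == r0 then c else 0.
Proof. by []. Qed.
Lemma pcoef_sum I (t : seq I) (P : pred I) (f : I -> puiseux F) r :
  (\sum_(i <- t | P i) f i) r = \sum_(i <- t | P i) f i r.
Proof. by elim/big_rec2: _ => // i y1 y2 _ <-. Qed.
Lemma pcoef_monoM c r0 g r : (pmono c r0 * g) r = c * g (r - r0).
Proof. exact: pconv_mono. Qed.
Lemma pmonoM c d r s : pmono c r * pmono d s = pmono (c * d) (r + s).
Proof.
apply/puiseux_eqP => t; rewrite pcoef_monoM !pcoef_mono subr_eq [s + r]addrC.
by case: eqP; rewrite ?mulr0.
Qed.

Section GeometricSeries.
Variables (j : nat) (g : puiseux F).
Hypotheses (j0 : (0 < j)%N)
  (gP : forall r, g r != 0 -> j%:R * r \is a Num.int /\ 0 < r).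

Let gX k r : (g ^+ k) r != 0 -> j%:R * r \is a Num.int /\ k%:R <= j%:R * r.
Proof.
have jp : 0 < j%:R :> rat by rewrite ltr0n.
elim: k r => [|k IH] r.
  by rewrite expr0 pcoef1; case: (eqVneq r 0) => [->|_]; rewrite ?eqxx ?mulr0.
rewrite exprS => /pconv_neq0[s [/gP[si sp] /IH[ti tk]]].
have s1 : 1 <= j%:R * s.
  have/natrP[m Hm] : j%:R * s \is a Num.nat.
    by rewrite natrEint si /= mulr_ge0 ?ler0n // ltW.
  have : 0 < j%:R * s by apply: mulr_gt0.
  by rewrite Hm ltr0n ler1n.
split; first by rewrite -[r](subrK s) mulrDr rpredD.
by rewrite -natr1; move: tk; rewrite mulrBr; lra.
Qed.

Let K r := (rbound (j%:R * r)).+1.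
Let geom_fun : rat -> F := fun r => (\sum_(k < K r) g ^+ k) r.

Let geom_stable r n : j%:R * r < n%:R ->
  geom_fun r = (\sum_(k < n) g ^+ k) r.
Proof.
have aux m1 m2 : (m1 <= m2)%N -> j%:R * r < m1%:R ->
    (\sum_(k < m1) g ^+ k) r = (\sum_(k < m2) g ^+ k) r.
  move=> m12 Hm; rewrite !pcoef_sum.
  rewrite -!(big_mkord xpredT (fun k => (g ^+ k) r)).
  rewrite [RHS](@big_cat_nat _ _ _ m1) //= [X in _ + X]big1_seq ?addr0 //.
  move=> k /=; rewrite mem_index_iota => /andP[mk _].
  apply: contraTeq Hm => /gX[_ Hk]; rewrite -leNgt; apply: le_trans Hk.
  by rewrite ler_nat.
move=> Hn; have HK : j%:R * r < (K r)%:R.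
  by apply: le_lt_trans (rboundP _) _; rewrite ltr_nat.
by case: (leqP (K r) n) => [|/ltnW] le; [apply: aux | apply/esym/aux].
Qed.

Let geom_puiseux : geom_fun \in @puiseux_pred F.
Proof.
apply/puiseux_predP; exists j, 0%N; split=> // r Hr.
have [k /gX[ri rk]] : exists k, (g ^+ k) r != 0.
  apply: contrapT => /forallNP Hn; move/eqP: Hr; apply.
  rewrite /geom_fun pcoef_sum big1 // => k _; apply/eqP.
  by apply: contra_notT (Hn k).
split=> //; rewrite oppr0 -(@pmulr_rge0 _ j%:R) ?ltr0n //.
exact: le_trans rk.
Qed.

Lemma geom_inverse : exists h, (1 - g) * h = 1.
Proof.
exists (Puiseux geom_puiseux); apply/puiseux_eqP => r.
pose n := (K r); have HK : j%:R * r < n%:R.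
  by apply: le_lt_trans (rboundP _) _; rewrite ltr_nat.
transitivity (((1 - g) * \sum_(k < n) g ^+ k) r).
  rewrite !pcoefM; apply: eq_fsbigr => s _.
  have [->|s0] := eqVneq ((1 - g) s) 0; first by rewrite !mul0r.
  congr (_ * _); apply: geom_stable; apply: le_lt_trans HK.
  rewrite ler_pM2l ?ltr0n // gerBl.
  move: s0; rewrite pcoefB pcoef1; case: (eqVneq s 0) => [->//|_].
  by rewrite sub0r oppr_eq0 => /gP[_ /ltW].
rewrite -[1 - g]opprB mulNr -subrX1 opprB pcoefB -[RHS]subr0; congr (_ - _).
by apply: contraTeq HK => /gX[_]; rewrite -leNgt.
Qed.

End GeometricSeries.

Lemma puiseux_lead f : f != 0 ->
  exists v, f v != 0 /\ forall r, f r != 0 -> v <= r.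
Proof.
move=> f0; have [j [N [j0 fP]]] := puiseuxP f.
have jp : 0 < j%:R :> rat by rewrite ltr0n.
have [r0 fr0] : exists r, f r != 0.
  apply: contrapT => /forallNP Hn; move/eqP: f0; apply.
  by apply/puiseux_eqP => r; apply/eqP; apply: contra_notT (Hn r).
have idx r : f r != 0 -> exists k, r = k%:R / j%:R - N%:R.
  move=> /fP[ri rb].
  have /natrP[k Hk] : j%:R * (r + N%:R) \is a Num.nat.
    rewrite natrEint; apply/andP; split.
      by rewrite mulrDr; apply: rpredD => //; rewrite -natrM intr_nat.
    by apply: mulr_ge0; [exact: ltW | lra].
  by exists k; rewrite -Hk mulrAC mulfV ?lt0r_neq0 // mul1r addrK.
have exk : exists k, f (k%:R / j%:R - N%:R) != 0.
  by have [k rk] := idx _ fr0; exists k; rewrite -rk.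
exists ((ex_minn exk)%:R / j%:R - N%:R).
case: ex_minnP => m Hm Hmin; split=> // r fr.
have [k rk] := idx _ fr; rewrite rk lerD2r ler_pM2r ?invr_gt0 // ler_nat.
by apply: Hmin; rewrite -rk.
Qed.

Lemma puiseux_inverse f : f != 0 -> exists h, h * f = 1.
Proof.
move=> /puiseux_lead[v [fv vmin]].
pose g := 1 - pmono (f v)^-1 (- v) * f.
have [j [N [j0 fP]]] := puiseuxP f.
have gE r : g r = (r == 0)%:R - (f v)^-1 * f (r + v).
  by rewrite pcoefB pcoef1 pcoef_monoM opprK.
have [||h Hh] := @geom_inverse j g => //.
  move=> r gr; have r0 : r != 0.
    by apply: contraNneq gr => ->; rewrite gE eqxx add0r mulVf // subrr.
  have frv : f (r + v) != 0.
    by apply: contraNneq gr => f0; rewrite gE f0 mulr0 subr0 (negbTE r0).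
  split; last by rewrite lt_neqAle eq_sym r0 -(lerD2r v) add0r vmin.
  by rewrite -[r](addrK v) mulrBr rpredB ?(fP _ frv).1 ?(fP _ fv).1.
exists (h * pmono (f v)^-1 (- v)); rewrite -mulrA mulrC -Hh.
by congr (_ * _); rewrite /g opprB addrC subrK.
Qed.

Definition pinv f : puiseux F := xget 0 [set h | h * f = 1].

Lemma pmulVf f : f != 0 -> pinv f * f = 1.
Proof. by move=> /puiseux_inverse Hf; exact: (xgetPex 0 Hf). Qed.

Lemma pinv0 : pinv 0 = 0.
Proof.
rewrite /pinv xgetPN // => h /= H; have := oner_neq0 (puiseux F).
by rewrite -H mulr0 eqxx.
Qed.

HB.instance Definition _ :=
  GRing.ComNzRing_isField.Build (puiseux F) pmulVf pinv0.

End PuiseuxRing.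

Notation ratfun F := {fraction {poly F}}.

Definition ratC (F : fieldType) (c : F) : ratfun F := FracField.tofrac c%:P.
HB.instance Definition _ (F : fieldType) :=
  GRing.RMorphism.copy (@ratC F) (@FracField.tofrac {poly F} \o polyC).

Definition ratX (F : fieldType) : ratfun F := FracField.tofrac 'X.

Section RatfunPuiseux.
Variable F : fieldType.
Implicit Types (p : {poly F}) (x : ratfun F) (r : rat).

Definition pconst (c : F) : puiseux F := pmono c 0.

Lemma pconst_zmod : zmod_morphism pconst.
Proof.
move=> c d; apply/puiseux_eqP => r; rewrite pcoefB !pcoef_mono.
by case: eqP; rewrite ?subr0.
Qed.
Lemma pconst_monoid : monoid_morphism pconst.
Proof. by split=> // c d; rewrite /pconst pmonoM addr0. Qed.
HB.instance Definition _ :=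
  GRing.isZmodMorphism.Build F (puiseux F) pconst pconst_zmod.
HB.instance Definition _ :=
  GRing.isMonoidMorphism.Build F (puiseux F) pconst pconst_monoid.

Definition poly_puiseux p : puiseux F := (map_poly pconst p).[pmono 1 1].
HB.instance Definition _ := GRing.RMorphism.copy poly_puiseux
  (horner_eval (pmono (1 : F) 1) \o map_poly pconst).

Lemma pmonoX r n : pmono (1 : F) r ^+ n = pmono 1 (r *+ n).
Proof.
by elim: n => [|n IH]; rewrite ?mulr0n // exprS IH pmonoM mulr1 mulrS.
Qed.

Lemma poly_puiseuxE p (n : nat) : poly_puiseux p n%:R = p`_n.
Proof.
rewrite /poly_puiseux (@horner_coef_wide _ (size p)) ?size_map_poly //.
rewrite pcoef_sum.
under eq_bigr => i _.
  rewrite coef_map pcoef_monoM pmonoX pcoef_mono subr0 eqr_nat.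
  rewrite (fun_if (fun c => p`_i * c)) mulr1 mulr0.
  over.
rewrite -big_mkcond /=.
have [np|np] := ltnP n (size p).
  by rewrite (big_pred1 (Ordinal np)).
rewrite nth_default // big1 // => i /eqP ni.
by have := ltn_ord i; rewrite -ni ltnNge np.
Qed.

Lemma poly_puiseux_eq0 p : (poly_puiseux p == 0) = (p == 0).
Proof.
apply/eqP/eqP => [p0|->]; last exact: rmorph0.
by apply/polyP => i; rewrite -poly_puiseuxE p0 coef0.
Qed.

Definition ratfun_puiseux x : puiseux F :=
  poly_puiseux \n_(repr x) / poly_puiseux \d_(repr x).

Let denom_neq0 x : poly_puiseux \d_(repr x) != 0.
Proof. by rewrite poly_puiseux_eq0 denom_ratioP. Qed.

Local Notation "x %:F" := (FracField.tofrac x).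

Lemma ratfun_div x : x = (\n_(repr x))%:F / (\d_(repr x))%:F.
Proof.
have dx : (\d_(repr x))%:F != 0 by rewrite tofrac_eq0 denom_ratioP.
apply: (mulIf dx); rewrite divfK // -{1}[x]reprK; move: (repr x) => y.
rewrite /FracField.tofrac; unlock.
rewrite -[LHS]FracField.pi_mul; apply/eqmodP => /=.
rewrite FracField.equivfE /FracField.mulf !numden_Ratio ?mulr1 ?oner_neq0 //.
by rewrite mulrC.
all: exact: denom_ratioP.
Qed.

Lemma ratfun_puiseux_div p q : q != 0 ->
  ratfun_puiseux (p%:F / q%:F) = poly_puiseux p / poly_puiseux q.
Proof.
move=> q0; set x := _ / _; have /eqP := ratfun_div x.
rewrite {1}/x eqr_div ?tofrac_eq0 ?denom_ratioP // -!rmorphM /= tofrac_eq.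
move=> /eqP E; apply/eqP.
by rewrite /ratfun_puiseux eqr_div ?denom_neq0 ?poly_puiseux_eq0 // -!rmorphM -E mulrC.
Qed.

Lemma ratfun_puiseux_poly p : ratfun_puiseux p%:F = poly_puiseux p.
Proof.
rewrite -[p%:F]divr1 -(rmorph1 (@FracField.tofrac {poly F})).
by rewrite ratfun_puiseux_div ?oner_neq0 // rmorph1 divr1.
Qed.

Lemma ratfun_puiseux_zmod : zmod_morphism ratfun_puiseux.
Proof.
move=> x y; rewrite {1}[x]ratfun_div {1}[y]ratfun_div.
rewrite -mulNr addf_div ?tofrac_eq0 ?denom_ratioP // -rmorphN -!rmorphM -rmorphD.
rewrite ratfun_puiseux_div ?mulf_neq0 ?denom_ratioP //.
rewrite /ratfun_puiseux -mulNr addf_div ?denom_neq0 //.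
by congr (_ / _); rewrite ?rmorphD /= !rmorphM ?rmorphN.
Qed.

Lemma ratfun_puiseux_monoid : monoid_morphism ratfun_puiseux.
Proof.
split; first by rewrite -(rmorph1 (@FracField.tofrac {poly F})) ratfun_puiseux_poly rmorph1.
move=> x y; rewrite {1}[x]ratfun_div {1}[y]ratfun_div mulf_div -!rmorphM.
rewrite ratfun_puiseux_div ?mulf_neq0 ?denom_ratioP //.
by rewrite /ratfun_puiseux mulf_div -!rmorphM.
Qed.

HB.instance Definition _ := GRing.isZmodMorphism.Build (ratfun F) (puiseux F)
  ratfun_puiseux ratfun_puiseux_zmod.
HB.instance Definition _ := GRing.isMonoidMorphism.Build (ratfun F) (puiseux F)
  ratfun_puiseux ratfun_puiseux_monoid.

End RatfunPuiseux.

Definition palg_pred (F : fieldType) : {pred puiseux F} :=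
  fun f => `[< algebraicOver (@ratfun_puiseux F) f >].

Lemma palg_divring_closed (F : fieldType) : divring_closed (@palg_pred F).
Proof.
split; first by apply/asboolP; exact: algebraic1.
  by move=> f g /asboolP Hf /asboolP Hg; apply/asboolP; exact: algebraic_sub.
by move=> f g /asboolP Hf /asboolP Hg; apply/asboolP; exact: algebraic_div.
Qed.
HB.instance Definition _ (F : fieldType) :=
  GRing.isDivringClosed.Build (puiseux F) (@palg_pred F)
    (@palg_divring_closed F).

Record palg (F : fieldType) :=
  Palg { palg_val :> puiseux F; _ : palg_val \in @palg_pred F }.

HB.instance Definition _ (F : fieldType) := [isSub for @palg_val F].
HB.instance Definition _ (F : fieldType) := [Choice of palg F by <:].
HB.instance Definition _ (F : fieldType) :=
  [SubChoice_isSubIntegralDomain of palg F by <:].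
HB.instance Definition _ (F : fieldType) :=
  [SubIntegralDomain_isSubField of palg F by <:].

Section RatfunPalg.
Variable F : fieldType.

Lemma palgP (f : palg F) : algebraicOver (@ratfun_puiseux F) (val f).
Proof. exact/asboolP/(valP f). Qed.

Definition ratfun_palg (x : ratfun F) : palg F :=
  Palg (asboolT (algebraic_id (@ratfun_puiseux F) x)).

Lemma ratfun_palg_zmod : zmod_morphism ratfun_palg.
Proof. by move=> x y; apply/val_inj; rewrite /= rmorphB. Qed.
Lemma ratfun_palg_monoid : monoid_morphism ratfun_palg.
Proof.
by split=> [|x y]; apply/val_inj; rewrite ?rmorph1 //= ?rmorph1 ?rmorphM.
Qed.
HB.instance Definition _ := GRing.isZmodMorphism.Build (ratfun F) (palg F)
  ratfun_palg ratfun_palg_zmod.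
HB.instance Definition _ := GRing.isMonoidMorphism.Build (ratfun F) (palg F)
  ratfun_palg ratfun_palg_monoid.

End RatfunPalg.

(* [qr j] is the chosen j-th root q_j of q. *)
Definition root_system (F : fieldType) (q : F) (qr : nat -> F) : Prop :=
  (forall j, (0 < j)%N -> qr j ^+ j = q) /\
  (forall j l k, (0 < l)%N -> (0 < k)%N -> j = (l * k)%N -> qr j ^+ l = qr k).

(* The factor by which z^r is multiplied when every z^(1/j) is sent to
   q_j * z^(1/j). *)
Definition rat_root (F : fieldType) (qr : nat -> F) (r : rat) : F :=
  qr `|denq r|%N ^ numq r.

Section PuiseuxOperators.
Variable F : fieldType.
Implicit Types (f g : puiseux F) (qr : nat -> F) (r : rat).

Lemma puiseux_scale (u : rat -> F) f : (fun r => u r * f r) \in @puiseux_pred F.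
Proof.
have [j [N [j0 fP]]] := puiseuxP f; apply/puiseux_predP; exists j, N.
by split=> // r; rewrite mulf_eq0 negb_or => /andP[_ /fP].
Qed.

Definition psigma qr f : puiseux F := Puiseux (puiseux_scale (rat_root qr) f).

(* delta = z d/dz sends z^r to r z^r *)
Definition pder f : puiseux F := Puiseux (puiseux_scale (fun r => ratr r) f).

Lemma psigmaE qr f r : psigma qr f r = rat_root qr r * f r. Proof. by []. Qed.
Lemma pderE f r : pder f r = ratr r * f r. Proof. by []. Qed.

Lemma psigma_zmod qr : zmod_morphism (psigma qr).
Proof. by move=> f g; apply/puiseux_eqP => r; apply: mulrBr. Qed.

Lemma pder_zmod : zmod_morphism pder.
Proof. by move=> f g; apply/puiseux_eqP => r; apply: mulrBr. Qed.
HB.instance Definition _ :=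
  GRing.isZmodMorphism.Build (puiseux F) (puiseux F) pder pder_zmod.

Lemma pconv_window f g r : exists W : seq rat, uniq W /\
  forall s, f s != 0 -> g (r - s) != 0 -> s \in W.
Proof.
have [j [N [j0 fP gP]]] := puiseux_common2 (puiseuxP f) (puiseuxP g).
exists (pwindow j N (rbound r + N)); split; first exact: pwindow_uniq.
move=> s /fP[fi fb] /gP[gi gb]; apply: pwindowP => //.
by rewrite natrD; have := rboundP r; lra.
Qed.

Section RootSystem.
Variables (q : F) (qr : nat -> F).
Hypotheses (q0 : q != 0) (qrP : root_system q qr).

Let qr_neq0 j : (0 < j)%N -> qr j != 0.
Proof.
move=> j0; have := q0; rewrite -(qrP.1 _ j0).
by apply: contraNneq => ->; rewrite expr0n eqn0Ngt j0.
Qed.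

Let rat_rootE (k : int) (j : nat) : (0 < j)%N ->
  rat_root qr (k%:~R / j%:R) = qr j ^ k.
Proof.
move=> j0; set r := _ / _; pose d := `|denq r|%N.
have d0 : (0 < d)%N by rewrite absz_gt0 denq_neq0.
have E : k * d%:Z = numq r * j%:Z.
  have jn0 : j%:R != 0 :> rat by rewrite pnatr_eq0 -lt0n.
  have dn0 : (denq r)%:~R != 0 :> rat by rewrite intr_eq0 denq_neq0.
  have : k%:~R / j%:R = (numq r)%:~R / (denq r)%:~R :> rat by rewrite divq_num_den.
  move/eqP; rewrite eqr_div // /d absz_denq.
  by rewrite -[j%:R]/((j%:Z)%:~R) -!intrM eqr_int => /eqP.
have dj : (d %| j)%N.
  have : (d %| `|numq r| * j)%N.
    by rewrite -[j in X in (_ %| X)%N]absz_nat -abszM -E abszM dvdn_mull.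
  by rewrite Gauss_dvdr // coprime_sym coprime_num_den.
move: dj => /dvdnP[l jE].
have l0 : (0 < l)%N by move: j0; rewrite jE muln_gt0 => /andP[].
have kE : k = numq r * l%:Z.
  have dn0 : d%:Z != 0 by rewrite eqz_nat -lt0n.
  apply: (mulIf dn0); by rewrite E jE PoszM mulrA.
rewrite /rat_root -/d -(qrP.2 _ _ _ l0 d0 jE) kE exprnP.
by rewrite mulrC exprz_exp.
Qed.

Lemma rat_rootD r s : rat_root qr (r + s) = rat_root qr r * rat_root qr s.
Proof.
pose j := (`|denq r| * `|denq s|)%N.
have r0 : (0 < `|denq r|)%N by rewrite absz_gt0 denq_neq0.
have s0 : (0 < `|denq s|)%N by rewrite absz_gt0 denq_neq0.
have j0 : (0 < j)%N by rewrite muln_gt0 r0.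
have jn0 : j%:R != 0 :> rat by rewrite pnatr_eq0 -lt0n.
have dE (t : rat) : `|denq t|%:R = (denq t)%:~R :> rat.
  by rewrite pmulrn absz_denq.
have rE : r = (numq r * `|denq s|%:Z)%:~R / j%:R.
  apply: (mulIf jn0); rewrite mulfVK // /j natrM intrM numqE dE.
  by rewrite -[`|denq s|%:~R]/(`|denq s|%:R) dE mulrA.
have sE : s = (numq s * `|denq r|%:Z)%:~R / j%:R.
  apply: (mulIf jn0); rewrite mulfVK // /j natrM intrM numqE.
  by rewrite -[`|denq r|%:~R]/(`|denq r|%:R) !dE mulrA mulrAC.
have [k kE] : exists k : int, r = k%:~R / j%:R by eexists; exact: rE.
have [l lE] : exists l : int, s = l%:~R / j%:R by eexists; exact: sE.
rewrite kE lE -mulrDl -intrD !rat_rootE //.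
by rewrite expfzDr // qr_neq0.
Qed.

Lemma psigma_monoid : monoid_morphism (psigma qr).
Proof.
split=> [|f g]; apply/puiseux_eqP => r; rewrite psigmaE.
  rewrite !pcoef1; case: (eqVneq r 0) => [->|_]; last by rewrite mulr0.
  by rewrite mulr1.
have [W [uW HW]] := pconv_window f g r.
rewrite !pcoefM (pconv_seq uW HW) (@pconv_seq _ _ _ _ W) //; last first.
  move=> s; rewrite !psigmaE !mulf_eq0 !negb_or => /andP[_ fs] /andP[_ gs].
  exact: HW.
rewrite mulr_sumr; apply: eq_bigr => s _; rewrite !psigmaE.
have -> : rat_root qr r = rat_root qr s * rat_root qr (r - s).
  by rewrite -rat_rootD [s + _]addrC subrK.
by rewrite mulrACA.
Qed.

Lemma psigma_const c : psigma qr (pconst c) = pconst c.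
Proof.
apply/puiseux_eqP => r /=; rewrite /pmono_fun.
by case: eqP => [->|_]; rewrite ?mulr0 // mul1r.
Qed.

Lemma psigma_z : psigma qr (pmono 1 1) = pconst q * pmono 1 1.
Proof.
apply/puiseux_eqP => r; rewrite pcoef_monoM subr0 /= /pmono_fun.
case: eqP => [->|_]; rewrite ?mulr0 // mulr1.
by rewrite -(qrP.1 1%N) // expr1 mulr1.
Qed.

Lemma integral_const c : integralOver (@ratfun_puiseux F) (pconst c).
Proof.
have <- : ratfun_puiseux (ratC c) = pconst c.
  by rewrite ratfun_puiseux_poly /poly_puiseux map_polyC hornerC.
exact: integral_id.
Qed.

Lemma integral_z : integralOver (@ratfun_puiseux F) (pmono 1 1).
Proof.
have <- : ratfun_puiseux (@ratX F) = pmono 1 1.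
  by rewrite ratfun_puiseux_poly /poly_puiseux map_polyX hornerX.
exact: integral_id.
Qed.

Lemma integral_const_poly (p : {poly F}) :
  {in map_poly (@pconst F) p : seq _, integralRange (@ratfun_puiseux F)}.
Proof.
by apply/integral_poly => i; rewrite coef_map; apply: integral_const.
Qed.

Lemma psigma_algebraic f : algebraicOver (@ratfun_puiseux F) f ->
  algebraicOver (@ratfun_puiseux F) (psigma qr f).
Proof.
pose sig : {rmorphism puiseux F -> puiseux F} := HB.pack (psigma qr)
  (GRing.isZmodMorphism.Build _ _ _ (psigma_zmod qr))
  (GRing.isMonoidMorphism.Build _ _ _ psigma_monoid).
have sig_poly p : integralOver (@ratfun_puiseux F) (sig (poly_puiseux p)).
  rewrite /poly_puiseux -horner_map -map_poly_comp.
  rewrite (eq_map_poly (g := @pconst F)); last by move=> c; exact: psigma_const.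
  apply: integral_horner; first exact: integral_const_poly.
  by rewrite /= psigma_z; apply: integral_mul integral_z; apply: integral_const.
move=> [p p0 pf]; apply/integral_algebraic.
apply: (@integral_root _ _ _ (map_poly (sig \o @ratfun_puiseux F) p)).
- by rewrite map_poly_eq0.
- by rewrite map_poly_comp rootE horner_map (rootP pf) rmorph0.
apply/integral_poly => i; rewrite coef_map.
change (integralOver (@ratfun_puiseux F) (sig (ratfun_puiseux p`_i))).
rewrite [ratfun_puiseux p`_i]/ratfun_puiseux fmorph_div.
by apply: integral_div; apply: sig_poly.
Qed.

End RootSystem.
End PuiseuxOperators.

Section PuiseuxDerivation.
Variable F : numFieldType.
Implicit Types (f g : puiseux F).

Lemma pderM f g : pder (f * g) = pder f * g + f * pder g.
Proof.
apply/puiseux_eqP => r; rewrite pderE pcoefD !pcoefM.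
have [W [uW HW]] := pconv_window f g r.
have HWl s : pder f s != 0 -> g (r - s) != 0 -> s \in W.
  by rewrite pderE mulf_eq0 negb_or => /andP[_]; apply: HW.
have HWr s : f s != 0 -> pder g (r - s) != 0 -> s \in W.
  by move=> fs; rewrite pderE mulf_eq0 negb_or => /andP[_]; apply: HW.
rewrite (pconv_seq uW HW) (pconv_seq uW HWl) (pconv_seq uW HWr).
rewrite mulr_sumr -big_split; apply: eq_bigr => s _; rewrite !pderE.
have -> : ratr r = ratr s + ratr (r - s) :> F by rewrite -rmorphD addrC subrK.
rewrite /=; ring.
Qed.

Lemma pder_const c : pder (pconst c) = 0 :> puiseux F.
Proof.
apply/puiseux_eqP => r /=; rewrite /pmono_fun.
by case: eqP => [->|_]; rewrite ?mulr0 // rmorph0 mul0r.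
Qed.

Lemma pder_z : pder (pmono 1 1) = pmono 1 1 :> puiseux F.
Proof.
apply/puiseux_eqP => r /=; rewrite /pmono_fun.
by case: eqP => [->|_]; rewrite ?mulr0 // rmorph1 mul1r.
Qed.

Lemma pder_horner (p : {poly puiseux F}) f :
  pder p.[f] = (map_poly (@pder F) p).[f] + p^`().[f] * pder f.
Proof.
elim/poly_ind: p => [|p c IH].
  by rewrite map_poly0 deriv0 !horner0 raddf0 mul0r addr0.
rewrite hornerMXaddC raddfD /= pderM IH derivD derivC derivM derivX addr0.
have -> : map_poly (@pder F) (p * 'X + c%:P) =
    map_poly (@pder F) p * 'X + (pder c)%:P.
  apply/polyP => i; rewrite coef_map !coefD !coefMX !coefC raddfD /=.
  by rewrite coef_map; case: eqP => _; rewrite ?raddf0.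
by rewrite !hornerE; ring.
Qed.

Lemma pder_ratfun_algebraic (x : ratfun F) :
  integralOver (@ratfun_puiseux F) (pder (ratfun_puiseux x)).
Proof.
have pder_poly p : integralOver (@ratfun_puiseux F) (pder (poly_puiseux p)).
  rewrite /poly_puiseux pder_horner -map_poly_comp.
  rewrite (eq_map_poly (g := fun=> 0)); last by move=> c; exact: pder_const.
  have -> : map_poly (fun=> 0) p = 0 :> {poly puiseux F}.
    by apply/polyP => i; rewrite coef_map_id0 // coef0.
  rewrite horner0 add0r pder_z deriv_map.
  apply: integral_mul; last exact: integral_z.
  by apply: integral_horner; [exact: integral_const_poly | exact: integral_z].
have int_poly p : integralOver (@ratfun_puiseux F) (poly_puiseux p).
  by rewrite -ratfun_puiseux_poly; apply: integral_id.
rewrite [ratfun_puiseux x]/ratfun_puiseux; set A := poly_puiseux _; set B := poly_puiseux _.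
have B0 : B != 0 by rewrite poly_puiseux_eq0 denom_ratioP.
have -> : pder (A / B) = (pder A - A / B * pder B) / B.
  have -> : pder A = pder (A / B) * B + A / B * pder B by rewrite -pderM divfK.
  by rewrite addrK mulfK.
apply: integral_div; last exact: int_poly.
apply: integral_sub; first exact: pder_poly.
by apply: integral_mul; [apply: integral_div; exact: int_poly | exact: pder_poly].
Qed.

Lemma pder_algebraic f : algebraicOver (@ratfun_puiseux F) f ->
  algebraicOver (@ratfun_puiseux F) (pder f).
Proof.
move=> fa; pose P n := `[< exists p : {poly ratfun F},
  [/\ p != 0, root (map_poly (@ratfun_puiseux F) p) f & size p = n] >].
have exP : exists n, P n.
  by have [p p0 pf] := fa; exists (size p); apply/asboolP; exists p.
case: (ex_minnP exP) => n /asboolP[p [p0 pf pn]] nmin.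
have sp1 : (1 < size p)%N.
  by have := root_size_gt1 _ pf; rewrite size_map_poly map_poly_eq0 => ->.
have dp0 : p^`() != 0.
  apply/eqP => /(congr1 (fun r : {poly ratfun F} => r`_(size p).-2)) /eqP.
  rewrite coef0 coef_deriv prednK -?subn1 ?subn_gt0 // subn1 -mulr_natr mulf_eq0.
  rewrite -[p`_ _]/(lead_coef p) lead_coef_eq0 (negbTE p0) /=.
  rewrite -(rmorph_nat (@ratC F)) fmorph_eq0 pnatr_eq0 -subn1.
  by rewrite subn_eq0 leqNgt sp1.
have dpf : (map_poly (@ratfun_puiseux F) p)^`().[f] != 0.
  rewrite deriv_map; apply/negP => dpf.
  have /nmin : P (size p^`()) by apply/asboolP; exists p^`(); split.
  by rewrite -pn leqNgt lt_size_deriv.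
have := pder_horner (map_poly (@ratfun_puiseux F) p) f.
rewrite (rootP pf) raddf0 => /esym/eqP; rewrite addrC addr_eq0 => /eqP E.
have -> : pder f = - (map_poly (@pder F) (map_poly (@ratfun_puiseux F) p)).[f] /
    (map_poly (@ratfun_puiseux F) p)^`().[f].
  by rewrite -E mulrC mulKf.
have fi : integralOver (@ratfun_puiseux F) f by apply/integral_algebraic.
apply/integral_algebraic/integral_div.
  apply: integral_opp; apply: integral_horner => //.
  by apply/integral_poly => i; rewrite !coef_map; apply: pder_ratfun_algebraic.
rewrite deriv_map; apply: integral_horner => //.
by apply/integral_poly => i; rewrite coef_map; apply: integral_id.
Qed.

End PuiseuxDerivation.

(* The default value of [insubd] is not used, by [palg_sigmaE] and [palg_derE]. *)
Definition palg_sigma (F : fieldType) (qr : nat -> F) (f : palg F) : palg F :=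
  insubd 0 (psigma qr (val f)).

Definition palg_der (F : fieldType) (f : palg F) : palg F :=
  insubd 0 (pder (val f)).

Lemma palg_sigmaE (F : fieldType) (q : F) (qr : nat -> F) (f : palg F) :
  q != 0 -> root_system q qr -> val (palg_sigma qr f) = psigma qr (val f).
Proof.
move=> q0 qrP; rewrite insubdK //; apply/asboolP.
by apply: (psigma_algebraic q0 qrP); apply: palgP.
Qed.

Lemma palg_derE (F : numFieldType) (f : palg F) :
  val (palg_der f) = pder (val f).
Proof.
by rewrite insubdK //; apply/asboolP; apply: pder_algebraic; apply: palgP.
Qed.

Definition palg_const (F : fieldType) (c : F) : palg F := ratfun_palg (ratC c).
HB.instance Definition _ (F : fieldType) :=
  GRing.RMorphism.copy (@palg_const F) (@ratfun_palg F \o @ratC F).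

Section PowerSeries.
Variable F : fieldType.

Lemma powser_puiseux (u : nat -> F) :
  (fun r => if r \is a Num.nat then u (Num.truncn r) else 0) \in @puiseux_pred F.
Proof.
apply/puiseux_predP; exists 1%N, 0%N; split=> // r.
case: ifP => [rn _|_]; last by rewrite eqxx.
by rewrite mul1r intr_nat // natr_ge0.
Qed.

(* the series of the u_m z^m *)
Definition powser (u : nat -> F) : puiseux F := Puiseux (powser_puiseux u).

(* the coefficients of f(qz) *)
Definition powser_sigma (q : F) (u : nat -> F) : nat -> F :=
  fun m => q ^+ m * u m.

Definition qpoch (q a : F) (m : nat) : F := \prod_(i < m) (1 - a * q ^+ i).

Definition hypergeometric (q : F) n s (a : 'I_n -> F) (b : 'I_s -> F) (lam : F)
    : nat -> F :=
  fun m => (\prod_(i < n) qpoch q (a i) m) / (\prod_(j < s) qpoch q (b j) m)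
           * lam ^+ m.

End PowerSeries.

Section QDifference.
Variable F : fieldType.

(* A q-difference operator sum_k c_k(z) sigma_q^k is encoded by the polynomial
   with coefficients c_k. Products of q-difference operators are not products
   of polynomials in general, but here only operators with constant
   coefficients, which commute with sigma_q, are multiplied together (see
   [qdiff_apply_factor]), and the result is multiplied on the left by
   z * lam. *)
Definition hyp_op (q : F) n s (a : 'I_n -> F) (b : 'I_s -> F) (lam : F)
    : {poly ratfun F} :=
  (@ratX F * ratC lam) *: \prod_(i < n) (ratC (a i) *: 'X - 1)
  - \prod_(j < s) (ratC (b j / q) *: 'X - 1).

Definition qdiff_apply (A : comNzRingType) (sigma : A -> A) (c : {poly A}) (f : A)
    : A := \sum_(k < size c) c`_k * iter k sigma f.

Lemma qdiff_applyE (A : comNzRingType) (sigma : A -> A) (c : {poly A}) f m :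
  (size c <= m)%N -> qdiff_apply sigma c f = \sum_(k < m) c`_k * iter k sigma f.
Proof.
move=> cm; rewrite /qdiff_apply (big_ord_widen m (fun k => c`_k * iter k sigma f)) //.
rewrite big_mkcond; apply: eq_bigr => k _; case: ltnP => // ck.
by rewrite nth_default // mul0r.
Qed.

Lemma qdiff_apply_factor (A : comNzRingType) (sigma : {rmorphism A -> A})
    (c : {poly A}) (a f : A) : (forall k, sigma c`_k = c`_k) ->
  qdiff_apply sigma ((a *: 'X - 1) * c) f =
  a * sigma (qdiff_apply sigma c f) - qdiff_apply sigma c f.
Proof.
move=> cfix; pose m := maxn (size ((a *: 'X - 1) * c)) (size c).+1.
have cm : ((size c).+1 <= m)%N by apply: leq_maxr.
have mS : m = m.-1.+1 by rewrite prednK // (leq_trans _ cm).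
rewrite (qdiff_applyE sigma f (leq_maxl _ _ : (size ((a *: 'X - 1) * c)%R <= m)%N)).
rewrite {2}(qdiff_applyE sigma f (ltnW cm)).
have cm' : (size c <= m.-1)%N by rewrite -ltnS -mS.
rewrite (qdiff_applyE sigma f cm').
rewrite rmorph_sum mulr_sumr /=.
have -> : \sum_(k < m.-1) a * sigma (c`_k * iter k sigma f) =
          \sum_(k < m) a * (if (k == 0 :> nat) then 0 else c`_k.-1) * iter k sigma f.
  rewrite [in RHS]mS big_ord_recl /= mulr0 mul0r add0r; apply: eq_bigr => k _.
  by rewrite rmorphM cfix mulrA.
rewrite -sumrB; apply: eq_bigr => k _.
by rewrite mulrBl mul1r coefB -scalerAl coefZ coefXM mulrBl.
Qed.

Definition companion_system (K : fieldType) n (c : {poly K}) : 'M[K]_n :=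
  \matrix_(i < n, j < n)
    if i.+1 == n then - c`_j / c`_n else (j == i.+1 :> nat)%:R.

End QDifference.

Definition derivation (A : pzRingType) (d : A -> A) : Prop :=
  (forall x y, d (x + y) = d x + d y) /\
  (forall x y, d (x * y) = d x * y + x * d y).

(* The values of the variables of a polynomial in m * N variables, seen as a
   differential polynomial of order < N in m differential variables: the
   variable of index [mxvec_index i k] stands for the k-th derivative of the
   i-th differential variable. *)
Definition dvals (A : Type) (d : A -> A) m N (y : 'I_m -> A) : 'I_(m * N) -> A :=
  fun e => mxvec (\matrix_(i < m, k < N) iter k d (y i)) 0 e.

Definition solves_dsystem (A : comNzRingType) (d : A -> A) m
    (Sys : forall N, set (mpoly (m * N) A)) (y : 'I_m -> A) : Prop :=
  forall N P, Sys N P -> meval (dvals d y) P = 0.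

Definition map_dsystem (A B : comNzRingType) (f : A -> B) m
    (Sys : forall N, set (mpoly (m * N) A)) : forall N, set (mpoly (m * N) B) :=
  fun N => map_mpoly f @` Sys N.

Definition differentially_closed (K : fieldType) (d : K -> K) : Prop :=
  derivation d /\
  forall m (Sys : forall N, set (mpoly (m * N) K)),
    (exists (E : fieldType) (dE : E -> E) (iota : {rmorphism K -> E})
            (y : 'I_m -> E),
       [/\ derivation dE, forall x, iota (d x) = dE (iota x) &
           solves_dsystem dE (map_dsystem iota Sys) y]) ->
    exists y : 'I_m -> K, solves_dsystem d Sys y.

Definition diff_alg_independent (K E : fieldType) (iota : K -> E) (d : E -> E)
    m (f : 'I_m -> E) : Prop :=
  forall N (P : (mpoly (m * N) K)),
    meval (dvals d f) (map_mpoly iota P) = 0 -> P = 0.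

(* T is the tensor product of A and B over C, characterized, as it is up to a
   unique isomorphism, as the coproduct of A and B in commutative C-algebras. *)
Definition is_tensor_product (C A B T : comNzRingType)
    (a : {rmorphism C -> A}) (b : {rmorphism C -> B})
    (i : {rmorphism A -> T}) (j : {rmorphism B -> T}) : Prop :=
  (forall c, i (a c) = j (b c)) /\
  forall (X : comPzRingType) (f : {rmorphism A -> X}) (g : {rmorphism B -> X}),
    (forall c, f (a c) = g (b c)) ->
    exists h : {rmorphism T -> X},
      [/\ forall x, h (i x) = f x, forall y, h (j y) = g y &
          forall h' : {rmorphism T -> X},
            (forall x, h' (i x) = f x) -> (forall y, h' (j y) = g y) ->
            h' =1 h].

Definition sd_ring (A : comNzRingType) (s d : A -> A) : Prop :=
  [/\ bijective s, derivation d & forall x, s (d x) = d (s x)].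

Definition sd_extension (A B : Type) (f : A -> B) (sA dA : A -> A)
    (sB dB : B -> B) : Prop :=
  (forall x, sB (f x) = f (sA x)) /\ (forall x, dB (f x) = f (dA x)).

Section PicardVessiot.
Variables (L : fieldType) (sL dL : L -> L).

Record is_PV_ring n (A : 'M[L]_n) (S : comUnitAlgType L)
    (sS : {rmorphism S -> S}) (dS : S -> S) (U : 'M[S]_n) : Prop := IsPVRing {
  PV_sd : sd_ring sS dS;
  PV_ext : sd_extension (fun x : L => x%:A : S) sL dL sS dS;
  PV_unit : U \in unitmx;
  PV_sol : map_mx sS U = map_mx (fun x => x%:A) A *m U;
  PV_gen : forall B : set S,
    (forall x : L, B x%:A) ->
    (forall x y, B x -> B y -> B (x + y)) ->
    (forall x y, B x -> B y -> B (x * y)) ->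
    (forall x, B x -> B (dS x)) ->
    (forall i j, B (U i j)) -> B (\det U)^-1 ->
    B = setT;
  PV_simple : forall I : set S,
    I 0 -> (forall x y, I x -> I y -> I (x + y)) ->
    (forall x y, I y -> I (x * y)) ->
    (forall x, I x -> I (sS x)) -> (forall x, I x -> I (dS x)) ->
    I = [set 0] \/ I = setT }.

(* Q, together with e : S -> Q, is the localization of S at its nonzerodivisors *)
Definition is_total_quotient_ring (S Q : comUnitAlgType L)
    (e : {lrmorphism S -> Q}) : Prop :=
  [/\ injective e,
      forall t : S, GRing.lreg t -> e t \is a GRing.unit &
      forall x : Q, exists u t : S, GRing.lreg t /\ x = e u / e t].

Definition sd_galois_group (Q : comUnitAlgType L) (sQ dQ : Q -> Q)
    : set {lrmorphism Q -> Q} :=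
  [set phi : {lrmorphism Q -> Q} | [/\ bijective phi, forall x, phi (sQ x) = sQ (phi x) &
                 forall x, phi (dQ x) = dQ (phi x)]].

Definition sd_galois_image (Q : comUnitAlgType L) (sQ dQ : Q -> Q) n
    (U : 'M[Q]_n) : set 'M[Q]_n :=
  (fun phi : {lrmorphism Q -> Q} => invmx U *m map_mx phi U)
    @` sd_galois_group sQ dQ.

End PicardVessiot.

Record GLn (F : fieldType) n :=
  GLnMx { GLn_val :> 'M[F]_n; _ : GLn_val \in unitmx }.

HB.instance Definition _ (F : fieldType) n := [isSub for @GLn_val F n].
HB.instance Definition _ (F : fieldType) n := [Choice of GLn F n by <:].

Section Zariski.
Variables (F : fieldType) (n : nat).

(* The zero locus of a set of polynomials in the n * n entries. Allowing
   1/det as well would give the same sets. *)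
Definition GLn_zeros (I : set (mpoly (n * n) F)) : set (GLn F n) :=
  [set M | forall P, I P -> meval (mxvec (GLn_val M) 0) P = 0].

Definition zariski_open (O : set (GLn F n)) : Prop :=
  exists I, O = ~` GLn_zeros I.

Lemma zariski_openT : zariski_open setT.
Proof.
exists [set 1]; apply/esym/seteqP; split=> // M _ /(_ 1 erefl) /eqP.
by rewrite meval1 oner_eq0.
Qed.

Lemma zariski_openI : setI_closed zariski_open.
Proof.
move=> _ _ [I ->] [J ->].
exists [set R | exists P Q, [/\ I P, J Q & R = P * Q]].
rewrite -setCU; congr (~` _); apply/seteqP; split=> M.
  case=> H R [P [Q [IP JQ ->]]]; rewrite mevalM.
    by rewrite (H _ IP) mul0r.
  by rewrite (H _ JQ) mulr0.
move=> H; apply: contrapT => /not_orP[/existsNP[P /not_implyP[IP P0]]].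
move=> /existsNP[Q /not_implyP[JQ Q0]].
have /eqP : meval (mxvec (GLn_val M) 0) (P * Q) = 0.
  by apply: H; exists P, Q.
by rewrite mevalM mulf_eq0 => /orP[/eqP|/eqP].
Qed.

Lemma zariski_open_bigU (T : Type) (f : T -> set (GLn F n)) :
  (forall i, zariski_open (f i)) -> zariski_open (\bigcup_i f i).
Proof.
move=> /choice[I fE]; exists (\bigcup_i I i).
have -> : GLn_zeros (\bigcup_i I i) = \bigcap_i GLn_zeros (I i).
  apply/seteqP; split=> M H; first by move=> i _ P IP; apply: H; exists i.
  by move=> P [i _ IP]; apply: (H i).
by rewrite setC_bigcap; apply: eq_bigcupr => i _; rewrite fE.
Qed.

HB.instance Definition _ := isOpenTopological.Build (GLn F n)
  zariski_openT zariski_openI zariski_open_bigU.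

Definition generated_group (D : 'M[F]_n) : set (GLn F n) :=
  [set M | exists k : nat, GLn_val M = D ^+ k \/ GLn_val M = invmx D ^+ k].

Definition generated_algebraic_group (D : 'M[F]_n) : set (GLn F n) :=
  closure (generated_group D).

End Zariski.

Definition cexp (R : realType) (w : R[i]) : R[i] :=
  Complex (expR (complex.Re w) * cos (complex.Im w))
          (expR (complex.Re w) * sin (complex.Im w)).

(* q^x for real x; logq is the chosen logarithm of q *)
Definition qpower (R : realType) (logq : R[i]) (x : R) : R[i] :=
  cexp (logq * Complex x 0).

(* Main.v *)
(** Let U be a fundamental matrix of the companion system sigma_q(Y) = A Y. If a
    sigma_q-stable space PP contains the value at U of a nonzero differential
    polynomial, the polynomials of bounded degree and order with values in PP
    form a sigma_q-stable space NN in a tensor power of a space of jets. The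
    jets of matrices Z which act on NN through the derived tensor
    representation form a Lie algebra, stable under the twisted adjoint action
    of sigma_q. Differentiating the products of the matrices A(q^m x), m going
    to infinity in an ultraproduct, gives a connection on NN; the difference of
    this connection and of its sigma_q-transform lies in the Lie algebra and
    its polar part, at the pole of the inverse of A, has rank one. The system is
    irreducible as no a_i / b_j is in q^Z, and the endomorphisms of its adjoint
    system are scalars thanks to the connectedness hypothesis, so that
    the Lie algebra contains every jet. Hence PP is stable under polarization,
    and lowering the degree shows that PP contains 1.

    With PP = 0 this proves that the entries of a fundamental matrix are
    differentially independent, which is the second claim. For the first one,
    the denominators of a sigma_q-constant form such a space PP, and it follows
    that the constants are in the field of constants; moreover U and U M satisfy the
    same differential relations for all M in GL_n, so that U |-> U M extends to an
    automorphism. *)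

(* What has to be produced is a nonzero element of the Lie algebra, which could be 0 a priori.
   Twisting by sigma_q moves the regular points of a connection along a q-orbit, and the only point
   where the passage is blocked is the point [z0] at which A is singular: from q^m z0 one gets down
   to q z0, from q^-m z0 one gets to z0 itself. One more twist of the first connection creates at z0
   a pole that the second one does not have, and their difference keeps it. The rank one matrices so
   obtained are values, at the points q^-m z0, of a different element for each m; the ultraproduct
   assembles them into one rank one matrix over an extension of the base field. The other obstacle
   is the field of constants. The argument wants algebraically closed constants killed by the
   derivation, so for the first claim it runs over Ct(z) with z d/dz, although the derivation of L
   need not vanish on Ct. The two derivations agree on C(z), where A has its entries: this is why
   solutions are studied under a compatibility of derivations that is required only for the iterated
   derivatives of the entries of A. *)
Require Import Defs.
From HB Require Import structures.
From mathcomp Require Import falgebra fieldext.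
From mathcomp Require Import all_boot all_order all_algebra complex.
From mathcomp Require Import generic_quotient.
From mathcomp Require Import boolp classical_sets functions cardinality fsbigop.
From mathcomp Require Import reals topology sequences exp trigo.
From mathcomp Require Import -(notations) mpoly.
From mathcomp Require Import ring lra zify.

Set Implicit Arguments.
Unset Strict Implicit.
Unset Printing Implicit Defensive.

Import Order.TTheory GRing.Theory Num.Theory.

Local Open Scope classical_set_scope.
Local Open Scope ring_scope.

(** * Extension of derivations *)

Section DerivationExtension.
Variables (R : comNzRingType) (E : fieldType) (h : {rmorphism R -> E}) (d0 : R -> E).
Hypothesis char0 : forall n, n.+1%:R != 0 :> E.
Hypothesis h_inj : injective h.
Hypothesis d0D : forall x y, d0 (x + y) = d0 x + d0 y.
Hypothesis d0M : forall x y, d0 (x * y) = d0 x * h y + h x * d0 y.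

(** A derivation defined on a subring of [E] containing the image of [h], coded by its graph so that
    partial derivations are ordered by inclusion. Functionality is stated at 0 only, which suffices
    by additivity. *)
Definition der_graph (H : set (E * E)) : Prop :=
  [/\ forall x, H (h x, d0 x),
      forall u, H (0, u) -> u = 0,
      forall x y u v, H (x, u) -> H (y, v) -> H (x + y, u + v),
      forall x u, H (x, u) -> H (- x, - u) &
      forall x y u v, H (x, u) -> H (y, v) -> H (x * y, u * y + x * v)].

Let d00 : d0 0 = 0.
Proof. by apply: (addrI (d0 0)); rewrite -d0D !addr0. Qed.

Let d01 : d0 1 = 0.
Proof. by apply: (addrI (d0 1)); rewrite addr0 -{3}[1]mulr1 d0M rmorph1 mulr1 mul1r. Qed.

(** The enlarged subring consists of values G(x), whose derivative must be K(x) + G'(x) v, where K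
    collects the derivatives of the coefficients of G. Only v is to be chosen: it is free if x is
    transcendental over the domain, and otherwise dictated by a relation of least degree. *)
Lemma der_graph_extend (H : set (E * E)) (x : E) : der_graph H ->
  exists H', [/\ der_graph H', H `<=` H' & exists v, H' (x, v)].
Proof.
move=> [Hh H0 HD HN HM].
have H00 : H (0, 0) by have := Hh 0; rewrite rmorph0 d00.
have H10 : H (1, 0) by have := Hh 1; rewrite rmorph1 d01.
have Hsum (I : Type) (r : seq I) (f g : I -> E) :
    (forall i, H (f i, g i)) -> H (\sum_(i <- r) f i, \sum_(i <- r) g i).
  move=> Hfg; elim: r => [|i r IH]; first by rewrite !big_nil.
  by rewrite !big_cons; apply: HD.
have HMn y u n : H (y, u) -> H (y *+ n, u *+ n).
  by move=> Hy; elim: n => [|n IH]; rewrite ?mulr0n // !mulrS; apply: HD.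
pose HP (G K : {poly E}) := forall i, H (G`_i, K`_i).
have HPD G K G' K' : HP G K -> HP G' K' -> HP (G + G') (K + K').
  by move=> a b i; rewrite !coefD; apply: HD.
have HPN G K : HP G K -> HP (- G) (- K).
  by move=> a i; rewrite !coefN; apply: HN.
have HPM G K G' K' : HP G K -> HP G' K' -> HP (G * G') (K * G' + G * K').
  move=> a b i; rewrite coefD !coefM -big_split /=.
  by apply: Hsum => j; apply: HM.
have HPC y u : H (y, u) -> HP y%:P u%:P.
  by move=> a i; rewrite !coefC; case: eqP.
have HPX : HP 'X 0.
  by move=> i; rewrite coefX coef0; case: eqP.
have HPd G K : HP G K -> HP G^`() K^`().
  by move=> a i; rewrite !coef_deriv; apply: HMn.
suff [v Hv] : exists v, forall G K, HP G K -> G.[x] = 0 -> K.[x] + G^`().[x] * v = 0.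
  exists [set z | exists G K, [/\ HP G K, z.1 = G.[x] & z.2 = K.[x] + G^`().[x] * v]].
  split.
  - split=> [y|u|y1 y2 u1 u2|y u|y1 y2 u1 u2].
    + exists (h y)%:P, (d0 y)%:P; split; rewrite ?hornerC //=; first exact: HPC.
      by rewrite derivC horner0 mul0r addr0.
    + by case=> G [K [a /= b ->]]; apply: Hv.
    + case=> G1 [K1 [a1 /= -> ->]] [G2 [K2 [a2 /= -> ->]]].
      exists (G1 + G2), (K1 + K2); split=> /=; rewrite ?hornerD //; first exact: HPD.
      by rewrite derivD hornerD; ring.
    + case=> G1 [K1 [a1 /= -> ->]].
      exists (- G1), (- K1); split=> /=; rewrite ?hornerN //; first exact: HPN.
      by rewrite derivN hornerN; ring.
    + case=> G1 [K1 [a1 /= -> ->]] [G2 [K2 [a2 /= -> ->]]].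
      exists (G1 * G2), (K1 * G2 + G1 * K2); split=> /=; rewrite ?hornerM //; first exact: HPM.
      by rewrite derivM !hornerD !hornerM; ring.
  - move=> [y u] Hyu; exists y%:P, u%:P; split; rewrite ?hornerC //=; first exact: HPC.
    by rewrite derivC horner0 mul0r addr0.
  - exists v, 'X, 0; split=> //=; first by rewrite hornerX.
    by rewrite derivX horner0 hornerC add0r mul1r.
case: (pselect (exists G K, [/\ HP G K, G != 0 & G.[x] = 0])) => [ex|nex]; last first.
  exists 0 => G K GK Gx; have [G0|G0] := eqVneq G 0; last by case: nex; exists G, K.
  have -> : K = 0.
    by apply/polyP => i; rewrite coef0; apply: H0; have := GK i; rewrite G0 coef0.
  by rewrite horner0 mulr0 addr0.
pose Q n := `[< exists G K, [/\ HP G K, G != 0, G.[x] = 0 & size G = n] >].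
have exQ : exists n, Q n by have [G [K [a b c]]] := ex; exists (size G); apply/asboolP; exists G, K.
case: (ex_minnP exQ) => n /asboolP[G [K [GK G0 Gx Gn]]] nmin.
have nminE G' K' : HP G' K' -> G'.[x] = 0 -> (size G' < n)%N -> G' = 0.
  move=> a b c; apply/eqP; apply: contraLR c => G'0; rewrite -leqNgt.
  by apply: nmin; apply/asboolP; exists G', K'.
(* The derivative of a relation of least degree is shorter; if it vanished at x it would be 0, and G
   would be constant in characteristic 0. *)
have dGx : G^`().[x] != 0.
  apply/eqP => dG0.
  have dG : G^`() = 0 by apply: nminE (HPd _ _ GK) dG0 _; rewrite -Gn lt_size_deriv.
  have : (size G <= 1)%N.
    apply/leq_sizeP => -[//|j] _; have := congr1 (fun p : {poly E} => p`_j) dG.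
    rewrite coef_deriv coef0 -mulr_natr => /eqP; rewrite mulf_eq0 (negbTE (char0 _)) orbF.
    by move/eqP.
  move/size1_polyC => GC; move: Gx G0; rewrite GC hornerC => ->.
  by rewrite eqxx.
exists (- K.[x] / G^`().[x]) => G' K' GK' Gx'.
set v := _ / _.
have Dv : K.[x] + G^`().[x] * v = 0 by rewrite /v mulrC mulfVK // subrr.
clearbody v.
have [m] := ubnP (size G'); elim: m => // m IH in G' K' GK' Gx' *.
rewrite ltnS => Hm.
have [G'0|G'0] := eqVneq G' 0.
  have -> : K' = 0.
    by apply/polyP => i; rewrite coef0; apply: H0; have := GK' i; rewrite G'0 coef0.
  by rewrite G'0 deriv0 !horner0 mul0r addr0.
have [lt|le] := ltnP (size G') n.
  by move: G'0; rewrite (nminE _ _ GK' Gx' lt) eqxx.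
pose a := (size G' - size G)%N.
pose XX : {poly E} := 'X^a.
have HXX : HP XX 0.
  by move=> i; rewrite coefXn coef0; case: eqP.
have HG : H (lead_coef G, K`_(size G).-1) by apply: GK.
have HG' : H (lead_coef G', K'`_(size G').-1) by apply: GK'.
set l := lead_coef G in HG *; set l' := lead_coef G' in HG' *.
set kl := K`_ _ in HG; set kl' := K'`_ _ in HG'.
have l0 : l != 0 by rewrite lead_coef_eq0.
(* Pseudo-division: the coefficients lie in a subring, so the leading term is cancelled after
   multiplication by [l], which is removed at the end as a nonzero factor. *)
pose G1 := l%:P * G' - l'%:P * XX * G.
have GK1 := HPD _ _ _ _ (HPM _ _ _ _ (HPC _ _ HG) GK')
  (HPN _ _ (HPM _ _ _ _ (HPM _ _ _ _ (HPC _ _ HG') HXX) GK)).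
rewrite -/G1 in GK1; set K1 := (X in HP _ X) in GK1.
have G1x : G1.[x] = 0 by rewrite /G1 !hornerE Gx Gx' !mulr0 subr0.
have sG1 : (size G1 < m)%N.
  apply: leq_trans Hm; apply: (@leq_ltn_trans (size G').-1); last first.
    by rewrite prednK // size_poly_gt0.
  apply/leq_sizeP => j; rewrite leq_eqVlt => /orP[/eqP <-|lt].
    rewrite /G1 coefB coefCM -mulrA coefCM -/(lead_coef G') coefXnM.
    have sz : ((size G').-1 - a = (size G).-1)%N.
      by rewrite /a; move: le; rewrite -Gn; lia.
    have -> : ((size G').-1 < a)%N = false.
      have G00 : (0 < size G)%N by rewrite size_poly_gt0.
      by rewrite /a; move: le; rewrite -Gn; lia.
    by rewrite sz -/(lead_coef G) -/l -/l' mulrC subrr.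
  have jG' : G'`_j = 0 by apply: nth_default; rewrite -(@prednK (size G')) // size_poly_gt0.
  rewrite /G1 coefB coefCM -mulrA coefCM coefXnM jG' mulr0 sub0r.
  have G00 : (0 < size G)%N by rewrite size_poly_gt0.
  case: ifP => ja; first by rewrite mulr0 oppr0.
  rewrite nth_default ?mulr0 ?oppr0 //.
  by move: lt le G00; rewrite /a -Gn; clear; move: (size G) (size G') => ? ?; lia.
have := IH _ _ GK1 G1x sG1.
rewrite /K1 /G1 derivD derivN !derivM !derivC mul0r add0r !hornerE Gx Gx'.
rewrite !mulr0 !add0r ?addr0 => E1.
have : l * (K'.[x] + G'^`().[x] * v) = l' * x ^+ a * (K.[x] + G^`().[x] * v).
  by apply/eqP; rewrite -subr_eq0 -E1; apply/eqP; ring.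
by rewrite Dv mulr0 => /eqP; rewrite mulf_eq0 (negbTE l0) => /eqP.
Qed.

Lemma derivation_extend : exists D : E -> E, derivation D /\ forall x, D (h x) = d0 x.
Proof.
pose G0 : set (E * E) := [set z | exists x, z = (h x, d0 x)].
have good0 : der_graph G0.
  split=> [x|u [x []]|_ _ _ _ [x [-> ->]] [y [-> ->]]|_ _ [x [-> ->]]|_ _ _ _ [x [-> ->]] [y [-> ->]]].
  - by exists x.
  - by move=> x0 ->; rewrite (_ : x = 0) //; apply: h_inj; rewrite rmorph0.
  - by exists (x + y); rewrite d0D rmorphD.
  - exists (- x); rewrite rmorphN; congr pair.
    by apply: (addrI (d0 x)); rewrite -d0D !subrr.
  - by exists (x * y); rewrite d0M rmorphM.
(* The base graph [G0] is added to every set because Zorn's lemma also considers the empty chain,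
   whose union is empty. *)
have [|G [goodG maxG]] := @Zorn_bigcup _ (fun H => der_graph (H `|` G0)).
  move=> F FP Ftot; set U := \bigcup_(X in F) X.
  have U2 z1 z2 : (U `|` G0) z1 -> (U `|` G0) z2 ->
      exists X, [/\ der_graph X, X `<=` (U `|` G0), X z1 & X z2].
    have sub X : F X -> (X `|` G0) `<=` (U `|` G0).
      by move=> FX z [Xz|?]; [left; exists X | right].
    case=> [[X FX Xz]|z0]; case=> [[Y FY Yz]|z0'].
    - have [XY|YX] := Ftot _ _ FX FY.
        by exists (Y `|` G0); split; [exact: FP | exact: sub | left; apply: XY | left].
      by exists (X `|` G0); split; [exact: FP | exact: sub | left | left; apply: YX].
    - by exists (X `|` G0); split; [exact: FP | exact: sub | left | right].
    - by exists (Y `|` G0); split; [exact: FP | exact: sub | right | left].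
    - by exists G0; split=> // z; right.
  split.
  - by move=> x; right; exists x.
  - by move=> u Hu; have [X [[_ X0 _ _ _] _ Xz _]] := U2 _ _ Hu Hu; apply: X0.
  - move=> x y u v Hx Hy; have [X [[_ _ XD _ _] sX Xz Xz']] := U2 _ _ Hx Hy.
    by apply: sX; apply: XD.
  - move=> x u Hx; have [X [[_ _ _ XN _] sX Xz _]] := U2 _ _ Hx Hx.
    by apply: sX; apply: XN.
  - move=> x y u v Hx Hy; have [X [[_ _ _ _ XM] sX Xz Xz']] := U2 _ _ Hx Hy.
    by apply: sX; apply: XM.
have tot x : exists u, (G `|` G0) (x, u).
  have [H [gH sH [v Hv]]] := der_graph_extend x goodG.
  have HG0 : H `|` G0 = H.
    by apply/seteqP; split=> z; [case=> // [[y ->]]; case: gH | left].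
  apply: contrapT => nx; apply: (maxG H); last by rewrite HG0.
  split=> [z Gz|HG]; first by apply: sH; left.
  by apply: nx; exists v; left; apply: HG.
have [D HDx] := choice tot; exists D.
case: goodG => gh g0 gD gN gM.
have fn x u v : (G `|` G0) (x, u) -> (G `|` G0) (x, v) -> u = v.
  move=> Hu Hv; have := gD _ _ _ _ Hu (gN _ _ Hv); rewrite subrr => /g0.
  by move/eqP; rewrite subr_eq0 => /eqP.
split; last by move=> x; apply: (fn (h x)).
by split=> x y; apply: (fn _ _ _ (HDx _)); [apply: gD | apply: gM].
Qed.

End DerivationExtension.

Section DerivationBasics.
Variables (A : comNzRingType) (d : A -> A).
Hypothesis dP : derivation d.

Lemma derivD x y : d (x + y) = d x + d y. Proof. exact: dP.1. Qed.
Lemma derM x y : d (x * y) = d x * y + x * d y. Proof. exact: dP.2. Qed.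
Lemma der0 : d 0 = 0. Proof. by apply: (addrI (d 0)); rewrite -derivD !addr0. Qed.
Lemma der1 : d 1 = 0.
Proof. by apply: (addrI (d 1)); rewrite addr0 -{3}[1]mulr1 derM mulr1 mul1r. Qed.
Lemma der_sum I (r : seq I) (P : pred I) f :
  d (\sum_(i <- r | P i) f i) = \sum_(i <- r | P i) d (f i).
Proof. by apply: (big_morph d derivD der0). Qed.
Lemma der_nat n : d n%:R = 0.
Proof. by elim: n => [|n IH]; rewrite ?der0 // mulrS derivD der1 IH addr0. Qed.
End DerivationBasics.

Lemma der_div (F : fieldType) (d : F -> F) (dP : derivation d) x y : y != 0 ->
  d (x / y) = (d x * y - x * d y) / (y * y).
Proof.
move=> y0; have E := derM dP (x / y) y; rewrite divfK // in E.
by rewrite E; field.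
Qed.

Lemma eq_divf_mul (F : fieldType) (f x y : F) : y != 0 -> f = x / y -> f * y = x.
Proof. by move=> y0 ->; rewrite divfK. Qed.

Lemma eq_mulf_div (F : fieldType) (f x y : F) : y != 0 -> f * y = x -> f = x / y.
Proof. by move=> y0 <-; rewrite mulfK. Qed.

(** * Rational functions and their values *)

Section RatfunValues.
(* [K], with [iota], is a field of rational functions over [k]. *)
Variables (k K : fieldType) (iota : {rmorphism {poly k} -> K}).
Hypothesis iota_inj : injective iota.
Hypothesis ratfunP : forall f : K, exists p d, d != 0 /\ f = iota p / iota d.
Local Notation "x %:F" := (iota x).

(** The constants of [K]. The embedding [iota] is kept abstract because the coordinate 1/z at
    infinity gives a second one into the same field. *)
Definition kC (c : k) : K := iota c%:P.
HB.instance Definition _ := GRing.RMorphism.copy kC (iota \o polyC).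

Lemma iota_eq (p r : {poly k}) : (p%:F == r%:F) = (p == r).
Proof. exact: inj_eq. Qed.
Lemma iota_eq0 (p : {poly k}) : (p%:F == 0) = (p == 0).
Proof. by rewrite -(rmorph0 iota) iota_eq. Qed.

Lemma ratfun_lift (F : fieldType) (h : {rmorphism {poly k} -> F}) : injective h ->
  exists g : {rmorphism K -> F}, forall p, g p%:F = h p.
Proof.
move=> hi; have h0 p : p != 0 -> h p != 0 by move=> p0; rewrite -(rmorph0 h) (inj_eq hi).
have /choice[n /choice[e nP]] := ratfunP.
pose g (x : K) := h (n x) / h (e x).
have gdiv p d : d != 0 -> g (p%:F / d%:F) = h p / h d.
  move=> d0; have [e0 xE] := nP (p%:F / d%:F).
  apply/eqP; rewrite /g eqr_div ?h0 // -!rmorphM.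
  move/eqP: xE; rewrite eqr_div ?iota_eq0 // -!rmorphM iota_eq => /eqP E.
  by rewrite E.
have gp p : g p%:F = h p.
  by rewrite -[p%:F]divr1 -(rmorph1 iota) gdiv ?oner_neq0 // rmorph1 divr1.
have ga : zmod_morphism g.
  move=> x y; have [p [d [d0 ->]]] := ratfunP x; have [p' [d' [d'0 ->]]] := ratfunP y.
  rewrite -mulNr addf_div ?iota_eq0 // -rmorphN -!rmorphM -rmorphD.
  rewrite !gdiv ?mulf_neq0 // -mulNr addf_div ?h0 //.
  by rewrite rmorphD !rmorphM rmorphN.
have gm : monoid_morphism g.
  split; first by rewrite -(rmorph1 iota) gp rmorph1.
  move=> x y; have [p [d [d0 ->]]] := ratfunP x; have [p' [d' [d'0 ->]]] := ratfunP y.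
  by rewrite mulf_div -!rmorphM !gdiv ?mulf_neq0 // mulf_div -!rmorphM.
pose G : {rmorphism K -> F} := HB.pack g
  (GRing.isZmodMorphism.Build _ _ _ ga) (GRing.isMonoidMorphism.Build _ _ _ gm).
by exists G.
Qed.

(* [f] is regular at [x], with value [v] there *)
Definition rval (f : K) (x v : k) :=
  exists p d, [/\ d.[x] != 0, f = p%:F / d%:F & v = p.[x] / d.[x]].

Let hor0 (d : {poly k}) x : d.[x] != 0 -> d != 0.
Proof. by apply: contraNneq => ->; rewrite horner0. Qed.

Lemma rval_uniq f x v w : rval f x v -> rval f x w -> v = w.
Proof.
move=> [p [d [d0 -> ->]]] [p' [d' [d'0 E ->]]]; apply/eqP; rewrite eqr_div //.
move/eqP: E; rewrite eqr_div ?iota_eq0 ?(hor0 d0) ?(hor0 d'0) //.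
by rewrite -!rmorphM iota_eq => /eqP E; rewrite -!hornerM E.
Qed.

Lemma rvalF p x : rval p%:F x p.[x].
Proof. by exists p, 1; rewrite hornerC rmorph1 !divr1 oner_neq0. Qed.

Lemma rvalC c x : rval (kC c) x c.
Proof. by have := rvalF c%:P x; rewrite hornerC. Qed.

Lemma rval0 x : rval 0 x 0.
Proof. by have := rvalC 0 x; rewrite rmorph0. Qed.

Lemma rval1 x : rval 1 x 1.
Proof. by have := rvalC 1 x; rewrite rmorph1. Qed.

Lemma rvalX x : rval (iota 'X) x x.
Proof. by have := rvalF 'X x; rewrite hornerX. Qed.

Lemma rvalD f g x v w : rval f x v -> rval g x w -> rval (f + g) x (v + w).
Proof.
move=> [p [d [d0 -> ->]]] [p' [d' [d'0 -> ->]]].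
exists (p * d' + p' * d), (d * d'); split; first by rewrite hornerM mulf_neq0.
  by rewrite addf_div ?iota_eq0 ?(hor0 d0) ?(hor0 d'0) // rmorphD !rmorphM.
by rewrite addf_div // !hornerE.
Qed.

Lemma rvalM f g x v w : rval f x v -> rval g x w -> rval (f * g) x (v * w).
Proof.
move=> [p [d [d0 -> ->]]] [p' [d' [d'0 -> ->]]].
exists (p * p'), (d * d'); split; first by rewrite hornerM mulf_neq0.
  by rewrite mulf_div !rmorphM.
by rewrite mulf_div !hornerE.
Qed.

Lemma rvalN f x v : rval f x v -> rval (- f) x (- v).
Proof.
by move=> H; have := rvalM (rvalC (-1) x) H; rewrite rmorphN rmorph1 !mulN1r.
Qed.

Lemma rvalB f g x v w : rval f x v -> rval g x w -> rval (f - g) x (v - w).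
Proof. by move=> a b; apply: rvalD a (rvalN b). Qed.

Lemma rvalV f x v : rval f x v -> v != 0 -> rval f^-1 x v^-1.
Proof.
move=> [p [d [d0 -> ->]]]; rewrite mulf_eq0 negb_or => /andP[p0 _].
by exists d, p; split=> //; rewrite invf_div.
Qed.

Lemma rvalXn f x v n : rval f x v -> rval (f ^+ n) x (v ^+ n).
Proof.
move=> H; elim: n => [|n IH]; first by rewrite !expr0; apply: rval1.
by rewrite !exprS; apply: rvalM.
Qed.

Lemma rval_sum (I : Type) (r : seq I) (P : pred I) f x v :
  (forall i, P i -> rval (f i) x (v i)) ->
  rval (\sum_(i <- r | P i) f i) x (\sum_(i <- r | P i) v i).
Proof.
move=> H; elim/big_rec2: _ => [|i a b Pi]; first exact: rval0.
by apply: rvalD; apply: H.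
Qed.

Lemma rval_prod (I : Type) (r : seq I) (P : pred I) f x v :
  (forall i, P i -> rval (f i) x (v i)) ->
  rval (\prod_(i <- r | P i) f i) x (\prod_(i <- r | P i) v i).
Proof.
move=> H; elim/big_rec2: _ => [|i a b Pi]; first exact: rval1.
by apply: rvalM; apply: H.
Qed.

Lemma rval_generic f : exists d : {poly k}, d != 0 /\
  forall x, d.[x] != 0 -> exists v, rval f x v /\ (f != 0 -> v != 0).
Proof.
have [p [d [d0 fE]]] := ratfunP f.
have [p0|p0] := eqVneq p 0.
  exists 1; split=> [|x _]; first exact: oner_neq0.
  have f0 : f = 0 by rewrite fE p0 rmorph0 mul0r.
  by exists 0; rewrite f0 eqxx; split=> //; exact: rval0.
exists (p * d); split; first by rewrite mulf_neq0.
move=> x; rewrite hornerM mulf_eq0 negb_or => /andP[px dx].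
exists (p.[x] / d.[x]); split; first by exists p, d.
by rewrite mulf_neq0 ?invr_eq0.
Qed.

Definition mval m n (M : 'M[K]_(m, n)) x (V : 'M[k]_(m, n)) :=
  forall i j, rval (M i j) x (V i j).

Lemma mval_uniq m n (M : 'M[K]_(m, n)) x V W : mval M x V -> mval M x W -> V = W.
Proof. by move=> a b; apply/matrixP => i j; apply: rval_uniq (a i j) (b i j). Qed.

Lemma mvalM m n p (M : 'M[K]_(m, n)) (M' : 'M[K]_(n, p)) x V W :
  mval M x V -> mval M' x W -> mval (M *m M') x (V *m W).
Proof. by move=> a b i j; rewrite !mxE; apply: rval_sum => l _; apply: rvalM. Qed.

Lemma mvalD m n (M M' : 'M[K]_(m, n)) x V W :
  mval M x V -> mval M' x W -> mval (M + M') x (V + W).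
Proof. by move=> a b i j; rewrite !mxE; apply: rvalD. Qed.

Lemma mvalN m n (M : 'M[K]_(m, n)) x V : mval M x V -> mval (- M) x (- V).
Proof. by move=> a i j; rewrite !mxE; apply: rvalN. Qed.

Lemma mvalZ m n f v (M : 'M[K]_(m, n)) x V :
  rval f x v -> mval M x V -> mval (f *: M) x (v *: V).
Proof. by move=> a b i j; rewrite !mxE; apply: rvalM. Qed.

Lemma mval0 m n x : mval (0 : 'M_(m, n)) x 0.
Proof. by move=> i j; rewrite !mxE; apply: rval0. Qed.

Lemma mvalC m n (V : 'M[k]_(m, n)) x : mval (map_mx (kC) V) x V.
Proof. by move=> i j; rewrite mxE; apply: rvalC. Qed.

Lemma mval_scalar n f v x : rval f x v -> mval (f%:M : 'M_n) x v%:M.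
Proof.
by move=> H i j; rewrite !mxE; case: eqP => _; rewrite ?mulr1n ?mulr0n //; apply: rval0.
Qed.

Lemma mval_sum m n (I : Type) (r : seq I) (P : pred I) (f : I -> 'M[K]_(m, n)) x v :
  (forall i, P i -> mval (f i) x (v i)) ->
  mval (\sum_(i <- r | P i) f i) x (\sum_(i <- r | P i) v i).
Proof.
move=> H; elim/big_rec2: _ => [|i a b Pi]; first exact: mval0.
by apply: mvalD; apply: H.
Qed.

Lemma mval_generic m n (M : 'M[K]_(m, n)) : exists d : {poly k}, d != 0 /\
  forall x, d.[x] != 0 -> exists V, mval M x V.
Proof.
have /choice[d dP] : forall ij : 'I_m * 'I_n, exists d : {poly k}, d != 0 /\
    forall x, d.[x] != 0 -> exists v, rval (M ij.1 ij.2) x v.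
  move=> ij; have [d [d0 H]] := rval_generic (M ij.1 ij.2).
  by exists d; split=> // x /H[v [? _]]; exists v.
exists (\prod_ij d ij); split; first by apply/prodf_neq0 => ij _; case: (dP ij).
move=> x; rewrite horner_prod => /prodf_neq0 H.
have /choice[V HV] ij : exists v, rval (M ij.1 ij.2) x v by apply: (dP ij).2; apply: H.
by exists (\matrix_(i, j) V (i, j)) => i j; rewrite mxE; apply: (HV (i, j)).
Qed.

Lemma poly_avoid (d : {poly k}) (x : nat -> k) : d != 0 -> injective x ->
  exists M, forall m, (M <= m)%N -> d.[x m] != 0.
Proof.
move=> d0 xi; have [m] := ubnP (size d); elim: m => // m IH in d d0 *; rewrite ltnS => Hm.
case: (pselect (exists j, root d (x j))) => [[j dj]|nj]; last first.
  by exists 0%N => l _; apply/negP => H; apply: nj; exists l.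
have [d' dE] := factor_theorem _ _ dj.
have d'0 : d' != 0 by apply: contraNneq d0 => d'0; rewrite dE d'0 mul0r.
have sd' : (size d' < m)%N.
  apply: leq_trans Hm; rewrite dE size_Mmonic ?monicXsubC // size_XsubC.
  by rewrite addn2.
have [M HM] := IH _ d'0 sd'.
exists (maxn M j.+1) => l; rewrite geq_max => /andP[Ml jl].
rewrite dE hornerM mulf_neq0 ?HM // hornerXsubC subr_eq0 (inj_eq xi).
by rewrite gtn_eqF.
Qed.

Section SigmaDelta.
Variables (q : k) (sig : {rmorphism K -> K}) (del : K -> K).
Hypothesis q0 : q != 0.
Hypothesis sigP : forall p, sig p%:F = (p \Po (q *: 'X))%:F.
Hypothesis delP : derivation del.
Hypothesis delF : forall p, del p%:F = ('X * p^`())%:F.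

Lemma rval_sig f x v : rval f (q * x) v -> rval (sig f) x v.
Proof.
move=> [p [d [d0 -> ->]]]; exists (p \Po (q *: 'X)), (d \Po (q *: 'X)).
by rewrite !horner_comp !hornerE fmorph_div !sigP.
Qed.

Lemma mval_sig m n (M : 'M[K]_(m, n)) x V : mval M (q * x) V -> mval (map_mx sig M) x V.
Proof. by move=> H i j; rewrite [map_mx _ _ _ _]mxE; apply: rval_sig (H i j). Qed.

Lemma sigC c : sig (kC c) = kC c.
Proof. by rewrite /kC sigP comp_polyC. Qed.

Lemma sigX : sig (iota 'X) = kC q * iota 'X.
Proof. by rewrite sigP comp_polyX -mul_polyC rmorphM. Qed.

Lemma del_div x y : y != 0 -> del (x / y) = (del x * y - x * del y) / (y * y).
Proof.
exact: der_div.
Qed.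

Lemma delC c : del (kC c) = 0.
Proof. by rewrite /kC delF derivC mulr0 rmorph0. Qed.

Lemma rval_del f x v : rval f x v -> exists w, rval (del f) x w.
Proof.
move=> [p [d [dx -> _]]]; have d0 := hor0 dx.
rewrite del_div ?iota_eq0 // !delF -!rmorphM -rmorphB /=.
by eexists; do 2 eexists; split; [|reflexivity|reflexivity]; rewrite hornerM mulf_neq0.
Qed.

Lemma mval_del m n (M : 'M[K]_(m, n)) x V : mval M x V -> exists W, mval (map_mx del M) x W.
Proof.
move=> H; have /choice[W HW] ij : exists w, rval (del (M ij.1 ij.2)) x w.
  exact: rval_del (H ij.1 ij.2).
by exists (\matrix_(i, j) W (i, j)) => i j; rewrite !mxE; apply: (HW (i, j)).
Qed.

Lemma sig_del f : sig (del f) = del (sig f).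
Proof.
have F p : sig (del p%:F) = del (sig p%:F).
  rewrite delF !sigP delF; congr (_%:F).
  rewrite comp_polyM comp_polyX deriv_comp derivZ derivX.
  by rewrite !mulrA -!mul_polyC; ring.
have [p [d [d0 ->]]] := ratfunP f.
have sd0 : sig d%:F != 0 by rewrite fmorph_eq0 iota_eq0.
rewrite del_div ?iota_eq0 // !fmorph_div del_div // -!F.
by rewrite rmorphB !rmorphM.
Qed.

Hypothesis q_not_root1 : forall m, q ^+ m.+1 != 1.

Lemma q_expr_inj i j : q ^+ i = q ^+ j -> i = j.
Proof.
wlog le : i j / (i <= j)%N.
  by move=> H E; case/orP: (leq_total i j) => l; [apply: H | apply/esym/H].
move=> E; apply/eqP; rewrite eqn_leq le /= leqNgt; apply/negP => lt.
have := q_not_root1 (j - i).-1; rewrite prednK ?subn_gt0 //.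
have qi : q ^+ i != 0 by rewrite expf_neq0.
rewrite -(inj_eq (mulfI qi)) -exprD subnKC // mulr1 E eqxx.
by [].
Qed.

(** Take a denominator of least degree e. Replacing z by qz and subtracting q^e times the original
    gives a fraction for f with a smaller denominator, so the difference is 0; hence denominator and
    numerator are both monomials of degree e. *)
Lemma sig_fixed f : sig f = f -> exists c, f = kC c.
Proof.
pose Q n := `[< exists p d, [/\ d != 0, f = p%:F / d%:F & size d = n] >].
have exQ : exists n, Q n.
  by have [p [d [? ?]]] := ratfunP f; exists (size d); apply/asboolP; exists p, d.
case: (ex_minnP exQ) => n /asboolP[p [d [d0 fE dn]]] nmin sf.
pose e := (size d).-1.
have qX g i : (g \Po (q *: 'X))`_i = q ^+ i * g`_i :> k.
  have -> : q *: 'X = q%:P * 'X :> {poly k} by rewrite mul_polyC.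
  rewrite comp_polyE; under eq_bigr do rewrite exprMn -rmorphXn /= mul_polyC scalerA.
  rewrite -(poly_def (size g) (fun i => g`_i * q ^+ i)) coef_poly.
  by case: ltnP => [_|/leq_sizeP ->//]; rewrite ?mulr0 // mulrC.
have sd0 : sig d%:F != 0 by rewrite fmorph_eq0 iota_eq0.
have E1 : f * d%:F = p%:F by apply: eq_divf_mul fE; rewrite iota_eq0.
have E2 : f * (d \Po (q *: 'X))%:F = (p \Po (q *: 'X))%:F.
  by rewrite -!sigP -E1 rmorphM sf.
pose d' := d \Po (q *: 'X) - q ^+ e *: d; pose p' := p \Po (q *: 'X) - q ^+ e *: p.
have E3 : f * d'%:F = p'%:F.
  rewrite /d' /p' -(mul_polyC (q ^+ e) d) -(mul_polyC (q ^+ e) p) !rmorphB !rmorphM /= mulrBr E2 mulrCA E1.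
  by [].
have d'0 : d' = 0.
  apply/eqP; apply/negPn/negP => d'0.
  have /nmin : Q (size d').
    apply/asboolP; exists p', d'; split=> //; by apply: eq_mulf_div E3; rewrite iota_eq0.
  rewrite -dn leqNgt; apply/negP/negPn.
  have dz : (0 < size d)%N by rewrite size_poly_gt0.
  rewrite -[X in (_ < X)%N](prednK dz) ltnS; apply/leq_sizeP => j.
  rewrite leq_eqVlt => /orP[/eqP <-|lt]; first by rewrite coefB qX coefZ subrr.
  by rewrite coefB qX coefZ nth_default ?mulr0 ?subrr // -(prednK dz).
have mono g : g \Po (q *: 'X) - q ^+ e *: g = 0 -> g = g`_e *: 'X^e.
  move=> g0; apply/polyP => i; have := congr1 (fun p : {poly k} => p`_i) g0.
  rewrite coefB qX !coefZ coef0 -mulrBl coefXn => /eqP; rewrite mulf_eq0.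
  case: (eqVneq i e) => [->|ie]; first by rewrite mulr1.
  rewrite mulr0 subr_eq0 => /orP[/eqP/q_expr_inj /eqP|/eqP //].
  by rewrite (negbTE ie).
have p'0 : p' = 0.
  by apply/eqP; rewrite -iota_eq0 -E3 d'0 rmorph0 mulr0.
have dE := mono _ d'0; have pE := mono _ p'0.
have de : d`_e != 0 by rewrite -/(lead_coef d) lead_coef_eq0.
exists (p`_e / d`_e); rewrite fE pE dE -!mul_polyC !rmorphM /=.
rewrite coefCM coefXn eqxx mulr1.
rewrite -/(kC p`_e) -/(kC d`_e) fmorphV /=.
have Xe : ('X^e : {poly k})%:F != 0 by rewrite iota_eq0 monic_neq0 // monicXn.
have de' : kC d`_e != 0 by rewrite fmorph_eq0.
by rewrite !coefCM !coefXn !eqxx !mulr1 -mulf_div divff // mulr1.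
Qed.

End SigmaDelta.
End RatfunValues.

(** * Ultrapowers of a field along the natural numbers *)

Section Ultraproduct.
Local Open Scope quotient_scope.
Variables (k : fieldType) (U : set_system nat) (UU : UltraFilter U).

Definition ueq (u v : nat -> k) : bool := `[< U [set m | u m = v m] >].

Lemma ueq_refl : reflexive ueq.
Proof. by move=> u; apply/asboolP; apply: filterS filterT. Qed.

Lemma ueq_sym u v : ueq u v = ueq v u.
Proof. by apply/asboolP/asboolP; apply: filterS => m /= ->. Qed.

Lemma ueq_trans : transitive ueq.
Proof.
move=> v u w /asboolP a /asboolP b; apply/asboolP.
by apply: filterS2 a b => m /= -> ->.
Qed.

Canonical ueq_equiv := EquivRel ueq ueq_refl ueq_sym ueq_trans.
Definition ultra := {eq_quot ueq_equiv}.
HB.instance Definition _ : EqQuotient _ ueq_equiv ultra := EqQuotient.on ultra.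
HB.instance Definition _ := Choice.on ultra.

Definition upi (u : nat -> k) : ultra := \pi_ultra u.

Lemma upiP u v : reflect (U [set m | u m = v m]) (upi u == upi v).
Proof. by apply: (iffP idP) => [/eqP/eqmodP/asboolP|H] //; apply/eqP/eqmodP/asboolP. Qed.

Lemma upi_eq u v : U [set m | u m = v m] -> upi u = upi v.
Proof. by move/upiP/eqP. Qed.

Lemma upi_repr x : upi (repr x) = x.
Proof. exact: reprK. Qed.

Lemma repr_upi u : U [set m | repr (upi u) m = u m].
Proof. by apply/upiP; rewrite upi_repr. Qed.

Definition uadd (x y : ultra) := upi (fun m => repr x m + repr y m).
Definition uopp (x : ultra) := upi (fun m => - repr x m).
Definition umul (x y : ultra) := upi (fun m => repr x m * repr y m).
Definition uinv (x : ultra) := upi (fun m => (repr x m)^-1).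
Definition u0 := upi (fun=> 0).
Definition u1 := upi (fun=> 1).

Lemma uaddE u v : uadd (upi u) (upi v) = upi (fun m => u m + v m).
Proof. by apply: upi_eq; apply: filterS2 (repr_upi u) (repr_upi v) => m /= -> ->. Qed.
Lemma umulE u v : umul (upi u) (upi v) = upi (fun m => u m * v m).
Proof. by apply: upi_eq; apply: filterS2 (repr_upi u) (repr_upi v) => m /= -> ->. Qed.
Lemma uoppE u : uopp (upi u) = upi (fun m => - u m).
Proof. by apply: upi_eq; apply: filterS (repr_upi u) => m /= ->. Qed.
Lemma uinvE u : uinv (upi u) = upi (fun m => (u m)^-1).
Proof. by apply: upi_eq; apply: filterS (repr_upi u) => m /= ->. Qed.

Let upi_ext u v : u =1 v -> upi u = upi v.
Proof. by move=> H; congr upi; apply/funext. Qed.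

Lemma uaddA : associative uadd.
Proof.
move=> x y z; rewrite -[x]upi_repr -[y]upi_repr -[z]upi_repr !uaddE.
by apply: upi_ext => m; rewrite addrA.
Qed.
Lemma uaddC : commutative uadd.
Proof.
by move=> x y; rewrite -[x]upi_repr -[y]upi_repr !uaddE; apply: upi_ext => m; rewrite addrC.
Qed.
Lemma uadd0 : left_id u0 uadd.
Proof. by move=> x; rewrite -[x]upi_repr !uaddE; apply: upi_ext => m; rewrite add0r. Qed.
Lemma uaddN : left_inverse u0 uopp uadd.
Proof.
by move=> x; rewrite -[x]upi_repr uoppE uaddE; apply: upi_ext => m; rewrite addNr.
Qed.
HB.instance Definition _ := GRing.isZmodule.Build ultra uaddA uaddC uadd0 uaddN.

Lemma umulA : associative umul.
Proof.
move=> x y z; rewrite -[x]upi_repr -[y]upi_repr -[z]upi_repr !umulE.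
by apply: upi_ext => m; rewrite mulrA.
Qed.
Lemma umulC : commutative umul.
Proof.
by move=> x y; rewrite -[x]upi_repr -[y]upi_repr !umulE; apply: upi_ext => m; rewrite mulrC.
Qed.
Lemma umul1 : left_id u1 umul.
Proof. by move=> x; rewrite -[x]upi_repr !umulE; apply: upi_ext => m; rewrite mul1r. Qed.
Lemma umulDl : left_distributive umul +%R.
Proof.
move=> x y z; rewrite -[x]upi_repr -[y]upi_repr -[z]upi_repr.
have aE u v : upi u + upi v = upi (fun m => u m + v m) := uaddE u v.
rewrite !(aE, umulE).
by apply: upi_ext => m; rewrite mulrDl.
Qed.
Lemma u1_neq0 : u1 != 0.
Proof.
apply/negP => /upiP H; apply: (@filter_not_empty _ U).
by apply: filterS H => m /= /eqP; rewrite oner_eq0.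
Qed.
HB.instance Definition _ := GRing.Zmodule_isComNzRing.Build ultra
  umulA umulC umul1 umulDl u1_neq0.

Lemma umulV (x : ultra) : x != 0 -> uinv x * x = 1.
Proof.
rewrite -[x]upi_repr uinvE => x0.
rewrite -[_ * _]/(umul _ _) umulE; apply: upi_eq.
have [H|H] := in_ultra_setVsetC [set m | repr x m = 0] UU.
  by case/negP: x0; apply/upiP.
by apply: filterS H => m /= /eqP; apply: mulVf.
Qed.
Lemma uinv0 : uinv 0 = 0.
Proof. by rewrite -[0]/u0 uinvE; apply: upi_ext => m; rewrite invr0. Qed.
HB.instance Definition _ := GRing.ComNzRing_isField.Build ultra umulV uinv0.

End Ultraproduct.

(** The ultrafilter contains the cofinite sets, so a class depends only on the tail of the sequence,
    and a tail without zeros has a nonzero class. *)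
Lemma sequence_field (k : fieldType) : exists (E : fieldType) (pi : (nat -> k) -> E),
  [/\ forall u v, pi (fun m => u m + v m) = pi u + pi v,
      forall u v, pi (fun m => u m * v m) = pi u * pi v,
      pi (fun=> 1) = 1,
      forall u M, (forall m, (M <= m)%N -> u m = 0) -> pi u = 0 &
      forall u M, (forall m, (M <= m)%N -> u m != 0) -> pi u != 0].
Proof.
have [U [UU sub]] := @ultraFilterLemma nat \oo _.
have co u M : (forall m, (M <= m)%N -> u m) -> U [set m | u m].
  by move=> H; apply: sub; exists M => // m /= /H.
exists (ultra k UU), (@upi k U UU); split.
- by move=> u v; rewrite -uaddE.
- by move=> u v; rewrite -umulE.
- by [].
- move=> u M H; apply: upi_eq; apply: (co _ M) => m /H ->.
  by [].
- move=> u M H; apply/negP => /upiP H0.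
  have H1 : U [set m | u m != 0] by apply: (co _ M) => m /H.
  apply: (@filter_not_empty _ U (@ultra_proper _ _ UU)).
  by apply: (@filterS2 _ U _ _ _ _ _ H0 H1) => m /= -> /eqP.
Qed.

(** The matrix is one of largest rank among those whose row space lies in [P]. This turns conditions
    on vectors into spaces to which ranks and linear equations apply. *)
Lemma subspace_mx (K : fieldType) w (P : 'rV[K]_w -> Prop) :
  P 0 -> (forall a u v, P u -> P v -> P (a *: u + v)) ->
  exists H : 'M[K]_w, forall v, P v <-> (v <= H)%MS.
Proof.
move=> P0 PL.
have PD u v : P u -> P v -> P (u + v) by move=> a b; rewrite -[u]scale1r; apply: PL.
have PZ a u : P u -> P (a *: u) by move=> b; rewrite -[_ *: _]addr0; apply: PL.
pose good (H : 'M[K]_w) := forall v : 'rV_w, (v <= H)%MS -> P v.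
pose Q r := `[< exists H, good H /\ \rank H = r >].
have exQ : exists r, Q r.
  by exists 0%N; apply/asboolP; exists 0; rewrite mxrank0; split=> // v; rewrite submx0 => /eqP ->.
have bQ r : Q r -> (r <= w)%N by move=> /asboolP[H [_ <-]]; apply: rank_leq_row.
case: (ex_maxnP exQ bQ) => r /asboolP[H [gH Hr]] Hmax; exists H => v; split; last exact: gH.
move=> Pv; apply/negPn/negP => nv.
have gHv : good (H + v)%MS.
  move=> u /sub_addsmxP[[u1 u2] /= ->]; apply: PD; first by apply: gH; rewrite submxMl.
  have -> : u2 *m v = u2 0 0 *: v.
    by apply/matrixP => i j; rewrite !mxE big_ord1 !ord1.
  exact: PZ.
have : Q (\rank (H + v)%MS) by apply/asboolP; exists (H + v)%MS.
move/Hmax; rewrite -Hr leqNgt; apply/negP/negPn.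
rewrite ltn_neqAle mxrankS ?addsmxSl // andbT.
apply: contra nv => /eqP E; have := mxrank_leqif_sup (addsmxSl H v).
by rewrite -E => -[_ /esym]; rewrite eqxx => /(submx_trans (addsmxSr H v)).
Qed.

(* [E] is a nonprincipal ultrapower of [k], seen through the classes of sequences. *)
Record seq_quot (k E : fieldType) (pi : (nat -> k) -> E) : Prop := SeqQuot {
  sqD : forall u v, pi (fun m => u m + v m) = pi u + pi v;
  sqM : forall u v, pi (fun m => u m * v m) = pi u * pi v;
  sq1 : pi (fun=> 1) = 1;
  sqZ : forall u M, (forall m, (M <= m)%N -> u m = 0) -> pi u = 0;
  sqN : forall u M, (forall m, (M <= m)%N -> u m != 0) -> pi u != 0 }.

Lemma seq_quot_exists (k : fieldType) : exists (E : fieldType) (pi : (nat -> k) -> E), seq_quot pi.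
Proof. by have [E [pi [*]]] := sequence_field k; exists E, pi; split. Qed.

Section SeqQuot.
Variables (k E : fieldType) (pi : (nat -> k) -> E).
Hypothesis piP : seq_quot pi.

Lemma sq_ev u v M : (forall m, (M <= m)%N -> u m = v m) -> pi u = pi v.
Proof.
move=> H; have -> : u = fun m => v m + (u m - v m).
  by apply/funext => m; rewrite addrC subrK.
rewrite (sqD piP) [pi (fun m => u m - v m)](sqZ piP (M := M)) ?addr0 //.
by move=> m /H ->; rewrite subrr.
Qed.

Lemma sq0 : pi (fun=> 0) = 0.
Proof. exact: (sqZ piP (M := 0%N)). Qed.

Lemma sqB u v : pi (fun m => u m - v m) = pi u - pi v.
Proof.
apply: (addIr (pi v)); rewrite subrK -(sqD piP); congr pi; apply/funext => m.
by rewrite subrK.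
Qed.

Lemma sq_sum (I : Type) (r : seq I) (P : pred I) (u : I -> nat -> k) :
  pi (fun m => \sum_(i <- r | P i) u i m) = \sum_(i <- r | P i) pi (u i).
Proof.
elim: r => [|i r IH].
  by rewrite big_nil -[RHS]sq0; congr pi; apply/funext => m; rewrite big_nil.
rewrite big_cons -IH; case: ifP => Pi; last first.
  by congr pi; apply/funext => m; rewrite big_cons Pi.
by rewrite -(sqD piP); congr pi; apply/funext => m; rewrite big_cons Pi.
Qed.

Definition mpi a b (F : nat -> 'M[k]_(a, b)) : 'M[E]_(a, b) :=
  \matrix_(i, j) pi (fun m => F m i j).

Lemma mpi_ev a b (F G : nat -> 'M[k]_(a, b)) M :
  (forall m, (M <= m)%N -> F m = G m) -> mpi F = mpi G.
Proof.
by move=> H; apply/matrixP => i j; rewrite !mxE; apply: (@sq_ev _ _ M) => m /H ->.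
Qed.

Lemma mpiM a b c (F : nat -> 'M[k]_(a, b)) (G : nat -> 'M[k]_(b, c)) :
  mpi (fun m => F m *m G m) = mpi F *m mpi G.
Proof.
apply/matrixP => i j; rewrite !mxE.
under [X in pi X]eq_fun do rewrite mxE.
by rewrite sq_sum; apply: eq_bigr => l _; rewrite !mxE (sqM piP).
Qed.

Lemma mpi1 n : mpi (fun=> 1%:M : 'M_n) = 1%:M.
Proof.
apply/matrixP => i j; rewrite !mxE /=.
by case: eqP; rewrite ?mulr1n ?mulr0n ?(sq1 piP) ?sq0.
Qed.

Lemma mpi_unit n (F : nat -> 'M[k]_n) : (forall m, F m \in unitmx) -> mpi F \in unitmx.
Proof.
move=> H; apply: (proj1 (@mulmx1_unit _ _ _ (mpi (fun m => invmx (F m))) _)).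
by rewrite -mpiM -(mpi1 n); apply: (@mpi_ev _ _ _ _ 0) => m _; apply: mulmxV.
Qed.

End SeqQuot.

(** * Evaluation of rational functions along a sequence of points *)

Section Evaluation.
Variables (k K : fieldType) (iota : {rmorphism {poly k} -> K}).
Hypothesis iota_inj : injective iota.
Hypothesis ratfunP : forall f : K, exists p d, d != 0 /\ f = iota p / iota d.
Variables (E : fieldType) (pi : (nat -> k) -> E).
Hypothesis piP : seq_quot pi.
Notation rval := (rval iota).
Notation mval := (mval iota).
Notation kC := (kC iota).

(* [ev] expands rational functions along the sequence [x]. *)
Definition is_ev (x : nat -> k) (ev : K -> E) :=
  forall f v M, (forall m, (M <= m)%N -> rval f (x m) (v m)) -> ev f = pi v.

(** A nonzero polynomial has finitely many zeros along an injective sequence, so its sequence of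
    values has a nonzero class and evaluation extends from polynomials to fractions. *)
Lemma ev_exists (x : nat -> k) : injective x ->
  exists ev : {rmorphism K -> E}, is_ev x ev.
Proof.
move=> xi; pose h (p : {poly k}) := pi (fun m => p.[x m]).
have ha : zmod_morphism h.
  by move=> p r; rewrite -sqB //; congr pi; apply/funext => m; rewrite hornerD hornerN.
have hm : monoid_morphism h.
  split; first by rewrite /h -(sq1 piP); congr pi; apply/funext => m; rewrite hornerC.
  by move=> p r; rewrite -(sqM piP); congr pi; apply/funext => m; rewrite hornerM.
pose H : {rmorphism {poly k} -> E} := HB.pack h
  (GRing.isZmodMorphism.Build _ _ _ ha) (GRing.isMonoidMorphism.Build _ _ _ hm).
have h0 p : p != 0 -> h p != 0.
  by move=> p0; have [M HM] := poly_avoid p0 xi; apply: (sqN piP) HM.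
have Hi : injective H.
  move=> p r /eqP; rewrite -subr_eq0 -rmorphB => /eqP E0; apply/eqP; rewrite -subr_eq0.
  by apply/negPn/negP => /h0; rewrite /h; move: E0; rewrite /= /h => ->; rewrite eqxx.
have [ev evH] := ratfun_lift iota_inj ratfunP Hi.
exists ev => f v M Hv; have [p [d [d0 fE]]] := ratfunP f.
have [M' HM'] := poly_avoid d0 xi.
rewrite fE fmorph_div !evH; apply/esym/eq_mulf_div; first exact: h0.
rewrite /= /h -(sqM piP); apply: (sq_ev piP (M := maxn M M')) => m.
rewrite geq_max => /andP[/Hv a /HM' b].
have c : rval f (x m) (p.[x m] / d.[x m]) by exists p, d.
by rewrite (rval_uniq iota_inj a c) divfK.
Qed.

Variables (x : nat -> k) (ev : {rmorphism K -> E}).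
Hypothesis xi : injective x.
Hypothesis evP : is_ev x ev.

Lemma ev_mval a b (F : 'M[K]_(a, b)) V M :
  (forall m, (M <= m)%N -> mval F (x m) (V m)) -> map_mx ev F = mpi pi V.
Proof.
by move=> H; apply/matrixP => i j; rewrite !mxE; apply: (evP (M := M)) => m /H; apply.
Qed.

Lemma mval_eventually a b (F : 'M[K]_(a, b)) :
  exists M V, forall m, (M <= m)%N -> mval F (x m) (V m).
Proof.
have [d [d0 H]] := mval_generic ratfunP F.
have [M HM] := poly_avoid d0 xi; exists M.
have /choice[V HV] m : exists V, (M <= m)%N -> mval F (x m) V.
  by case: (leqP M m) => [/HM/H[V HV]|_]; [exists V | exists 0].
by exists V.
Qed.

End Evaluation.

(** * The Lie algebra of a stable space of tensors *)

Section AbstractConnection.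
Variables (k K : fieldType) (iota : {rmorphism {poly k} -> K}).
Hypothesis iota_inj : injective iota.
Hypothesis ratfunP : forall f : K, exists p d, d != 0 /\ f = iota p / iota d.
Notation rval := (rval iota).
Notation mval := (mval iota).
Notation kC := (kC iota).
Variables (q : k) (sig : {rmorphism K -> K}) (del : K -> K).
Hypothesis sigP : forall p, sig (iota p) = iota (p \Po (q *: 'X)).
Hypothesis delC : forall c, del (kC c) = 0.
Variables (x : nat -> k) (w : nat) (N M : 'M[K]_w) (Mv : nat -> 'M[k]_w).
Hypothesis xi : injective x.
Hypothesis xS : forall m, x m.+1 = q * x m.
Hypothesis MvP : forall m, mval M (x m) (Mv m).
Hypothesis Mv_unit : forall m, Mv m \in unitmx.
Hypothesis NM : (map_mx sig N *m M <= N)%MS.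
Variables (E : fieldType) (pi : (nat -> k) -> E).
Hypothesis piP : seq_quot pi.

(** Multiplication by the product [G m] takes the rows of the base at x (m0 + m) to combinations,
    with matrix [H m], of its rows at the fixed point x m0. In the ultraproduct this reads
    [BE *m GE = HE *m B0], where [D] kills [B0] since its entries come from k; differentiating this
    identity gives the connection. *)
Lemma abs_connection : exists m0, forall (ev : {rmorphism K -> E}) (D : E -> E)
    (G : nat -> 'M[k]_w),
  is_ev iota pi (fun m => x (m0 + m)%N) ev ->
  derivation D -> (forall f, D (ev f) = ev (del f)) ->
  G 0%N = 1%:M -> (forall m, G m.+1 = Mv (m0 + m)%N *m G m) ->
  let B := row_base N in
  mpi pi G \in unitmx /\
  ((map_mx ev (map_mx del B) + map_mx ev B *m (map_mx D (mpi pi G) *m invmx (mpi pi G)))%R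
   <= map_mx ev B)%MS.
Proof.
set B := row_base N.
have /submxP[C CB] : (map_mx sig B *m M <= B)%MS.
  apply: submx_trans (_ : (map_mx sig N *m M <= _)%MS).
    by rewrite submxMr // map_submx eq_row_base.
  by rewrite (submx_trans NM) // eq_row_base.
have [M1 [Bv BvP]] := mval_eventually ratfunP xi B.
have [M2 [Cv CvP]] := mval_eventually ratfunP xi C.
pose m0 := maxn M1 M2; exists m0 => ev D G evP DP Dev G0 GS /=.
set GE := mpi pi G.
have Gu m : G m \in unitmx.
  elim: m => [|m IH]; first by rewrite G0 unitmx1.
  by rewrite GS unitmx_mul Mv_unit.
have GEu : GE \in unitmx by apply: mpi_unit.
split=> //.
pose H := fix H m := if m is m'.+1 then Cv (m0 + m')%N *m H m' else 1%:M.
have BP m : mval B (x (m0 + m)%N) (Bv (m0 + m)%N).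
  by apply: BvP; rewrite (leq_trans (leq_maxl M1 M2)) // leq_addr.
have CP m : mval C (x (m0 + m)%N) (Cv (m0 + m)%N).
  by apply: CvP; rewrite (leq_trans (leq_maxr M1 M2)) // leq_addr.
have BH m : Bv (m0 + m)%N *m G m = H m *m Bv m0.
  elim: m => [|m IH]; first by rewrite addn0 G0 mulmx1 mul1mx.
  rewrite GS mulmxA /=.
  have -> : Bv (m0 + m.+1)%N *m Mv (m0 + m)%N = Cv (m0 + m)%N *m Bv (m0 + m)%N.
    have a : mval (map_mx sig B *m M) (x (m0 + m)%N) (Bv (m0 + m.+1)%N *m Mv (m0 + m)%N).
      apply: mvalM => //; apply: (mval_sig sigP).
      by rewrite -xS -addnS; apply: BP.
    have b := mvalM iota_inj (CP m) (BP m); rewrite -CB in b.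
    exact: (mval_uniq iota_inj a b).
  by rewrite -mulmxA IH mulmxA.
pose BE := map_mx ev B; pose HE := mpi pi H; pose B0 := map_mx ev (map_mx kC (Bv m0)).
have EBH : BE *m GE = HE *m B0.
  have -> : BE = mpi pi (fun m => Bv (m0 + m)%N) by apply: (ev_mval evP (M := 0%N)).
  have -> : B0 = mpi pi (fun=> Bv m0).
    by apply: (ev_mval evP (M := 0%N)) => m _; apply: mvalC.
  rewrite -!mpiM //; apply: (mpi_ev piP (M := 0%N)) => m _; exact: BH.
have DB0 : map_mx D B0 = 0.
  by apply/matrixP => i j; rewrite !mxE Dev delC rmorph0.
have DM a b c (X : 'M[E]_(a, b)) (Y : 'M[E]_(b, c)) :
    map_mx D (X *m Y) = map_mx D X *m Y + X *m map_mx D Y.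
  apply/matrixP => i j; rewrite !mxE der_sum // -big_split.
  by apply: eq_bigr => l _; rewrite !mxE derM.
have HEu : HE \in unitmx.
  have BEf : row_free BE by rewrite /row_free mxrank_map -/(row_free B) row_base_free.
  have : row_free (BE *m GE) by rewrite /row_free mxrankMfree ?row_free_unit.
  rewrite EBH -row_free_unit /row_free => /eqP rk.
  by rewrite eqn_leq rank_leq_row /= -[X in (X <= _)%N]rk mxrankM_maxl.
have := congr1 (map_mx D) EBH; rewrite !DM DB0 mulmx0 addr0 => E1.
have E2 : map_mx D BE + BE *m (map_mx D GE *m invmx GE) = (map_mx D HE *m invmx HE) *m BE.
  apply: (can_inj (mulmxK GEu)).
  rewrite mulmxDl -!mulmxA mulVmx // mulmx1 E1 EBH.
  by rewrite !mulmxA mulmxKV.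
have -> : map_mx ev (map_mx del B) = map_mx D BE.
  by apply/matrixP => i j; rewrite !mxE Dev.
by rewrite E2 submxMl.
Qed.

End AbstractConnection.

(** The inclusion is a system of affine linear equations in the unknowns [z] with coefficients in
    [K], and solvability of such a system does not change under field extension. *)
Lemma descend_solution (K E : fieldType) (ev : {rmorphism K -> E}) r w t
    (B dB : 'M[K]_(r, w)) (F : 'I_t -> 'M[K]_w) (z : 'I_t -> E) :
  ((map_mx ev dB + map_mx ev B *m (\sum_i z i *: map_mx ev (F i)))%R <= map_mx ev B)%MS ->
  exists y : 'I_t -> K, ((dB + B *m (\sum_i y i *: F i))%R <= B)%MS.
Proof.
move=> zP; pose L : 'M[K]_(t, r * w) := \matrix_i mxvec (B *m F i *m cokermx B).
pose R := mxvec (- dB *m cokermx B).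
have LE : map_mx ev R = (\row_i z i) *m map_mx ev L.
  move: zP; rewrite submxE mulmxDl -map_cokermx -map_mxM addrC => /eqP /addr0_eq E1.
  rewrite /R mulNmx map_mxvec map_mxN -E1 opprK mulmx_sumr mulmx_suml.
  rewrite mulmx_sum_row linear_sum /=; apply: eq_bigr => i _.
  rewrite mxE -map_row rowK map_mxvec !map_mxM -scalemxAr -scalemxAl.
  by rewrite linearZ.
have : (R <= L)%MS by rewrite -(map_submx ev) LE submxMl.
case/submxP => y yP; exists (y 0); rewrite submxE mulmxDl addrC addr_eq0 -mulNmx; apply/eqP.
apply: (can_inj mxvecK); rewrite -/R yP.
rewrite mulmx_sumr mulmx_suml mulmx_sum_row linear_sum /=; apply: eq_bigr => i _.
by rewrite rowK -scalemxAr -scalemxAl linearZ.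
Qed.

(** * Tensor powers of matrices and their derivatives *)

Section Tensors.
Variables (I : finType) (d : nat).
Notation W := {ffun 'I_d -> I}.

Section Ring.
Variable R : comNzRingType.
Implicit Types (A B : I -> I -> R) (F G : 'I_d -> I -> I -> R).

(** The Kronecker product of the d matrices [F s], with rows and columns indexed by words of length
    d. *)
Definition tens F : 'M[R]_#|W| :=
  \matrix_(a, b) \prod_s F s ((enum_val a : W) s) ((enum_val b : W) s).

Definition kmul A B : I -> I -> R := fun i j => \sum_l A i l * B l j.
Definition kid : I -> I -> R := fun i j => (i == j)%:R.
Definition kadd A B : I -> I -> R := fun i j => A i j + B i j.
Definition kscale (x : R) A : I -> I -> R := fun i j => x * A i j.

Lemma kmul1l A : kmul kid A = A.
Proof.
apply/funext => i; apply/funext => j; rewrite /kmul (bigD1 i) //= /kid eqxx mul1r.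
by rewrite big1 ?addr0 // => l /negbTE li; rewrite eq_sym li mul0r.
Qed.

Lemma kmul1r A : kmul A kid = A.
Proof.
apply/funext => i; apply/funext => j; rewrite /kmul (bigD1 j) //= /kid eqxx mulr1.
by rewrite big1 ?addr0 // => l /negbTE li; rewrite li mulr0.
Qed.

Lemma eq_tens F G : (forall s, F s = G s) -> tens F = tens G.
Proof. by move=> H; congr tens; apply/funext. Qed.

Lemma tensM F G : tens F *m tens G = tens (fun s => kmul (F s) (G s)).
Proof.
apply/matrixP => a b; rewrite !mxE /kmul bigA_distr_bigA /=.
rewrite (reindex_onto enum_rank enum_val) /=; last by move=> i _; rewrite enum_valK.
rewrite (eq_bigl xpredT); last by move=> f; rewrite enum_rankK eqxx.
by apply: eq_bigr => f _; rewrite !mxE enum_rankK big_split.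
Qed.

Lemma tens1 : tens (fun=> kid) = 1%:M.
Proof.
apply/matrixP => a b; rewrite !mxE; case: (eqVneq a b) => [->|ab].
  by rewrite big1 // => s _; rewrite /kid eqxx.
have /existsP[s sab] : [exists s, (enum_val a : W) s != (enum_val b : W) s].
  apply: contra_neqT ab; rewrite negb_exists => /forallP H.
  by apply: enum_val_inj; apply/ffunP => s; apply/eqP; have := H s; rewrite negbK.
by rewrite (bigD1 s) //= /kid (negbTE sab) mul0r.
Qed.

(* the derivative of [tens (fun=> A)] in the direction [B] *)
Definition dtens A B := \sum_s tens (fun t => if t == s then B else A).

Lemma dtensMr A B C : dtens A B *m tens (fun=> C) = dtens (kmul A C) (kmul B C).
Proof.
rewrite mulmx_suml; apply: eq_bigr => s _; rewrite tensM; apply: eq_tens => t.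
by case: ifP.
Qed.

Lemma dtensMl A B C : tens (fun=> C) *m dtens A B = dtens (kmul C A) (kmul C B).
Proof.
rewrite mulmx_sumr; apply: eq_bigr => s _; rewrite tensM; apply: eq_tens => t.
by case: ifP.
Qed.

Lemma dtensD A B C : dtens A (kadd B C) = dtens A B + dtens A C.
Proof.
rewrite -big_split; apply: eq_bigr => s _; apply/matrixP => a b; rewrite !mxE.
rewrite (bigD1 s) //= [in RHS](bigD1 s) //= [X in _ = _ + X](bigD1 s) //= !eqxx.
rewrite mulrDl; congr (_ * _ + _ * _); apply: eq_bigr => t /negbTE ->; by [].
Qed.

Lemma dtensZ A B x : dtens A (kscale x B) = x *: dtens A B.
Proof.
rewrite scaler_sumr; apply: eq_bigr => s _; apply/matrixP => a b; rewrite !mxE.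
rewrite (bigD1 s) //= [in RHS](bigD1 s) //= !eqxx.
rewrite mulrA; congr (_ * _); apply: eq_bigr => t /negbTE ->; by [].
Qed.

(** The terms where A and B act in different slots are the same in both products; only those where
    they act in the same slot remain. *)
Lemma dtens_bracket A B :
  dtens kid A *m dtens kid B - dtens kid B *m dtens kid A =
  dtens kid (kmul A B) - dtens kid (kmul B A).
Proof.
have E X Y : dtens kid X *m dtens kid Y = dtens kid (kmul X Y) +
    \sum_s \sum_(s' | s' != s) tens (fun t => if t == s then X else if t == s' then Y else kid).
  rewrite mulmx_suml -big_split; apply: eq_bigr => s _.
  rewrite mulmx_sumr (bigD1 s) //= tensM; congr (_ + _).
    by apply: eq_tens => t; case: ifP => // _; rewrite kmul1l.
  apply: eq_bigr => s' ss'; rewrite tensM; apply: eq_tens => t.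
  case: ifP => [/eqP ->|_]; last by rewrite kmul1l.
  by rewrite eq_sym (negbTE ss') kmul1r.
rewrite !E opprD addrACA; set X := (X in _ + (_ - X)).
rewrite (_ : \sum_s _ = X) ?subrr ?addr0 //.
rewrite /X (exchange_big_dep xpredT) //=; apply: eq_bigr => s _.
apply: eq_big => [s'|s' ss']; first by rewrite eq_sym.
apply: eq_tens => t; case: (eqVneq t s) => [->|ts]; last by case: ifP.
by rewrite (negbTE ss').
Qed.

End Ring.

Lemma der_prod (R R' : comNzRingType) (h : {rmorphism R -> R'}) (D : R -> R') :
  (forall x y, D (x * y) = D x * h y + h x * D y) ->
  forall (J : finType) (f : J -> R),
  D (\prod_i f i) = \sum_i D (f i) * \prod_(j | j != i) h (f j).
Proof.
move=> DM J f.
have D1 : D 1 = 0 by apply: (addrI (D 1)); rewrite addr0 -{3}[1]mulr1 DM rmorph1 mulr1 mul1r.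
suff H (r : seq J) : uniq r -> D (\prod_(i <- r) f i) =
    \sum_(i <- r) D (f i) * \prod_(j <- r | j != i) h (f j).
  by have := H _ (index_enum_uniq J).
elim: r => [|i r IH] /=; first by rewrite !big_nil.
move=> /andP[ir ur]; rewrite !big_cons DM IH //= eqxx rmorph_prod mulr_sumr.
congr (_ * _ + _).
  rewrite [in RHS]big_seq_cond [LHS]big_seq_cond; apply: eq_bigl => j.
  by case: (boolP (j \in r)) => //= jr; rewrite (memPn ir).
rewrite !big_seq; apply: eq_bigr => j jr; rewrite big_cons mulrCA.
by rewrite eq_sym (memPn ir).
Qed.

Lemma der_tens (R : comNzRingType) (D : R -> R) (A : I -> I -> R) : derivation D ->
  map_mx D (tens (fun=> A)) = dtens A (fun i j => D (A i j)).
Proof.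
move=> DP; apply/matrixP => a b; rewrite !mxE summxE.
rewrite (@der_prod _ _ idfun D); last exact: (derM DP).
apply: eq_bigr => s _; rewrite !mxE [RHS](bigD1 s) //= eqxx; congr (_ * _).
by apply: eq_bigr => t /negbTE ->.
Qed.

Lemma map_tens (R R' : comNzRingType) (h : {rmorphism R -> R'}) F :
  map_mx h (tens F) = tens (fun s i j => h (F s i j)).
Proof. by apply/matrixP => a b; rewrite !mxE rmorph_prod. Qed.

Lemma map_dtens (R R' : comNzRingType) (h : {rmorphism R -> R'}) A B :
  map_mx h (dtens A B) = dtens (fun i j => h (A i j)) (fun i j => h (B i j)).
Proof.
rewrite /dtens raddf_sum; apply: eq_bigr => s _ /=; rewrite map_tens; apply: eq_tens => t.
by case: ifP.
Qed.

End Tensors.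

(** * The representation of jets of matrices on tensors *)

Section JetKernels.
Variables (N n c d : nat).
(** An index is an order of derivation, a row and a column. The additional index [None] stands for
    the constant 1, so that all polynomials of degree at most d, and not only the forms of degree d,
    are tensors in the d-th power. *)
Definition jidx : finType := option ('I_N.+1 * 'I_n.+1 * 'I_c)%type.

Section Ring.
Variable R : comNzRingType.
Notation jet := {poly 'M[R]_n.+1}.
Implicit Types (g Z : jet) (e : R).

(* Block lower triangular Toeplitz matrices: the action of a jet on the truncated
   expansions of the derivatives, with one more basis vector, fixed by the group. *)
Definition tk e Z : jidx -> jidx -> R := fun i j =>
  match i, j with
  | None, None => e
  | Some (l, x, a), Some (l', x', a') =>
      if (a == a') && (l' <= l)%N then Z`_(l - l') x x' else 0
  | _, _ => 0
  end.

Lemma tkM e e' Z Z' : kmul (tk e Z) (tk e' Z') = tk (e * e') (Z * Z').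
Proof.
apply/funext => i; apply/funext => j; rewrite /kmul.
have big_opt (F : jidx -> R) : \sum_o F o = F None + \sum_p F (Some p).
  rewrite (bigD1 None) //=; congr (_ + _).
  rewrite (reindex_omap Some id) /=; last by case.
  by apply: eq_bigl => p; rewrite eqxx.
rewrite big_opt; case: i j => [[[l x] a]|] [[[l' x'] a']|] /=; rewrite ?mul0r ?mulr0 ?add0r ?addr0.
- transitivity (\sum_(p : 'I_N.+1 * 'I_n.+1) \sum_(b : 'I_c)
      tk e Z (Some (l, x, a)) (Some (p, b)) * tk e' Z' (Some (p, b)) (Some (l', x', a'))).
    by rewrite pair_bigA; apply: eq_bigr => -[[? ?] ?] _.
  transitivity (\sum_(p : 'I_N.+1) \sum_(y : 'I_n.+1) if (a == a') && (l' <= p <= l)%N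
      then Z`_(l - p) x y * Z'`_(p - l') y x' else 0).
    rewrite [RHS]pair_bigA; apply: eq_bigr => -[l'' y] _ /=; rewrite (bigD1 a) //= eqxx big1 ?addr0.
      by case: (a == a'); case: (l'' <= l)%N; case: (l' <= l'')%N; rewrite ?mul0r ?mulr0.
    by move=> b; rewrite eq_sym => /negbTE -> /=; rewrite mul0r.
  case: (eqVneq a a') => /= _; last by rewrite big1 // => ? _; rewrite big1.
  case: leqP => [le|lt]; last first.
    rewrite big1 // => p _; rewrite big1 // => y _; case: ifP => // /andP[u v].
    by move: (leq_trans u v); rewrite leqNgt lt.
  rewrite coefMr summxE -(big_mkord xpredT (fun p => \sum_y if (l' <= p <= l)%N
      then Z`_(l - p) x y * Z'`_(p - l') y x' else 0)).
  rewrite (@big_cat_nat _ _ _ l') //=; last by rewrite ltnW // ltnS (leq_trans le) // -ltnS ltn_ord.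
  rewrite big1_seq ?add0r; last first.
    move=> p /=; rewrite mem_index_iota => /andP[_ pl]; rewrite big1 // => y _.
    by rewrite leqNgt pl.
  rewrite (@big_cat_nat _ _ _ l.+1) /= ?(leqW le) ?ltn_ord //.
  rewrite [X in _ + X]big1_seq ?addr0; last first.
    move=> p /=; rewrite mem_index_iota => /andP[pl _]; rewrite big1 // => y _.
    by rewrite [(p <= l)%N]leqNgt pl andbF.
  rewrite -{1}[l' : nat]add0n big_addn subSn // big_mkord; apply: eq_bigr => p _.
  rewrite !mxE; apply: eq_bigr => y _.
  have pl : (p <= l - l')%N by rewrite -ltnS ltn_ord.
  rewrite leq_addl addnK (_ : (p + l' <= l)%N); last by rewrite addnC -leq_subRL.
  by rewrite addnC subnDA.
- by rewrite big1 ?addr0 // => -[[? ?] ?] _; rewrite mulr0.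
- by rewrite big1 ?addr0 // => -[[? ?] ?] _; rewrite mul0r.
- by rewrite big1 ?addr0 // => -[[? ?] ?] _; rewrite mul0r.
Qed.

Lemma tk1 : tk 1 1 = @kid jidx R.
Proof.
apply/funext => i; apply/funext => j; rewrite /kid.
case: i j => [[[l x] a]|] [[[l' x'] a']|] //=.
rewrite coef1 -[Some _ == _]/((l, x, a) == (l', x', a')) !xpair_eqE.
case: (eqVneq a a') => _ /=; last by rewrite andbF.
rewrite andbT; case: leqP => [le|lt]; last first.
  by case: eqP => // E; move: lt; rewrite E ltnn.
rewrite subn_eq0; case: (leqP l l') => [le'|lt] /=.
  have -> : l = l' by apply/val_inj/eqP; rewrite eqn_leq le'.
  by rewrite eqxx mxE.
by case: (eqVneq l l') => [E|_]; [move: lt; rewrite E ltnn | rewrite mxE].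
Qed.

Lemma tkD e e' Z Z' : kadd (tk e Z) (tk e' Z') = tk (e + e') (Z + Z').
Proof.
apply/funext => i; apply/funext => j; rewrite /kadd.
case: i j => [[[l x] a]|] [[[l' x'] a']|] //=; rewrite ?addr0 //.
by case: ifP; rewrite ?addr0 // coefD mxE.
Qed.

Lemma tkZ e u Z : kscale u (tk e Z) = tk (u * e) ((u%:M : 'M_n.+1) *: Z).
Proof.
apply/funext => i; apply/funext => j; rewrite /kscale.
case: i j => [[[l x] a]|] [[[l' x'] a']|] //=; rewrite ?mulr0 //.
case: ifP; rewrite ?mulr0 // coefZ => _.
have -> : (u%:M : 'M_n.+1) * Z`_(l - l') = u *: Z`_(l - l') by apply: mul_scalar_mx.
by rewrite mxE.
Qed.

Definition jagree Z Z' := forall l, (l <= N)%N -> Z`_l = Z'`_l.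

Lemma tk_agree e Z Z' : jagree Z Z' -> tk e Z = tk e Z'.
Proof.
move=> H; apply/funext => i; apply/funext => j.
case: i j => [[[l x] a]|] [[[l' x'] a']|] //=; rewrite H //.
by rewrite (leq_trans (leq_subr _ _)) // -ltnS ltn_ord.
Qed.

Definition rho g := tens (d := d) (fun=> tk 1 g).
(** The derivative of [rho] at g in the direction Z. The 0 in [tk 0 Z] is the derivative of the
    entry 1 that [tk 1 g] has at the index [None]. *)
Definition drho' g Z := dtens d (tk 1 g) (tk 0 Z).
Definition drho Z := drho' 1 Z.

Lemma rhoM g h : rho g *m rho h = rho (g * h).
Proof. by rewrite /rho tensM; apply: eq_tens => s; rewrite tkM mulr1. Qed.
Lemma rho1 : rho 1 = 1%:M.
Proof. by rewrite /rho tk1 tens1. Qed.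
Lemma rho_agree g h : jagree g h -> rho g = rho h.
Proof. by move=> H; rewrite /rho (tk_agree _ H). Qed.
Lemma rho_drho g Z : rho g *m drho Z = drho' g (g * Z).
Proof. by rewrite /rho /drho /drho' dtensMl !tkM !mulr1 mulr0. Qed.
Lemma drho_rho g Z : drho Z *m rho g = drho' g (Z * g).
Proof. by rewrite /rho /drho /drho' dtensMr !tkM !mulr1 !mul1r. Qed.
Lemma drho'_agree g h Z Z' : jagree g h -> jagree Z Z' -> drho' g Z = drho' h Z'.
Proof. by move=> H1 H2; rewrite /drho' (tk_agree _ H1) (tk_agree _ H2). Qed.
Lemma drhoD g Z Z' : drho' g (Z + Z') = drho' g Z + drho' g Z'.
Proof. by rewrite /drho' -dtensD tkD addr0. Qed.
Lemma drhoZ g u Z : drho' g ((u%:M : 'M_n.+1) *: Z) = u *: drho' g Z.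
Proof. by rewrite /drho' -dtensZ tkZ mulr0. Qed.
Lemma drho0 g : drho' g 0 = 0.
Proof. by apply: (addrI (drho' g 0)); rewrite -drhoD !addr0. Qed.
Lemma drhoN g Z : drho' g (- Z) = - drho' g Z.
Proof. by apply: (addIr (drho' g Z)); rewrite -drhoD !addNr drho0. Qed.
Lemma drho_sum g (T : Type) (r : seq T) (F : T -> jet) :
  drho' g (\sum_(i <- r) F i) = \sum_(i <- r) drho' g (F i).
Proof. by apply: (big_morph (drho' g)) => [Z Z'|]; [exact: drhoD | exact: drho0]. Qed.
Lemma drho_bracket Z Z' :
  drho Z *m drho Z' - drho Z' *m drho Z = drho (Z * Z' - Z' * Z).
Proof. by rewrite /drho /drho' tk1 dtens_bracket !tkM mulr0 -!tk1 -!/(drho' _ _) drhoD drhoN. Qed.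

End Ring.

Lemma rho_unit (R : comUnitRingType) (g h : {poly 'M[R]_n.+1}) : jagree (g * h) 1 -> rho g \in unitmx.
Proof. by move=> H; apply: (proj1 (@mulmx1_unit _ _ _ (rho h) _)); rewrite rhoM (rho_agree H) rho1. Qed.

Definition jmap (R R' : comNzRingType) (f : R -> R') (Z : {poly 'M[R]_n.+1}) :
  {poly 'M[R']_n.+1} := map_poly (map_mx f) Z.

Lemma jmapE (R R' : comNzRingType) (f : R -> R') Z l : f 0 = 0 ->
  (jmap f Z)`_l = map_mx f Z`_l.
Proof. by move=> f0; rewrite coef_map_id0 //; apply/matrixP => i j; rewrite !mxE f0. Qed.

Lemma map_tk (R R' : comNzRingType) (f : R -> R') e Z i j : f 0 = 0 ->
  f (tk e Z i j) = tk (f e) (jmap f Z) i j.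
Proof.
move=> f0; case: i j => [[[l x] a]|] [[[l' x'] a']|] //=.
by case: ifP => // _; rewrite jmapE // mxE.
Qed.

Lemma map_drho' (R R' : comNzRingType) (f : {rmorphism R -> R'}) g Z :
  map_mx f (drho' g Z) = drho' (jmap f g) (jmap f Z).
Proof.
rewrite /drho' map_dtens; congr dtens; apply/funext => i; apply/funext => j.
  by rewrite (map_tk _ _ _ _ (rmorph0 f)) rmorph1.
by rewrite (map_tk _ _ _ _ (rmorph0 f)) rmorph0.
Qed.

Lemma jmap1 (R R' : comNzRingType) (f : {rmorphism R -> R'}) : jmap f 1 = 1.
Proof. by rewrite /jmap rmorph1. Qed.

Lemma map_drho (R R' : comNzRingType) (f : {rmorphism R -> R'}) Z :
  map_mx f (drho Z) = drho (jmap f Z).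
Proof. by rewrite /drho map_drho' jmap1. Qed.

Lemma der_rho (R : comNzRingType) (D : R -> R) g : derivation D ->
  map_mx D (rho g) = drho' g (jmap D g).
Proof.
move=> DP; rewrite /rho der_tens // /drho'; congr dtens.
apply/funext => i; apply/funext => j; rewrite map_tk ?(der0 DP) //.
by rewrite (der1 DP).
Qed.

End JetKernels.

(** * Divided derivatives and truncated Taylor expansions *)

Section Leibniz.
Variables (R : comNzRingType) (D : R -> R).
Hypothesis DP : derivation D.

Lemma iter_der_sum l I (r : seq I) (P : pred I) f :
  iter l D (\sum_(i <- r | P i) f i) = \sum_(i <- r | P i) iter l D (f i).
Proof. by elim: l => //= l ->; rewrite der_sum. Qed.

Lemma iter_derM l x y : iter l D (x * y) =
  \sum_(i < l.+1) (iter i D x * iter (l - i) D y) *+ 'C(l, i).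
Proof.
elim: l => [|l IH]; first by rewrite big_ord1 bin0.
rewrite iterS IH der_sum //.
have DMn z m : D (z *+ m) = D z *+ m.
  by elim: m => [|m IHm]; rewrite ?mulr0n ?(der0 DP) // !mulrS derivD // IHm.
have -> : \sum_(i < l.+1) D ((iter i D x * iter (l - i) D y) *+ 'C(l, i)) =
    \sum_(i < l.+1) (iter i.+1 D x * iter (l - i) D y) *+ 'C(l, i) +
    \sum_(i < l.+1) (iter i D x * iter (l.+1 - i) D y) *+ 'C(l, i).
  rewrite -big_split; apply: eq_bigr => i _; rewrite DMn derM // mulrnDl.
  by rewrite subSn // -ltnS ltn_ord.
pose a i := iter i.+1 D x * iter (l - i) D y.
rewrite [RHS]big_ord_recl /= bin0 ?subn0.
rewrite [X in _ = _ + X](eq_bigr (fun i : 'I_l.+1 => a i *+ 'C(l, i.+1) + a i *+ 'C(l, i))); last first.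
  by move=> i _; rewrite -mulrnDr -binS /bump leq0n add1n subSS.
rewrite big_split /= [X in _ = _ + (X + _)]big_ord_recr /= bin_small // mulr0n addr0.
rewrite [X in _ + X = _]big_ord_recl /= bin0 ?subn0 [LHS]addrC -addrA; congr (_ + (_ + _)).
Qed.

Variable c : nat -> R.
Hypothesis cP : forall l, c l * (l`!)%:R = 1.

Lemma divided_leibniz l x y : c l * iter l D (x * y) =
  \sum_(i < l.+1) (c i * iter i D x) * (c (l - i)%N * iter (l - i) D y).
Proof.
rewrite iter_derM mulr_sumr; apply: eq_bigr => i _.
have il : (i <= l)%N by rewrite -ltnS ltn_ord.
have E : c l * 'C(l, i)%:R = c i * c (l - i)%N.
  transitivity (c l * 'C(l, i)%:R * (c i * i`!%:R) * (c (l - i)%N * (l - i)`!%:R)).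
    by rewrite !cP !mulr1.
  transitivity (c i * c (l - i)%N * (c l * ('C(l, i) * (i`! * (l - i)`!))%:R)).
    by rewrite !natrM; ring.
  by rewrite bin_fact // cP mulr1.
rewrite mulrACA -E -mulr_natr; ring.
Qed.
End Leibniz.

Section JetsOfMatrices.
Variables (k K : fieldType) (iota : {rmorphism {poly k} -> K}).
Hypothesis iota_inj : injective iota.
Hypothesis ratfunP : forall f : K, exists p d, d != 0 /\ f = iota p / iota d.
Hypothesis char0 : forall l, l.+1%:R != 0 :> k.
Notation rval := (rval iota).
Notation mval := (mval iota).
Notation kC := (kC iota).
Variables (del : K -> K).
Hypothesis delP : derivation del.
Hypothesis delF : forall p, del (iota p) = iota ('X * p^`()).
Variables (n N : nat).
Notation jet := {poly 'M[K]_n.+1}.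

Lemma K_fact l : (l`!)%:R != 0 :> K.
Proof.
have l0 : (l`!)%:R != 0 :> k by case: (l`!) (fact_gt0 l).
by rewrite -(rmorph_nat (kC : {rmorphism k -> K})) fmorph_eq0.
Qed.

(** Dividing by l! turns the Leibniz rule into the product of polynomials, which makes this map
    multiplicative up to order N ([jetmxM]). *)
Definition jetmx (F : 'M[K]_n.+1) : jet :=
  \poly_(l < N.+1) ((l`!%:R^-1) *: map_mx (iter l del) F).

Lemma jetmxE F l : (l <= N)%N -> (jetmx F)`_l = (l`!%:R^-1) *: map_mx (iter l del) F.
Proof. by move=> lN; rewrite coef_poly ltnS lN. Qed.

Lemma jetmxM F G : jagree N (jetmx F * jetmx G) (jetmx (F *m G)).
Proof.
move=> l lN; rewrite jetmxE // coefM; apply/matrixP => i j.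
rewrite !mxE iter_der_sum // mulr_sumr summxE.
pose cc l : K := (l`!%:R)^-1.
have ccP m : cc m * (m`!)%:R = 1 by rewrite mulVf // K_fact.
under [RHS]eq_bigr => x _ do rewrite (divided_leibniz delP ccP).
rewrite exchange_big; apply: eq_bigr => p _.
have pl : (p <= l)%N by rewrite -ltnS ltn_ord.
rewrite !jetmxE ?(leq_trans pl) ?(leq_trans (leq_subr _ _)) //.
by rewrite -[_ * _]/(_ *m _) mxE; apply: eq_bigr => x _; rewrite !mxE.
Qed.

Lemma jetmx1 : jagree N (jetmx 1%:M) 1.
Proof.
move=> l lN; rewrite jetmxE // coef1; case: l lN => [|l] _ /=.
  by rewrite fact0 invr1 scale1r; apply/matrixP => i j; rewrite !mxE.
apply/matrixP => i j; rewrite !mxE.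
have -> : iter l.+1 del (i == j)%:R = 0.
  by elim: l => [|l IH]; [apply: der_nat | rewrite iterS IH der0].
by rewrite mulr0.
Qed.

Definition jval L (Z : jet) x (V : {poly 'M[k]_n.+1}) :=
  forall l, (l <= L)%N -> mval Z`_l x V`_l.

Lemma jvalM L Z Z' x V V' : jval L Z x V -> jval L Z' x V' -> jval L (Z * Z') x (V * V').
Proof.
move=> a b l lL; rewrite !coefM; apply: mval_sum => // i _; apply: (mvalM iota_inj).
  by apply: a; rewrite (leq_trans _ lL) // -ltnS ltn_ord.
by apply: b; rewrite (leq_trans (leq_subr _ _)).
Qed.

Lemma jvalD L Z Z' x V V' : jval L Z x V -> jval L Z' x V' -> jval L (Z + Z') x (V + V').
Proof. by move=> a b l lL; rewrite !coefD; apply: (mvalD iota_inj); auto. Qed.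

Lemma jvalN L Z x V : jval L Z x V -> jval L (- Z) x (- V).
Proof. by move=> a l lL; rewrite !coefN; apply: mvalN => //; auto. Qed.

Lemma jval_ex L (Z : jet) x : (forall l, (l <= L)%N -> exists V, mval Z`_l x V) ->
  exists V, jval L Z x V.
Proof.
move=> H; have /choice[V VP] l : exists V, (l <= L)%N -> mval Z`_l x V.
  by case: (leqP l L) => [/H[V ?]|_]; [exists V | exists 0].
by exists (\poly_(l < L.+1) V l) => l lL; rewrite coef_poly ltnS lL; apply: VP.
Qed.

Lemma jval_generic L (Z : jet) : exists d : {poly k}, d != 0 /\
  forall x, d.[x] != 0 -> exists V, jval L Z x V.
Proof.
have /choice[d dP] : forall l : nat, exists d : {poly k}, d != 0 /\
    forall x, d.[x] != 0 -> exists V, mval Z`_l x V.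
  by move=> l; apply: (mval_generic ratfunP).
exists (\prod_(l < L.+1) d l); split; first by apply/prodf_neq0 => l _; case: (dP l).
move=> x; rewrite horner_prod => /prodf_neq0 H; apply: jval_ex => l lL.
by apply: (dP l).2; apply: (H (Ordinal (lL : (l < L.+1)%N))).
Qed.

Lemma mval_iter_del l (F : 'M[K]_n.+1) x V : mval F x V -> exists W, mval (map_mx (iter l del) F) x W.
Proof.
move=> H; elim: l => [|l [W HW]].
  by exists V => i j; rewrite mxE; apply: H.
have [W' HW'] := mval_del iota_inj delP delF HW; exists W' => i j.
by have := HW' i j; rewrite !mxE.
Qed.

Lemma jval_jetmx F x V : mval F x V -> exists W, jval N (jetmx F) x W.
Proof.
move=> H; apply: jval_ex => l lN; rewrite jetmxE //.
have [W HW] := mval_iter_del l H; exists ((l`!%:R)^-1 *: W).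
move=> i j; rewrite !mxE; apply: rvalM; last by have := HW i j; rewrite mxE.
by have := rvalC iota ((l`!%:R)^-1) x; rewrite fmorphV rmorph_nat.
Qed.

Lemma jval_jdel Z x V : jval N Z x V -> exists W, jval N (jmap del Z) x W.
Proof.
move=> H; apply: jval_ex => l lN; rewrite jmapE ?(der0 delP) //.
by have [W HW] := mval_del iota_inj delP delF (H l lN); exists W.
Qed.

Lemma jval_jsig (q : k) (sig : {rmorphism K -> K}) L Z x V :
  (forall p, sig (iota p) = iota (p \Po (q *: 'X))) ->
  jval L Z (q * x) V -> jval L (jmap sig Z) x V.
Proof.
by move=> sigP H l lL; rewrite jmapE ?rmorph0 //; apply: (mval_sig sigP); apply: H.
Qed.

End JetsOfMatrices.

Section JetAgreement.
Variables (N n : nat) (R : comNzRingType).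
Notation jet := {poly 'M[R]_n.+1}.
Notation "Z =j Z'" := (jagree N (Z : jet) Z') (at level 70).
Implicit Types Z W : jet.

Lemma jagree_refl Z : Z =j Z. Proof. by []. Qed.
Lemma jagree_sym Z Z' : Z =j Z' -> Z' =j Z. Proof. by move=> H l /H. Qed.
Lemma jagree_trans Z Z' Z'' : Z =j Z' -> Z' =j Z'' -> Z =j Z''.
Proof. by move=> a b l lN; rewrite a ?b. Qed.
Lemma jagreeM Z Z' W W' : Z =j Z' -> W =j W' -> Z * W =j Z' * W'.
Proof.
move=> a b l lN; rewrite !coefM; apply: eq_bigr => i _; rewrite a ?b //.
  by rewrite (leq_trans (leq_subr _ _)).
by rewrite (leq_trans _ lN) // -ltnS ltn_ord.
Qed.
Lemma jagreeD Z Z' W W' : Z =j Z' -> W =j W' -> Z + W =j Z' + W'.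
Proof. by move=> a b l lN; rewrite !coefD a ?b. Qed.
End JetAgreement.

Lemma der_mxM (R : comNzRingType) (D : R -> R) a b c (X : 'M[R]_(a, b)) (Y : 'M[R]_(b, c)) :
  derivation D -> map_mx D (X *m Y) = map_mx D X *m Y + X *m map_mx D Y.
Proof.
move=> DP; apply/matrixP => i j; rewrite !mxE der_sum // -big_split.
by apply: eq_bigr => l _; rewrite !mxE derM.
Qed.

Local Notation tensor_rho := rho.
Local Notation tensor_drho := drho.
Local Notation tensor_drho' := drho'.
Local Notation ratfun_const := kC.

(** * Connections on a stable space of tensors *)

Section Connection.
Variables (k K : fieldType) (iota : {rmorphism {poly k} -> K}).
Hypothesis iota_inj : injective iota.
Hypothesis ratfunP : forall f : K, exists p d, d != 0 /\ f = iota p / iota d.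
Hypothesis char0 : forall l, l.+1%:R != 0 :> k.
Notation rval := (rval iota).
Notation mval := (mval iota).
Notation kC := (kC iota).
Variables (q : k) (sig sigi : {rmorphism K -> K}) (del : K -> K).
Hypothesis q0 : q != 0.
Hypothesis q_not_root1 : forall m, q ^+ m.+1 != 1.
Hypothesis sigP : forall p, sig (iota p) = iota (p \Po (q *: 'X)).
Hypothesis sigiP : forall p, sigi (iota p) = iota (p \Po (q^-1 *: 'X)).
Hypothesis sigiK : cancel sigi sig.
Hypothesis delP : derivation del.
Hypothesis delF : forall p, del (iota p) = iota ('X * p^`()).
Variables (n N c d : nat).
Notation jet := {poly 'M[K]_n.+1}.
Notation W := #|{ffun 'I_d -> jidx N n c}|.
Variables (A A' : 'M[K]_n.+1).
Hypotheses (AA' : A *m A' = 1%:M) (A'A : A' *m A = 1%:M).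
Notation rho := (@rho N n c d _).
Notation drho := (@drho N n c d _).
Notation drho' := (@drho' N n c d _).
Let J := jetmx del N A.
Let J' := jetmx del N A'.
Variable NN : 'M[K]_W.
Hypothesis NNJ : (map_mx sig NN *m rho J :=: NN)%MS.
Notation "Z =j Z'" := (jagree N (Z : jet) Z') (at level 70).

Lemma jetJJ' : J * J' =j 1.
Proof.
apply: jagree_trans (jetmxM iota char0 delP A A') _.
by rewrite AA'; apply: jetmx1.
Qed.

Lemma jetJ'J : J' * J =j 1.
Proof.
apply: jagree_trans (jetmxM iota char0 delP A' A) _.
by rewrite A'A; apply: jetmx1.
Qed.

Lemma rhoJ_unit : rho J \in unitmx.
Proof. exact: rho_unit jetJJ'. Qed.

Lemma sub_rhoJ m (X : 'M[K]_(m, W)) r (Y : 'M[K]_(r, W)) :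
  (map_mx sig X *m rho J <= map_mx sig Y *m rho J)%MS = (X <= Y)%MS.
Proof. by rewrite submxMfree ?row_free_unit ?rhoJ_unit // map_submx. Qed.

Let drhoA g Z Z' : Z =j Z' -> drho' g Z = drho' g Z'.
Proof. by move=> H; apply: drho'_agree. Qed.

Definition liestab (Z : jet) : Prop := (NN *m drho Z <= NN)%MS.

Lemma liestab0 : liestab 0.
Proof. by rewrite /liestab /drho drho0 mulmx0 sub0mx. Qed.
Lemma liestabD Z Z' : liestab Z -> liestab Z' -> liestab (Z + Z').
Proof. by move=> a b; rewrite /liestab /drho drhoD mulmxDr addmx_sub. Qed.
Lemma liestabZ u Z : liestab Z -> liestab ((u%:M : 'M_n.+1) *: Z).
Proof. by move=> a; rewrite /liestab /drho drhoZ -scalemxAr scalemx_sub. Qed.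
Lemma liestab_bracket Z Z' : liestab Z -> liestab Z' -> liestab (Z * Z' - Z' * Z).
Proof.
move=> a b; rewrite /liestab -drho_bracket mulmxBr !mulmxA addmx_sub ?eqmx_opp //.
  exact: submx_trans (submxMr _ a) b.
exact: submx_trans (submxMr _ b) a.
Qed.
Lemma liestab_agree Z Z' : Z =j Z' -> liestab Z -> liestab Z'.
Proof. by move=> H; rewrite /liestab /drho (drhoA _ H). Qed.

(** [rho J] carries the sigma-transform of [NN] onto [NN], hence conjugates the stabilizer of the
    former, which contains the transform of Z, into that of the latter. *)
Lemma liestab_sig Z : liestab Z -> liestab (J' * jmap sig Z * J).
Proof.
move=> a; rewrite /liestab -(eqmxMr _ NNJ) -NNJ -mulmxA rho_drho.
rewrite (@drho'_agree _ _ _ _ _ J J _ (jmap sig Z * J)) //; last first.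
  rewrite !mulrA -[X in _ =j X * _]mul1r; apply: jagreeM => //.
  by apply: jagreeM => //; apply: jetJJ'.
by rewrite -drho_rho mulmxA -map_drho -map_mxM sub_rhoJ.
Qed.

Lemma jmap_sigi (Z : jet) : jmap sig (jmap sigi Z) = Z.
Proof.
apply/polyP => l; rewrite !jmapE ?rmorph0 //; apply/matrixP => i j.
by rewrite !mxE sigiK.
Qed.

Lemma liestab_sigi Z : liestab Z -> liestab (jmap sigi (J * Z * J')).
Proof.
move=> a; rewrite /liestab -sub_rhoJ map_mxM map_drho jmap_sigi -mulmxA drho_rho.
rewrite (@drho'_agree _ _ _ _ _ J J _ (J * Z)) //; last first.
  rewrite -(mulrA (J * Z)); apply: (@jagree_trans _ _ _ _ (J * Z * 1)); last by rewrite mulr1.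
  by apply: jagreeM => //; exact: jetJ'J.
by rewrite -rho_drho mulmxA NNJ (eqmxMr _ NNJ).
Qed.

Let B := row_base NN.
Let BJ := map_mx sig B *m rho J.

Let BJE : (BJ :=: B)%MS.
Proof.
have e : (map_mx sig B :=: map_mx sig NN)%MS by apply/eqmxP; rewrite !map_submx !eq_row_base submx_refl.
apply: eqmx_trans (eqmxMr _ e) _; apply: eqmx_trans NNJ _.
by apply/eqmx_sym/eq_row_base.
Qed.

(** The operator del + Z preserves the space [NN]. A change of base only adds combinations of the
    rows, so the condition can be read in the base [BJ] as well, as is done in
    [connection_transport]. *)
Definition connection (Z : jet) : Prop := ((map_mx del B + B *m drho Z)%R <= B)%MS.

Lemma connection_sub Z Z' : connection Z -> connection Z' -> liestab (Z - Z').
Proof.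
move=> a b; rewrite /liestab -(eqmxMr _ (eq_row_base NN)) -(eq_row_base NN) -/B.
rewrite /drho drhoD drhoN mulmxBr.
have -> : B *m drho' 1 Z - B *m drho' 1 Z' =
    (map_mx del B + B *m drho Z) - (map_mx del B + B *m drho Z').
  by rewrite opprD addrACA subrr add0r.
by rewrite addmx_sub ?eqmx_opp.
Qed.

Let sig_del_mx a b (X : 'M[K]_(a, b)) : map_mx del (map_mx sig X) = map_mx sig (map_mx del X).
Proof.
by apply/matrixP => i j; rewrite !mxE (sig_del iota_inj ratfunP sigP delP delF).
Qed.

(** The hypothesis is the gauge relation between Z and V. In the base [BJ] of [NN], the operator
    with V is the sigma-transform, carried by [rho J], of the operator with Z in the base [B]. *)
Lemma connection_transport Z V : jmap del J + J * V =j jmap sig Z * J ->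
  connection Z <-> connection V.
Proof.
move=> H.
have key : map_mx del BJ + BJ *m drho V = map_mx sig (map_mx del B + B *m drho Z) *m rho J.
  rewrite /BJ der_mxM // der_rho // -[X in _ + X = _]mulmxA rho_drho -addrA -mulmxDr -drhoD.
  rewrite (drhoA _ H) -drho_rho map_mxD (map_mxM _ B) map_drho mulmxDl mulmxA.
  by rewrite sig_del_mx.
have mv (X Y : 'M[K]_(\rank NN, W)) C : X = C *m Y ->
    map_mx del X + X *m drho V = map_mx del C *m Y + C *m (map_mx del Y + Y *m drho V).
  by move=> ->; rewrite der_mxM // mulmxDr !mulmxA addrA.
split=> [a|a].
  have /submxP[X BX] : (B <= BJ)%MS by rewrite BJE.
  rewrite /connection (mv _ _ _ BX) addmx_sub -?BJE ?submxMl //.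
  by rewrite mulmx_sub // key sub_rhoJ.
have /submxP[Y BY] : (BJ <= B)%MS by rewrite BJE.
have : ((map_mx del BJ + BJ *m drho V)%R <= BJ)%MS.
  by rewrite (mv _ _ _ BY) BJE addmx_sub ?submxMl // mulmx_sub.
by rewrite key sub_rhoJ.
Qed.

(** The solution V of the gauge relation of [connection_transport] for given Z, with J inverted by
    J' up to order N; [ctaui] is the solution Z for given V. *)
Definition ctau Z := J' * (jmap sig Z * J - jmap del J).
Definition ctaui Z := jmap sigi ((J * Z + jmap del J) * J').

Lemma connection_tau Z : connection Z -> connection (ctau Z).
Proof.
move=> a; apply: (proj1 (@connection_transport Z _ _) a).
rewrite /ctau mulrA.
apply: (@jagree_trans _ _ _ _ (jmap del J + 1 * (jmap sig Z * J - jmap del J))).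
  by apply: jagreeD => //; apply: jagreeM => //; apply: jetJJ'.
by rewrite mul1r addrC subrK.
Qed.

Lemma connection_taui Z : connection Z -> connection (ctaui Z).
Proof.
move=> a; apply: (proj2 (@connection_transport _ Z _) a).
rewrite /ctaui jmap_sigi -mulrA.
apply: (@jagree_trans _ _ _ _ ((J * Z + jmap del J) * 1)).
  by rewrite mulr1 addrC.
by apply: jagreeM => //; apply/jagree_sym/jetJ'J.
Qed.

Variable z0 : k.
Hypothesis z0_neq0 : z0 != 0.
Hypothesis A_reg : forall x, x != 0 -> exists V, mval A x V.
Hypothesis A'_reg : forall x, x != 0 -> x != z0 -> exists V, mval A' x V.

Let up m := q ^+ m.+1 * z0.
Let dn m := q ^- m * z0.

Lemma up_inj : injective up.
Proof. by move=> i j /(mulIf z0_neq0) /(q_expr_inj q0 q_not_root1) []. Qed.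
Lemma dn_inj : injective dn.
Proof. by move=> i j /(mulIf z0_neq0) /invr_inj /(q_expr_inj q0 q_not_root1). Qed.
Lemma up_neq0 m : up m != 0. Proof. by rewrite mulf_neq0 ?expf_neq0. Qed.
Lemma up_neq m : up m != z0.
Proof. by rewrite -[X in _ != X]mul1r (inj_eq (mulIf z0_neq0)) q_not_root1. Qed.
Lemma dn_neq m : dn m.+1 != z0.
Proof. by rewrite -[X in _ != X]mul1r (inj_eq (mulIf z0_neq0)) invr_eq1 q_not_root1. Qed.

Lemma jval_J x : x != 0 -> exists V, jval iota N J x V.
Proof. by move=> /A_reg[V /(jval_jetmx iota_inj delP delF)]; apply. Qed.
Lemma jval_J' x : x != 0 -> x != z0 -> exists V, jval iota N J' x V.
Proof. by move=> a /(A'_reg a)[V /(jval_jetmx iota_inj delP delF)]; apply. Qed.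
Lemma jval_dJ x : x != 0 -> exists V, jval iota N (jmap del J) x V.
Proof. by move=> /jval_J[V /(jval_jdel iota_inj delP delF)]. Qed.

Section Existence.
Variables (E : fieldType) (pi : (nat -> k) -> E).
Hypothesis piP : seq_quot pi.
Notation kjet := {poly 'M[k]_n.+1}.

Definition jpi (f : nat -> kjet) : {poly 'M[E]_n.+1} :=
  \poly_(l < N.+1) mpi pi (fun m => (f m)`_l).

Lemma jpiE f l : (l <= N)%N -> (jpi f)`_l = mpi pi (fun m => (f m)`_l).
Proof. by move=> lN; rewrite coef_poly ltnS lN. Qed.

Lemma jpiM f g : jagree N (jpi f * jpi g) (jpi (fun m => f m * g m)).
Proof.
move=> l lN; rewrite jpiE // coefM; apply/matrixP => i j; rewrite mxE summxE.
transitivity (\sum_(p < l.+1) pi (fun m => ((f m)`_p *m (g m)`_(l - p)) i j)).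
  apply: eq_bigr => p _; have pl : (p <= l)%N by rewrite -ltnS ltn_ord.
  rewrite !jpiE ?(leq_trans pl) ?(leq_trans (leq_subr _ _)) //.
  by rewrite -[_ * _]/(_ *m _) -mpiM // mxE.
by rewrite -sq_sum //; congr pi; apply/funext => m; rewrite coefM summxE.
Qed.

Lemma jpi1 f : (forall m, jagree N (f m) 1) -> jagree N (jpi f) 1.
Proof.
move=> H l lN; rewrite jpiE //; have -> : (fun m => (f m)`_l) = fun=> (1 : kjet)`_l.
  by apply/funext => m; apply: H.
apply/matrixP => i j; rewrite mxE !coef1; case: l {lN} => [|l] /=.
  by have /matrixP/(_ i j) := mpi1 piP n.+1; rewrite mxE.
by rewrite mulr0n; under [X in pi X]eq_fun do rewrite mxE; rewrite mxE; exact: sq0.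
Qed.

Lemma mpi_rho (f : nat -> kjet) :
  mpi pi (fun m => @tensor_rho N n c d _ (f m)) = @tensor_rho N n c d _ (jpi f).
Proof.
have sq_prod (T : Type) (r : seq T) (u : T -> nat -> k) :
    pi (fun m => \prod_(i <- r) u i m) = \prod_(i <- r) pi (u i).
  elim: r => [|i r IH].
    by rewrite big_nil -[RHS](sq1 piP); congr pi; apply/funext => m; rewrite big_nil.
  by rewrite big_cons -IH -(sqM piP); congr pi; apply/funext => m; rewrite big_cons.
apply/matrixP => a b; rewrite !mxE.
under [X in pi X]eq_fun do rewrite mxE.
rewrite sq_prod; apply: eq_bigr => s _.
move: (fun_of_fin _ s) (fun_of_fin _ s) => i j.
case: i j => [[[l x] y]|] [[[l' x'] y']|] //=; rewrite ?sq0 ?(sq1 piP) //.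
case: ifP => _; last exact: sq0.
by rewrite jpiE ?mxE // (leq_trans (leq_subr _ _)) // -ltnS ltn_ord.
Qed.

(** The points q^(m+1) z0 avoid 0 and z0, so A and its inverse have values at all of them and
    [abs_connection] applies to [rho J]. The connection obtained has the form [drho Zt] with Zt over
    the ultraproduct; expanded on elementary jets, it solves a linear system over [K], and
    [descend_solution] brings it down. *)
Lemma connection_exists : exists Z, connection Z.
Proof.
have /choice[Jv JvP] m := jval_J (up_neq0 m).
have /choice[Jv' Jv'P] m := jval_J' (up_neq0 m) (up_neq m).
have jval_agree x V V' Z Z' : jval iota N Z x V -> jval iota N Z' x V' ->
    Z =j Z' -> jagree N V V'.
  by move=> a b ab l lN; apply: (mval_uniq iota_inj (a l lN)); rewrite ab //; apply: b.
have jval1 x : jval iota N (1 : jet) x 1.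
  move=> l lN; rewrite !coef1; case: (l == 0%N); last exact: mval0.
  exact: mval_scalar (rval1 _ _).
have JvJ' m : jagree N (Jv m * Jv' m) 1.
  exact: jval_agree (jvalM iota_inj (JvP m) (Jv'P m)) (jval1 _) jetJJ'.
have JvJ m : jagree N (Jv' m * Jv m) 1.
  exact: jval_agree (jvalM iota_inj (Jv'P m) (JvP m)) (jval1 _) jetJ'J.
have [|||||m0 H] := @abs_connection k K iota iota_inj ratfunP q sig del sigP _ up W NN (rho J)
    (fun m => @tensor_rho N n c d _ (Jv m)) up_inj _ _ _ _ E pi piP.
- by move=> e; rewrite /ratfun_const delF derivC mulr0 rmorph0.
- by move=> m; rewrite /up exprS mulrA.
- move=> m a b; rewrite !mxE; apply: rval_prod => s _.
  move: (fun_of_fin _ s) (fun_of_fin _ s) => i j.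
  case: i j => [[[l x] y]|] [[[l' x'] y']|] //=; try exact: rval0; try exact: rval1.
  case: ifP => _; last exact: rval0.
  by apply: JvP; rewrite (leq_trans (leq_subr _ _)) // -ltnS ltn_ord.
- by move=> m; apply: rho_unit (JvJ' m).
- by rewrite NNJ.
have xi : injective (fun m => up (m0 + m)%N) by move=> i j /up_inj /addnI.
have [ev evP] := ev_exists iota_inj ratfunP piP xi.
have charE l : l.+1%:R != 0 :> E.
  rewrite -(rmorph_nat ev) fmorph_eq0 -(rmorph_nat (kC : {rmorphism k -> K})) fmorph_eq0.
  exact: char0.
have [||D [DP Dev]] := @derivation_extend K E ev (fun f => ev (del f)) charE (fmorph_inj ev).
- by move=> x y; rewrite derivD // rmorphD.
- by move=> x y; rewrite derM // rmorphD !rmorphM.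
(* The products of the values of J at successive points, and their inverses up to order N: the
   logarithmic derivative is then itself a jet. *)
pose gam := fix gam m : kjet := if m is m'.+1 then Jv (m0 + m')%N * gam m' else 1.
pose gam' := fix gam' m : kjet := if m is m'.+1 then gam' m' * Jv' (m0 + m')%N else 1.
have gamK m : jagree N (gam m * gam' m) 1.
  elim: m => [|m IH]; first by rewrite /= mulr1.
  rewrite /= mulrA -[X in X * _]mulrA.
  apply: (@jagree_trans _ _ _ _ (Jv (m0 + m)%N * 1 * Jv' (m0 + m)%N)).
    by apply: jagreeM => //; apply: jagreeM.
  by rewrite mulr1; apply: JvJ'.
have gamK' m : jagree N (gam' m * gam m) 1.
  elim: m => [|m IH]; first by rewrite /= mulr1.
  rewrite /= mulrA -[X in X * _]mulrA.
  apply: (@jagree_trans _ _ _ _ (gam' m * 1 * gam m)).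
    by apply: jagreeM => //; apply: jagreeM.
  by rewrite mulr1.
have [||Gu] := H ev D (fun m => @tensor_rho N n c d _ (gam m)) evP DP Dev.
- by rewrite rho1.
- by move=> m; rewrite rhoM.
rewrite /= -/B mpi_rho der_rho // => HB.
pose G := jpi gam; pose G' := jpi gam'.
have GG' : jagree N (G' * G) 1.
  by apply: jagree_trans (jpiM _ _) _; apply: jpi1.
pose Zt := jmap D G * G'.
have ZtE : @tensor_drho' N n c d _ G (jmap D G) *m invmx (@tensor_rho N n c d _ G) = @tensor_drho N n c d _ Zt.
  have Gu' : @tensor_rho N n c d _ G \in unitmx by rewrite -mpi_rho.
  apply: (can_inj (mulmxK Gu')); rewrite mulmxKV // drho_rho; apply: drho'_agree => //.
  rewrite /Zt -mulrA -[X in jagree _ X]mulr1.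
  by apply: jagreeM => //; apply: jagree_sym.
rewrite ZtE in HB.
pose T : finType := ('I_N.+1 * 'I_n.+1 * 'I_n.+1)%type.
pose bas (R : comNzRingType) (t : T) : {poly 'M[R]_n.+1} := (delta_mx t.1.2 t.2)%:P * 'X^(t.1.1).
(* Expansion on elementary jets. Only orders at most N matter, which makes the number of unknowns of
   the linear system finite. *)
have dec (R : comNzRingType) (Z : {poly 'M[R]_n.+1}) : jagree N Z
    (\sum_(t : 'I_#|T|) ((Z`_(enum_val t).1.1 (enum_val t).1.2 (enum_val t).2)%:M : 'M_n.+1)
       *: bas R (enum_val t)).
  move=> l lN; rewrite coef_sum (reindex_onto enum_rank enum_val) /=; last by move=> i _; rewrite enum_valK.
  rewrite (eq_bigl xpredT); last by move=> f; rewrite enum_rankK eqxx.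
  under eq_bigr => t _ do rewrite enum_rankK coefZ coefCM coefXn.
  rewrite (eq_bigr (fun t : T => if t.1.1 == Ordinal (lN : (l < N.+1)%N)
      then Z`_l t.1.2 t.2 *: delta_mx t.1.2 t.2 else 0)); last first.
    move=> [[l' x] y] _ /=; rewrite -[l' == _]/(val l' == l) eq_sym.
    case: eqP => [->|_]; last by rewrite !mulr0.
    by rewrite mulr1 -[_ * _]/(_ *m _) mul_scalar_mx.
  rewrite {1}[Z`_l]matrix_sum_delta pair_bigA /=.
  rewrite -(pair_bigA _ (fun p y => if p.1 == Ordinal (lN : (l < N.+1)%N)
      then Z`_l p.2 y *: delta_mx p.2 y else 0)) /=.
  rewrite -(pair_bigA _ (fun l' x => \sum_y if l' == Ordinal (lN : (l < N.+1)%N)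
      then Z`_l x y *: delta_mx x y else 0)) /=.
  rewrite (bigD1 (Ordinal (lN : (l < N.+1)%N))) //= eqxx [X in _ + X]big1 ?addr0 ?pair_bigA //.
  by move=> l' /negbTE ->; rewrite big1 // => x _; rewrite big1.
have [|y yP] := @descend_solution K E ev _ _ #|T| B (map_mx del B)
    (fun t => drho (bas K (enum_val t)))
    (fun t => Zt`_(enum_val t).1.1 (enum_val t).1.2 (enum_val t).2).
  rewrite (_ : \sum_i _ = @tensor_drho N n c d _ Zt) // [RHS](drho'_agree _ _ (@jagree_refl _ _ _ _) (dec _ Zt)).
  rewrite drho_sum; apply: eq_bigr => t _; rewrite drhoZ map_drho; congr (_ *: drho' _ _).
  rewrite /bas /jmap rmorphM /= map_polyC map_polyXn /= map_delta_mx //.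
exists (\sum_(t : 'I_#|T|) ((y t)%:M : 'M_n.+1) *: bas K (enum_val t)).
rewrite /connection /drho drho_sum.
by under eq_bigr do rewrite drhoZ.
Qed.

End Existence.
End Connection.

(** * Elements of the Lie algebra with a polar part of rank one *)

Section PoleElements.
Variables (k K : fieldType) (iota : {rmorphism {poly k} -> K}).
Hypothesis iota_inj : injective iota.
Hypothesis ratfunP : forall f : K, exists p d, d != 0 /\ f = iota p / iota d.
Hypothesis char0 : forall l, l.+1%:R != 0 :> k.
Notation rval := (rval iota).
Notation mval := (mval iota).
Notation kC := (kC iota).
Notation jval := (jval iota).
Variables (q : k) (sig sigi : {rmorphism K -> K}) (del : K -> K).
Hypothesis q0 : q != 0.
Hypothesis q_not_root1 : forall m, q ^+ m.+1 != 1.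
Hypothesis sigP : forall p, sig (iota p) = iota (p \Po (q *: 'X)).
Hypothesis sigiP : forall p, sigi (iota p) = iota (p \Po (q^-1 *: 'X)).
Hypothesis sigiK : cancel sigi sig.
Hypothesis delP : derivation del.
Hypothesis delF : forall p, del (iota p) = iota ('X * p^`()).
Variables (n N : nat).
Notation jet := {poly 'M[K]_n.+1}.
Variables (A A' : 'M[K]_n.+1).
Hypotheses (AA' : A *m A' = 1%:M) (A'A : A' *m A = 1%:M).
Let J := jetmx del N A.
Let J' := jetmx del N A'.
Variable z0 : k.
Hypothesis z0_neq0 : z0 != 0.
Hypothesis A_reg : forall x, x != 0 -> exists V, mval A x V.
Hypothesis A'_reg : forall x, x != 0 -> x != z0 -> exists V, mval A' x V.
(** Local data at z0: [r0] has a simple zero there, it clears the pole of [A'] and leaves the rank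
    one matrix [e *m r], and the value of A kills e. The last hypothesis will be the nonvanishing of
    a trace. *)
Variables (r0 : K) (r1 : k) (e : 'cV[k]_n.+1) (r : 'rV[k]_n.+1) (Az dA : 'M[k]_n.+1).
Hypothesis r0_val : rval r0 z0 0.
Hypothesis r0_der : rval (del r0) z0 r1.
Hypothesis r1_neq0 : r1 != 0.
Hypothesis r0A' : mval (r0 *: A') z0 (e *m r).
Hypothesis AzP : mval A z0 Az.
Hypothesis Az_e : Az *m e = 0.
Hypothesis dAP : mval (map_mx del A) z0 dA.
Hypothesis dA_e : r *m dA *m e != 0.

Let dn m := q ^- m * z0.

(* A Lie algebra of jets, stable under the twisted action of [sig], with elements
   whose leading polar part at [z0] has rank one and nonzero trace. *)
Record lie_system (g : jet -> Prop) : Prop := LieSystem {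
  ls0 : g 0;
  lsD : forall Z Z', g Z -> g Z' -> g (Z + Z');
  lsZ : forall u Z, g Z -> g ((u%:M : 'M_n.+1) *: Z);
  lsB : forall Z Z', g Z -> g Z' -> g (Z * Z' - Z' * Z);
  ls_agree : forall Z Z', jagree N Z Z' -> g Z -> g Z';
  ls_sig : forall Z, g Z -> g (J' * jmap sig Z * J);
  ls_sigi : forall Z, g Z -> g (jmap sigi (J * Z * J'));
  ls_pole : forall L, (L <= N)%N -> exists B phi,
    [/\ g B, forall l, (l < L)%N -> mval B`_l z0 0, mval B`_L z0 (e *m phi) & phi *m e != 0] }.

(** Each derivation raises the order of the pole by one and multiplies the leading coefficient by
    -(l + 1) times the derivative of [r0] at z0, nonzero in characteristic 0. *)
Lemma pole_coef l : exists c : k, c != 0 /\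
  mval (r0 ^+ l.+1 *: map_mx (iter l del) A') z0 (c *: (e *m r)).
Proof.
elim: l => [|l [c [c0 IH]]].
  exists 1; split; first exact: oner_neq0.
  rewrite expr1 scale1r => i j; have := r0A' i j; rewrite !mxE; exact.
exists (- (l.+1%:R * r1 * c)); split; first by rewrite oppr_eq0 !mulf_neq0.
have [W HW] := mval_del iota_inj delP delF IH.
have E : r0 ^+ l.+2 *: map_mx (iter l.+1 del) A' =
    r0 *: map_mx del (r0 ^+ l.+1 *: map_mx (iter l del) A') -
    (l.+1%:R * del r0) *: (r0 ^+ l.+1 *: map_mx (iter l del) A').
  apply/matrixP => i j; rewrite !mxE /= (derM delP).
  have -> : del (r0 ^+ l.+1) = l.+1%:R * del r0 * r0 ^+ l.
    elim: (l) => [|m IHm]; first by rewrite expr0 !expr1 mulr1 mul1r.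
    by rewrite exprS (derM delP) IHm -[m.+2]addn1 natrD exprS; ring.
  by rewrite [r0 ^+ l.+2]exprS [r0 ^+ l.+1]exprS; ring.
rewrite E; have -> : - (l.+1%:R * r1 * c) *: (e *m r) =
    0 *: W - (l.+1%:R * r1) *: (c *: (e *m r)).
  by rewrite scale0r add0r scalerA scaleNr.
apply: (mvalD iota_inj); first exact: mvalZ.
apply: mvalN; apply: mvalZ => //; apply: rvalM => //.
by have := rvalC iota (l.+1%:R) z0; rewrite rmorph_nat.
Qed.

Lemma jpole L l : (l <= L)%N -> (L <= N)%N -> exists c : k, (l = L -> c != 0) /\
  mval ((r0 ^+ L.+1) *: J'`_l) z0 ((if l == L then c else 0) *: (e *m r)).
Proof.
move=> lL LN; have [c [c0 H]] := pole_coef l.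
exists (c * (l`!%:R)^-1); split=> [_|].
  rewrite mulf_neq0 // invr_eq0 -(prednK (fact_gt0 l)); exact: char0.
rewrite jetmxE ?(leq_trans lL) // scalerA.
have -> : r0 ^+ L.+1 * (l`!)%:R^-1 = (r0 ^+ (L - l) * (l`!)%:R^-1) * r0 ^+ l.+1.
  by rewrite mulrAC -exprD addnS subnK.
rewrite -scalerA.
have -> : (if l == L then c * (l`!)%:R^-1 else 0) *: (e *m r) =
   (0 ^+ (L - l) * (l`!)%:R^-1) *: (c *: (e *m r)).
  rewrite scalerA; case: eqVneq => [->|nlL]; first by rewrite subnn expr0 mul1r mulrC.
  by rewrite expr0n subn_eq0 leqNgt ltn_neqAle nlL lL /= !mul0r.
apply: mvalZ => //; apply: rvalM; first exact: rvalXn.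
by have := rvalC iota ((l`!%:R)^-1) z0; rewrite fmorphV rmorph_nat.
Qed.

(** The coefficient of order l of J' has a pole of order l + 1. Multiplication by r0^(L+1) therefore
    annihilates at z0 all orders below L, and in order L leaves only the product of the leading
    polar part with the order 0 part of T. *)
Lemma jpole_mul L T V : (L <= N)%N -> jval N T z0 V -> exists c : k, c != 0 /\
  forall l, (l <= L)%N ->
  mval ((r0 ^+ L.+1) *: (J' * T)`_l) z0 (if l == L then e *m (c *: (r *m V`_0)) else 0).
Proof.
move=> LN TV; have [c [c0 Hc]] := jpole (leqnn L) LN; exists c; split; first exact: c0.
move=> l lL; rewrite coefM scaler_sumr.
have -> : (if l == L then e *m (c *: (r *m V`_0)) else 0) =
    \sum_(i < l.+1) ((if i == L :> nat then c else 0) *: (e *m r)) *m V`_(l - i).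
  case: eqVneq => [->|nlL].
    rewrite big_ord_recr /= eqxx subnn big1 ?add0r => [|i _].
      by rewrite -scalemxAr -scalemxAl mulmxA.
    by rewrite ltn_eqF // scale0r mul0mx.
  rewrite big1 // => i _; rewrite ltn_eqF ?scale0r ?mul0mx //.
  by rewrite (leq_trans (ltn_ord i)) // ltn_neqAle nlL.
apply: (mval_sum iota_inj) => i _; have il : (i <= l)%N by rewrite -ltnS ltn_ord.
have -> : r0 ^+ L.+1 *: (J'`_i * T`_(l - i)) = (r0 ^+ L.+1 *: J'`_i) *m T`_(l - i).
  by rewrite -scalemxAl.
apply: (mvalM iota_inj); last by apply: TV; rewrite (leq_trans (leq_subr _ _)) // (leq_trans lL).
have [c' [_ Hc']] := jpole (leq_trans il lL) LN.
by case: eqVneq Hc' => [->|] Hc' //; rewrite eqxx in Hc.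
Qed.

Variables (c d : nat).
Notation W := #|{ffun 'I_d -> jidx N n c}|.
Variable NN : 'M[K]_W.
Hypothesis NNJ : (map_mx sig NN *m @rho N n c d _ J :=: NN)%MS.

Notation conn := (connection del NN).

(** The value of [ctau Z] at x involves Z at qx and J, J' at x. Regularity thus passes from q^(m+2)
    z0 to q^(m+1) z0; it stops at q z0, since the next step would need J' at its pole. *)
Lemma connection_regular_up : exists Z V, conn Z /\ jval N Z (q * z0) V.
Proof.
have [E [pi piP]] := seq_quot_exists k.
have [Z0 cZ0] := connection_exists iota_inj ratfunP char0 q0 q_not_root1 sigP
  delP delF AA' A'A NNJ z0_neq0 A_reg A'_reg piP.
have [p [p0 pP]] := jval_generic ratfunP N Z0.
pose up m := q ^+ m.+1 * z0.
have [M HM] := poly_avoid p0 (@up_inj k q q0 q_not_root1 z0 z0_neq0).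
have [V HV] := pP _ (HM M (leqnn _)).
suff H m : (exists Z V, conn Z /\ jval N Z (up m) V) ->
    exists Z V, conn Z /\ jval N Z (up 0%N) V.
  have [|Z [V' [a b]]] := H M; first by exists Z0, V.
  by exists Z, V'; split=> //; rewrite /up expr1 in b.
elim: m => // m IH [Z [V' [cZ ZV]]]; apply: IH.
have um0 : up m != 0 by rewrite mulf_neq0 ?expf_neq0.
have umz : up m != z0 by apply: up_neq.
have [V1 H1] := jval_J iota_inj delP delF N A_reg um0.
have [V2 H2] := jval_J' iota_inj delP delF N A'_reg um0 umz.
have [V3 H3] := jval_dJ iota_inj delP delF N A_reg um0.
exists (ctau sig del N A A' Z), (V2 * (V' * V1 - V3)); split.
  exact: (connection_tau iota_inj ratfunP char0 sigP delP delF AA' NNJ).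
apply: (jvalM iota_inj) => //; apply: (jvalD iota_inj); last exact: jvalN.
apply: (jvalM iota_inj) => //; apply: (jval_jsig sigP).
by move: ZV; rewrite /up exprS mulrA.
Qed.

(** [ctaui] goes the other way: its value at x involves the data at x / q. Regularity passes from
    q^-(m+1) z0 to q^-m z0 and reaches z0 without J' ever being evaluated there. *)
Lemma connection_regular : exists Z V, conn Z /\ jval N Z z0 V.
Proof.
have [Z0 [_ [cZ0 _]]] := connection_regular_up.
have [p [p0 pP]] := jval_generic ratfunP N Z0.
have [M HM] := poly_avoid p0 (@dn_inj k q q0 q_not_root1 z0 z0_neq0).
have [V HV] := pP _ (HM M (leqnn _)).
suff H m : (exists Z V, conn Z /\ jval N Z (dn m) V) ->
    exists Z V, conn Z /\ jval N Z (dn 0%N) V.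
  have [|Z [V' [a b]]] := H M; first by exists Z0, V.
  by exists Z, V'; split=> //; rewrite /dn expr0 invr1 mul1r in b.
elim: m => // m IH [Z [V' [cZ ZV]]]; apply: IH.
have um0 : dn m.+1 != 0 by rewrite mulf_neq0 ?invr_eq0 ?expf_neq0.
have umz : dn m.+1 != z0 by apply: dn_neq.
have [V1 H1] := jval_J iota_inj delP delF N A_reg um0.
have [V2 H2] := jval_J' iota_inj delP delF N A'_reg um0 umz.
have [V3 H3] := jval_dJ iota_inj delP delF N A_reg um0.
exists (ctaui sigi del N A A' Z), ((V1 * V' + V3) * V2); split.
  exact: (connection_taui iota_inj ratfunP char0 sigP sigiK delP delF AA' A'A NNJ).
apply: (jval_jsig sigiP).
have -> : q^-1 * dn m = dn m.+1 by rewrite /dn exprS invfM mulrA.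
apply: (jvalM iota_inj) => //; apply: (jvalD iota_inj) => //.
exact: (jvalM iota_inj).
Qed.

(** The pole elements are the multiples by r0^(L+1) of one difference: [ctau Zp], which has the
    poles of J' at z0, minus the connection [Zm] regular at z0. When the row factor is paired with
    e, the term containing the value of A vanishes; what remains is the derivative of A, and [dA_e]
    makes it nonzero. *)
Lemma lie_system_liestab : lie_system (liestab (c := c) (d := d) NN).
Proof.
split.
- exact: liestab0.
- exact: liestabD.
- exact: liestabZ.
- exact: liestab_bracket.
- exact: liestab_agree.
- exact: (liestab_sig iota char0 delP AA' NNJ).
- exact: (liestab_sigi iota char0 sigiK delP AA' A'A NNJ).
move=> L LN.
have [Zp [Vp [cZp ZVp]]] := connection_regular_up.
have [Zm [Vm [cZm ZVm]]] := connection_regular.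
pose T := jmap sig Zp * J - jmap del J.
have gD : liestab NN (J' * T - Zm).
  apply: (connection_sub (del := del)) => //.
  exact: (connection_tau iota_inj ratfunP char0 sigP delP delF AA' NNJ).
have [V1 H1] := jval_jetmx iota_inj delP delF N AzP.
have [V3 H3] := jval_jdel iota_inj delP delF H1.
have TV : jval N T z0 (Vp * V1 - V3).
  apply: (jvalD iota_inj); last exact: jvalN.
  by apply: (jvalM iota_inj) => //; apply: (jval_jsig sigP).
have [f [f0 Hf]] := jpole_mul LN TV.
have V10 : V1`_0 = Az.
  apply: (mval_uniq iota_inj (H1 0%N (leq0n _))) => i j.
  by rewrite jetmxE // fact0 invr1 scale1r mxE; apply: AzP.
have V30 : V3`_0 = dA.
  apply: (mval_uniq iota_inj (H3 0%N (leq0n _))) => i j.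
  by rewrite jmapE ?(der0 delP) // jetmxE // fact0 invr1 scale1r; have := dAP i j; rewrite !mxE.
exists (((r0 ^+ L.+1)%:M : 'M_n.+1) *: (J' * T - Zm)), (f *: (r *m (Vp * V1 - V3)`_0)).
have val l : (l <= L)%N -> mval (((r0 ^+ L.+1)%:M : 'M_n.+1) *: (J' * T - Zm))`_l z0
    (if l == L then e *m (f *: (r *m (Vp * V1 - V3)`_0)) else 0).
  move=> lL; rewrite coefZ -[_ * _]/(_ *m _) mul_scalar_mx coefB scalerBr.
  rewrite -[if _ then _ else _]subr0; apply: (mvalD iota_inj); first exact: Hf.
  have := mvalN (mvalZ (rvalXn L.+1 r0_val) (ZVm l (leq_trans lL LN))).
  by rewrite expr0n scale0r oppr0.
split.
- exact: liestabZ.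
- by move=> l lL; have := val l (ltnW lL); rewrite ltn_eqF.
- by have := val L (leqnn _); rewrite eqxx.
rewrite -scalemxAl scaler_eq0 negb_or f0 /= coefB coef0M V10 V30.
rewrite -[_ * Az]/(_ *m Az) mulmxBr mulmxBl -!mulmxA Az_e !mulmx0 sub0r oppr_eq0.
by rewrite mulmxA.
Qed.

End PoleElements.

(** * A density theorem for algebras of matrices *)

Inductive alg_closure (K : fieldType) n (h : 'M[K]_n -> Prop) : 'M[K]_n -> Prop :=
| alg_gen X of h X : alg_closure h X
| alg_one : alg_closure h 1%:M
| alg_add X Y of alg_closure h X & alg_closure h Y : alg_closure h (X + Y)
| alg_scale a X of alg_closure h X : alg_closure h (a *: X)
| alg_mul X Y of alg_closure h X & alg_closure h Y : alg_closure h (X *m Y).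

Section Density.
Variables (K : fieldType) (n : nat) (h : 'M[K]_n -> Prop).
Hypothesis simple_h : forall H : 'M[K]_n, H != 0 ->
  (forall X, h X -> (H *m X <= H)%MS) -> (1%:M <= H)%MS.
Hypothesis comm_h : forall C : 'M[K]_n, (forall X, h X -> C *m X = X *m C) ->
  exists a, C = a%:M.
Let R := alg_closure h.

Let RN X Y : R X -> R Y -> R (X - Y).
Proof. by move=> a b; rewrite -scaleN1r; apply: alg_add => //; apply: alg_scale. Qed.

Let VJ (S : {set 'I_n}) (X : 'M[K]_n) := forall i, i \notin S -> row i X = 0.

Let VJD S X Y : VJ S X -> VJ S Y -> VJ S (X + Y).
Proof. by move=> a b i iS; rewrite linearD /= a // b // addr0. Qed.
Let VJZ S a X : VJ S X -> VJ S (a *: X).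
Proof. by move=> b i iS; rewrite linearZ /= b // scaler0. Qed.
Let VJN S X Y : VJ S X -> VJ S Y -> VJ S (X - Y).
Proof. by move=> a b; rewrite -scaleN1r; apply: VJD => //; apply: VJZ. Qed.
Let VJM S X Y : VJ S X -> VJ S (X *m Y).
Proof. by move=> a i iS; rewrite row_mul a // mul0mx. Qed.

Let E i (r : 'rV[K]_n) : 'M[K]_n := \matrix_(l, j) (r 0 j *+ (l == i)).
Let rowEi i r l : row l (E i r) = if l == i then r else 0.
Proof. by apply/rowP => j; rewrite !mxE; case: eqP => _; rewrite ?mulr1n ?mulr0n ?mxE. Qed.
Let ED i a r r' : E i (a *: r + r') = a *: E i r + E i r'.
Proof. by apply/row_matrixP => l; rewrite linearD linearZ /= !rowEi; case: eqP => _ //; rewrite scaler0 addr0. Qed.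
Let EM i r X : E i (r *m X) = E i r *m X.
Proof. by apply/row_matrixP => l; rewrite row_mul !rowEi; case: eqP => _ //; rewrite mul0mx. Qed.
Let Esum X : X = \sum_i E i (row i X).
Proof.
apply/row_matrixP => l; rewrite linear_sum /= (bigD1 l) //= rowEi eqxx big1 ?addr0 //.
by move=> i /negbTE il; rewrite rowEi eq_sym il.
Qed.

(** Let V be the right ideal of matrices supported on the rows in S, where S is maximal such that V
    meets R in 0. Simplicity makes R and V complementary. The projection onto R along V commutes
    with right multiplication by h, so its blocks [C i j] lie in the commutant and are scalars; as
    it fixes 1, it is the identity. *)
Lemma density X : R X.
Proof.
pose good (S : {set 'I_n}) := `[< forall X, R X -> VJ S X -> X = 0 >].
have g0 : good (@finset.set0 _).
  apply/asboolP => Y _ H; apply/row_matrixP => i; rewrite H ?inE //.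
  by rewrite row0.
case: (arg_maxnP (fun S : {set 'I_n} => #|S|) g0) => S /asboolP gS Smax.
have dec i r : exists2 Y, R Y & VJ S (E i r - Y).
  have [||H HP] := @subspace_mx K n (fun r => exists2 Y, R Y & VJ S (E i r - Y)); last first.
  - apply/HP; apply: (submx_trans (submx1 r)); apply: simple_h; last first.
      move=> Z hZ; apply/row_subP => l; rewrite row_mul.
      have [Y RY VY] := (HP (row l H)).2 (row_sub l H).
      apply/HP; exists (Y *m Z); first by apply: alg_mul => //; apply: alg_gen.
      by rewrite EM -mulmxBl; apply: VJM.
    apply/eqP => H0.
    have iS : i \notin S.
      apply/negP => iS; case/negP: (oner_neq0 K).
      have /HP : exists2 Y, R Y & VJ S (E i (delta_mx 0 i) - Y).
        exists 0; first by rewrite -(scale0r 1%:M); apply/alg_scale/alg_one.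
        rewrite subr0 => l lS; rewrite rowEi; case: eqP => // li.
        by move: lS; rewrite li iS.
      rewrite H0 submx0 => /eqP/rowP/(_ i); rewrite !mxE !eqxx => /eqP.
      by [].
    (* If no nonzero row placed in position i belongs to R + V, then S can be enlarged by i, against
       its maximality. *)
    have : good (i |: S).
      apply/asboolP => Y RY VY; apply: gS => // l lS.
      have [li|li] := eqVneq l i; last first.
        by apply: VY; rewrite !inE negb_or li.
      have /HP : exists2 Y', R Y' & VJ S (E i (row i Y) - Y').
        exists Y => // l' l'S; rewrite linearB /= rowEi; case: eqP => [->|/eqP l'i].
          by rewrite subrr.
        by rewrite VY ?subrr // !inE negb_or l'i.
      by rewrite H0 submx0 li => /eqP.
    by move/Smax; rewrite /= cardsU1 iS add1n ltnn.
  - move=> a u v [Y RY VY] [Y' RY' VY']; exists (a *: Y + Y').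
      by apply: alg_add => //; apply: alg_scale.
    rewrite ED opprD addrACA -scalerBr; apply: VJD => //.
    exact: VJZ.
  - exists 0; first by rewrite -(scale0r 1%:M); apply/alg_scale/alg_one.
    by move=> l _; rewrite subr0 rowEi; case: eqP => // _.
have uniqR Y Y' X' : R Y -> R Y' -> VJ S (X' - Y) -> VJ S (X' - Y') -> Y = Y'.
  move=> a b c d; apply/eqP; rewrite -subr_eq0; apply/eqP; apply: gS; first exact: RN.
  have -> : Y - Y' = (X' - Y') - (X' - Y) by rewrite opprB [RHS]addrC addrA subrK.
  exact: VJN.
have /choice[pr prP] : forall z : 'I_n * 'rV[K]_n, exists Y, R Y /\ VJ S (E z.1 z.2 - Y).
  by move=> z; have [Y RY VY] := dec z.1 z.2; exists Y.
pose C i j : 'M[K]_n := \matrix_l row j (pr (i, delta_mx 0 l)).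
have prlin i a u v : pr (i, a *: u + v) = a *: pr (i, u) + pr (i, v).
  have [R1 V1] := prP (i, a *: u + v); have [R2 V2] := prP (i, u); have [R3 V3] := prP (i, v).
  apply: (uniqR _ _ _ R1 _ V1); first by apply: alg_add => //; apply: alg_scale.
  rewrite /= ED opprD addrACA -scalerBr; apply: VJD => //; exact: VJZ.
have pr0 i : pr (i, 0) = 0.
  have := prlin i 1 0 0; rewrite !scale1r addr0 => H.
  by apply: (addrI (pr (i, 0))); rewrite -H addr0.
have prC i j u : row j (pr (i, u)) = u *m C i j.
  have {1}-> : u = \sum_l u 0 l *: delta_mx 0 l by apply: row_sum_delta.
  rewrite mulmx_sum_row.
  elim: (index_enum _) => [|l s IH]; first by rewrite !big_nil pr0 row0.
  by rewrite !big_cons prlin linearD linearZ /= IH rowK.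
have prM i u Z : h Z -> pr (i, u *m Z) = pr (i, u) *m Z.
  move=> hZ; have [R1 V1] := prP (i, u *m Z); have [R2 V2] := prP (i, u).
  apply: (uniqR _ _ _ R1 _ V1); first by apply: alg_mul => //; apply: alg_gen.
  by rewrite /= EM -mulmxBl; apply: VJM.
have /choice[c cP] : forall ij : 'I_n * 'I_n, exists a, C ij.1 ij.2 = a%:M.
  move=> [i j] /=; apply: comm_h => Z hZ; apply/row_matrixP => l.
  rewrite !row_mul; have -> : row l (C i j) = delta_mx 0 l *m C i j by rewrite -rowE.
  transitivity (row j (pr (i, delta_mx 0 l *m Z))); first by rewrite prM // row_mul prC.
  by rewrite prC -rowE.
have CP i j : C i j = (c (i, j))%:M := cP (i, j).
pose pi (Y : 'M[K]_n) := \sum_i pr (i, row i Y).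
have piR Y : R (pi Y).
  rewrite /pi; elim: (index_enum _) => [|l s IH].
    by rewrite big_nil -(scale0r 1%:M); apply/alg_scale/alg_one.
  by rewrite big_cons; apply: alg_add => //; exact: (prP (l, _)).1.
have piV Y : VJ S (Y - pi Y).
  rewrite {1}(Esum Y) /pi -sumrB; elim: (index_enum _) => [|l s IH].
    by rewrite big_nil => i _; rewrite row0.
  by rewrite big_cons; apply: VJD => //; exact: (prP (l, _)).2.
have pi1 : pi 1%:M = 1%:M.
  apply: (uniqR _ _ 1%:M (piR _) _ (piV _)); first exact: alg_one.
  by rewrite subrr => i _; rewrite row0.
have cE i j : c (i, j) = (i == j)%:R.
  have /row_matrixP/(_ j)/rowP/(_ i) := pi1.
  rewrite /pi linear_sum /= summxE (bigD1 i) //= prC CP mul_mx_scalar !mxE eqxx mulr1.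
  rewrite big1 ?addr0 => [|l li].
    by rewrite eq_sym.
  by rewrite prC CP mul_mx_scalar !mxE (negbTE li) mulr0.
suff -> : X = pi X by apply: piR.
apply/row_matrixP => j; rewrite /pi linear_sum /= (bigD1 j) //= prC CP cE eqxx mulmx1.
by rewrite big1 ?addr0 // => i ij; rewrite prC CP cE (negbTE ij) mul_mx_scalar scale0r.
Qed.

End Density.

(** * Matrices of order 0 stable under the twisted action *)

Section LevelZero.
Variables (k K : fieldType) (iota : {rmorphism {poly k} -> K}).
Hypothesis iota_inj : injective iota.
Hypothesis ratfunP : forall f : K, exists p d, d != 0 /\ f = iota p / iota d.
Notation rval := (rval iota).
Notation mval := (mval iota).
Variables (q : k) (sig sigi : {rmorphism K -> K}).
Hypothesis q0 : q != 0.
Hypothesis q_not_root1 : forall m, q ^+ m.+1 != 1.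
Hypothesis sigP : forall p, sig (iota p) = iota (p \Po (q *: 'X)).
Hypothesis sigiK : cancel sigi sig.
Hypothesis sigKi : cancel sig sigi.
Variables (n : nat).
Variables (A A' : 'M[K]_n).
Hypotheses (AA' : A *m A' = 1%:M) (A'A : A' *m A = 1%:M).
Variable z0 : k.
Hypothesis z0_neq0 : z0 != 0.
Let dn m := q ^- m * z0.
Variables (Av Av' : nat -> 'M[k]_n).
Hypothesis AvP : forall m, mval A (dn m.+1) (Av m).
Hypothesis AvP' : forall m, mval A' (dn m.+1) (Av' m).
Variable e : 'cV[k]_n.
Hypothesis e_neq0 : e != 0.

(* [K^n], as a module of rows over the twisted polynomials in [sig], is simple. *)
Definition irreducible_system := forall P : 'rV[K]_n -> Prop,
  P 0 -> (forall a u v, P u -> P v -> P (a *: u + v)) ->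
  (forall u, P u <-> P (map_mx sig u *m A)) ->
  (exists2 u, u != 0 & P u) -> forall u, P u.
Hypothesis irr : irreducible_system.

(** The vector e at z0, transported to q^-m z0 by the values of [A']. *)
Fixpoint evec m : 'cV[k]_n := if m is m'.+1 then Av' m' *m evec m' else e.

Let AvK m : Av m *m Av' m = 1%:M.
Proof.
apply: (mval_uniq iota_inj (mvalM iota_inj (AvP m) (AvP' m))); rewrite AA'.
by apply: mval_scalar; apply: rval1.
Qed.

Lemma evec_neq0 m : evec m != 0.
Proof.
elim: m => //= m; apply: contra_neq => H.
by rewrite -[evec m]mul1mx -(AvK m) -mulmxA H mulmx0.
Qed.

Let dn_inj : injective dn := @dn_inj k q q0 q_not_root1 z0 z0_neq0.

(** Rows whose values eventually kill [evec] form a sigma-stable subspace. If it contained a nonzero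
    row, irreducibility would put all unit rows in it and [evec] would vanish at some point. *)
Lemma row_vanishing (u : 'rV[K]_n) :
  (exists M, forall m V, (M <= m)%N -> mval u (dn m) V -> V *m evec m = 0) -> u = 0.
Proof.
move=> Hu; apply: contrapT => /eqP u0.
suff H (v : 'rV[K]_n) : exists M, forall m V, (M <= m)%N -> mval v (dn m) V -> V *m evec m = 0.
  have /choice[M MP] : forall i : 'I_n, exists M, forall m (V : 'rV_n), (M <= m)%N ->
      mval (delta_mx 0 i : 'rV_n) (dn m) V -> V *m evec m = 0 by move=> i; apply: H.
  pose m := \max_i M i; case/negP: (evec_neq0 m); apply/eqP/row_matrixP => i.
  rewrite row0 rowE; apply: (MP i); first exact: leq_bigmax.
  by move=> x y; rewrite !mxE; case: (_ && _); [apply: rval1 | apply: rval0].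
move: v; apply: irr.
- exists 0%N => m V _ HV; rewrite (mval_uniq iota_inj HV (@mval0 k K iota _ _ _)) mul0mx.
  by [].
- move=> a v w [M1 H1] [M2 H2].
  have [M3 [V3 P3]] := mval_eventually ratfunP dn_inj v.
  have [M4 [V4 P4]] := mval_eventually ratfunP dn_inj w.
  have [M5 [V5 P5]] := mval_eventually ratfunP dn_inj (a%:M : 'M_1).
  exists (M1 + M2 + M3 + M4 + M5)%N => m V le HV.
  have h5 : mval (a%:M : 'M_1) (dn m) (V5 m) by apply: P5; lia.
  have h3 : mval v (dn m) (V3 m) by apply: P3; lia.
  have h4 : mval w (dn m) (V4 m) by apply: P4; lia.
  have := mvalD iota_inj (mvalM iota_inj h5 h3) h4; rewrite mul_scalar_mx => h6.
  rewrite (mval_uniq iota_inj HV h6) mulmxDl -mulmxA.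
  by rewrite (H1 m _ _ h3) ?(H2 m _ _ h4) ?mulmx0 ?addr0 //; lia.
- move=> v; split=> -[M H].
    have [M3 [V3 P3]] := mval_eventually ratfunP dn_inj v.
    exists (M + M3).+1 => -[//|m] V le HV.
    have h3 : mval v (dn m) (V3 m) by apply: P3; lia.
    have h4 : mval (map_mx sig v *m A) (dn m.+1) (V3 m *m Av m).
      apply: (mvalM iota_inj) (AvP m); apply: (mval_sig sigP).
      by rewrite (_ : q * _ = dn m) // /dn exprS invfM !mulrA mulfV // mul1r.
    rewrite (mval_uniq iota_inj HV h4) /= mulmxA -(mulmxA _ (Av m)) AvK mulmx1.
    by apply: (H m) => //; lia.
  exists M => m V le HV.
  have h4 : mval (map_mx sig v *m A) (dn m.+1) (V *m Av m).
    apply: (mvalM iota_inj) (AvP m); apply: (mval_sig sigP).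
    by rewrite (_ : q * _ = dn m) // /dn exprS invfM !mulrA mulfV // mul1r.
  have := H m.+1 _ (leqW le) h4.
  by rewrite /= mulmxA -(mulmxA _ (Av m)) AvK mulmx1.
- by exists u.
Qed.

Lemma mx_vanishing (C : 'M[K]_n) M :
  (forall m V, (M <= m)%N -> mval C (dn m) V -> V *m evec m = 0) -> C = 0.
Proof.
move=> H; apply/row_matrixP => i; rewrite row0; apply: row_vanishing.
have [M3 [V3 P3]] := mval_eventually ratfunP dn_inj C.
exists (M + M3)%N => m V le HV.
have h3 : mval C (dn m) (V3 m) by apply: P3; lia.
have -> : V = row i (V3 m).
  apply: (mval_uniq iota_inj HV) => x y; rewrite !mxE; apply: h3.
by rewrite -row_mul (H m) ?row0 //; lia.
Qed.

Variable h : 'M[K]_n -> Prop.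
Hypothesis hD : forall X Y, h X -> h Y -> h (X + Y).
Hypothesis hZ : forall a X, h X -> h (a *: X).
Hypothesis h_sig : forall X, h X -> h (A' *m map_mx sig X *m A).
Hypothesis h_sigi : forall X, h X -> h (map_mx sigi (A *m X *m A')).
Hypothesis h_pole : forall m, exists X phi,
  [/\ h X, mval X (dn m) (evec m *m phi) & phi *m evec m != 0].

(* A commutative reduced algebra stable under [sig] consists of scalars. *)
Definition scalar_commutants := forall P : 'M[K]_n -> Prop,
  (forall f, P f%:M) -> (forall X Y, P X -> P Y -> P (X + Y)) ->
  (forall X Y, P X -> P Y -> P (X *m Y)) ->
  (forall X Y, P X -> P Y -> X *m Y = Y *m X) ->
  (forall X, P X -> X *m X = 0 -> X = 0) ->
  (forall X, P X -> P (A' *m map_mx sig X *m A)) ->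
  forall X, P X -> exists f, X = f%:M.
Hypothesis scal : scalar_commutants.

Let sigiKm a b (X : 'M[K]_(a, b)) : map_mx sig (map_mx sigi X) = X.
Proof. by apply/matrixP => i j; rewrite !mxE sigiK. Qed.

(** At q^-m z0 a matrix commuting with h commutes with a rank one matrix evec phi of nonzero trace,
    hence has [evec] as an eigenvector. So two such matrices commute on [evec], and one of square 0
    kills it; by [mx_vanishing] the commutant is commutative and reduced, and [scal] applies to
    it. *)
Lemma comm_level0 (C : 'M[K]_n) : (forall X, h X -> C *m X = X *m C) -> exists a, C = a%:M.
Proof.
have eig (D : 'M[K]_n) V m : (forall X, h X -> D *m X = X *m D) -> mval D (dn m) V ->
    exists x : k, V *m evec m = x *: evec m.
  move=> cD DV; have [X [phi [hX Xv pe]]] := h_pole m.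
  have E : V *m (evec m *m phi) = (evec m *m phi) *m V.
    apply: (mval_uniq iota_inj (mvalM iota_inj DV Xv)); rewrite cD //.
    exact: (mvalM iota_inj).
  have := congr1 (mulmx^~ (evec m)) E; rewrite -!mulmxA.
  rewrite [phi *m evec m]mx11_scalar mulmxA mul_mx_scalar => E2.
  have s0 : (phi *m evec m) 0 0 != 0.
    by apply: contraNneq pe => s0; rewrite [phi *m _]mx11_scalar s0 -scalemx1 scale0r.
  exists (((phi *m evec m) 0 0)^-1 * (phi *m (V *m evec m)) 0 0).
  rewrite -scalerA; apply: (canRL (scalerK s0)); rewrite E2.
  by rewrite {1}[phi *m (V *m _)]mx11_scalar mul_mx_scalar.
move=> HC; apply: (scal (P := fun D => forall X, h X -> D *m X = X *m D)) => //.
- by move=> f X _; rewrite mul_scalar_mx mul_mx_scalar.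
- by move=> X Y a b Z hZ'; rewrite mulmxDl mulmxDr a // b.
- by move=> X Y a b Z hZ'; rewrite -mulmxA b // mulmxA a // mulmxA.
- move=> X Y a b; apply/eqP; rewrite -subr_eq0; apply/eqP.
  have [M1 [V1 P1]] := mval_eventually ratfunP dn_inj X.
  have [M2 [V2 P2]] := mval_eventually ratfunP dn_inj Y.
  apply: (@mx_vanishing _ (M1 + M2)%N) => m V le HV.
  have h1 : mval X (dn m) (V1 m) by apply: P1; lia.
  have h2 : mval Y (dn m) (V2 m) by apply: P2; lia.
  have h3 := mvalD iota_inj (mvalM iota_inj h1 h2) (mvalN (mvalM iota_inj h2 h1)).
  rewrite (mval_uniq iota_inj HV h3) mulmxBl -!mulmxA.
  have [x xE] := eig _ _ _ a h1; have [y yE] := eig _ _ _ b h2.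
  by rewrite xE yE -!scalemxAr xE yE !scalerA mulrC subrr.
- move=> X a X2; have [M1 [V1 P1]] := mval_eventually ratfunP dn_inj X.
  apply: (@mx_vanishing _ M1) => m V le HV.
  have h1 : mval X (dn m) (V1 m) by apply: P1.
  have h2 : V1 m *m V1 m = 0.
    by apply: (mval_uniq iota_inj (mvalM iota_inj h1 h1)); rewrite X2; apply: mval0.
  rewrite (mval_uniq iota_inj HV h1); have [x xE] := eig _ _ _ a h1; rewrite xE.
  have /eqP := congr1 (mulmx^~ (evec m)) h2.
  rewrite mul0mx -mulmxA xE -scalemxAr xE scalerA scaler_eq0 (negbTE (evec_neq0 m)) orbF.
  by rewrite mulf_eq0 orbb => /eqP ->; rewrite scale0r.
- move=> X a Y hY; have := a _ (h_sigi hY) => /(congr1 (map_mx sig)).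
  rewrite map_mxM sigiKm (map_mxM _ (map_mx sigi _)) sigiKm => E.
  set YY := A *m Y *m A' in E.
  have YE : Y = A' *m YY *m A by rewrite /YY !mulmxA A'A mul1mx -mulmxA A'A mulmx1.
  have cj (S T : 'M[K]_n) : (A' *m S *m A) *m (A' *m T *m A) = A' *m (S *m T) *m A.
    by rewrite !mulmxA -(mulmxA _ A A') AA' mulmx1.
  by rewrite YE !cj E.
Qed.

Let hstab (H : 'M[K]_n) := forall X, h X -> (H *m X <= H)%MS.

Let tw (H : 'M[K]_n) := map_mx sig H *m A.
Let twi (H : 'M[K]_n) := map_mx sigi (H *m A').

Let A_unit : A \in unitmx.
Proof. exact: (proj1 (mulmx1_unit AA')). Qed.

Let twK H : tw (twi H) = H.
Proof. by rewrite /tw /twi sigiKm -mulmxA A'A mulmx1. Qed.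

Let tw_sub m (u : 'M[K]_(m, n)) (H : 'M[K]_n) : (map_mx sig u *m A <= tw H)%MS = (u <= H)%MS.
Proof. by rewrite submxMfree ?row_free_unit // map_submx. Qed.

Let hstab_twi H : hstab H -> hstab (twi H).
Proof.
move=> a X hX; rewrite -tw_sub twK map_mxM -mulmxA.
have -> : map_mx sig X *m A = A *m (A' *m map_mx sig X *m A).
  by rewrite !mulmxA AA' mul1mx.
by rewrite mulmxA -/(tw (twi H)) twK; apply: a; apply: h_sig.
Qed.

Let hstab_tw H : hstab H -> hstab (tw H).
Proof.
move=> a X hX.
have -> : tw H *m X = map_mx sig (H *m map_mx sigi (A *m X *m A')) *m A.
  by rewrite /tw map_mxM sigiKm !mulmxA -(mulmxA _ A') A'A mulmx1.
by rewrite tw_sub; apply: a; apply: h_sigi.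
Qed.

Let rank_tw H : \rank (tw H) = \rank H.
Proof. by rewrite mxrankMfree ?row_free_unit // mxrank_map. Qed.

Let rank_twi H : \rank (twi H) = \rank H.
Proof. by rewrite -rank_tw twK. Qed.

(** The h-stable subspaces of least rank are permuted by the twisted sigma, so their sum is
    everything by irreducibility, and one of them, [H0], has an h-stable complement. The projection
    onto [H0] commutes with h, so it is a scalar by [comm_level0], and [H0] is the whole space. *)
Lemma simple_level0 (H : 'M[K]_n) : H != 0 -> hstab H -> (1%:M <= H)%MS.
Proof.
move=> Hn0 Hst.
pose Q r := `[< exists H, [/\ H != 0, hstab H & \rank H = r] >].
have exQ : exists r, Q r by exists (\rank H); apply/asboolP; exists H.
case: (ex_minnP exQ) => d /asboolP[H0 [H0n H0s H0d]] dmin.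
have dminE (T : 'M[K]_n) : hstab T -> (\rank T < d)%N -> T = 0.
  move=> Ts lt; apply/eqP/negPn/negP => Tn; have /dmin : Q (\rank T) by apply/asboolP; exists T.
  by rewrite leqNgt lt.
(* The sum of all minimal subspaces is replaced by an arbitrary [T] that contains each of them,
   which avoids sums over infinite families. *)
have minfull (T : 'M[K]_n) : (forall H, hstab H -> \rank H = d -> (H <= T)%MS) -> (1%:M <= T)%MS.
  pose P (u : 'rV[K]_n) := forall T : 'M[K]_n,
    (forall H, hstab H -> \rank H = d -> (H <= T)%MS) -> (u <= T)%MS.
  suff PT u : P u by move=> HT; apply/row_subP => i; apply: PT.
  move: u; apply: irr.
  - by move=> T' _; apply: sub0mx.
  - by move=> a u v Pu Pv T' HT; rewrite addmx_sub ?scalemx_sub ?Pu ?Pv.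
  - move=> u; split=> Pu T' HT.
      rewrite -[T']twK tw_sub; apply: Pu => H1 s1 r1.
      have := HT _ (hstab_tw s1); rewrite rank_tw => /(_ r1).
      by rewrite -{1}[T']twK tw_sub.
    rewrite -tw_sub; apply: Pu => H1 s1 r1.
    rewrite -[H1]twK tw_sub; apply: HT; first exact: hstab_twi.
    by rewrite rank_twi.
  - have [i ri] : exists i, row i H0 != 0.
      apply: contrapT => /forallNP nr; case/negP: H0n; apply/eqP/row_matrixP => i.
      by rewrite row0; apply/eqP/negPn/negP => /nr.
    by exists (row i H0) => // T' /(_ _ H0s H0d); apply: submx_trans; apply: row_sub.
have hstabD X Y : hstab X -> hstab Y -> hstab (X + Y)%MS.
  move=> a b Z hZ'; rewrite addsmxMr; apply: addsmxS; [exact: a | exact: b].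
have hstabI X Y : hstab X -> hstab Y -> hstab (X :&: Y)%MS.
  move=> a b Z hZ'; rewrite sub_capmx.
  by rewrite (submx_trans _ (a Z hZ')) ?(submx_trans _ (b Z hZ')) // submxMr ?capmxSl ?capmxSr.
pose G r := `[< exists C, [/\ hstab C, (H0 :&: C)%MS = 0 & \rank C = r] >].
have exG : exists r, G r.
  exists 0%N; apply/asboolP; exists 0; rewrite capmx0 mxrank0; split=> //.
  by move=> X _; rewrite mul0mx sub0mx.
have bG r : G r -> (r <= n)%N by move=> /asboolP[C [_ _ <-]]; apply: rank_leq_row.
case: (ex_maxnP exG bG) => r /asboolP[C [Cs CH Cr]] rmax.
have full : (1%:M <= H0 + C)%MS.
  apply: minfull => H1 s1 r1; apply/negPn/negP => nle.
  have I0 : (H1 :&: (H0 + C))%MS = 0.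
    apply: dminE; first by apply: hstabI => //; apply: hstabD.
    rewrite -r1 ltn_neqAle mxrankS ?capmxSl // andbT; apply: contra nle => /eqP rE.
    have := mxrank_leqif_sup (capmxSl H1 (H0 + C)%MS); rewrite rE => -[_ /esym].
    by rewrite eqxx sub_capmx => /andP[].
  have : G (\rank (C + H1)%MS).
    apply/asboolP; exists (C + H1)%MS; split=> //; first exact: hstabD.
    apply/eqP; rewrite -submx0; apply/rV_subP => v; rewrite sub_capmx => /andP[v0].
    case/sub_addsmxP => -[u1 u2] /= vE.
    have u20 : u2 *m H1 = 0.
      apply/eqP; rewrite -submx0 -I0 sub_capmx submxMl /=.
      have -> : u2 *m H1 = v - u1 *m C by rewrite vE addrC addKr.
      by rewrite addmx_sub ?eqmx_opp ?(submx_trans v0) ?addsmxSl // mulmx_sub // addsmxSr.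
    rewrite -CH sub_capmx v0 vE u20 addr0 submxMl.
    by [].
  move/rmax; rewrite -Cr leqNgt ltn_neqAle mxrankS ?addsmxSl // andbT => /negPn/eqP rE.
  have := mxrank_leqif_sup (addsmxSl C H1); rewrite -rE => -[_ /esym].
  rewrite eqxx => /(submx_trans (addsmxSr C H1)) /submx_trans/(_ (addsmxSr H0 C)).
  by apply/negP.
have [P Pid P0] : exists2 P : 'M[K]_n, forall m (u : 'M_(m, n)), (u <= H0)%MS -> u *m P = u
    & forall m (u : 'M_(m, n)), (u <= C)%MS -> u *m P = 0.
  by exists (proj_mx H0 C) => m u; [apply: proj_mx_id | apply: proj_mx_0].
have [f fE] : exists f, P = f%:M.
  apply: comm_level0 => X hX.
  have rowc (u : 'rV[K]_n) : u *m (P *m X) = u *m (X *m P).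
    have /sub_addsmxP[[u1 u2] /= ->] : (u <= H0 + C)%MS by apply: submx_trans full; apply: submx1.
    rewrite !mulmxDl !mulmxA (Pid _ _ (submxMl u1 H0)) (P0 _ _ (submxMl u2 C)) mul0mx addr0.
    by rewrite -!(mulmxA _ _ X) (Pid _ (u1 *m _)) ?(P0 _ (u2 *m _)) ?addr0 // mulmx_sub ?Cs ?H0s.
  by apply/row_matrixP => i; rewrite !rowE rowc.
have f1 : f = 1.
  have := Pid _ _ (submx_refl H0); rewrite fE mul_mx_scalar => /eqP.
  rewrite -{2}[H0]scale1r -subr_eq0 -scalerBl scaler_eq0 (negbTE H0n) orbF subr_eq0.
  by move/eqP.
have C0 : C = 0.
  by have := P0 _ _ (submx_refl C); rewrite fE f1 mulmx1.
have H0full : (1%:M <= H0)%MS by move: full; rewrite C0 addsmx0.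
have dn1 : d = n.
  by apply/eqP; rewrite -H0d eqn_leq rank_leq_row /= -{1}(mxrank1 K n) mxrankS.
rewrite sub1mx; apply/eqP/eqP; rewrite eqn_leq rank_leq_col -{1}dn1.
by apply: dmin; apply/asboolP; exists H.
Qed.

Lemma density_level0 X : alg_closure h X.
Proof. by apply: density; [exact: simple_level0 | exact: comm_level0]. Qed.
End LevelZero.

(** * Lie algebras of jets with rank one elements *)

Section RankOne.
Variables (E : fieldType) (n : nat) (h : 'M[E]_n -> Prop).
Hypothesis two : 2%:R != 0 :> E.
Hypothesis h0 : h 0.
Hypothesis hD : forall X Y, h X -> h Y -> h (X + Y).
Hypothesis hZ : forall a X, h X -> h (a *: X).
Hypothesis hB : forall X Y, h X -> h Y -> h (X *m Y - Y *m X).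
Hypothesis irr_col : forall P : 'cV[E]_n -> Prop,
  P 0 -> (forall a u v, P u -> P v -> P (a *: u + v)) ->
  (forall X v, h X -> P v -> P (X *m v)) -> (exists2 v, v != 0 & P v) -> forall v, P v.
Hypothesis irr_row : forall P : 'rV[E]_n -> Prop,
  P 0 -> (forall a u v, P u -> P v -> P (a *: u + v)) ->
  (forall X v, h X -> P v -> P (v *m X)) -> (exists2 v, v != 0 & P v) -> forall v, P v.
Variables (e : 'cV[E]_n) (f : 'rV[E]_n).
Hypothesis fe : f *m e != 0.
Hypothesis hp : h (e *m f).

Let s := (f *m e) 0 0.
Let s0 : s != 0.
Proof. by apply: contraNneq fe => s0; rewrite [f *m e]mx11_scalar -/s s0 -scalemx1 scale0r. Qed.
Let hN X Y : h X -> h Y -> h (X - Y).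
Proof. by move=> a b; rewrite -scaleN1r; auto. Qed.
Let hZi a X : a != 0 -> h (a *: X) -> h X.
Proof. by move=> a0 H; rewrite -[X]scale1r -(mulVf a0) -scalerA; apply: hZ. Qed.

Let sc (v : 'cV[E]_n) (w : 'rV[E]_n) (x : 'cV[E]_n) (y : 'rV[E]_n) :
  (v *m w) *m (x *m y) = (w *m x) 0 0 *: (v *m y).
Proof. by rewrite mulmxA -(mulmxA v) {1}[w *m x]mx11_scalar mul_mx_scalar -scalemxAl. Qed.

(** With p = e f one has p^2 = s p and p Y p = y p, and s [Y, p] + [[Y, p], p] + 2 y p equals 2 s Y
    p. This is where 2 is inverted. *)
Let hYp Y : h Y -> h (Y *m (e *m f)).
Proof.
move=> hY; have hC := hB hY hp; have hCC := hB hC hp.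
have pp : (e *m f) *m (e *m f) = s *: (e *m f) by apply: sc.
pose y := (f *m (Y *m e)) 0 0.
have pYp : (e *m f) *m Y *m (e *m f) = y *: (e *m f).
  by rewrite -mulmxA (mulmxA Y) sc.
have : h ((2%:R * s) *: (Y *m (e *m f))).
  have -> : (2%:R * s) *: (Y *m (e *m f)) =
     s *: (Y *m (e *m f) - e *m f *m Y) +
     (((Y *m (e *m f) - e *m f *m Y) *m (e *m f) - (e *m f) *m (Y *m (e *m f) - e *m f *m Y)) +
      (2%:R * y) *: (e *m f)).
    rewrite mulmxBl mulmxBr pYp -(mulmxA Y (e *m f) (e *m f)) pp (mulmxA (e *m f) Y) pYp.
    rewrite (mulmxA (e *m f) (e *m f)) pp -scalemxAr -scalemxAl scalerBr.
    move: (Y *m (e *m f)) (e *m f *m Y) (e *m f) => a b p; clearbody s y.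
    by apply/matrixP => i j; rewrite !mxE; ring.
  by apply: hD; [apply: hZ | apply: hD => //; apply: hZ].
by apply: hZi; rewrite mulf_neq0.
Qed.

Let hpY Y : h Y -> h ((e *m f) *m Y).
Proof. by move=> hY; rewrite -[_ *m Y](subKr (Y *m (e *m f))); apply: hN; [apply: hYp | apply: hB]. Qed.

Let colf v : h (v *m f).
Proof.
move: v; apply: irr_col.
- by rewrite mul0mx.
- by move=> a u v hu hv; rewrite mulmxDl -scalemxAl; apply: hD => //; apply: hZ.
- move=> Y v hY hv; have := hYp (hB hY hv); rewrite mulmxBl.
  have -> : Y *m (v *m f) *m (e *m f) = s *: (Y *m v *m f) by rewrite (mulmxA Y) sc.
  have -> : v *m f *m Y *m (e *m f) = (f *m Y *m e) 0 0 *: (v *m f).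
    by rewrite -(mulmxA v f Y) sc.
  move=> H; apply: (hZi s0); rewrite -[s *: _](subrK ((f *m Y *m e) 0 0 *: (v *m f))).
  by apply: hD; [exact: H | apply: hZ].
- exists e => //; apply: contraNneq fe => ->; by rewrite mulmx0.
Qed.

Let rowe w : h (e *m w).
Proof.
move: w; apply: irr_row.
- by rewrite mulmx0.
- by move=> a u v hu hv; rewrite mulmxDr -scalemxAr; apply: hD => //; apply: hZ.
- move=> Y w hY hw; have := hpY (hB hY hw); rewrite mulmxBr.
  have -> : e *m f *m (Y *m (e *m w)) = (f *m Y *m e) 0 0 *: (e *m w).
    by rewrite (mulmxA Y) sc mulmxA.
  rewrite -(mulmxA e w Y) sc -/s => H.
  apply: (hZi s0); rewrite -[s *: _](subKr ((f *m Y *m e) 0 0 *: (e *m w))).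
  by apply: hN => //; apply: hZ.
- exists f => //; apply: contraNneq fe => ->; by rewrite mul0mx.
Qed.

(** By irreducibility h contains all products v f and e w, and the bracket of v f with e w is s v w
    up to a multiple of e f. *)
Lemma rank_one_full X : h X.
Proof.
have vw (v : 'cV[E]_n) (w : 'rV[E]_n) : h (v *m w).
  have := hB (colf v) (rowe w); rewrite !sc -/s => H.
  apply: (hZi s0); rewrite -[s *: _](subrK ((w *m v) 0 0 *: (e *m f))).
  by apply: hD => //; apply: hZ.
rewrite [X]matrix_sum_delta; apply: big_ind => // i _; apply: big_ind => // j _; apply: hZ.
by rewrite -(mul_delta_mx (0 : 'I_1)).
Qed.

End RankOne.

(** * Lie systems contain all jets *)

Section LieSystemFull.
Variables (k K : fieldType) (iota : {rmorphism {poly k} -> K}).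
Hypothesis iota_inj : injective iota.
Hypothesis ratfunP : forall f : K, exists p d, d != 0 /\ f = iota p / iota d.
Hypothesis char0 : forall l, l.+1%:R != 0 :> k.
Notation rval := (rval iota).
Notation mval := (mval iota).
Notation jval := (jval iota).
Variables (q : k) (sig sigi : {rmorphism K -> K}) (del : K -> K).
Hypothesis q0 : q != 0.
Hypothesis q_not_root1 : forall m, q ^+ m.+1 != 1.
Hypothesis sigP : forall p, sig (iota p) = iota (p \Po (q *: 'X)).
Hypothesis sigiK : cancel sigi sig.
Hypothesis delP : derivation del.
Hypothesis delF : forall p, del (iota p) = iota ('X * p^`()).
Variables (n N : nat).
Notation jet := {poly 'M[K]_n.+1}.
Variables (A A' : 'M[K]_n.+1).
Hypotheses (AA' : A *m A' = 1%:M) (A'A : A' *m A = 1%:M).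
Let J := jetmx del N A.
Let J' := jetmx del N A'.
Variable z0 : k.
Hypothesis z0_neq0 : z0 != 0.
Hypothesis A_reg : forall x, x != 0 -> exists V, mval A x V.
Hypothesis A'_reg : forall x, x != 0 -> x != z0 -> exists V, mval A' x V.
Variable e : 'cV[k]_n.+1.
Hypothesis e_neq0 : e != 0.
Hypothesis irr : irreducible_system sig A.
Hypothesis scal : scalar_commutants sig A A'.
Variable g : jet -> Prop.
Hypothesis gP : lie_system iota sig sigi del N A A' z0 e g.

Let dn m := q ^- m * z0.
Let dn_inj : injective dn := @dn_inj k q q0 q_not_root1 z0 z0_neq0.

Variables (Av Av' : nat -> 'M[k]_n.+1).
Hypothesis AvP : forall m, mval A (dn m.+1) (Av m).
Hypothesis AvP' : forall m, mval A' (dn m.+1) (Av' m).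
Notation evec := (evec Av' e).

Let jetmx0 (F : 'M[K]_n.+1) : (jetmx del N F)`_0 = F.
Proof.
rewrite jetmxE // fact0 invr1 scale1r; apply/matrixP => i j; by rewrite !mxE.
Qed.

(** The twisted action of sigma moves a pole element from q^-m z0 to q^-(m+1) z0, where A and its
    inverse are regular. As the orders below L vanish at the point, only the order 0 parts of J and
    J' act on the coefficient of order L. *)
Lemma pole_transport L m : (L <= N)%N -> exists B phi,
  [/\ g B, forall l, (l < L)%N -> mval B`_l (dn m) 0,
      mval B`_L (dn m) (evec m *m phi) & phi *m evec m != 0].
Proof.
move=> LN; elim: m => [|m [B [phi [gB B0 BL pe]]]].
  have [B [phi [gB B0 BL pe]]] := ls_pole gP LN.
  by exists B, phi; split=> //; rewrite /dn ?expr0 ?invr1 ?mul1r //; move=> l /B0.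
have [V1 H1] := jval_jetmx iota_inj delP delF N (AvP m).
have [V2 H2] := jval_jetmx iota_inj delP delF N (AvP' m).
pose P : {poly 'M[k]_n.+1} := (evec m *m phi)%:P * 'X^L.
have BP : jval L B (dn m) P.
  move=> l lL; rewrite coefCM coefXn; case: eqVneq => [->|nl]; first by rewrite mulr1.
  by rewrite mulr0; apply: B0; rewrite ltn_neqAle nl.
have jL Z V x : jval N Z x V -> jval L Z x V by move=> H l lL; apply: H; apply: leq_trans LN.
have H : jval L (J' * jmap sig B * J) (dn m.+1) (V2 * P * V1).
  apply: (jvalM iota_inj); last exact: jL.
  apply: (jvalM iota_inj); first exact: jL.
  apply: (jval_jsig sigP).
  by rewrite (_ : q * _ = dn m) // /dn exprS invfM !mulrA mulfV // mul1r.
have E : V2 * P * V1 = (V2 * (evec m *m phi)%:P * V1) * 'X^L.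
  by rewrite /P -!mulrA -commr_polyXn.
have V20 : V2`_0 = Av' m.
  by apply: (mval_uniq iota_inj (H2 0%N (leq0n _))); rewrite jetmx0.
have V10 : V1`_0 = Av m.
  by apply: (mval_uniq iota_inj (H1 0%N (leq0n _))); rewrite jetmx0.
have AvK : Av m *m Av' m = 1%:M.
  apply: (mval_uniq iota_inj (mvalM iota_inj (AvP m) (AvP' m))); rewrite AA'.
  by apply: mval_scalar; apply: rval1.
exists (J' * jmap sig B * J), (phi *m Av m); split.
- exact: (ls_sig gP).
- move=> l lL; have := H l (ltnW lL); rewrite E coefMXn lL.
  exact.
- have := H L (leqnn _); rewrite E coefMXn ltnn subnn coef0M coef0M V20 V10 coefC eqxx.
  have -> : evec m.+1 *m (phi *m Av m) = Av' m * (evec m *m phi) * Av m; last by [].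
  by rewrite -[RHS]/(Av' m *m (evec m *m phi) *m Av m) /= !mulmxA.
- by rewrite /= mulmxA -(mulmxA phi) AvK mulmx1.
Qed.

Let h X := exists2 Z, g Z & Z`_0 = X.

Let hD X Y : h X -> h Y -> h (X + Y).
Proof. by move=> [Z gZ <-] [Z' gZ' <-]; exists (Z + Z'); rewrite ?coefD //; apply: (lsD gP). Qed.
Let hZ a X : h X -> h (a *: X).
Proof.
move=> [Z gZ <-]; exists ((a%:M : 'M_n.+1) *: Z); first exact: (lsZ gP).
by rewrite coefZ -[_ * _]/(_ *m _) mul_scalar_mx.
Qed.
Let hB X Y : h X -> h Y -> h (X *m Y - Y *m X).
Proof.
move=> [Z gZ <-] [Z' gZ' <-]; exists (Z * Z' - Z' * Z); first exact: (lsB gP).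
by rewrite coefB !coef0M.
Qed.
Let h_sig X : h X -> h (A' *m map_mx sig X *m A).
Proof.
move=> [Z gZ <-]; exists (J' * jmap sig Z * J); first exact: (ls_sig gP).
by rewrite !coef0M !jetmx0 jmapE ?rmorph0.
Qed.
Let h_sigi X : h X -> h (map_mx sigi (A *m X *m A')).
Proof.
move=> [Z gZ <-]; exists (jmap sigi (J * Z * J')); first exact: (ls_sigi gP).
by rewrite jmapE ?rmorph0 // !coef0M !jetmx0.
Qed.
Let h_pole m : exists X phi, [/\ h X, mval X (dn m) (evec m *m phi) & phi *m evec m != 0].
Proof.
have [B [phi [gB _ BL pe]]] := pole_transport m (leq0n N).
by exists B`_0, phi; split=> //; exists B.
Qed.

Lemma alg_level0 X : alg_closure h X.
Proof.
exact: (density_level0 iota_inj ratfunP q0 q_not_root1 sigP sigiK AA' A'A z0_neq0 AvP AvP'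
  e_neq0 irr h_sig h_sigi h_pole scal).
Qed.

(** Elements of h with a value of rank one are known only point by point. Membership in h is given
    by linear equations over [K]; the matrix evec phi satisfies their values at every q^-m z0, so
    that in the ultraproduct [eE *m fE] belongs to the extension [hE] of h. As h generates all
    matrices as an associative algebra, [hE] acts irreducibly on rows and columns; [rank_one_full]
    applies, and the conclusion descends. *)
Lemma level0_full X : h X.
Proof.
have [E [pi piP]] := seq_quot_exists k.
have [ev evP] := ev_exists iota_inj ratfunP piP dn_inj.
have h00 : h 0 by exists 0; [exact: (ls0 gP) | rewrite coef0].
have [H HP] : exists H : 'M[K]_(n.+1 * n.+1), forall v : 'rV_(n.+1 * n.+1),
    h (vec_mx v) <-> (v <= H)%MS.
  apply: subspace_mx; first by rewrite raddf0.
  by move=> a u v hu hv; rewrite linearD linearZ; apply: hD => //; apply: hZ.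
have HPm Y : h Y <-> (mxvec Y <= H)%MS by rewrite -HP mxvecK.
pose hE (Y : 'M[E]_n.+1) := (mxvec Y <= map_mx ev H)%MS.
have hEev Y : h Y -> hE (map_mx ev Y).
  by move=> /HPm; rewrite /hE -map_mxvec map_submx.
have hED Y Y' : hE Y -> hE Y' -> hE (Y + Y') by move=> a b; rewrite /hE linearD addmx_sub.
have hEZ a Y : hE Y -> hE (a *: Y) by move=> b; rewrite /hE linearZ scalemx_sub.
have hE0 : hE 0 by rewrite /hE linear0 sub0mx.
have hEspan (P : 'M[E]_n.+1 -> Prop) : P 0 -> (forall a Y Y', P Y -> P Y' -> P (a *: Y + Y')) ->
    (forall Y, h Y -> P (map_mx ev Y)) -> forall Y, hE Y -> P Y.
  move=> P0 PL Pev Y /submxP[u uE]; rewrite -[Y]mxvecK uE mulmx_sum_row linear_sum /=.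
  elim: (index_enum _) => [|i r IH]; first by rewrite big_nil.
  rewrite big_cons linearZ /=; apply: PL => //.
  rewrite -map_row -map_vec_mx; apply: Pev; apply/HP; exact: row_sub.
have hEB Y Y' : hE Y -> hE Y' -> hE (Y *m Y' - Y' *m Y).
  move=> hY; move: Y'; apply: (hEspan).
  - by rewrite mulmx0 mul0mx subrr.
  - move=> a Z Z' hZ1 hZ2.
    rewrite mulmxDr mulmxDl -scalemxAr -scalemxAl opprD addrACA -scalerBr.
    by apply: hED => //; apply: hEZ.
  move=> Z hZ1; move: Y hY; apply: (hEspan).
  - by rewrite mulmx0 mul0mx subrr.
  - move=> a Y Y' hY1 hY2.
    rewrite mulmxDr mulmxDl -scalemxAr -scalemxAl opprD addrACA -scalerBr.
    by apply: hED => //; apply: hEZ.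
  by move=> Y hY; rewrite -!map_mxM -map_mxB; apply/hEev/hB.
have /choice[XP XPP] m : exists z : 'M[K]_n.+1 * 'rV[k]_n.+1,
    [/\ h z.1, mval z.1 (dn m) (evec m *m z.2) & z.2 *m evec m != 0].
  by have [Y [phi H1]] := h_pole m; exists (Y, phi).
pose eE := mpi pi evec; pose fE := mpi pi (fun m => (XP m).2).
have feE : fE *m eE != 0.
  rewrite -mpiM //; apply/eqP => /matrixP/(_ 0 0); rewrite !mxE => E0.
  have nz m : (0 <= m)%N -> ((XP m).2 *m evec m) 0 0 != 0.
    move=> _; have [_ _] := XPP m.
    by apply: contraNneq => m0; rewrite [_ *m evec m]mx11_scalar m0 -scalemx1 scale0r.
  by have := sqN piP nz; rewrite E0 eqxx.
have pE : hE (eE *m fE).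
  rewrite /hE submxE -map_cokermx -mpiM //.
  have [M [V VP]] := mval_eventually ratfunP dn_inj (cokermx H).
  rewrite (ev_mval evP VP).
  have -> : mxvec (mpi pi (fun m => evec m *m (XP m).2)) = mpi pi (fun m => mxvec (evec m *m (XP m).2)).
    apply/rowP => x; case/mxvec_indexP: x => i j; rewrite mxvecE !mxE.
    by congr pi; apply/funext => m; rewrite mxvecE.
  rewrite -mpiM // (mpi_ev piP (G := fun=> 0) (M := M)).
    by apply/eqP/matrixP => i j; rewrite !mxE -[RHS](sq0 piP); congr pi; apply/funext => m; rewrite mxE.
  move=> m le; have [hX Xv _] := XPP m.
  have Xv' : mval (mxvec (XP m).1) (dn m) (mxvec (evec m *m (XP m).2)).
    move=> x y; rewrite ord1; case/mxvec_indexP: y => i j; rewrite !mxvecE; exact: Xv.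
  apply: (mval_uniq iota_inj (mvalM iota_inj Xv' (VP m le))).
  move/HPm: hX; rewrite submxE => /eqP ->; exact: mval0.
have two : 2%:R != 0 :> E.
  rewrite -(rmorph_nat ev) fmorph_eq0 -(rmorph_nat (kC iota : {rmorphism k -> K})) fmorph_eq0.
  exact: char0.
have col (P : 'cV[E]_n.+1 -> Prop) : P 0 -> (forall a u v, P u -> P v -> P (a *: u + v)) ->
  (forall X v, hE X -> P v -> P (X *m v)) -> (exists2 v, v != 0 & P v) -> forall v, P v.
  move=> P0 PL PM [v v0 Pv] w.
  have PD u u' : P u -> P u' -> P (u + u') by rewrite -{2}[u]scale1r; apply: PL.
  have PZ a u : P u -> P (a *: u) by move=> Pu; rewrite -[_ *: _]addr0; apply: PL.
  have PA Y u : P u -> P (map_mx ev Y *m u).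
    move: u; elim: (alg_level0 Y) => {Y} [Y hY|| Y Y' _ IH _ IH'|a Y _ IH|Y Y' _ IH _ IH'] u Pu.
    - by apply: PM => //; apply: hEev.
    - by rewrite map_mx1 mul1mx.
    - by rewrite map_mxD mulmxDl; apply: PD; auto.
    - by rewrite map_mxZ -scalemxAl; apply: PZ; auto.
    - by rewrite map_mxM -mulmxA; auto.
  have [i vi] : exists i, v i 0 != 0.
    apply: contrapT => /forallNP nv; case/negP: v0; apply/eqP/matrixP => i j.
    by rewrite ord1 mxE; apply/eqP/negPn/negP => /nv.
  have Pd j : P (delta_mx j 0).
    have -> : delta_mx j 0 = (v i 0)^-1 *: (map_mx ev (delta_mx j i) *m v).
      apply/colP => x; rewrite !mxE (bigD1 i) //= !mxE eqxx big1 ?addr0 => [|y yi].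
        by rewrite eqxx !andbT; case: eqP => _; rewrite ?rmorph1 ?rmorph0 ?mul1r ?mul0r ?mulr0 ?mulVf.
      by rewrite !mxE (negbTE yi) andbF rmorph0 mul0r.
    by apply/PZ/PA.
  rewrite [w]matrix_sum_delta; elim: (index_enum _) => [|j r IH]; first by rewrite big_nil.
  by rewrite big_cons big_ord1; apply: PD => //; apply: PZ.
have row (P : 'rV[E]_n.+1 -> Prop) : P 0 -> (forall a u v, P u -> P v -> P (a *: u + v)) ->
  (forall X v, hE X -> P v -> P (v *m X)) -> (exists2 v, v != 0 & P v) -> forall v, P v.
  move=> P0 PL PM [v v0 Pv] w.
  have PD u u' : P u -> P u' -> P (u + u') by rewrite -{2}[u]scale1r; apply: PL.
  have PZ a u : P u -> P (a *: u) by move=> Pu; rewrite -[_ *: _]addr0; apply: PL.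
  have PA Y u : P u -> P (u *m map_mx ev Y).
    move: u; elim: (alg_level0 Y) => {Y} [Y hY|| Y Y' _ IH _ IH'|a Y _ IH|Y Y' _ IH _ IH'] u Pu.
    - by apply: PM => //; apply: hEev.
    - by rewrite map_mx1 mulmx1.
    - by rewrite map_mxD mulmxDr; apply: PD; auto.
    - by rewrite map_mxZ -scalemxAr; apply: PZ; auto.
    - by rewrite map_mxM mulmxA; auto.
  have [i vi] : exists i, v 0 i != 0.
    apply: contrapT => /forallNP nv; case/negP: v0; apply/eqP/rowP => i.
    by rewrite mxE; apply/eqP/negPn/negP => /nv.
  have Pd j : P (delta_mx 0 j).
    have -> : delta_mx 0 j = (v 0 i)^-1 *: (v *m map_mx ev (delta_mx i j)).
      apply/rowP => x; rewrite !mxE (bigD1 i) //= !mxE eqxx big1 ?addr0 => [|y yi].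
        by case: eqP => _; rewrite /= ?rmorph1 ?rmorph0 ?mulr1 ?mulr0 ?mulVf.
      by rewrite !mxE (negbTE yi) rmorph0 mulr0.
    by apply/PZ/PA.
  rewrite [w]row_sum_delta; elim: (index_enum _) => [|j r IH]; first by rewrite big_nil.
  by rewrite big_cons; apply: PD => //; apply: PZ.
have := rank_one_full two hE0 hED hEZ hEB col row feE pE (map_mx ev X).
by rewrite /hE -map_mxvec map_submx => /HPm.
Qed.

Let T : finType := ('I_N.+1 * 'I_n.+1 * 'I_n.+1)%type.
Let evl (x : 'I_#|T|) : 'I_N.+1 * 'I_n.+1 * 'I_n.+1 := enum_val x.
Let dec (v : 'rV[K]_#|T|) : jet :=
  \poly_(l < N.+1) \matrix_(i, j) v 0 (enum_rank ((inord l, i, j) : T)).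

(** A linear form sending Y to the sum of the tr (c_l Y_l) and vanishing on g is shown to be 0, from
    the top order down. If c_l = 0 for l > M, apply it to the pole elements p = evec phi of level M
    and to their brackets with elements of arbitrary order 0 part, which [level0_full] provides. At
    q^-m z0 the value V of c_M then satisfies tr (V p) = 0 and commutes with p, which forces V evec
    = 0; so c_M = 0 by [mx_vanishing]. *)
Theorem lie_system_full Z : g Z.
Proof.
have decE v (t : T) : (dec v)`_(t.1.1) t.1.2 t.2 = v 0 (enum_rank t).
  by case: t => [[l i] j] /=; rewrite coef_poly ltn_ord mxE inord_val.
have [G GP] : exists G : 'M[K]_#|T|, forall v, g (dec v) <-> (v <= G)%MS.
  apply: subspace_mx.
    apply: (ls_agree gP) (ls0 gP) => l lN; rewrite coef0; apply/matrixP => i j.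
    by rewrite coef_poly ltnS lN !mxE.
  move=> a u v gu gv; apply: (ls_agree gP) (lsD gP (lsZ gP a gu) gv) => l lN.
  rewrite coefD coefZ -[_ * _]/(_ *m _) mul_scalar_mx; apply/matrixP => i j.
  by rewrite !coef_poly ltnS lN !mxE.
pose u : 'rV_#|T| := \row_x Z`_(evl x).1.1 (evl x).1.2 (evl x).2.
suff H : (u <= G)%MS.
  move/GP: H; apply: (ls_agree gP) => l lN; apply/matrixP => i j.
  by rewrite coef_poly ltnS lN !mxE /evl enum_rankK /= inordK.
rewrite submxE; suff -> : cokermx G = 0 by rewrite mulmx0.
apply/matrixP => x0 y0; rewrite [RHS]mxE.
pose c (l : nat) : 'M[K]_n.+1 := \matrix_(i, j) cokermx G (enum_rank ((inord l, j, i) : T)) y0.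
have cg Y : g Y -> \sum_(l < N.+1) \tr (c l *m Y`_l) = 0.
  move=> gY; pose v : 'rV_#|T| := \row_x Y`_(evl x).1.1 (evl x).1.2 (evl x).2.
  have /GP : g (dec v).
    apply: (ls_agree gP) gY => l lN; apply/matrixP => i j.
    by rewrite coef_poly ltnS lN !mxE /evl enum_rankK /= inordK.
  rewrite submxE => /eqP/rowP/(_ y0); rewrite !mxE => E0; rewrite -[RHS]E0.
  rewrite (reindex_onto enum_rank enum_val) /=; last by move=> i _; rewrite enum_valK.
  rewrite [RHS](eq_bigl xpredT); last by move=> t; rewrite enum_rankK eqxx.
  rewrite (eq_bigr (fun l : 'I_N.+1 => \sum_(j < n.+1) \sum_(i < n.+1)
     Y`_l j i * cokermx G (enum_rank ((l, j, i) : T)) y0)); last first.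
    move=> l _; rewrite /mxtrace; under eq_bigr => i _ do rewrite mxE.
    rewrite exchange_big /=; apply: eq_bigr => j _; apply: eq_bigr => i _.
    by rewrite mxE inord_val mulrC.
  rewrite pair_bigA pair_bigA /=; apply: eq_bigr => -[[l j] i] _ /=.
  by rewrite [v 0 _]mxE /evl enum_rankK.
suff c0 L : (L <= N.+1)%N -> forall l, (N.+1 - L <= l)%N -> (l <= N)%N -> c l = 0.
  have := c0 N.+1 (leqnn _) (evl x0).1.1; rewrite subnn => /(_ isT).
  rewrite -ltnS ltn_ord => /(_ isT) /matrixP/(_ (evl x0).2 (evl x0).1.2).
  by rewrite !mxE inord_val -!surjective_pairing enum_valK.
elim: L => [_ l|L IH LN l].
  by rewrite subn0 => H1 H2; move: (leq_trans H1 H2); rewrite ltnn.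
rewrite leq_eqVlt => /orP[/eqP <-|lt] lN; last first.
  by apply: IH => //; [exact: ltnW | move: lt; lia].
(* [M] is N - L, so that the induction on L runs through the orders N, N - 1, down to 0. *)
set M := (N.+1 - L.+1)%N in lN *; have MN : (M <= N)%N by [].
have cM l' : (M < l')%N -> (l' <= N)%N -> c l' = 0.
  by move=> a b; apply: IH => //; [exact: ltnW | move: a; rewrite /M; lia].
have trg Y x (V : 'M[k]_n.+1) W : g Y -> (forall l, (l < M)%N -> mval Y`_l x 0) ->
    mval Y`_M x V -> (forall l, (l <= M)%N -> exists W, mval (c l) x W) -> mval (c M) x W ->
    \tr (W *m V) = 0.
  move=> gY Y0 YM cr cW; have := cg _ gY.
  rewrite (bigD1 (Ordinal (MN : (M < N.+1)%N))) //= => E0.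
  have tv (F : 'M[K]_n.+1) U : mval F x U -> rval (\tr F) x (\tr U).
    by move=> H; apply: (rval_sum iota_inj) => i _; apply: H.
  have r0 : rval (\sum_(i < N.+1 | i != Ordinal (MN : (M < N.+1)%N)) \tr (c i *m Y`_i)) x 0.
    elim/big_ind: _ => [|a b ha hb|i iM]; first exact: rval0.
      by rewrite -[0]addr0; apply: (rvalD iota_inj).
    have nM : (i : nat) != M.
      by apply: contra iM => /eqP iM; apply/eqP/val_inj.
    have [lt|le] := ltnP i M.
      have [W' HW] := cr _ (ltnW lt).
      by have := tv _ _ (mvalM iota_inj HW (Y0 _ lt)); rewrite mulmx0 mxtrace0.
    rewrite cM ?mul0mx ?mxtrace0; first exact: rval0.
      by rewrite ltn_neqAle eq_sym nM.
    by rewrite -ltnS ltn_ord.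
  apply: (rval_uniq iota_inj (tv _ _ (mvalM iota_inj cW YM))).
  have -> : \tr (c M *m Y`_M) = 0 - \sum_(i < N.+1 | i != Ordinal (MN : (M < N.+1)%N)) \tr (c i *m Y`_i).
    by rewrite sub0r; apply/eqP; rewrite -addr_eq0 E0.
  by have := rvalB iota_inj (rval0 iota x) r0; rewrite subr0.
have /choice[Yt YtP] (ij : 'I_n.+1 * 'I_n.+1) : exists Y, g Y /\ Y`_0 = delta_mx ij.1 ij.2.
  by have [Y gY Y0] := level0_full (delta_mx ij.1 ij.2); exists Y.
have regseq (F : jet) : exists M0, forall m, (M0 <= m)%N -> exists V, jval N F (dn m) V.
  have [d [d0 dP]] := jval_generic ratfunP N F.
  have [M0 HM] := poly_avoid d0 dn_inj.
  by exists M0 => m /HM; apply: dP.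
have /choice[M1 M1P] ij := regseq (Yt ij).
have [M2 M2P] := regseq (\poly_(l < N.+1) c l).
apply: (mx_vanishing iota_inj ratfunP q0 q_not_root1 sigP AA' z0_neq0 AvP AvP' e_neq0 irr
  (M := (M2 + \max_ij M1 ij)%N)) => m V le HV.
have [B [phi [gB B0 BM pe]]] := pole_transport m MN.
have cr l' : (l' <= M)%N -> exists W, mval (c l') (dn m) W.
  move=> l'M; have [|W HW] := M2P m; first by move: le; lia.
  exists W`_l'; have := HW l' (leq_trans l'M MN).
  by rewrite coef_poly ltnS (leq_trans l'M MN).
pose p := evec m *m phi.
have t1 : \tr (V *m p) = 0 by apply: trg gB B0 BM cr HV.
have t2 i j : \tr (V *m (delta_mx i j *m p - p *m delta_mx i j)) = 0.
  have [gY Y0] := YtP (i, j).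
  have [|W HW] := M1P (i, j) m.
    by apply: leq_trans le; rewrite (leq_trans _ (leq_addl _ _)) // (leq_bigmax (i, j)).
  have jB : jval M B (dn m) (p%:P * 'X^M).
    move=> l' l'M; rewrite coefCM coefXn; case: eqVneq => [->|nl]; first by rewrite mulr1.
    by rewrite mulr0; apply: B0; rewrite ltn_neqAle nl.
  have jW : jval M (Yt (i, j)) (dn m) W by move=> l' l'M; apply: HW; apply: leq_trans MN.
  have W0 : W`_0 = delta_mx i j.
    apply: (mval_uniq iota_inj (HW 0%N (leq0n _))); rewrite Y0 => x y.
    by rewrite !mxE; case: (_ && _); [apply: rval1 | apply: rval0].
  have jj : jval M (Yt (i, j) * B - B * Yt (i, j)) (dn m) ((W * p%:P - p%:P * W) * 'X^M).
    rewrite mulrBl -(mulrA p%:P) (commr_polyXn W M) !mulrA -(mulrA W).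
    apply: (jvalD iota_inj); first exact: (jvalM iota_inj).
    by apply: jvalN; apply: (jvalM iota_inj).
  apply: (trg (Yt (i, j) * B - B * Yt (i, j)) (dn m)) => //.
  - exact: (lsB gP).
  - by move=> l' l'M; have := jj l' (ltnW l'M); rewrite coefMXn l'M.
  - have E0 : (W * p%:P - p%:P * W)`_0 = delta_mx i j *m p - p *m delta_mx i j.
      by rewrite coefB !coef0M coefC eqxx W0.
    by have := jj M (leqnn _); rewrite coefMXn ltnn subnn E0.
have comm : p *m V = V *m p.
  apply/matrixP => j i; have := t2 i j.
  rewrite mulmxBr raddfB /= (mulmxA V (delta_mx i j) p) (mulmxA V p) (mxtrace_mulC _ p) (mulmxA p V) => /eqP.
  have trd (F : 'M[k]_n.+1) : \tr (F *m delta_mx i j) = F j i.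
    rewrite /mxtrace (bigD1 j) //= big1 ?addr0.
      rewrite mxE (bigD1 i) //= mxE !eqxx mulr1 big1 ?addr0 // => x xi.
      by rewrite mxE (negbTE xi) mulr0.
    move=> x xj; rewrite mxE big1 // => y _; rewrite mxE (negbTE xj) andbF mulr0.
    by [].
  by rewrite !trd subr_eq0 => /eqP.
have s0 : (phi *m evec m) 0 0 != 0.
  by apply: contraNneq pe => s0; rewrite [phi *m _]mx11_scalar s0 -scalemx1 scale0r.
have := congr1 (mulmx^~ (evec m)) comm; rewrite /p -!mulmxA.
rewrite {1}[phi *m evec m]mx11_scalar mul_mx_scalar.
have -> : phi *m (V *m evec m) = 0.
  rewrite mulmxA; move: t1; rewrite /p mulmxA mxtrace_mulC mulmxA => t1.
  by rewrite [_ *m evec m]mx11_scalar -[X in X%:M]trace_mx11 t1 -scalemx1 scale0r.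
by rewrite mulmx0 -scalemxAr => /esym/eqP; rewrite scaler_eq0 (negbTE s0) => /eqP.
Qed.

End LieSystemFull.

(** * The companion system *)

Section Companion.
Variables (k K : fieldType) (iota : {rmorphism {poly k} -> K}).
Hypothesis iota_inj : injective iota.
Hypothesis ratfunP : forall f : K, exists p d, d != 0 /\ f = iota p / iota d.
Hypothesis closed_k : forall p : {poly k}, size p != 1%N -> exists x, root p x.
Notation rval := (rval iota).
Notation mval := (mval iota).
Notation kC := (kC iota).
Notation z := (iota 'X).
Variables (q : k) (sig : {rmorphism K -> K}) (del : K -> K).
Hypothesis q0 : q != 0.
Hypothesis q_not_root1 : forall m, q ^+ m.+1 != 1.
Hypothesis sigP : forall p, sig (iota p) = iota (p \Po (q *: 'X)).
Hypothesis delP : derivation del.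
Hypothesis delF : forall p, del (iota p) = iota ('X * p^`()).
Variables (n : nat) (P Q : {poly k}) (lam : k).
Hypothesis lam0 : lam != 0.
Hypothesis sP : size P = n.+2.
Hypothesis sQ : (size Q <= n.+1)%N.
Hypotheses (P00 : P`_0 != 0) (Q00 : Q`_0 != 0).
Hypothesis PQ : forall x y m, root P x -> root Q y -> x <> q ^+ m * y.
Hypothesis QP : forall x y m, root P x -> root Q y -> y <> q ^+ m * x.

Let p := P`_n.+1.
Let p0 : p != 0.
Proof. by rewrite /p -[n.+1]/(n.+2.-1) -sP -/(lead_coef P) lead_coef_eq0 -size_poly_eq0 sP. Qed.

(* [comp_mx = comp_inf + z^-1 comp_1] is the companion matrix of the operator
   z lam P(sigma_q) - Q(sigma_q). *)
Definition comp_inf : 'M[k]_n.+1 :=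
  \matrix_(i, j) if i == ord_max then - P`_j / p else (j == i.+1 :> nat)%:R.
Definition comp_1 : 'M[k]_n.+1 :=
  \matrix_(i, j) if i == ord_max then Q`_j / (lam * p) else 0.
Definition comp_mx : 'M[K]_n.+1 := map_mx kC comp_inf + z^-1 *: map_mx kC comp_1.
Local Notation A := comp_mx.

Let z0K : z != 0.
Proof. by rewrite (iota_eq0 iota_inj) polyX_eq0. Qed.

Let w (j : nat) : K := kC (- P`_j / p) + z^-1 * kC (Q`_j / (lam * p)).

Lemma comp_mxE i j : A i j = if i == ord_max then w j else (j == i.+1 :> nat)%:R.
Proof.
rewrite !mxE; case: eqP => _ //; rewrite rmorph0 mulr0 addr0.
by rewrite rmorph_nat.
Qed.

(** The zero of [w 0], the only nonzero entry of the first column of A, whose vanishing makes A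
    singular. *)
Definition comp_pole : k := Q`_0 / (lam * P`_0).
Local Notation z0 := comp_pole.

Lemma comp_pole_neq0 : z0 != 0.
Proof. by rewrite mulf_neq0 // invr_eq0 mulf_neq0. Qed.

Let rval_w x j : x != 0 -> rval (w j) x (- P`_j / p + x^-1 * (Q`_j / (lam * p))).
Proof.
move=> x0; apply: (rvalD iota_inj); first exact: rvalC.
apply: rvalM; last exact: rvalC.
by apply: rvalV => //; exact: rvalX.
Qed.

Let w0_val x : x != 0 -> x != z0 -> - P`_0 / p + x^-1 * (Q`_0 / (lam * p)) != 0.
Proof.
move=> x0; apply: contra_neq => E; apply: (mulIf P00).
have -> : z0 * P`_0 = Q`_0 / lam by rewrite /z0; field; rewrite lam0 P00.
apply: (mulIf (invr_neq0 p0)).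
have : x * (- P`_0 / p + x^-1 * (Q`_0 / (lam * p))) = 0 by rewrite E mulr0.
have -> : x * (- P`_0 / p + x^-1 * (Q`_0 / (lam * p))) = Q`_0 / lam / p - x * P`_0 / p.
  by field; rewrite p0 lam0 x0.
by move/eqP; rewrite subr_eq0 => /eqP ->.
Qed.

Let w0_neq0 : w 0 != 0.
Proof.
have [x [x0 xz]] : exists x, x != 0 /\ x != z0.
  have [zq|zq] := eqVneq (q * z0) z0.
    have := q_not_root1 0; rewrite expr1 -(inj_eq (mulIf comp_pole_neq0)) zq mul1r eqxx.
    by [].
  by exists (q * z0); rewrite mulf_neq0 // comp_pole_neq0.
apply: contraTneq (w0_val x0 xz) => w00; rewrite negbK.
have := rval_w 0 x0; rewrite w00 => H; apply/eqP.
exact: (rval_uniq iota_inj H (rval0 _ _)).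
Qed.

Definition comp_inv : 'M[K]_n.+1 := \matrix_(i, j)
  if i == ord0 then (if j == ord_max then 1 else - w j.+1) / w 0
  else (i == j.+1 :> nat)%:R.
Local Notation A' := comp_inv.

Lemma comp_mulV : A *m A' = 1%:M.
Proof.
apply/matrixP => i j; rewrite [RHS]mxE mxE.
under eq_bigr => l _ do rewrite comp_mxE [A' _ _]mxE.
case: (eqVneq i ord_max) => [->|im].
  rewrite (bigD1 ord0) //= mulrC divfK //.
  have [->|jm] := eqVneq j ord_max.
    rewrite big1 ?addr0 // => l /negbTE ->.
    by rewrite ltn_eqF ?ltn_ord // mulr0.
  have jn : (j < n)%N.
    by rewrite ltn_neqAle -ltnS ltn_ord andbT; apply: contra jm => /eqP E; apply/eqP/val_inj.
  have jl : (j.+1 < n.+1)%N by [].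
  rewrite (bigD1 (Ordinal jl)) //= eqxx mulr1 big1 => [|l /andP[/negbTE -> lj]].
    by rewrite addr0 addNr.
  by rewrite (_ : (l == j.+1 :> nat) = false) ?mulr0 //; apply: contraNF lj => /eqP E; apply/eqP/val_inj.
have iN : (i < n)%N.
  by rewrite ltn_neqAle -ltnS ltn_ord andbT; apply: contra im => /eqP E; apply/eqP/val_inj.
have il : (i.+1 < n.+1)%N by [].
rewrite (bigD1 (Ordinal il)) //= eqxx mul1r eqSS big1 ?addr0 // => l li.
by rewrite (_ : (l == i.+1 :> nat) = false) ?mul0r //; apply: contraNF li => /eqP E; apply/eqP/val_inj.
Qed.

Lemma comp_reg x : x != 0 -> exists V, mval A x V.
Proof.
move=> x0; exists (comp_inf + x^-1 *: comp_1).
apply: (mvalD iota_inj); first exact: mvalC.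
apply: mvalZ; last exact: mvalC.
by apply: rvalV => //; exact: rvalX.
Qed.

Lemma comp_inv_reg x : x != 0 -> x != z0 -> exists V, mval A' x V.
Proof.
move=> x0 xz; pose v (j : nat) := - P`_j / p + x^-1 * (Q`_j / (lam * p)).
exists (\matrix_(i, j) if i == ord0 then (if j == ord_max then 1 else - v j.+1) / v 0%N
   else (i == j.+1 :> nat)%:R) => i j; rewrite !mxE; case: eqP => _.
  apply: rvalM; last by apply: rvalV; [exact: rval_w | exact: w0_val].
  by case: eqP => _; [exact: rval1 | apply/rvalN/rval_w].
by case: (_ == _); [exact: rval1 | exact: rval0].
Qed.

Definition comp_e : 'cV[k]_n.+1 := delta_mx 0 0.

(** Take [r0] equal to [w 0], whose zero at the pole is simple. The first basis column is killed
    there by A, since [w 0] is the only nonzero entry of the first column. *)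
Lemma comp_pole_data : exists (r0 : K) (r1 : k) (r : 'rV[k]_n.+1) (Az dA : 'M[k]_n.+1),
  [/\ rval r0 z0 0, rval (del r0) z0 r1, r1 != 0, mval (r0 *: A') z0 (comp_e *m r) &
   [/\ mval A z0 Az, Az *m comp_e = 0, mval (map_mx del A) z0 dA & r *m dA *m comp_e != 0]].
Proof.
have zn := comp_pole_neq0.
pose v (j : nat) := - P`_j / p + z0^-1 * (Q`_j / (lam * p)).
have v0 : v 0%N = 0.
  by rewrite /v /z0; field; rewrite Q00 p0 P00 lam0.
pose r1 : k := - (z0^-1 * (Q`_0 / (lam * p))).
have delz : del z^-1 = - z^-1.
  have -> : z^-1 = 1 / z by rewrite div1r.
  rewrite (der_div delP) // (der1 delP) mul0r sub0r delF derivX mulr1 mul1r.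
  by rewrite mulNr invfM mulrA divff // mul1r.
have delw j : del (w j) = - (z^-1 * kC (Q`_j / (lam * p))).
  by rewrite /w (derivD delP) (derM delP) !(delC delF) add0r mulr0 addr0 delz mulNr.
have rdelw j : rval (del (w j)) z0 (- (z0^-1 * (Q`_j / (lam * p)))).
  rewrite delw; apply: rvalN; apply: rvalM; last exact: rvalC.
  by apply: rvalV => //; exact: rvalX.
exists (w 0), r1, (\row_j if j == ord_max then 1 else - v j.+1),
  (\matrix_(i, j) if i == ord_max then v j else (j == i.+1 :> nat)%:R),
  (\matrix_(i, j) if i == ord_max then - (z0^-1 * (Q`_j / (lam * p))) else 0).
have r10 : r1 != 0 by rewrite oppr_eq0 mulf_neq0 ?invr_eq0 // mulf_neq0 ?invr_eq0 // mulf_neq0.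
split=> //.
- by rewrite -v0; apply: rval_w.
- move=> i j; rewrite !mxE big_ord1 !mxE.
  rewrite eqxx andbT -[i == 0]/(i == ord0); case: (eqVneq i ord0) => [_|i0]; rewrite ?eqxx.
    rewrite mul1r mulrC divfK //.
    by case: eqP => _; [exact: rval1 | apply/rvalN/rval_w].
  rewrite mul0r -[X in rval _ _ X](mul0r ((i == j.+1 :> nat)%:R)).
  apply: rvalM; first by rewrite -v0; apply: rval_w.
  by case: (_ == _); [exact: rval1 | exact: rval0].
split.
- move=> i j; rewrite comp_mxE mxE; case: eqP => _; first exact: rval_w.
  by case: (_ == _); [exact: rval1 | exact: rval0].
- apply/matrixP => i j; rewrite !mxE (bigD1 ord0) //= big1 ?addr0.
    by rewrite !mxE !ord1 eqxx mulr1; case: eqP => // _; exact: v0.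
  by move=> l /negbTE l0; rewrite !mxE l0 mulr0.
- move=> i j; rewrite [map_mx _ _ _ _]mxE comp_mxE mxE; case: eqP => _; first exact: rdelw.
  by rewrite (der_nat delP); exact: rval0.
- apply: contraNneq r10 => /matrixP/(_ 0 0); rewrite mxE (bigD1 ord0) //= big1 ?addr0; last first.
    by move=> l /negbTE l0; rewrite [comp_e _ _]mxE l0 mulr0.
  rewrite [comp_e _ _]mxE !eqxx mulr1 mxE (bigD1 ord_max) //= big1 ?addr0.
    by rewrite !mxE !eqxx mul1r => /eqP.
  by move=> l /negbTE lm; rewrite [X in _ * X]mxE lm mulr0.
Qed.

(** * Irreducibility of the companion system *)

Section Irreducibility.
Let s (u : 'rV[K]_n.+1) := map_mx sig u *m A.
Let sD u v : s (u + v) = s u + s v. Proof. by rewrite /s map_mxD mulmxDl. Qed.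
Let sZ a u : s (a *: u) = sig a *: s u. Proof. by rewrite /s map_mxZ -scalemxAl. Qed.
Let s0 : s 0 = 0. Proof. by rewrite /s map_mx0 mul0mx. Qed.
Let itD i u v : iter i s (u + v) = iter i s u + iter i s v.
Proof. by elim: i => //= i ->. Qed.
Let it0 i : iter i s 0 = 0. Proof. by elim: i => //= i ->. Qed.

Let v (i : nat) := iter i s (delta_mx 0 0 : 'rV[K]_n.+1).

Let vE (i : 'I_n.+1) : v i = delta_mx 0 i.
Proof.
case: i => i; elim: i => [|i IH] iN; first by congr delta_mx; apply/val_inj.
rewrite /v iterS -/(v _) (IH (ltnW iN)) /s.
have -> : map_mx sig (delta_mx 0 (Ordinal (ltnW iN))) = delta_mx 0 (Ordinal (ltnW iN)) :> 'rV_n.+1.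
  by apply/rowP => j; rewrite !mxE rmorph_nat.
rewrite -rowE; apply/rowP => j; rewrite [row _ _ _ _]mxE comp_mxE mxE.
by rewrite -val_eqE /= ltn_eqF // eqxx.
Qed.

Let sC c : sig (kC c) = kC c. Proof. exact: sigC. Qed.

(** The operator G(s). Constants commute with s, so [op] is multiplicative in G; moving it across a
    power of z rescales the variable of G by a power of q ([opz]). *)
Let op (G : {poly k}) u := \sum_(i < size G) kC G`_i *: iter i s u.

Let opE m (G : {poly k}) u : (size G <= m)%N -> op G u = \sum_(i < m) kC G`_i *: iter i s u.
Proof.
move=> le; rewrite /op (big_ord_widen m (fun i => kC G`_i *: iter i s u)) // big_mkcond.
apply: eq_bigr => i _; case: ltnP => // le'; by rewrite nth_default // rmorph0 scale0r.
Qed.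

Let opD G G' u : op (G + G') u = op G u + op G' u.
Proof.
pose m := maxn (size (G + G')) (maxn (size G) (size G')).
rewrite !(@opE m) /m ?leq_max ?leqnn ?orbT // -big_split.
by apply: eq_bigr => i _; rewrite coefD rmorphD scalerDl.
Qed.

Let opZ c G u : op (c *: G) u = kC c *: op G u.
Proof.
rewrite (@opE (size G)) ?size_scale_leq // scaler_sumr.
by apply: eq_bigr => i _; rewrite coefZ rmorphM scalerA.
Qed.

Let opX G u : op ('X * G) u = s (op G u).
Proof.
rewrite (@opE (size G).+1); last first.
  by have [->|G0] := eqVneq G 0; rewrite ?mulr0 ?size_poly0 // mulrC size_mulX.
rewrite big_ord_recl coefXM eqxx rmorph0 scale0r add0r /op.
rewrite (big_morph s sD s0); apply: eq_bigr => i _.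
by rewrite coefXM /= sZ sC.
Qed.

Let op0 u : op 0 u = 0. Proof. by rewrite /op size_poly0 big_ord0. Qed.
Let opC c u : op c%:P u = kC c *: u.
Proof. by rewrite (@opE 1) ?size_polyC_leq1 // big_ord1 coefC eqxx. Qed.

Let opuD G u u' : op G (u + u') = op G u + op G u'.
Proof. by rewrite /op -big_split; apply: eq_bigr => i _; rewrite itD scalerDr. Qed.

Let opZu G c u : op G (kC c *: u) = kC c *: op G u.
Proof.
rewrite /op scaler_sumr; apply: eq_bigr => i _.
have -> : iter i s (kC c *: u) = kC c *: iter i s u.
  by elim: (nat_of_ord i) => //= j ->; rewrite sZ sC.
by rewrite !scalerA mulrC.
Qed.

Let opM G G' u : op (G * G') u = op G (op G' u).
Proof.
elim/poly_ind: G => [|G c IH]; first by rewrite mul0r !op0.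
have -> : (G * 'X + c%:P) * G' = 'X * (G * G') + c%:P * G' by ring.
by rewrite !opD opX IH mul_polyC opZ [G * 'X]mulrC opX opC.
Qed.

Let scp c (G : {poly k}) := G \Po (c *: 'X).

Let opz l G u : op G (z ^+ l *: u) = z ^+ l *: op (scp (q ^+ l) G) u.
Proof.
have sz : sig (z ^+ l) = kC (q ^+ l) * z ^+ l.
  by rewrite rmorphXn (sigX sigP) exprMn (rmorphXn (kC : {rmorphism k -> K})).
elim/poly_ind: G => [|G c IH]; first by rewrite /scp comp_poly0 !op0 scaler0.
rewrite opD [G * 'X]mulrC opX IH sZ sz opC /scp comp_polyD comp_polyC comp_polyM comp_polyX opD.
rewrite -scalerAl opZ opX opC scalerDr !scalerA; congr (_ + _ *: _); last by rewrite mulrC.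
by rewrite mulrC.
Qed.

Let Phi g := op g (v 0).

(** The scalar equation z lam P(s) v_0 = Q(s) v_0 satisfied by the cyclic vector. *)
Let relation : z *: (kC lam *: Phi P) = Phi Q.
Proof.
rewrite /Phi (@opE n.+2) ?sP // big_ord_recr /= -/(v n) -/p.
have -> : s (v n) = \sum_(j < n.+1) w j *: v j.
  have -> : v n = delta_mx 0 ord_max by apply: (vE ord_max).
  rewrite /s; have -> : map_mx sig (delta_mx 0 ord_max) = delta_mx 0 ord_max :> 'rV_n.+1.
    by apply/rowP => j; rewrite !mxE rmorph_nat.
  rewrite -rowE; apply/rowP => j; rewrite [row _ _ _ _]mxE comp_mxE eqxx summxE.
  rewrite (bigD1 j) //= vE !mxE !eqxx mulr1 big1 ?addr0 // => i ij.
  by rewrite vE !mxE eq_sym (negbTE ij) mulr0.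
rewrite scaler_sumr -big_split /= (@opE n.+1) // !scaler_sumr; apply: eq_bigr => j _.
rewrite -/(v j) [kC p *: _]scalerA -scalerDl !scalerA; congr (_ *: _).
rewrite /w !rmorphM !fmorphV rmorphM rmorphN.
by field; rewrite z0K !fmorph_eq0 lam0 p0.
Qed.

Let relationC C : z *: (kC lam *: Phi (P * C)) = Phi (Q * scp q^-1 C).
Proof.
rewrite [P * C]mulrC [Q * _]mulrC /Phi !opM -/(Phi P) -/(Phi Q) -relation.
rewrite -[in RHS](expr1 z) opz !expr1 opZu; congr (_ *: (_ *: op _ _)).
by rewrite /scp -comp_polyA linearZ /= comp_polyX scalerA mulVf // scale1r comp_polyXr.
Qed.

(** The polynomials g with g(s) v_0 in W form an ideal I, and [relation] shows that with g it
    contains Q(X) g(X/q) and P(X) g(qX). Let g generate I. From a nonzero root of g one moves along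
    its q-orbit through roots of g, in one direction until a root of Q is met and in the other until
    a root of P is met, which nonresonance forbids. So g is a monomial; as W is also stable under
    the inverse of s, it contains v_0. *)
Lemma comp_irreducible : irreducible_system sig A.
Proof.
move=> W W0 WL Ws [u u0 Wu].
have WD x y : W x -> W y -> W (x + y) by rewrite -{2}[x]scale1r; apply: WL.
have WZ a x : W x -> W (a *: x) by move=> Wx; rewrite -[_ *: _]addr0; apply: WL.
have Wit i x : W x -> W (iter i s x) by move=> Wx; elim: i => //= i /Ws.
have Wop G x : W x -> W (op G x).
  by move=> Wx; rewrite /op; apply: big_ind => // i _; apply/WZ/Wit.
have scK c (G : {poly k}) : c != 0 -> scp c^-1 (scp c G) = G.
  by move=> c0; rewrite /scp -comp_polyA linearZ /= comp_polyX scalerA mulfV // scale1r comp_polyXr.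
have scsc c d (G : {poly k}) : scp c (scp d G) = scp (d * c) G.
  by rewrite /scp -comp_polyA linearZ /= comp_polyX scalerA.
have sc1 G : scp 1 G = G by rewrite /scp scale1r comp_polyXr.
have scM c G H : scp c (G * H) = scp c G * scp c H by rewrite /scp comp_polyM.
have scroot c G x : root (scp c G) x = root G (c * x) by rewrite /root horner_comp !hornerE.
have sc0 c G : c != 0 -> (scp c G == 0) = (G == 0).
  move=> c0; apply/eqP/eqP => [G0|->]; last by rewrite /scp comp_poly0.
  by rewrite -(scK c G) // G0 /scp comp_poly0.
pose I g := W (Phi g).
have ID g g' : I g -> I g' -> I (g + g') by rewrite /I /Phi opD; apply: (WD).
have IM g g' : I g -> I (g' * g) by rewrite /I /Phi opM; apply: (Wop).
have IZ c g : I g -> I (c *: g) by rewrite -mul_polyC; apply: (IM).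
have lamK : kC lam != 0 by rewrite fmorph_eq0.
have PhiZ c G : Phi (c *: G) = kC c *: Phi G by rewrite /Phi opZ.
have PhiD G G' : Phi (G + G') = Phi G + Phi G' by rewrite /Phi opD.
have IQ g : I g -> I (Q * scp q^-1 g).
  by move=> Ig; rewrite /I -relationC; apply: (WZ); apply: (WZ); rewrite -/(I _); apply: (IM).
have IP g : I g -> I (P * scp q g).
  move=> Ig; have H : W (z *: (kC lam *: Phi (P * scp q g))).
    by rewrite relationC scK //; rewrite -/(I _); apply: (IM).
  have := WZ (kC lam)^-1 _ (WZ z^-1 _ H).
  by rewrite !scalerA divfK // mulVf // scale1r.
pose qi := q^-1; have qi0 : qi != 0 by rewrite invr_eq0.
have cop j : coprimep (scp (qi ^+ j.+1) P) Q.
  rewrite /coprimep; apply/negPn/negP => /closed_k[x].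
  rewrite root_gcd scroot => /andP[Px Qx]; apply: (QP (m := j.+1) Px Qx).
  by rewrite exprVn mulrA mulfV ?mul1r // expf_neq0.
(* This produces a nonzero element of I. An element of W of degree m + 1 in z is hit by P(q^-(m+1)
   s), which turns its top coefficient [Phi (B m.+1)] into [Phi (P * B m.+1)], and [relation] then
   lowers the degree. The divisibility clauses form the invariant that keeps the new top coefficient
   from vanishing; they survive because P rescaled by powers of q is prime to Q. *)
have descent m j (B : nat -> {poly k}) : W (\sum_(l < m.+1) z ^+ l *: Phi (B l)) ->
    (forall l, (l < m)%N -> (0 < j)%N -> scp (qi ^+ (m + j - l)) P %| B l) ->
    ~~ (scp (qi ^+ j) P %| B m) -> exists2 g, g != 0 & I g.
  elim: m j B => [|m IH] j B WB Bd Bm.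
    exists (B 0%N); first by apply: contraNneq Bm => ->; rewrite dvdp0.
    by move: WB; rewrite big_ord1 expr0 scale1r.
  pose B' l := scp (qi ^+ (m.+1 - l)) P * B l +
    (if l == m then lam^-1 *: (Q * scp qi (B m.+1)) else 0).
  apply: (IH j.+1 B').
  - have := Wop (scp (qi ^+ m.+1) P) _ WB.
    have op_sum r (F : nat -> 'rV[K]_n.+1) G : op G (\sum_(l < r) F l) = \sum_(l < r) op G (F l).
      elim: r => [|r IHr]; last by rewrite !big_ord_recr opuD IHr.
      by rewrite !big_ord0 /op big1 // => i _; rewrite it0 scaler0.
    rewrite (op_sum m.+2 (fun l => z ^+ l *: Phi (B l))).
    have opl (l : nat) : (l <= m.+1)%N -> op (scp (qi ^+ m.+1) P) (z ^+ l *: Phi (B l)) =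
        z ^+ l *: Phi (scp (qi ^+ (m.+1 - l)) P * B l).
      move=> lm; rewrite opz /Phi opM scsc; congr (_ *: op (scp _ _) _).
      by rewrite -{1}(subnK lm) exprD -mulrA -exprMn mulVf // expr1n mulr1.
    rewrite big_ord_recr opl // subnn expr0 sc1.
    have -> : z ^+ m.+1 *: Phi (P * B m.+1) = z ^+ m *: Phi (lam^-1 *: (Q * scp qi (B m.+1))).
      rewrite PhiZ -relationC exprSr -!scalerA; congr (_ *: _).
      by rewrite !scalerA mulrAC -rmorphM mulVf // rmorph1 mul1r.
    rewrite [X in W (X + _)](eq_bigr (fun l : 'I_m.+1 =>
      z ^+ l *: Phi (scp (qi ^+ (m.+1 - l)) P * B l))); last first.
      by move=> l _; apply: (opl l); apply: ltnW.
    rewrite big_ord_recr [X in _ -> W X]big_ord_recr /= /B' eqxx PhiD scalerDr addrA.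
    rewrite [X in _ -> W (X + _ + _)](eq_bigr (fun l : 'I_m =>
      z ^+ l *: Phi (scp (qi ^+ (m.+1 - l)) P * B l))) //.
    by move=> l _; rewrite ltn_eqF // addr0.
  - move=> l lm _; rewrite /B' ltn_eqF // addr0 addnS -addSn.
    case: j Bd Bm => [|j] Bd Bm; first by rewrite addn0 dvdp_mulr.
    by rewrite dvdp_mull // Bd // ltnW // ltnS.
  - rewrite /B' eqxx; apply: contra Bm => dv.
    have d1 : scp (qi ^+ j.+1) P %| scp (qi ^+ (m.+1 - m)) P * B m.
      case: j Bd dv => [|j] Bd dv; first by rewrite subSnn dvdp_mulr.
      rewrite dvdp_mull //; have := Bd m (ltnSn m) isT.
      by rewrite addSnnS addKn; apply.
    move: dv; rewrite dvdp_addr // dvdpZr ?invr_eq0 // Gauss_dvdpr // => dv.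
    have := dvdp_comp_poly (q *: 'X) dv; rewrite -!/(scp _ _) !scsc mulVf // sc1.
    by rewrite exprSr -mulrA mulVf // mulr1.
(* Clear the denominators of a nonzero row of W and order it by powers of z. At j = 0 the
   divisibility clauses are void, and the top coefficient is not divisible by P because its degree
   is smaller. *)
have [g0 g0n Ig0] : exists2 g, g != 0 & I g.
  have /choice[a /choice[d ad]] := fun i => ratfunP (u 0 i).
  pose D := \prod_i d i.
  have D0 : D != 0 by apply/prodf_neq0 => i _; case: (ad i).
  pose pp i := a i * \prod_(j | j != i) d j.
  have ppE i : iota D * u 0 i = iota (pp i).
    have [di uE] := ad i; rewrite {1}uE /D (bigD1 i) //= /pp !rmorphM.
    by field; rewrite (iota_eq0 iota_inj).
  pose B l := \poly_(i < n.+1) (pp (inord i))`_l.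
  pose M := \max_i size (pp i).
  have sE : iota D *: u = \sum_(l < M) z ^+ l *: Phi (B l).
    rewrite [u in LHS]row_sum_delta scaler_sumr.
    transitivity (\sum_(i < n.+1) \sum_(l < M) (z ^+ l * kC (pp i)`_l) *: v i).
      apply: eq_bigr => i _; rewrite scalerA ppE -vE -scaler_suml; congr (_ *: _).
      rewrite -[pp i in LHS]coefK poly_def rmorph_sum.
      rewrite (big_ord_widen M (fun l => iota ((pp i)`_l *: 'X^l))); last exact: leq_bigmax.
      rewrite big_mkcond; apply: eq_bigr => l _; case: ltnP => [_|le].
        by rewrite -mul_polyC rmorphM rmorphXn mulrC.
      by rewrite nth_default // rmorph0 mulr0.
    rewrite exchange_big; apply: eq_bigr => l _; rewrite /Phi (@opE n.+1) ?size_poly // scaler_sumr.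
    by apply: eq_bigr => i _; rewrite coef_poly ltn_ord inord_val scalerA.
  have [i ui] : exists i, u 0 i != 0.
    apply: contrapT => /forallNP nu; case/negP: u0; apply/eqP/rowP => i.
    by rewrite mxE; apply/eqP/negPn/negP => /nu.
  have ppi : pp i != 0.
    by rewrite -(iota_eq0 iota_inj) -ppE mulf_neq0 // (iota_eq0 iota_inj).
  have exB : exists l, B l != 0.
    exists (size (pp i)).-1; apply/eqP => /(congr1 (fun f : {poly k} => f`_i)).
    rewrite coef_poly ltn_ord inord_val coef0 -/(lead_coef _) => /eqP.
    by rewrite lead_coef_eq0 (negbTE ppi).
  have bB l : B l != 0 -> (l <= M)%N.
    apply: contraNT; rewrite -ltnNge => lM; apply/eqP/polyP => j.
    rewrite coef_poly coef0; case: ifP => // _; apply: nth_default.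
    by apply: leq_trans (ltnW lM); apply: (leq_bigmax (inord j)).
  case: (ex_maxnP exB bB) => m Bm Bmax.
  apply: (descent m 0%N B) => //.
    suff <- : \sum_(l < M) z ^+ l *: Phi (B l) = \sum_(l < m.+1) z ^+ l *: Phi (B l).
      by rewrite -sE; apply: (WZ).
    have zero l : (m < l)%N -> z ^+ l *: Phi (B l) = 0.
      move=> ml; have -> : B l = 0 by apply/eqP; apply: contraTT ml => /Bmax; rewrite leqNgt.
      by rewrite /Phi op0 scaler0.
    rewrite (big_ord_widen (maxn M m.+1) (fun l => z ^+ l *: Phi (B l)) (leq_maxl _ _)).
    rewrite [RHS](big_ord_widen (maxn M m.+1) (fun l => z ^+ l *: Phi (B l)) (leq_maxr _ _)).
    rewrite [LHS]big_mkcond [RHS]big_mkcond; apply: eq_bigr => l _.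
    case: ltnP => lM; case: ltnP => lm //; first exact: zero.
    have -> : B l = 0; last by rewrite /Phi op0 scaler0.
    apply/polyP => j; rewrite coef_poly coef0; case: ifP => // _; apply: nth_default.
    by apply: leq_trans lM; apply: (leq_bigmax (inord j)).
  rewrite expr0 sc1; apply/negP => /(dvdp_leq Bm); rewrite sP leqNgt ltnS.
  by rewrite (size_poly _ _).
pose Sz r := `[< exists g, [/\ g != 0, I g & size g = r] >].
have exS : exists r, Sz r by exists (size g0); apply/asboolP; exists g0.
case: (ex_minnP exS) => r /asboolP[g [gn Ig gr]] gmin.
have gdiv f : I f -> g %| f.
  move=> If; rewrite /dvdp; apply/negPn/negP => fn.
  have /gmin : Sz (size (f %% g)).
    apply/asboolP; exists (f %% g); split=> //.
    have -> : f %% g = f + (- (f %/ g)) * g by rewrite {2}(divp_eq f g) mulNr addrAC subrr add0r.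
    by apply: (ID) => //; apply: (IM).
  by rewrite -gr leqNgt ltn_modp gn.
have rootdv (f f' : {poly k}) x : f %| f' -> root f x -> root f' x.
  by rewrite -!dvdp_XsubCl => ff xf; apply: dvdp_trans ff.
have noroot x : root g x -> x = 0.
  move=> gx; apply/eqP/negPn/negP => x0.
  have inj c : c = q \/ c = qi -> injective (fun i => c ^+ i * x).
    move=> cq i j /(mulIf x0) E; apply: (q_expr_inj q0 q_not_root1).
    by case: cq E => -> //; rewrite !exprVn => /invr_inj.
  have hit (F : {poly k}) c : c = q \/ c = qi -> (forall y, root g y -> root F y \/ root g (c * y)) ->
      exists i, root F (c ^+ i * x).
    move=> cq step; apply: contrapT => /forallNP nF.
    have gi i : root g (c ^+ i * x).
      elim: i => [|i IHi]; first by rewrite expr0 mul1r.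
      by rewrite exprS -mulrA; case: (step _ IHi) => // /nF.
    have [M HM] := poly_avoid gn (inj c cq).
    by have := HM M (leqnn _); rewrite (eqP (gi M)) eqxx.
  have [i Qi] : exists i, root Q (qi ^+ i * x).
    apply: (hit); [by right | move=> y gy].
    have : root (Q * scp q^-1 g) y by apply: (rootdv g) gy; apply: (gdiv); apply: (IQ).
    by rewrite rootM scroot => /orP[]; [left | right].
  have [j Pj] : exists j, root P (q ^+ j * x).
    apply: (hit); [by left | move=> y gy].
    have : root (P * scp q g) y by apply: (rootdv g) gy; apply: (gdiv); apply: (IP).
    by rewrite rootM scroot => /orP[]; [left | right].
  apply: (PQ (m := (j + i)%N) Pj Qi).
  by rewrite mulrA exprD -mulrA -[in RHS]mulrA (mulrA (q ^+ i)) exprVn mulfV ?mul1r ?expf_neq0.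
have [e [h [h0 gE]]] : exists e h, h.[0] != 0 /\ g = h * 'X^e.
  have [e [h [h0 gE]]] := multiplicity_XsubC g 0.
  by exists e, h; split; [move: h0; rewrite gn | rewrite subr0 in gE].
have hs : size h = 1%N.
  apply/eqP/negPn/negP => /closed_k[x hx].
  have x0 : x = 0 by apply: noroot; rewrite gE rootM hx.
  by move: h0 hx; rewrite x0 rootE => /negbTE ->.
have IXe : I 'X^e.
  have [c c0 hc] := size_poly1P _ (introT eqP hs).
  have := IZ c^-1 _ Ig; rewrite gE hc mul_polyC scalerA mulVf // scale1r.
  exact.
have Wv0 : W (v 0).
  have vX : Phi 'X^e = v e.
    elim: e {gE IXe} => [|e IHe]; first by rewrite /Phi expr0 -[1]/(1%:P) opC rmorph1 scale1r.
    by rewrite /Phi exprS opX -/(Phi _) IHe.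
  move: IXe; rewrite /I vX; elim: e {gE vX} => //= e IHe We; apply: IHe.
  exact/Ws.
move=> x; rewrite [x]row_sum_delta; apply: big_ind => // i _; apply: WZ; rewrite -vE.
exact: Wit.
Qed.
End Irreducibility.
End Companion.

Lemma stable_eigenvector (k : fieldType) m (H M : 'M[k]_m) :
  (forall p : {poly k}, size p != 1%N -> exists x, root p x) ->
  H != 0 -> (H *m M <= H)%MS ->
  exists c (u : 'rV[k]_m), [/\ u != 0, (u <= H)%MS & u *m M = c *: u].
Proof.
move=> closed_k H0 HM.
have [r [R [rf RH HR r0]]] : exists r (R : 'M[k]_(r, m)),
    [/\ row_free R, (R <= H)%MS, (H <= R)%MS & (0 < r)%N].
  exists (\rank H), (row_base H); split; rewrite ?eq_row_base ?row_base_free //.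
  by rewrite lt0n mxrank_eq0.
have RM : (R *m M <= R)%MS.
  by apply: submx_trans (submxMr _ RH) _; apply: submx_trans HM HR.
pose R' := R *m M *m pinvmx R.
have E : R' *m R = R *m M by rewrite mulmxKpV.
have [|c] := closed_k (char_poly R'); first by rewrite size_char_poly eqSS -lt0n.
rewrite -eigenvalue_root_char => /eigenvalueP[t tR t0].
exists c, (t *m R); split.
- apply: contra_neq t0 => tR0; apply: (row_free_inj rf).
  by rewrite tR0 mul0mx.
- exact: submx_trans (submxMl _ _) RH.
- by rewrite -mulmxA -E mulmxA tR -scalemxAl.
Qed.

(** V F(A) = F(cA) V for every polynomial F. For the characteristic polynomial F of A this gives
    F(cA) V = 0 with V nonzero, so that some root of F is an eigenvalue of cA. *)
Lemma twisted_commutation (k : fieldType) n (A V : 'M[k]_n.+1) c :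
  (forall p : {poly k}, size p != 1%N -> exists x, root p x) ->
  V != 0 -> V *m A = c *: (A *m V) -> c != 0 ->
  exists x y, [/\ eigenvalue A x, eigenvalue A y & x = c * y].
Proof.
move=> closed_k V0 VA c0.
have VF (F : {poly k}) : V * horner_mx A F = horner_mx (c *: A) F * V.
  elim/poly_ind: F => [|F a IH]; first by rewrite !rmorph0 mulr0 mul0r.
  rewrite !rmorphD !rmorphM /= !horner_mx_X !horner_mx_C mulrDr mulrDl mulrA IH.
  rewrite -mulrA; congr (_ + _); last by rewrite -[LHS]/(_ *m _) -[RHS]/(_ *m _) mul_mx_scalar mul_scalar_mx.
  by rewrite -!mulrA; congr (_ * _); rewrite -[LHS]/(V *m A) VA -[RHS]/(_ *m _) -scalemxAl.
have key m (F : {poly k}) (X : 'M[k]_n.+1) : (size F <= m)%N -> F != 0 -> X != 0 ->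
    horner_mx (c *: A) F * X = 0 -> exists2 a, root F a & eigenvalue (c *: A) a.
  elim: m F X => [|m IH] F X Fm F0 X0 FX.
    by move: Fm F0; rewrite leqn0 size_poly_eq0 => ->.
  have [/size_poly1P[b b0 Fb]|/closed_k[a Fa]] := boolP (size F == 1%N).
    case/negP: X0; move: FX; rewrite Fb horner_mx_C -[_ * _]/(_ *m _) mul_scalar_mx => /eqP.
    by rewrite scaler_eq0 (negbTE b0).
  have [X1|X1] := eqVneq ((c *: A - a%:M) * X) 0.
    exists a => //; rewrite /eigenvalue kermx_eq0 row_free_unit.
    apply: contra X0 => U; rewrite -[X]mul1mx -(mulVmx U) -mulmxA.
    by rewrite -[(_ - _) *m X]/(_ * X) X1 mulmx0.
  have [F1 F1E] := factor_theorem _ _ Fa.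
  have F10 : F1 != 0 by apply: contraNneq F0 => F10; rewrite F1E F10 mul0r.
  have [||b F1b Ab] := IH F1 _ _ F10 X1; last by exists b; rewrite // F1E rootM F1b.
    by move: Fm; rewrite F1E size_Mmonic ?monicXsubC // size_XsubC addn2.
  by move: FX; rewrite F1E rmorphM rmorphB /= horner_mx_X horner_mx_C mulrA.
have [|||a Aa cAa] := @key _ (char_poly A) V (leqnn _).
- by rewrite monic_neq0 // char_poly_monic.
- by [].
- by rewrite -VF Cayley_Hamilton mulr0.
rewrite -eigenvalue_root_char in Aa.
exists a, (a / c); split=> //; last by rewrite mulrC divfK.
have /eigenvalueP[t tA t0] := cAa; apply/eigenvalueP; exists t => //.
rewrite mulrC -scalerA -tA -scalemxAr scalerA mulVf ?scale1r //.
Qed.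

(** * The point at infinity *)

Section Infinity.
Variables (k K : fieldType) (iota : {rmorphism {poly k} -> K}).
Hypothesis iota_inj : injective iota.
Hypothesis ratfunP : forall f : K, exists p d, d != 0 /\ f = iota p / iota d.
Notation kC := (kC iota).
Notation z := (iota 'X).

(* [K] is also the field of rational functions of the coordinate [1 / z] at infinity. *)
Definition iota_inf : {rmorphism {poly k} -> K} :=
  GRing.RMorphism.clone _ _ (horner_eval z^-1 \o map_poly kC) _.

Lemma iota_infE p : iota_inf p = (map_poly kC p).[z^-1].
Proof. by []. Qed.

Let z0 : z != 0.
Proof. by rewrite (iota_eq0 iota_inj) polyX_eq0. Qed.

Lemma iota_infC c : iota_inf c%:P = kC c.
Proof. by rewrite iota_infE map_polyC hornerC. Qed.

Lemma iota_infX : iota_inf 'X = z^-1.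
Proof. by rewrite iota_infE map_polyX hornerX. Qed.

Lemma iota_inf_inj : injective iota_inf.
Proof.
apply: raddf_inj => p pE; apply/eqP; rewrite -lead_coef_eq0; apply/eqP.
have [->|p0] := eqVneq p 0; first by rewrite lead_coef0.
pose r := \sum_(i < size p) p`_i *: 'X^((size p).-1 - i) : {poly k}.
have r0 : r = 0.
  apply: iota_inj; rewrite rmorph0.
  transitivity (z ^+ (size p).-1 * iota_inf p); last by rewrite pE mulr0.
  rewrite /r rmorph_sum iota_infE horner_coef size_map_poly mulr_sumr; apply: eq_bigr => i _.
  rewrite -mul_polyC rmorphM rmorphXn coef_map [RHS]mulrCA; congr (_ * _).
  have im : (i <= (size p).-1)%N by rewrite -ltnS prednK ?size_poly_gt0.
  by rewrite -{2}(subnK im) exprD exprVn -mulrA mulfV ?mulr1 // expf_neq0.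
have sp : (0 < size p)%N by rewrite size_poly_gt0.
have lm : ((size p).-1 < size p)%N by rewrite prednK.
have := congr1 (fun f : {poly k} => f`_0) r0.
rewrite coef0 coef_sum (bigD1 (Ordinal lm)) //= subnn expr0 coefZ coef1 eqxx mulr1 big1 ?addr0 //.
move=> i im; rewrite coefZ coefXn (_ : (0 == _)%N = false) ?mulr0 //.
have iN := ltn_ord i.
have : (i != (size p).-1 :> nat) by apply: contra im => /eqP E; apply/eqP/val_inj.
move: iN sp => /= ; lia.
Qed.

Lemma ratfun_infP (f : K) : exists p d, d != 0 /\ f = iota_inf p / iota_inf d.
Proof.
have H (p : {poly k}) : exists (m : nat) (p' : {poly k}), iota p = iota_inf p' / iota_inf 'X^m.
  elim/poly_ind: p => [|p c [m [p' IH]]]; first by exists 0%N, 0; rewrite !rmorph0 mul0r.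
  exists m.+1, (p' + c *: 'X^(m.+1)); rewrite rmorphD rmorphM IH -/(kC c).
  rewrite [iota_inf (p' + _)]rmorphD -mul_polyC [iota_inf (_ * _)]rmorphM iota_infC !rmorphXn iota_infX.
  rewrite exprS; field.
  by rewrite ?expf_neq0 ?invr_eq0 // z0.
have [p [d [d0 ->]]] := ratfunP f.
have [m [p' ->]] := H p; have [e [d' dE]] := H d; rewrite dE.
have d'0 : d' != 0.
  apply: contraNneq d0 => d'0; apply/eqP/iota_inj.
  by rewrite dE d'0 rmorph0 mul0r rmorph0.
exists (p' * 'X^e), (d' * 'X^m); split; first by rewrite mulf_neq0 // monic_neq0 // monicXn.
have Xn j : iota_inf 'X^j != 0 by rewrite (iota_eq0 iota_inf_inj) monic_neq0 // monicXn.
rewrite !rmorphM; field.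
by rewrite !Xn (iota_eq0 iota_inf_inj) d'0.
Qed.

Definition rinf f v := rval iota_inf f 0 v.
Definition minf m n (M : 'M[K]_(m, n)) V := mval iota_inf M 0 V.

Lemma rinf_C c : rinf (kC c) c.
Proof. by rewrite -iota_infC; exact: rvalC. Qed.

Lemma rinf_V : rinf z^-1 0.
Proof. by rewrite -iota_infX; apply: rvalX. Qed.

Lemma minfC m n (V : 'M[k]_(m, n)) : minf (map_mx kC V) V.
Proof. by move=> i j; rewrite mxE; apply: rinf_C. Qed.

Lemma rinf_divz f : rinf (z^-1 * f) 0 -> exists v, rinf f v.
Proof.
move=> [p [d [d0 E /esym/eqP]]]; rewrite mulf_eq0 invr_eq0 (negbTE d0) orbF => p0.
have [p1 pE] := factor_theorem _ _ p0; rewrite subr0 in pE.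
exists (p1.[0] / d.[0]), p1, d; split=> //.
move: E; rewrite pE rmorphM iota_infX => E.
apply: (mulfI (invr_neq0 z0)); rewrite E mulrA; congr (_ / _); exact: mulrC.
Qed.

Lemma rinf_order f : f != 0 -> exists a b v, v != 0 /\ rinf (f * z^-1 ^+ b / z^-1 ^+ a) v.
Proof.
move=> f0; have [p [d [d0 fE]]] := ratfun_infP f.
have p0 : p != 0 by apply: contra_neq f0 => p0; rewrite fE p0 rmorph0 mul0r.
have [a [p1 p1n pE]] := multiplicity_XsubC p 0; rewrite p0 subr0 /= in p1n pE.
have [b [d1 d1n dE]] := multiplicity_XsubC d 0; rewrite d0 subr0 /= in d1n dE.
exists a, b, (p1.[0] / d1.[0]); split; first by rewrite mulf_neq0 ?invr_eq0.
exists p1, d1; split=> //; rewrite fE pE dE !rmorphM !rmorphXn iota_infX.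
have d1K : iota_inf d1 != 0.
  by rewrite (iota_eq0 iota_inf_inj); apply: contraNneq d1n => ->; rewrite rootE horner0.
have un j : z^-1 ^+ j != 0 by rewrite expf_neq0 // invr_eq0.
move: (un a) (un b); move: (z^-1 ^+ a) (z^-1 ^+ b) => x y x0 y0.
by field; rewrite d1K x0 y0.
Qed.

Lemma rinf_poly p : rinf (iota p) 0 -> p = 0.
Proof.
move=> H; apply/eqP; rewrite -lead_coef_eq0; apply/eqP.
have [->|p0] := eqVneq p 0; first by rewrite lead_coef0.
have sp : (0 < size p)%N by rewrite size_poly_gt0.
have lm : ((size p).-1 < size p)%N by rewrite prednK.
have H1 : rinf (z^-1 ^+ (size p).-1 * iota p) 0.
  by rewrite -(mulr0 (0 ^+ (size p).-1)); apply: rvalM => //; apply/rvalXn/rinf_V.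
apply/esym; apply: (rval_uniq iota_inf_inj H1).
have -> : z^-1 ^+ (size p).-1 * iota p = \sum_(i < size p) kC p`_i * z^-1 ^+ ((size p).-1 - i).
  rewrite -{2}[p]coefK poly_def rmorph_sum mulr_sumr; apply: eq_bigr => i _.
  have im : (i <= (size p).-1)%N by rewrite -ltnS prednK.
  rewrite -mul_polyC rmorphM rmorphXn mulrCA; congr (_ * _).
  by rewrite -{1}(subnK im) exprD -mulrA -exprMn mulVf // expr1n mulr1.
have -> : lead_coef p = \sum_(i < size p) p`_i * 0 ^+ ((size p).-1 - i).
  rewrite (bigD1 (Ordinal lm)) //= subnn expr0 mulr1 big1 ?addr0 // => i im.
  rewrite expr0n (_ : _ == _ = false) ?mulr0 //.
  have iN := ltn_ord i.
  have : (i != (size p).-1 :> nat) by apply: contra im => /eqP E; apply/eqP/val_inj.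
  move: iN sp => /=; lia.
apply: (rval_sum iota_inf_inj) => i _; apply: rvalM; first exact: rinf_C.
exact/rvalXn/rinf_V.
Qed.

Section Sigma.
Variables (q : k) (sig : {rmorphism K -> K}).
Hypothesis q0 : q != 0.
Hypothesis sigP : forall p, sig (iota p) = iota (p \Po (q *: 'X)).

Let sigu : sig z^-1 = kC q^-1 * z^-1.
Proof. by rewrite fmorphV (sigX sigP) invfM fmorphV. Qed.

Lemma sig_inf p : sig (iota_inf p) = iota_inf (p \Po (q^-1 *: 'X)).
Proof.
elim/poly_ind: p => [|p c IH]; first by rewrite comp_poly0 !rmorph0.
rewrite comp_polyD comp_polyM comp_polyX comp_polyC !rmorphD !rmorphM IH.
rewrite iota_infC (sigC sigP) -mul_polyC [iota_inf (_ * 'X)]rmorphM iota_infC iota_infX sigu.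
by [].
Qed.

Lemma minf_sig m n (M : 'M[K]_(m, n)) V : minf M V -> minf (map_mx sig M) V.
Proof.
by move=> H; apply: (mval_sig (q := q^-1)); [exact: sig_inf | rewrite mulr0].
Qed.

(** Up to a power of the coordinate 1/z, f has a nonzero value at infinity, a point fixed by sigma.
    Comparing the values of both sides expresses c through the power of q produced by the
    coordinate; two exponents are used to avoid negative powers. *)
Lemma sig_semifixed f c : f != 0 -> sig f = kC c * f -> exists i j, c * q ^+ i = q ^+ j.
Proof.
move=> f0 sf; have [a [b [v [v0 H]]]] := rinf_order f0.
exists a, b; have := H.
have /(_ _ _) := rval_sig (q := q^-1) (x := 0) sig_inf; rewrite mulr0 => /(_ _ _ H) H1.
have H2 : rinf (sig (f * z^-1 ^+ b / z^-1 ^+ a)) (c * q ^- b / q ^- a * v).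
  have -> : sig (f * z^-1 ^+ b / z^-1 ^+ a) =
      kC (c * q ^- b / q ^- a) * (f * z^-1 ^+ b / z^-1 ^+ a).
    rewrite fmorph_div rmorphM [sig (z^-1 ^+ b)]rmorphXn [sig (z^-1 ^+ a)]rmorphXn sf sigu !exprMn.
    have kn j : kC q^-1 ^+ j = (kC (q ^+ j))^-1 by rewrite -rmorphXn exprVn fmorphV.
    have un j : z^-1 ^+ j != 0 by rewrite expf_neq0 // invr_eq0.
    have qn j : kC (q ^+ j) != 0 by rewrite fmorph_eq0 expf_neq0.
    rewrite !kn !rmorphM !fmorphV /=.
    move: (un a) (un b) (qn a) (qn b).
    move: (z^-1 ^+ a) (z^-1 ^+ b) (kC (q ^+ a)) (kC (q ^+ b)) => x y x' y' x0 y0 x'0 y'0.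
    by field; rewrite ?x0 ?y0 ?x'0 ?y'0 ?oner_neq0.
  by apply: rvalM => //; exact: rinf_C.
move=> _; have /(mulIf v0) := etrans (mul1r v) (rval_uniq iota_inf_inj H1 H2).
move=> E; have qn j : q ^+ j != 0 by rewrite expf_neq0.
have := congr1 (fun t => t * q ^+ b) E; rewrite mul1r => ->.
by field; rewrite !qn oner_neq0.
Qed.
End Sigma.
End Infinity.

(** * Endomorphisms of the adjoint system *)

Section ScalarCommutants.
Variables (k K : fieldType) (iota : {rmorphism {poly k} -> K}).
Hypothesis iota_inj : injective iota.
Hypothesis ratfunP : forall f : K, exists p d, d != 0 /\ f = iota p / iota d.
Hypothesis closed_k : forall p : {poly k}, size p != 1%N -> exists x, root p x.
Hypothesis char0 : forall l, l.+1%:R != 0 :> k.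
Notation kC := (kC iota).
Notation z := (iota 'X).
Variables (q : k) (sig : {rmorphism K -> K}).
Hypothesis q0 : q != 0.
Hypothesis q_not_root1 : forall m, q ^+ m.+1 != 1.
Hypothesis sigP : forall p, sig (iota p) = iota (p \Po (q *: 'X)).
Variables (n : nat) (A A' : 'M[K]_n.+1) (B B' : 'M[k]_n.+1).
Hypotheses (AA' : A *m A' = 1%:M) (A'A : A' *m A = 1%:M).
Hypotheses (AB : minf iota A B) (AB' : minf iota A' B').
Hypothesis irr : irreducible_system sig A.
Hypothesis ratio : forall x y i j, eigenvalue B x -> eigenvalue B y ->
  x ^+ n.+1 * q ^+ i = y ^+ n.+1 * q ^+ j -> exists i j, x * q ^+ i = y * q ^+ j.

Let z0 : z != 0.
Proof. by rewrite (iota_eq0 iota_inj) polyX_eq0. Qed.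
Let iinj := iota_inf_inj iota_inj.

Let B'B : B' *m B = 1%:M.
Proof.
apply: (mval_uniq iinj (mvalM iinj AB' AB)); rewrite A'A.
by apply: mval_scalar; apply: rval1.
Qed.

(** The rows killed by X form a sigma-stable subspace; irreducibility leaves only 0 and
    everything. *)
Lemma semifixed_unit (X : 'M[K]_n.+1) c : c != 0 -> A' *m map_mx sig X *m A = c *: X ->
  X != 0 -> X \in unitmx.
Proof.
move=> c0 sX X0; apply: contraNT X0 => Xu.
pose W (u : 'rV[K]_n.+1) := u *m X = 0.
have sigX' : map_mx sig X *m A = c *: (A *m X).
  by rewrite -[map_mx sig X]mul1mx -AA' -!mulmxA [A' *m _]mulmxA sX -scalemxAr.
have H : forall u, W u.
  apply: (irr (P := W)).
  - by rewrite /W mul0mx.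
  - by move=> a u v uX vX; rewrite /W mulmxDl -scalemxAl uX vX scaler0 addr0.
  - move=> u; rewrite /W.
    have -> : map_mx sig u *m A *m X = c^-1 *: (map_mx sig (u *m X) *m A).
      by rewrite map_mxM -!mulmxA sigX' -scalemxAr scalerA mulVf // scale1r.
    split=> [->|/eqP]; first by rewrite map_mx0 mul0mx scaler0.
    rewrite scaler_eq0 invr_eq0 (negbTE c0) /= => /eqP H; apply/eqP.
    by rewrite -(map_mx_eq0 sig) -[map_mx _ _]mulmx1 -AA' mulmxA H mul0mx.
  - move: Xu; rewrite -row_free_unit -kermx_eq0 => /matrix0Pn[i [j ker]].
    exists (row i (kermx X)); last by rewrite /W -row_mul mulmx_ker row0.
    by apply: contra_neq ker => /rowP/(_ j); rewrite !mxE.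
apply/eqP/row_matrixP => i; rewrite row0 rowE; exact: H.
Qed.

(** A power of z makes X fixed by the twisted action. Its characteristic polynomial then has
    coefficients in k, hence a root in k; X minus this root is fixed and singular, so it is 0 by
    [semifixed_unit]. *)
Lemma semifixed_scalar (X : 'M[K]_n.+1) c i j :
  A' *m map_mx sig X *m A = kC c *: X -> c * q ^+ i = q ^+ j -> exists f, X = f%:M.
Proof.
move=> sX cq.
have c0 : c != 0 by apply: contraTneq isT => c0; move/eqP: cq; rewrite c0 mul0r eq_sym expf_eq0 (negbTE q0) andbF.
pose u := z ^+ i / z ^+ j; pose Y := u *: X.
have zn m : z ^+ m != 0 by rewrite expf_neq0.
have qn m : kC q ^+ m != 0 by rewrite expf_neq0 // fmorph_eq0.
have u0 : u != 0 by rewrite mulf_neq0 ?invr_eq0.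
have su : sig u = kC c^-1 * u.
  have -> : c^-1 = q ^+ i / q ^+ j.
    by rewrite -cq; field; rewrite c0 expf_neq0.
  rewrite /u fmorph_div !rmorphXn (sigX sigP) !exprMn fmorph_div !rmorphXn.
  move: (zn i) (zn j) (qn i) (qn j).
  move: (z ^+ i) (z ^+ j) (kC q ^+ i) (kC q ^+ j) => x y x' y' x0 y0 x'0 y'0.
  by field; rewrite ?x0 ?y0 ?x'0 ?y'0.
have sY : A' *m map_mx sig Y *m A = Y.
  rewrite /Y map_mxZ su -scalemxAr -scalemxAl sX scalerA mulrAC -rmorphM mulVf //.
  by rewrite rmorph1 mul1r.
have sYA : map_mx sig Y *m A = A *m Y.
  by rewrite -[map_mx sig Y]mul1mx -AA' -!mulmxA [A' *m _]mulmxA sY.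
have cp : map_poly sig (char_poly Y) = char_poly Y.
  rewrite map_char_poly.
  have -> : map_mx sig Y = A *m Y *m A' by rewrite -sYA -mulmxA AA' mulmx1.
  rewrite /char_poly /char_poly_mx !map_mxM.
  have AA'P : map_mx polyC A *m map_mx polyC A' = 1%:M by rewrite -map_mxM AA' map_mx1.
  rewrite -[_ - _](_ : map_mx polyC A *m ('X%:M - map_mx polyC Y) *m map_mx polyC A' = _).
    by rewrite !det_mulmx mulrAC -det_mulmx AA'P det1 mul1r.
  by rewrite mulmxBr mulmxBl scalar_mxC -['X%:M *m _ *m _]mulmxA AA'P mulmx1.
have [p pE] : exists p : {poly k}, char_poly Y = map_poly kC p.
  have /choice[a aE] m : exists a, (char_poly Y)`_m = kC a.
    by apply: (sig_fixed iota_inj ratfunP q0 sigP q_not_root1); rewrite -coef_map cp.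
  exists (\poly_(m < size (char_poly Y)) a m); apply/polyP => m.
  rewrite coef_map coef_poly; case: ltnP => [_|le]; first exact: aE.
  by rewrite nth_default // raddf0.
have [|g pg] := closed_k (p := p).
  by rewrite -(size_map_poly kC) -pE size_char_poly.
have gY : ~~ (Y - (kC g)%:M \in unitmx).
  rewrite -row_free_unit -kermx_eq0; change (eigenvalue Y (kC g)).
  by rewrite eigenvalue_root_char pE fmorph_root.
have Yg : Y = (kC g)%:M.
  apply/eqP; rewrite -subr_eq0; apply: contraNT gY => gY.
  apply: (@semifixed_unit _ 1) => //; first exact: oner_neq0.
  rewrite map_mxB mulmxBr mulmxBl sY scale1r map_scalar_mx /= (sigC sigP).
  by rewrite mul_mx_scalar -scalemxAl A'A scalemx1.
exists (u^-1 * kC g); rewrite -[X]scale1r -(mulVf u0) -scalerA -/Y Yg.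
by rewrite -mul_scalar_mx scalar_mxM.
Qed.

Definition polymx (X : 'M[K]_n.+1) := forall a b, exists p, X a b = iota p.

Lemma polymxD X Y : polymx X -> polymx Y -> polymx (X + Y).
Proof.
move=> HX HY a b; have [p pE] := HX a b; have [r rE] := HY a b.
by exists (p + r); rewrite mxE pE rE rmorphD.
Qed.

Lemma polymx0 : polymx 0.
Proof. by move=> a b; exists 0; rewrite mxE rmorph0. Qed.

Lemma polymxZ p X : polymx X -> polymx (iota p *: X).
Proof. by move=> HX a b; have [r rE] := HX a b; exists (p * r); rewrite mxE rE rmorphM. Qed.

Lemma polymxM X Y : polymx X -> polymx Y -> polymx (X *m Y).
Proof.
move=> HX HY a b; rewrite mxE.
apply: (big_ind (fun x => exists p, x = iota p)); first by exists 0; rewrite rmorph0.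
  by move=> _ _ [p ->] [r ->]; exists (p + r); rewrite rmorphD.
by move=> l _; have [p ->] := HX a l; have [r ->] := HY l b; exists (p * r); rewrite rmorphM.
Qed.

Lemma polymx_sig X : polymx X -> polymx (map_mx sig X).
Proof. by move=> HX a b; have [p pE] := HX a b; rewrite mxE pE sigP; eexists. Qed.

Lemma common_denom X : exists d, d != 0 /\ polymx (iota d *: X).
Proof.
have /choice[d dP] : forall ij : 'I_n.+1 * 'I_n.+1, exists d, d != 0 /\
    exists p, iota d * X ij.1 ij.2 = iota p.
  move=> ij; have [p [d [d0 E]]] := ratfunP (X ij.1 ij.2).
  by exists d; split=> //; exists p; rewrite E mulrC divfK // (iota_eq0 iota_inj).
exists (\prod_ij d ij); split; first by apply/prodf_neq0 => ij _; case: (dP ij).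
move=> a b; have [_ [p pE]] := dP (a, b).
exists (p * \prod_(ij | ij != (a, b)) d ij).
by rewrite mxE (bigD1 (a, b)) //= !rmorphM mulrAC pE.
Qed.

(* [X] is integral over the polynomials, up to a common denominator *)
Definition almost_integral (X : 'M[K]_n.+1) :=
  exists2 d, d != 0 & forall j, polymx (iota d *: X ^+ j).

Lemma almost_integralD X Y : X * Y = Y * X ->
  almost_integral X -> almost_integral Y -> almost_integral (X + Y).
Proof.
move=> XY [d d0 dX] [e e0 eY]; exists (d * e) => [|j]; first by rewrite mulf_neq0.
rewrite exprDn_comm // scaler_sumr; apply: (big_ind polymx); first exact: polymx0.
  exact: polymxD.
move=> i _; rewrite -scalerMnr -scaler_nat -(rmorph_nat iota).
apply: polymxZ; rewrite rmorphM -[_ * Y ^+ i]/(_ *m _) -scalerA scalemxAr scalemxAl.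
exact: polymxM.
Qed.

Lemma almost_integralZ c X : almost_integral X -> almost_integral (kC c *: X).
Proof.
move=> [d d0 dX]; exists d => // j; rewrite exprZn scalerA mulrC -scalerA -rmorphXn.
exact: polymxZ.
Qed.

Let sg X := A' *m map_mx sig X *m A.

Let sgM X Y : sg (X * Y) = sg X * sg Y.
Proof.
rewrite -[sg X * _]/(_ *m _) /sg -[_ * _]/(X *m Y) map_mxM -!mulmxA.
by rewrite [A *m (A' *m _)]mulmxA AA' mul1mx.
Qed.

Let sgX X j : sg (X ^+ j) = sg X ^+ j.
Proof.
elim: j => [|j IH]; last by rewrite !exprS sgM IH.
by rewrite !expr0 /sg -[1]/(1%:M) map_mx1 mulmx1.
Qed.

Let sgZ a X : sg (a *: X) = sig a *: sg X.
Proof. by rewrite /sg map_mxZ -scalemxAr -scalemxAl. Qed.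

Let sg_minf X V : minf iota X V -> minf iota (sg X) (B' *m V *m B).
Proof. by move=> H; do 2 apply: (mvalM iinj) => //; exact: minf_sig. Qed.

Lemma almost_integral_sg X : almost_integral X -> almost_integral (A' *m map_mx sig X *m A).
Proof.
move=> [d d0 dX]; have [e [e0 eA]] := common_denom A; have [e' [e'0 eA']] := common_denom A'.
exists (e * (e' * (d \Po (q *: 'X)))).
  rewrite !mulf_neq0 // -(iota_eq0 iota_inj) -sigP fmorph_eq0 (iota_eq0 iota_inj).
  by [].
move=> j; rewrite -/(sg X) -sgX !rmorphM -sigP.
have -> : (iota e * (iota e' * sig (iota d))) *: sg (X ^+ j) =
    (iota e' *: A') *m map_mx sig (iota d *: X ^+ j) *m (iota e *: A).
  by rewrite map_mxZ -scalemxAr -!scalemxAl -[A' *m (_ *: _)]scalemxAr -scalemxAl !scalerA mulrA.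
by apply: polymxM => //; apply: polymxM => //; apply: polymx_sig.
Qed.

(** If D clears the denominators of the characteristic polynomial of X, the Cayley-Hamilton equation
    of D X is monic with polynomial coefficients. All powers are then polynomial combinations of the
    first ones, whose common denominator serves for all. *)
Lemma almost_integral_multiple X : exists p, p != 0 /\ almost_integral (iota p *: X).
Proof.
pose N := n.+1; pose c i := (char_poly X)`_i.
have /choice[d dP] i : exists d, d != 0 /\ exists p, iota d * c i = iota p.
  have [p [d [d0 E]]] := ratfunP (c i).
  by exists d; split=> //; exists p; rewrite E mulrC divfK // (iota_eq0 iota_inj).
pose D := \prod_(i < N) d i.
have D0 : D != 0 by apply/prodf_neq0 => i _; case: (dP i).
have /choice[p pE] (i : 'I_N) : exists p, iota D * c i = iota p.
  have [_ [p pE]] := dP i.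
  by exists (p * \prod_(l < N | l != i) d l); rewrite /D (bigD1 i) //= !rmorphM mulrAC pE.
exists D; split=> //; pose Y := iota D *: X; rewrite -/Y.
have YN : Y ^+ N = - \sum_(i < N) (iota (p i * D ^+ (N - i.+1))) *: Y ^+ i.
  have := congr1 (fun M => iota D ^+ N *: M) (Cayley_Hamilton X).
  rewrite scaler0 /horner_mx /horner_morph horner_coef size_map_poly size_char_poly.
  rewrite big_ord_recr /= scalerDr coef_map.
  have -> : (char_poly X)`_N = 1.
    by have := char_poly_monic X; rewrite monicE lead_coefE size_char_poly => /eqP.
  rewrite -[X in _ + _ *: X]/(1%:M *m X ^+ N) mul1mx -exprZn addrC => /eqP; rewrite addr_eq0 => /eqP ->.
  congr (- _); rewrite scaler_sumr; apply: eq_bigr => i _.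
  rewrite coef_map -[_ * X ^+ i]/((c i)%:M *m X ^+ i) mul_scalar_mx scalerA exprZn scalerA; congr (_ *: _).
  have iN : (N = i + (1 + (N - i.+1)))%N by rewrite addnA addn1 subnKC.
  by rewrite {1}iN !exprD expr1 rmorphM rmorphXn -pE; ring.
have /choice[e eP] i := common_denom (Y ^+ i).
exists (\prod_(i < N) e i); first by apply/prodf_neq0 => i _; case: (eP i).
move=> j; have [m] := ubnP j; elim: m j => // m IH j; rewrite ltnS => jm.
case: (ltnP j N) => jN.
  rewrite (bigD1 (Ordinal jN)) //= mulrC rmorphM -scalerA; apply: polymxZ.
  by case: (eP j).
rewrite -(subnKC jN) exprD YN mulNr mulr_suml scalerN -scaleN1r -(rmorph1 iota) -rmorphN.
apply: polymxZ; rewrite scaler_sumr.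
apply: (big_ind polymx); [exact: polymx0 | exact: polymxD |].
move=> i _; rewrite -[(_ *: Y ^+ i) * _]/(_ *m _) -scalemxAl -[Y ^+ i *m _]/(_ * _) -exprD.
rewrite scalerA mulrC -scalerA; apply: polymxZ; apply: IH.
by have := ltn_ord i; lia.
Qed.

Lemma minf_entries a (X : 'M[K]_n.+1) : (forall i j, exists v, rinf iota (a * X i j) v) ->
  exists V, minf iota (a *: X) V.
Proof.
move=> H; have /choice[V VP] (ij : 'I_n.+1 * 'I_n.+1) : exists v, rinf iota (a * X ij.1 ij.2) v.
  exact: H.
by exists (\matrix_(i, j) V (i, j)) => i j; rewrite !mxE; apply: (VP (i, j)).
Qed.

(** The powers of X vanish at infinity to growing order, while they have a common denominator.
    Multiplied by it, the entries of a high power are polynomials vanishing at infinity, hence 0. *)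
Lemma almost_integral_nilpotent X : almost_integral X -> minf iota X 0 -> exists j, X ^+ j.+1 = 0.
Proof.
move=> [d d0 dX] X0.
have [Y [V [XE YV]]] : exists Y V, X = z^-1 *: Y /\ minf iota Y V.
  have [|V XV] := @minf_entries z X.
    move=> i j; apply: (rinf_divz iota_inj); rewrite mulKf //.
    by have := X0 i j; rewrite mxE.
  by exists (z *: X), V; rewrite scalerA mulVf // scale1r.
have YnV j : minf iota (Y ^+ j) (V ^+ j).
  elim: j => [|j IH]; last by rewrite !exprS; apply: (mvalM iinj).
  by rewrite !expr0; apply: mval_scalar; apply: rval1.
have [m [w dw]] : exists m w, rinf iota (z^-1 ^+ m * iota d) w.
  have [|a [b [v [_ H]]]] := @rinf_order _ _ _ iota_inj ratfunP (iota d).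
    by rewrite (iota_eq0 iota_inj).
  exists b, (0 ^+ a * v); rewrite mulrC.
  have -> : iota d * z^-1 ^+ b = z^-1 ^+ a * (iota d * z^-1 ^+ b / z^-1 ^+ a).
    by rewrite mulrCA mulfV ?mulr1 // expf_neq0 // invr_eq0.
  by apply: rvalM => //; apply/rvalXn/rinf_V.
exists m; have H : minf iota (iota d *: X ^+ m.+1) (0 *: (w *: V ^+ m.+1)).
  have -> : iota d *: X ^+ m.+1 = z^-1 *: ((z^-1 ^+ m * iota d) *: Y ^+ m.+1).
    by rewrite XE exprZn !scalerA exprS; congr (_ *: _); ring.
  by apply: mvalZ; [exact: rinf_V | apply: mvalZ => //; exact: YnV].
have dX0 : iota d *: X ^+ m.+1 = 0.
  apply/matrixP => i j; rewrite [RHS]mxE.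
  have [p pE] := dX m.+1 i j; rewrite pE (@rinf_poly _ _ _ iota_inj p) ?rmorph0 // -pE.
  have z00 : (0 : 'M[k]_n.+1) i j = 0 by rewrite mxE.
  by rewrite -z00 -(scale0r (w *: V ^+ m.+1)); exact: H.
by move/eqP: dX0; rewrite scaler_eq0 (iota_eq0 iota_inj) (negbTE d0) => /eqP.
Qed.

(** Otherwise the algebra has nonzero traceless almost integral elements; take those with a pole of
    least order v at infinity. Their leading coefficients there determine them, by minimality of v
    or, if v = 0, because nilpotent elements are 0. So they form a finite dimensional space over k,
    on which sigma acts, up to q^v, through conjugation by B. An eigenvector V, with eigenvalue c,
    comes from some Y whose twisted transform is c q^v Y. The determinant of Y shows that (c
    q^v)^(n+1) is an integral power of q, and c is a quotient of eigenvalues of B by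
    [twisted_commutation]. By [ratio], c is an integral power of q; so Y is scalar and, being
    traceless, 0. *)
Lemma comp_scalar_commutants : scalar_commutants sig A A'.
Proof.
move=> P Psc PD PM PC Pred Psg X PX; apply: contrapT => nX.
have PZ a Y : P Y -> P (a *: Y) by move=> PY; rewrite -mul_scalar_mx; apply: PM.
have N0 : n.+1%:R != 0 :> K by rewrite -(rmorph_nat kC) fmorph_eq0 char0.
pose X0 := X - ((\tr X / n.+1%:R)%:M).
have PX0 : P X0 by rewrite /X0 -scaleN1r; apply: (PD) => //; apply: (PZ).
have X00 : X0 != 0 by apply: contra_notN nX; rewrite subr_eq0 => /eqP E; eexists; exact: E.
have tX0 : \tr X0 = 0 by rewrite /X0 linearB /= mxtrace_scalar -[_ *+ _]mulr_natr divfK // subrr.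
have [p [p0 pX]] := almost_integral_multiple X0.
pose u := z^-1; pose G v Y := [/\ P Y, \tr Y = 0, almost_integral Y & exists V, minf iota (u ^+ v *: Y) V].
have exG : exists v, `[< exists2 Y, Y != 0 & G v Y >].
  pose X1 := iota p *: X0.
  have /choice[b bP] (ij : 'I_n.+1 * 'I_n.+1) : exists b, exists v, rinf iota (u ^+ b * X1 ij.1 ij.2) v.
    have [->|f0] := eqVneq (X1 ij.1 ij.2) 0.
      by exists 0%N, 0; rewrite mulr0; apply: rval0.
    have [a [b [v [_ H]]]] := rinf_order iota_inj ratfunP f0.
    exists b, (0 ^+ a * v).
    have -> : u ^+ b * X1 ij.1 ij.2 = u ^+ a * (X1 ij.1 ij.2 * u ^+ b / u ^+ a).
      by rewrite mulrCA mulfV ?mulr1 1?mulrC // expf_neq0 // invr_eq0.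
    by apply: rvalM => //; apply/rvalXn/rinf_V.
  exists (\sum_ij b ij)%N; apply/asboolP; exists X1.
    by rewrite scaler_eq0 (iota_eq0 iota_inj) negb_or p0.
  split=> //; first exact: PZ.
    by rewrite linearZ /= tX0 mulr0.
  apply: minf_entries => i j; have [v vP] := bP (i, j).
  exists (0 ^+ (\sum_(l | l != (i, j)) b l)%N * v).
  rewrite (bigD1 (i, j)) //= addnC exprD -mulrA; apply: rvalM => //.
  exact/rvalXn/rinf_V.
case: (ex_minnP exG) => v /asboolP[Y0 Y00 GY0] vmin.
have inj Y : G v Y -> minf iota (u ^+ v *: Y) 0 -> Y = 0.
  move=> [PY tY aY _] Y0v; apply/eqP/negPn/negP => Yn.
  case: v vmin Y0v {GY0} => [|v] vmin Y0v.
    case/negP: Yn; move: Y0v; rewrite expr0 scale1r => Y0v.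
    have [j Yj] := almost_integral_nilpotent aY Y0v.
    (* [Pred] speaks of squares only, so nilpotency is exploited through the exponents 2^i. *)
    have red i (Z : 'M[K]_n.+1) : P Z -> Z ^+ (2 ^ i) = 0 -> Z = 0.
      elim: i Z => [|i IH] Z PZ0; first by rewrite expn0 expr1.
      rewrite expnS exprM => /IH H; apply: (Pred _ PZ0); apply: H.
      exact: (PM _ _ PZ0 PZ0).
    apply/eqP/(red j.+1 _ PY).
    by rewrite -(subnK (ltnW (ltn_expl j.+1 (ltnSn 1)))) exprD Yj mulr0.
  have /vmin : `[< exists2 Y, Y != 0 & G v Y >]; last by rewrite ltnn.
  apply/asboolP; exists Y => //; split=> //.
  apply: minf_entries => i j; apply: (rinf_divz iota_inj); rewrite mulrA -exprS.
  by have := Y0v i j; rewrite !mxE.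
have GL a Y Z V V' : G v Y -> G v Z -> minf iota (u ^+ v *: Y) V -> minf iota (u ^+ v *: Z) V' ->
    G v (kC a *: Y + Z) /\ minf iota (u ^+ v *: (kC a *: Y + Z)) (a *: V + V').
  move=> [PY tY aY _] [PZ0 tZ aZ _] YV ZV.
  have H : minf iota (u ^+ v *: (kC a *: Y + Z)) (a *: V + V').
    rewrite scalerDr scalerA mulrC -scalerA; apply: (mvalD iinj) => //.
    by apply: mvalZ => //; exact: rinf_C.
  split=> //; split; last by eexists; exact: H.
  - by apply: (PD) => //; apply: (PZ).
  - by rewrite linearD linearZ /= tY tZ mulr0 addr0.
  - by apply: almost_integralD => //; [apply: (PC) => //; apply: (PZ) | apply: almost_integralZ].
have uq : sig u = kC q^-1 * u by rewrite /u fmorphV (sigX sigP) invfM fmorphV.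
have Gsg Y V : G v Y -> minf iota (u ^+ v *: Y) V ->
    G v (sg Y) /\ minf iota (u ^+ v *: sg Y) (q ^+ v *: (B' *m V *m B)).
  move=> [PY tY aY _] YV.
  have H : minf iota (u ^+ v *: sg Y) (q ^+ v *: (B' *m V *m B)).
    have -> : u ^+ v *: sg Y = kC (q ^+ v) *: sg (u ^+ v *: Y).
      have qv : kC (q ^+ v) * kC q^-1 ^+ v = 1.
        by rewrite -rmorphXn -rmorphM -exprMn mulfV // expr1n rmorph1.
      by rewrite sgZ [sig (u ^+ v)]rmorphXn uq exprMn scalerA mulrA qv mul1r.
    by apply: mvalZ; [exact: rinf_C | exact: sg_minf].
  split=> //; split; last by eexists; exact: H.
  - exact: Psg.
  - by rewrite /sg mxtrace_mulC mulmxA AA' mul1mx trace_map_mx tY rmorph0.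
  - exact: almost_integral_sg.
have [||H HP] := @subspace_mx k (n.+1 * n.+1)
  (fun r => exists2 Y, G v Y & minf iota (u ^+ v *: Y) (vec_mx r)).
- exists 0; last by rewrite scaler0 linear0; apply: mval0.
  split; [by rewrite -(scale0r X); apply: PZ | by rewrite linear0 | | by exists 0; rewrite scaler0; apply: mval0].
  by rewrite -(scale0r (iota p *: X0)) -(rmorph0 kC); exact: almost_integralZ.
- move=> a r r' [Y GY YV] [Z GZ ZV]; have [? ?] := GL a _ _ _ _ GY GZ YV ZV.
  by exists (kC a *: Y + Z) => //; rewrite (linearP (@vec_mx _ _ _)).
pose M := lin_mx (mulmxr B \o mulmx B').
have [||c [r [r0 rH rM]]] := @stable_eigenvector k _ H M closed_k.
- case: GY0 => PY0 tY0 aY0 [V V0]; apply: contra_neq Y00 => H0.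
  have : (mxvec V <= H)%MS by apply/HP; exists Y0; rewrite ?mxvecK //; split=> //; exists V.
  rewrite H0 submx0 mxvec_eq0 => /eqP V00; apply: inj; last by rewrite -V00.
  by split=> //; exists V.
- apply/row_subP => i; rewrite row_mul; apply/HP.
  have [Y GY YV] := (HP (row i H)).2 (row_sub i H).
  have [GsY sYV] := Gsg _ _ GY YV.
  (* [GL] handles combinations a Y + Z only. Its two uses add up to q^-v times the transform of Y,
     whose leading coefficient is exactly B' V B. *)
  have [G1 V1] := GL 0 _ _ _ _ GY GsY YV sYV.
  have [G2 V2] := GL (q ^- v - 1) _ _ _ _ GsY G1 sYV V1.
  exists (kC (q ^- v - 1) *: sg Y + (kC 0 *: Y + sg Y)) => //.
  rewrite mul_rV_lin /= mxvecK; move: V2; congr (minf _ _ _).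
  rewrite scale0r add0r scalerBl scale1r addrNK scalerA mulVf ?scale1r //.
  by rewrite expf_neq0.
have [Y GY YV] := (HP r).2 rH.
pose V := vec_mx r; have V0 : V != 0.
  by apply: contra_neq r0 => V0; rewrite -[r]vec_mxK -/V V0 linear0.
have VB : B' *m V *m B = c *: V.
  have := rM; rewrite mul_rV_lin /= -/V => /(congr1 vec_mx).
  by rewrite mxvecK linearZ.
have BB' : B *m B' = 1%:M := mulmx1C B'B.
have VB' : V *m B = c *: (B *m V).
  by rewrite scalemxAr -VB !mulmxA BB' mul1mx.
have c0 : c != 0.
  apply: contra_neq V0 => c0.
  by rewrite -[V]mulmx1 -BB' mulmxA VB' c0 scale0r mul0mx.
have Yn0 : Y != 0.
  apply: contra_neq V0 => Yn0; apply: (mval_uniq iinj YV); rewrite Yn0 scaler0.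
  exact: mval0.
have sY : sg Y = kC (c * q ^+ v) *: Y.
  apply/eqP; rewrite -subr_eq0 -scaleNr -rmorphN addrC; apply/eqP.
  have [GsY sYV] := Gsg _ _ GY YV.
  have [G1 V1] := GL (- (c * q ^+ v)) _ _ _ _ GY GsY YV sYV.
  apply: inj => //; move: V1; congr (minf _ _ _).
  by rewrite VB scalerA mulrC scaleNr addNr.
have Yu : Y \in unitmx.
  by apply: semifixed_unit sY Yn0; rewrite fmorph_eq0 mulf_neq0 // expf_neq0.
have dY : sig (\det Y) = kC ((c * q ^+ v) ^+ n.+1) * \det Y.
  have := congr1 determinant sY; rewrite /sg !det_mulmx mulrAC -det_mulmx A'A det1 mul1r.
  by rewrite detZ det_map_mx -rmorphXn.
have [i [j cN]] : exists i j, (c * q ^+ v) ^+ n.+1 * q ^+ i = q ^+ j.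
  apply: (sig_semifixed iota_inj ratfunP q0 sigP _ dY).
  by rewrite -unitfE -unitmxE.
have [x [y [Bx By xy]]] := twisted_commutation closed_k V0 VB' c0.
have y0 : y != 0.
  have /eigenvalueP[t tB t0] := By; apply: contra_neq t0 => y0.
  by rewrite -[t]mulmx1 -BB' mulmxA tB y0 scale0r mul0mx.
have [i' [j' xq]] : exists i j, x * q ^+ i = y * q ^+ j.
  apply: (ratio (i := (v * n.+1 + i)%N) (j := j) Bx By).
  by rewrite xy -cN !exprMn exprD exprM; ring.
have [f Yf] : exists f, Y = f%:M.
  apply: (semifixed_scalar (c := c * q ^+ v) (i := i') (j := (v + j')%N) sY).
  apply: (mulfI y0); rewrite exprD; transitivity (x * q ^+ i' * q ^+ v); first by rewrite xy; ring.
  by rewrite xq; ring.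
case: GY => _ tY _ _; case/negP: Yn0; move: tY.
rewrite Yf mxtrace_scalar -mulr_natr => /eqP; rewrite mulf_eq0 (negbTE N0) orbF => /eqP ->.
by rewrite -scalemx1 scale0r.
Qed.

End ScalarCommutants.

(** * Polarization of relations *)

Section MpolyTaylor.
Variables (K : fieldType) (mu : nat).

Lemma mpoly_closed (p : mpoly mu K) (P : mpoly mu K -> Prop) :
  (forall c, P (mpolyC mu c)) -> (forall i, P (mpolyX K (mnm1 i))) ->
  (forall p q, P p -> P q -> P (p + q)) -> (forall p q, P p -> P q -> P (p * q)) -> P p.
Proof.
move=> PC PX PD PM; rewrite [p]mpolyE; apply: big_ind.
- by rewrite -(mpolyC0 mu K); apply: PC.
- exact: PD.
move=> m _; rewrite -mul_mpolyC; apply: (PM); first exact: PC.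
rewrite mpolyXE_id; apply: big_ind.
- by rewrite -(mpolyC1 mu K); apply: PC.
- exact: (PM).
move=> i _; elim: (m i) => [|j IH].
  by rewrite expr0 -(mpolyC1 mu K); apply: PC.
by rewrite exprS; apply: (PM).
Qed.

Variables (B : comNzRingType) (h : {rmorphism K -> B}) (v d : 'I_mu -> B).
Let g : {rmorphism K -> {poly B}} := GRing.RMorphism.clone _ _ (polyC \o h) _.
Let v' x : {poly B} := (v x)%:P + 'X * (d x)%:P.

(** Substituting v + X d and reading the coefficients of 1 and X computes the value and the
    derivative in the direction d at once. *)
Lemma mmap_taylor (p : mpoly mu K) :
  (mmap g v' p)`_0 = mmap h v p /\
  (mmap g v' p)`_1 = \sum_x mmap h v (mderiv x p) * d x.
Proof.
pose Q (p : mpoly mu K) := (mmap g v' p)`_0 = mmap h v p /\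
  (mmap g v' p)`_1 = \sum_x mmap h v (mderiv x p) * d x.
apply: (@mpoly_closed p Q) => [c|i|p1 p2 [a b] [a' b']|p1 p2 [a b] [a' b']]; rewrite /Q.
- rewrite !mmapC !coefC /=; split=> //; rewrite big1 // => x _.
  by rewrite mderivC mmap0 mul0r.
- rewrite !mmapX !mmap1U !coefD !coefC !coefXM !coefC /= addr0 add0r; split=> //.
  rewrite (bigD1 i) //= big1 ?addr0 => [|j ji]; rewrite mderivX mnm1E.
    rewrite (_ : mnm_sub _ _ = mnm0); last by apply/mnmP => j; rewrite mnmBE subnn mnm0E.
    by rewrite eqxx mpolyX0 scale1r rmorph1 mul1r.
  by rewrite eq_sym (negbTE ji) scale0r mmap0 mul0r.
- rewrite !raddfD /= !coefD a b a' b' -big_split; split=> //; apply: eq_bigr => x _.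
  by rewrite linearD /= raddfD /= mulrDl.
- rewrite !rmorphM /= coef0M coefM !big_ord_recl big_ord0 a b a' b' addr0 /=; split=> //.
  rewrite mulr_sumr mulr_suml -big_split; apply: eq_bigr => x _ /=.
  by rewrite mderivM rmorphD !rmorphM /=; ring.
Qed.

End MpolyTaylor.

Section Words.
Variables (K : fieldType) (N n c mu : nat) (idx : 'I_mu -> jidx N n c) (kap : 'I_mu -> K).

(** A monomial becomes a word in the indices, padded with [None], where Y is 1, up to the common
    length d. One row r serves for all rings and all values: [polarization] uses it both in [B] and
    in the polynomials over [B]. *)
Lemma mpoly_words (p : mpoly mu K) : exists d (r : 'rV[K]_#|{ffun 'I_d -> jidx N n c}|),
  forall (R : comNzRingType) (g : {rmorphism K -> R}) (Y : jidx N n c -> R), Y None = 1 ->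
  \sum_w g (r 0 w) * \prod_s Y ((enum_val w : {ffun 'I_d -> jidx N n c}) s) =
  mmap g (fun x => g (kap x) * Y (idx x)) p.
Proof.
pose d := msize p; exists d.
pose l (m : multinom mu) : seq (jidx N n c) := flatten [seq nseq (m x) (idx x) | x <- enum 'I_mu].
pose wd m : {ffun 'I_d -> jidx N n c} := [ffun s : 'I_d => nth None (l m) s].
exists (\sum_(m <- msupp p) (mcoeff m p * \prod_x kap x ^+ m x) *: delta_mx 0 (enum_rank (wd m))).
move=> R g Y Y1.
pose F (r : 'rV[K]_#|{ffun 'I_d -> jidx N n c}|) :=
  \sum_w g (r 0 w) * \prod_s Y ((enum_val w : {ffun 'I_d -> jidx N n c}) s).
rewrite -/(F _) (big_morph F (id1 := 0) (op1 := +%R)); first last.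
- by rewrite /F big1 // => w _; rewrite mxE rmorph0 mul0r.
- move=> r r'; rewrite /F -big_split; apply: eq_bigr => w _.
  by rewrite mxE rmorphD mulrDl.
rewrite /mmap big_seq [RHS]big_seq; apply: eq_bigr => m mp.
rewrite /F (bigD1 (enum_rank (wd m))) //= [X in _ + X]big1 ?addr0; last first.
  by move=> w /negbTE wm; rewrite !mxE wm andbF mulr0 rmorph0 mul0r.
rewrite !mxE !eqxx mulr1 rmorphM -mulrA enum_rankK; congr (_ * _).
rewrite /mmap1; under [RHS]eq_bigr => x _ do rewrite exprMn.
rewrite big_split rmorph_prod /=; under eq_bigr => x _ do rewrite rmorphXn.
congr (_ * _).
have sl : (size (l m) <= d)%N.
  rewrite /l size_flatten /shape -map_comp sumnE big_map big_enum /=.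
  under eq_bigr => x _ do rewrite size_nseq.
  by rewrite -mdegE ltnW // /d; apply: msize_mdeg_lt.
transitivity (\prod_(i <- l m) Y i).
  under eq_bigr => s _ do rewrite ffunE.
  rewrite (big_nth None) big_mkord (big_ord_widen d (fun s => Y (nth None (l m) s)) sl).
  rewrite [RHS]big_mkcond; apply: eq_bigr => s _; case: ltnP => // le.
  by rewrite nth_default.
rewrite /l big_flatten big_map big_enum /=; apply: eq_bigr => x _.
by rewrite big_nseq; elim: (m x) => //= j ->; rewrite exprS.
Qed.

End Words.

(** * Polarization and descent on the degree *)

Section Core.
Variables (K : fieldType) (sig : {rmorphism K -> K}) (n N c : nat) (J J' : {poly 'M[K]_n.+1}).
Hypothesis JJ' : jagree N (J * J') 1.
Hypothesis full : forall d (NN : 'M[K]_#|{ffun 'I_d -> jidx N n c}|),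
  (map_mx sig NN *m @rho N n c d _ J :=: NN)%MS -> forall Z, liestab NN Z.
Variables (B : comNzRingType) (h : {rmorphism K -> B}) (sB : {rmorphism B -> B}).
Hypothesis sBh : forall a, sB (h a) = h (sig a).
Variables (Y : jidx N n c -> B).
Hypothesis Y1 : Y None = 1.
Hypothesis sY : forall i, sB (Y i) = \sum_j h (tk 1 J i j) * Y j.
Variable PP : B -> Prop.
Hypothesis PP0 : PP 0.
Hypothesis PPD : forall x y, PP x -> PP y -> PP (x + y).
Hypothesis PPZ : forall a x, PP x -> PP (h a * x).
Hypothesis PPs : forall x, PP x -> PP (sB x).

(** The infinitesimal action of the elementary jet E_ab X^L on the coordinates: order l and row a
    become order l - L and row b, everything else goes to 0. *)
Let dY (L : nat) a b (i : jidx N n c) : B :=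
  if i is Some (l, a', j) then
    if (a' == a) && (L <= l)%N then Y (Some (inord (l - L), b, j)) else 0
  else 0.

Variables (mu : nat) (idx : 'I_mu -> jidx N n c) (kap : 'I_mu -> K).
Let y x := h (kap x) * Y (idx x).

(** The tensors with value in [PP] form a space [NN]; it is stable because sigma acts on values
    through [rho J], and comparing ranks turns the inclusion into an equality. By [full] every jet
    acts on [NN], and the value of r acted on by E_ab X^L is the derivative of the value of r in the
    direction [dY]. *)
Lemma polarization (p : mpoly mu K) L a b : (L <= N)%N -> PP (mmap h y p) ->
  PP (\sum_x mmap h y (mderiv x p) * (h (kap x) * dY L a b (idx x))).
Proof.
move=> LN Pp; have [d [r rP]] := mpoly_words idx kap p.
pose W : finType := {ffun 'I_d -> jidx N n c}.
pose F (u : 'rV[K]_#|W|) := \sum_w h (u 0 w) * \prod_s Y ((enum_val w : W) s).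
have FZ a' u : F (a' *: u) = h a' * F u.
  by rewrite /F mulr_sumr; apply: eq_bigr => w _; rewrite mxE rmorphM mulrA.
have FD u v : F (u + v) = F u + F v.
  by rewrite /F -big_split; apply: eq_bigr => w _; rewrite mxE rmorphD mulrDl.
have [||NN NNP] := @subspace_mx K _ (fun u => PP (F u)).
- by rewrite -(scale0r 0) FZ rmorph0 mul0r.
- by move=> a' u v Pu Pv; rewrite FD FZ; apply: PPD => //; apply: PPZ.
have Fsig u : F (map_mx sig u *m @rho N n c d _ J) = sB (F u).
  rewrite /F rmorph_sum; under [RHS]eq_bigr => w _ do
    rewrite rmorphM rmorph_prod sBh (eq_bigr _ (fun s _ => sY _)) bigA_distr_bigA mulr_sumr.
  rewrite exchange_big /= (reindex_onto enum_rank enum_val) /=; last by move=> i _; rewrite enum_valK.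
  rewrite (eq_bigl xpredT); last by move=> f; rewrite enum_rankK eqxx.
  apply: eq_bigr => f _; rewrite enum_rankK mxE rmorph_sum mulr_suml; apply: eq_bigr => w _.
  by rewrite rmorphM !mxE enum_rankK rmorph_prod big_split mulrA.
have NNJ : (map_mx sig NN *m @rho N n c d _ J :=: NN)%MS.
  apply/eqmxP; rewrite -mxrank_leqif_eq.
    by rewrite mxrankMfree ?mxrank_map // row_free_unit; exact: rho_unit JJ'.
  apply/row_subP => i; rewrite row_mul -map_row; apply/NNP; rewrite Fsig.
  exact/PPs/NNP/row_sub.
pose Z : {poly 'M[K]_n.+1} := (delta_mx a b : 'M[K]_n.+1) *: 'X^L.
have Zcoef l : Z`_l = if l == L then delta_mx a b else 0.
  by rewrite coefZ coefXn; case: eqP => _; rewrite ?mulr1 ?mulr0.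
have := (NNP (r *m @drho N n c d _ Z)).2 _.
have := NNP (r *m @drho N n c d _ Z) => /proj2 H.
have {}H : PP (F (r *m @drho N n c d _ Z)).
  apply: H; apply: submx_trans (full NNJ Z); apply: submxMr.
  apply/NNP; rewrite /F rP //.
move=> _; congr PP: H.
have E i : \sum_j h (tk 0 Z i j) * Y j = dY L a b i.
  rewrite (bigD1 None) //= /dY; case: i => [[[l a'] j]|] /=; last first.
    by rewrite rmorph0 mul0r add0r big1 // => -[[[? ?] ?]|] //= _; rewrite rmorph0 mul0r.
  rewrite rmorph0 mul0r add0r.
  case: ifP => [/andP[/eqP -> Ll]|Hn].
    have lN : (l - L < N.+1)%N by rewrite (leq_ltn_trans (leq_subr _ _)).
    rewrite (bigD1 (Some (inord (l - L), b, j))) //= inordK // eqxx leq_subr subKn //.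
    rewrite Zcoef eqxx mxE !eqxx rmorph1 mul1r big1 ?addr0 // => -[[[l' b'] j']|] //= ne.
    case: ifP => [/andP[/eqP jj' le]|_]; last by rewrite rmorph0 mul0r.
    rewrite Zcoef; case: eqP => [lL|_]; last by rewrite mxE rmorph0 mul0r.
    rewrite mxE eqxx /=; case: (eqVneq b' b) => [bb|_]; last by rewrite rmorph0 mul0r.
    case/negP: ne; rewrite bb jj'; apply/eqP; congr (Some (_, _, _)).
    by apply/val_inj; rewrite /= inordK // -lL subKn.
  rewrite big1 // => -[[[l' b'] j']|] //= _.
  case: ifP => [/andP[_ le]|_]; last by rewrite rmorph0 mul0r.
  rewrite Zcoef; case: eqP => [lL|_]; last by rewrite mxE rmorph0 mul0r.
  rewrite mxE; case: (eqVneq a' a) => [aa|_]; last by rewrite rmorph0 mul0r.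
  by move: Hn; rewrite aa eqxx -lL leq_subr.
(* The identity of [mpoly_words] is read at Y + X dY over the polynomials; its coefficients of X are
   the two derivatives to be compared. *)
pose g : {rmorphism K -> {poly B}} := GRing.RMorphism.clone _ _ (polyC \o h) _.
pose Ye i : {poly B} := (Y i)%:P + 'X * (dY L a b i)%:P.
have Ye1 : Ye None = 1 by rewrite /Ye Y1 mulr0 addr0.
have := congr1 (fun f : {poly B} => f`_1) (rP _ g Ye Ye1).
have -> : mmap g (fun x => g (kap x) * Ye (idx x)) p =
    mmap g (fun x => (y x)%:P + 'X * (h (kap x) * dY L a b (idx x))%:P) p.
  apply: eq_bigr => m _; congr (_ * _); apply: eq_bigr => x _; congr (_ ^+ _).
  by rewrite /Ye /y /= !polyCM; ring.
rewrite (mmap_taylor h y (fun x => h (kap x) * dY L a b (idx x)) p).2 => <-.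
rewrite coef_sum /F.
transitivity (\sum_w h (r 0 w) * \sum_s dY L a b ((enum_val w : W) s) *
    \prod_(t | t != s) Y ((enum_val w : W) t)); last first.
  apply: eq_bigr => w _; rewrite coefCM; congr (_ * _).
  pose ev0 : {rmorphism {poly B} -> B} := GRing.RMorphism.clone _ _ (horner_eval (0 : B)) _.
  rewrite (@der_prod _ _ ev0 (fun f : {poly B} => f`_1)); last first.
    move=> f f'; rewrite coefM !big_ord_recl big_ord0 addr0 /= /horner_eval !horner_coef0.
    by rewrite addrC.
  apply: eq_bigr => s _; rewrite /Ye coefD coefC coefXM coefC /= add0r; congr (_ * _).
  by apply: eq_bigr => t _; rewrite /= /horner_eval hornerD hornerM hornerX !hornerC mul0r addr0.
under eq_bigr => w _ do rewrite mxE rmorph_sum mulr_suml.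
rewrite exchange_big; apply: eq_bigr => w _.
under eq_bigr => w' _ do rewrite rmorphM -mulrA.
rewrite -mulr_sumr; congr (_ * _).
have drE w' : @drho N n c d _ Z w w' =
    \sum_s \prod_t (if t == s then tk 0 Z else tk 1 1) ((enum_val w : W) t) ((enum_val w' : W) t).
  by rewrite /drho /drho' /dtens summxE; apply: eq_bigr => s _; rewrite mxE.
under eq_bigr => w' _ do rewrite drE rmorph_sum mulr_suml.
rewrite exchange_big; apply: eq_bigr => s _.
transitivity (\sum_(w' : 'I_#|W|) \prod_t (h ((if t == s then tk 0 Z else tk 1 1) ((enum_val w : W) t) ((enum_val w' : W) t)) * Y ((enum_val w' : W) t))).
  by apply: eq_bigr => w' _; rewrite rmorph_prod big_split.
rewrite (reindex_onto enum_rank enum_val) /=; last by move=> i _; rewrite enum_valK.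
rewrite (eq_bigl xpredT); last by move=> f; rewrite enum_rankK eqxx.
transitivity (\sum_(f : W) \prod_t (h ((if t == s then tk 0 Z else tk 1 1) ((enum_val w : W) t) (f t)) * Y (f t))).
  by apply: eq_bigr => f _; rewrite enum_rankK.
rewrite -(bigA_distr_bigA (fun t j => h ((if t == s then tk 0 Z else tk 1 1) ((enum_val w : W) t) j) * Y j)).
rewrite (bigD1 s) //= eqxx E; congr (_ * _); apply: eq_bigr => t /negbTE ->.
rewrite tk1 (bigD1 ((enum_val w : W) t)) //= /kid eqxx rmorph1 mul1r big1 ?addr0 // => j.
by rewrite eq_sym => /negbTE ->; rewrite rmorph0 mul0r.
Qed.

Hypothesis char0 : forall l, l.+1%:R != 0 :> K.
Hypothesis idx_inj : injective idx.
Hypothesis idx_Some : forall x, idx x != None.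
Hypothesis kap0 : forall x, kap x != 0.
Hypothesis PPY : forall t : 'I_c -> B,
  (forall b, PP (\sum_j Y (Some (inord 0, b, j)) * t j)) -> forall j, PP (t j).

Lemma mderiv_eq0_const (p : mpoly mu K) : (forall x, mderiv x p = 0) ->
  p = mpolyC mu (mcoeff mnm0 p).
Proof.
move=> dp; apply/mpolyP => m; rewrite mcoeffC.
have [->|m0] := eqVneq m mnm0; first by rewrite mulr1.
have [i mi] : exists i, m i != 0%N.
  apply: contrapT => /forallNP H; case/eqP: m0; apply/mnmP => i; rewrite mnm0E.
  by apply/eqP/negPn/negP => /H.
have mE : m = mnm_add (mnm_sub m (mnm1 i)) (mnm1 i).
  apply/mnmP => j; rewrite mnmDE mnmBE mnm1E; case: eqVneq => [<-|_]; last by rewrite subn0 addn0.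
  by rewrite subnK // lt0n.
have := congr1 (mcoeff (mnm_sub m (mnm1 i))) (dp i).
rewrite mcoeff_mderiv -mE mcoeff0 -[_ *+ _.+1]mulr_natr => /eqP.
by rewrite mulf_eq0 (negbTE (char0 _)) orbF mulr0 => /eqP.
Qed.

Lemma msize_mderiv x (p : mpoly mu K) : mderiv x p != 0 -> (msize (mderiv x p) < msize p)%N.
Proof.
move=> dp; rewrite msizeE.
have H m : m \in msupp (mderiv x p) -> ((mdeg m).+1 < msize p)%N.
  rewrite mcoeff_msupp mcoeff_mderiv => H.
  have : mnm_add m (mnm1 x) \in msupp p.
    by rewrite mcoeff_msupp; apply: contraNneq H => ->; rewrite mul0rn.
  by move/msize_mdeg_lt; rewrite mdegD mdeg1 addn1.
have pos : (0 < msize p)%N.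
  have : msupp (mderiv x p) != [::] by rewrite msupp_eq0.
  by case E : (msupp _) => [|m s] // _; apply: leq_trans (H m _); rewrite // E inE eqxx.
rewrite -(prednK pos) ltnS; apply/bigmax_leqP_seq => m /H lt _.
by rewrite -ltnS (prednK pos).
Qed.

(** Polarize at the highest order L on which p depends. Only the variables of order L contribute,
    and they are replaced by coordinates of order 0; [PPY] cancels the latter and puts a nonzero
    partial derivative of p, of smaller degree, in [PP]. At the end p is a nonzero constant. *)
Theorem no_relation (p : mpoly mu K) : p != 0 -> PP (mmap h y p) -> PP 1.
Proof.
have [r] := ubnP (msize p); elim: r => // r IH in p *; rewrite ltnS => pr p0 Pp.
case: (pselect (exists x, mderiv x p != 0)) => [[x1 dx1]|ndx]; last first.
  have pE := mderiv_eq0_const (fun x => contrapT (fun H => ndx (ex_intro _ x (introN eqP H)))).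
  move: p0 Pp; move: (mcoeff _ p) pE => k0 ->; rewrite mmapC => c0 /(PPZ k0^-1).
  rewrite -rmorphM mulVf ?rmorph1 //.
  by apply: contraNneq c0 => ->; rewrite mpolyC0.
pose lev x := if idx x is Some (l, _, _) then nat_of_ord l else 0%N.
case: (@arg_maxnP _ x1 (fun x => mderiv x p != 0) lev dx1) => x0 dx0 xmax.
case E0 : (idx x0) => [[[L a] j0]|]; last by have := idx_Some x0; rewrite E0.
have LN : (L <= N)%N by rewrite -ltnS.
pose t j := \sum_(x | idx x == Some (L, a, j)) mmap h y (mderiv x p) * h (kap x).
have Pt : PP (t j0).
  apply: PPY => b; have := polarization a b LN Pp; congr PP.
  under [RHS]eq_bigr => j _ do rewrite mulr_sumr big_mkcond.
  rewrite exchange_big; apply: eq_bigr => x _ /=.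
  have [dx|dx] := eqVneq (mderiv x p) 0.
    by rewrite dx mmap0 mul0r big1 // => j _; rewrite !mul0r mulr0 if_same.
  have := xmax x dx; rewrite /lev E0 /dY; case E : (idx x) => [[[l a'] j']|]; last first.
    by have := idx_Some x; rewrite E.
  move=> lL; case: ifP => [/andP[/eqP -> Ll]|H].
    have -> : l = L by apply/val_inj/eqP; rewrite eqn_leq; apply/andP; split; [exact: lL | exact: Ll].
    rewrite (bigD1 j') //= eqxx big1 ?addr0 ?subnn; first by ring.
    by move=> j /negbTE jj; rewrite -[_ == _]/((L, a, j') == (L, a, j)) !xpair_eqE eq_sym jj andbF.
  rewrite !mulr0 big1 // => j _; rewrite -[_ == _]/((l, a', j') == (L, a, j)) !xpair_eqE.
  by case: eqP => [lE|_] //=; move: H; rewrite lE leqnn andbT => ->.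
apply: (IH (mderiv x0 p)) => //.
  exact: leq_trans (msize_mderiv dx0) pr.
have := PPZ (kap x0)^-1 Pt; congr PP; rewrite /t (bigD1 x0) ?E0 //= big1 ?addr0.
  by rewrite mulrCA -rmorphM mulVf // rmorph1 mulr1.
by move=> x /andP[/eqP xE]; rewrite -E0 in xE; rewrite (idx_inj xE) eqxx.
Qed.

End Core.

(** * Scaling automorphisms of rational functions *)

Section RatfunAutomorphisms.
Variables (k K : fieldType) (iota : {rmorphism {poly k} -> K}).
Hypothesis iota_inj : injective iota.
Hypothesis ratfunP : forall f : K, exists p d, d != 0 /\ f = iota p / iota d.

Lemma ratfun_scaling (q : k) : q != 0 -> exists sig : {rmorphism K -> K},
  forall p, sig (iota p) = iota (p \Po (q *: 'X)).
Proof.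
move=> q0; pose h : {rmorphism {poly k} -> K} :=
  GRing.RMorphism.clone _ _ (iota \o comp_poly (q *: 'X)) _.
have hi : injective h.
  apply: raddf_inj => p /eqP /=; rewrite (iota_eq0 iota_inj) comp_poly2_eq0 => [/eqP //|].
  by rewrite size_scale // size_polyX.
by have [g gP] := ratfun_lift iota_inj ratfunP hi; exists g => p; rewrite gP.
Qed.

Lemma ratfun_morph_eq (F : fieldType) (f g : {rmorphism K -> F}) :
  (forall c, f (kC iota c) = g (kC iota c)) -> f (iota 'X) = g (iota 'X) -> f =1 g.
Proof.
move=> fgC fgX x; have [p [d [_ ->]]] := ratfunP x.
suff H r : f (iota r) = g (iota r) by rewrite !fmorph_div !H.
elim/poly_ind: r => [|r c IH]; first by rewrite !rmorph0.
by rewrite !rmorphD !rmorphM /= IH fgX; congr (_ + _); exact: fgC.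
Qed.

Lemma ratfun_scalingK (q : k) (sig sigi : {rmorphism K -> K}) : q != 0 ->
  (forall p, sig (iota p) = iota (p \Po (q *: 'X))) ->
  (forall p, sigi (iota p) = iota (p \Po (q^-1 *: 'X))) -> cancel sigi sig.
Proof.
move=> q0 sigP sigiP x.
apply: (@ratfun_morph_eq K (GRing.RMorphism.clone _ _ (sig \o sigi) _) idfun) => [c|] /=.
  by rewrite (sigC sigiP) (sigC sigP).
by rewrite (sigX sigiP) rmorphM (sigC sigP) (sigX sigP) mulrA -rmorphM mulVf // rmorph1 mul1r.
Qed.

End RatfunAutomorphisms.

(** * Differential relations of solutions of the companion system *)

Section CompanionFull.
Variables (k K : fieldType) (iota : {rmorphism {poly k} -> K}).
Hypothesis iota_inj : injective iota.
Hypothesis ratfunP : forall f : K, exists p d, d != 0 /\ f = iota p / iota d.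
Hypothesis closed_k : forall p : {poly k}, size p != 1%N -> exists x, root p x.
Hypothesis char0 : forall l, l.+1%:R != 0 :> k.
Notation kC := (kC iota).
Variables (q : k) (sig : {rmorphism K -> K}) (del : K -> K).
Hypothesis q0 : q != 0.
Hypothesis q_not_root1 : forall m, q ^+ m.+1 != 1.
Hypothesis sigP : forall p, sig (iota p) = iota (p \Po (q *: 'X)).
Hypothesis delP : derivation del.
Hypothesis delF : forall p, del (iota p) = iota ('X * p^`()).
Variables (n : nat) (P Q : {poly k}) (lam : k).
Hypothesis lam0 : lam != 0.
Hypothesis sP : size P = n.+2.
Hypothesis sQ : (size Q <= n.+1)%N.
Hypotheses (P00 : P`_0 != 0) (Q00 : Q`_0 != 0).
Hypothesis PQ : forall x y m, root P x -> root Q y -> x <> q ^+ m * y.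
Hypothesis QP : forall x y m, root P x -> root Q y -> y <> q ^+ m * x.
Hypothesis PP_ratio : forall x y i j, root P x -> root P y ->
  x ^+ n.+1 * q ^+ i = y ^+ n.+1 * q ^+ j -> exists i j, x * q ^+ i = y * q ^+ j.

Notation A := (comp_mx iota n P Q lam).
Notation A' := (comp_inv iota n P Q lam).

(** An eigenvector of the transpose is a geometric progression 1, x, x^2 up to a factor, and the
    last row of the matrix gives P(x) = 0. *)
Lemma comp_inf_eigenvalue x : eigenvalue (comp_inf n P) x -> root P x.
Proof.
rewrite eigenvalue_root_char => /eqP Hx.
have p0 : P`_n.+1 != 0.
  by rewrite -[n.+1]/(n.+2.-1) -sP -/(lead_coef P) lead_coef_eq0 -size_poly_eq0 sP.
have : (comp_inf n P - x%:M)^T \notin unitmx.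
  rewrite unitmx_tr -row_free_unit -kermx_eq0; change (eigenvalue (comp_inf n P) x).
  by rewrite eigenvalue_root_char; apply/eqP.
rewrite -row_free_unit -kermx_eq0 => /matrix0Pn[i0 [j0 ker]].
pose v := row i0 (kermx (comp_inf n P - x%:M)^T).
have v0 : v != 0 by apply: contra_neq ker => /rowP/(_ j0); rewrite !mxE.
have vE : v *m (comp_inf n P)^T = x *: v.
  apply/eqP; rewrite -subr_eq0 -mul_mx_scalar -mulmxBr -[x%:M in X in _ *m X]tr_scalar_mx.
  by rewrite -linearB /= -row_mul mulmx_ker row0.
have vi (i : 'I_n.+1) : v 0 i = x ^+ i * v 0 0.
  case: i => i; elim: i => [|i IH] iN.
    by rewrite expr0 mul1r; congr (v _ _); apply/val_inj.
  have := congr1 (fun w : 'rV_n.+1 => w 0 (Ordinal (ltnW iN))) vE.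
  rewrite [RHS]mxE (IH (ltnW iN)) mulrA -exprS => <-.
  rewrite [RHS]mxE (bigD1 (Ordinal iN)) //= [(comp_inf n P)^T _ _]mxE [comp_inf _ _ _ _]mxE.
  rewrite -val_eqE /= ltn_eqF // eqxx mulr1 big1 ?addr0 // => j jn.
  rewrite [(comp_inf n P)^T _ _]mxE [comp_inf _ _ _ _]mxE -val_eqE /= ltn_eqF //.
  by rewrite (_ : (j == i.+1 :> nat) = false) ?mulr0 //; apply: contraNF jn => /eqP E; apply/eqP/val_inj.
have v00 : v 0 0 != 0.
  by apply: contra_neq v0 => E; apply/rowP => i; rewrite vi E mulr0 mxE.
have := congr1 (fun w : 'rV_n.+1 => w 0 ord_max) vE.
rewrite [RHS]mxE vi mulrA -exprS mxE => E.
rewrite rootE horner_coef sP big_ord_recr /=.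
suff -> : P`_n.+1 * x ^+ n.+1 = - \sum_(i < n.+1) P`_i * x ^+ i by rewrite subrr.
apply: (mulIf v00); rewrite -mulrA -E mulNr mulr_sumr mulr_suml -sumrN; apply: eq_bigr => i _.
rewrite (_ : (comp_inf n P)^T i ord_max = - P`_i / P`_n.+1); last by rewrite !mxE eqxx.
rewrite mulrCA [P`_n.+1 * _]mulrC divfK // (vi i) mulrN; congr (- _).
by rewrite mulrC mulrA.
Qed.

Lemma comp_mx_inf : minf iota A (comp_inf n P).
Proof.
rewrite -[comp_inf n P]addr0 -(scale0r (comp_1 n P Q lam)).
apply: (mvalD (iota_inf_inj iota_inj)); first exact: minfC.
by apply: mvalZ; [exact: rinf_V | exact: minfC].
Qed.

Lemma comp_inv_inf : exists V, minf iota A' V.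
Proof.
have p0 : P`_n.+1 != 0.
  by rewrite -[n.+1]/(n.+2.-1) -sP -/(lead_coef P) lead_coef_eq0 -size_poly_eq0 sP.
pose w (j : nat) : K := kC (- P`_j / P`_n.+1) + (iota 'X)^-1 * kC (Q`_j / (lam * P`_n.+1)).
have wV j : rinf iota (w j) (- P`_j / P`_n.+1).
  rewrite -[X in rinf _ _ X]addr0.
  apply: (rvalD (iota_inf_inj iota_inj)); first exact: rinf_C.
  rewrite -[X in rval _ _ _ X](mul0r (Q`_j / (lam * P`_n.+1))).
  by apply: rvalM; [exact: rinf_V | exact: rinf_C].
exists (\matrix_(i, j) if i == ord0 then (if j == ord_max then 1 else - (- P`_j.+1 / P`_n.+1)) / (- P`_0 / P`_n.+1)
   else (i == j.+1 :> nat)%:R) => i j; rewrite !mxE; case: eqP => _.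
  apply: rvalM; last by apply: rvalV; [exact: wV | rewrite mulf_neq0 ?oppr_eq0 ?invr_eq0].
  by case: eqP => _; [exact: rval1 | apply/rvalN/wV].
by case: (_ == _); [exact: rval1 | exact: rval0].
Qed.

Lemma companion_full N c d (NN : 'M[K]_#|{ffun 'I_d -> jidx N n c}|) :
  (map_mx sig NN *m @rho N n c d _ (jetmx del N A) :=: NN)%MS -> forall Z, liestab NN Z.
Proof.
move=> NNJ.
have [sigi sigiP] := ratfun_scaling iota_inj ratfunP (invr_neq0 q0).
have sigiK := ratfun_scalingK ratfunP q0 sigP sigiP.
have AA' := comp_mulV iota_inj q0 q_not_root1 lam0 sP P00 Q00.
have A'A := mulmx1C AA'.
have z00 := comp_pole_neq0 lam0 P00 Q00.
have Areg := comp_reg iota_inj n P Q lam.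
have A'reg := comp_inv_reg iota_inj (Q := Q) lam0 sP P00.
have [r0 [r1 [r [Az [dA [r0v r0d r1n r0A' [AzP Aze dAP dAe]]]]]]] :=
  comp_pole_data iota_inj q0 q_not_root1 delP delF lam0 sP P00 Q00.
have irr := comp_irreducible iota_inj ratfunP closed_k q0 q_not_root1 sigP lam0 sP sQ PQ QP.
have [V AV'] := comp_inv_inf.
have scal : scalar_commutants sig A A'.
  apply: (comp_scalar_commutants iota_inj ratfunP closed_k char0 q0 q_not_root1 sigP AA' A'A comp_mx_inf AV' irr).
  move=> x y i j /comp_inf_eigenvalue Px /comp_inf_eigenvalue Py; exact: PP_ratio.
have gP := lie_system_liestab iota_inj ratfunP char0 q0 q_not_root1 sigP sigiP sigiK delP delF
  AA' A'A z00 Areg A'reg r0v r0d r1n r0A' AzP Aze dAP dAe NNJ.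
have qn m : q ^- m.+1 * comp_pole P Q lam != 0 by rewrite mulf_neq0 ?invr_eq0 ?expf_neq0.
have qz m : q ^- m.+1 * comp_pole P Q lam != comp_pole P Q lam.
  rewrite -{2}[comp_pole P Q lam]mul1r (inj_eq (mulIf z00)) -[1]invr1 (inj_eq invr_inj).
  exact: q_not_root1.
have /choice[Av AvP] m := Areg _ (qn m).
have /choice[Av' AvP'] m := A'reg _ (qn m) (qz m).
apply: (lie_system_full iota_inj ratfunP char0 q0 q_not_root1 sigP sigiK delP delF AA' A'A z00
  _ irr scal gP AvP AvP').
apply/eqP => /matrixP/(_ 0 0); rewrite !mxE !eqxx => /eqP; exact/negP/oner_neq0.
Qed.

Variables (B : comNzRingType) (h : {rmorphism K -> B}) (sB : {rmorphism B -> B}) (dB : B -> B).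
Hypothesis sBh : forall a, sB (h a) = h (sig a).
Hypothesis dBP : derivation dB.
(** Asked of the entries of A only: in the application to L the derivation of [B] need not vanish on
    the constants k, whereas [del] does. *)
Hypothesis dBh : forall l a b, dB (h (iter l del (A a b))) = h (iter l.+1 del (A a b)).
Hypothesis sdB : forall x, sB (dB x) = dB (sB x).
Variables (c : nat) (U : 'I_n.+1 -> 'I_c -> B).
Hypothesis sU : forall a j, sB (U a j) = \sum_b h (A a b) * U b j.
(** Divided derivatives, to match the normalization of [jetmx], and the constant 1 at the additional
    index. *)
Definition jet_coord N (i : jidx N n c) : B :=
  if i is Some (l, a, j) then h (l`!%:R^-1) * iter l dB (U a j) else 1.

Lemma jet_coord_sig N (i : jidx N n c) :
  sB (jet_coord i) = \sum_j h (tk 1 (jetmx del N A) i j) * jet_coord j.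
Proof.
have f0 l : (l`!)%:R != 0 :> K := K_fact iota char0 l.
have hit l a b : iter l dB (h (A a b)) = h (iter l del (A a b)).
  by elim: l => //= l ->; rewrite dBh.
have sit l x : sB (iter l dB x) = iter l dB (sB x).
  by elim: l => //= l IH; rewrite sdB IH.
rewrite (bigD1 None) //=; case: i => [[[l a] j]|] /=; last first.
  by rewrite !rmorph1 mulr1 big1 ?addr0 // => -[[[? ?] ?]|] //= _; rewrite rmorph0 mul0r.
rewrite rmorph0 mul0r add0r rmorphM sBh fmorphV rmorph_nat sit sU.
rewrite iter_der_sum // mulr_sumr.
pose cc m := h (m`!%:R^-1).
have cP m : cc m * (m`!)%:R = 1 by rewrite -(rmorph_nat h) -rmorphM mulVf // rmorph1.
have dl b : h (l`!%:R^-1) * iter l dB (h (A a b) * U b j) = \sum_(i < l.+1)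
    (h (i`!%:R^-1) * iter i dB (h (A a b))) * (h ((l - i)`!%:R^-1) * iter (l - i) dB (U b j)).
  exact: (divided_leibniz dBP cP).
rewrite (eq_bigr _ (fun b _ => dl b)).
have lN : (l < N.+1)%N := ltn_ord l.
transitivity (\sum_(b < n.+1) \sum_(l' : 'I_N.+1 | (l' <= l)%N)
    h ((jetmx del N A)`_(l - l') a b) * jet_coord (Some (l', b, j))).
  apply: eq_bigr => b _.
  rewrite (reindex_inj rev_ord_inj) /=.
  rewrite (big_ord_widen N.+1 (fun i => h ((l.+1 - i.+1)`!%:R^-1) * iter (l.+1 - i.+1) dB (h (A a b)) *
    (h ((l - (l.+1 - i.+1))`!%:R^-1) * iter (l - (l.+1 - i.+1)) dB (U b j))) lN).
  apply: eq_bigr => i; rewrite ltnS => il; rewrite subSS subKn // hit -rmorphM.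
  have ln : (l - i <= N)%N by rewrite (leq_trans (leq_subr _ _)) // -ltnS.
  by congr (h _ * _); rewrite jetmxE // [RHS]mxE; congr (_ * _); rewrite [RHS]mxE.
rewrite exchange_big /= (reindex_omap Some id) /=; last by case.
rewrite [RHS](eq_bigl xpredT); last by move=> x; rewrite eqxx.
transitivity (\sum_(x : 'I_N.+1 * 'I_n.+1) \sum_(j' : 'I_c)
    h (tk 1 (jetmx del N A) (Some (l, a, j)) (Some (x, j'))) * jet_coord (Some (x, j'))); last first.
  by rewrite pair_bigA; apply: eq_bigr => -[[? ?] ?].
rewrite [LHS]big_mkcond; transitivity (\sum_(l' : 'I_N.+1) \sum_(b : 'I_n.+1) if (l' <= l)%N then
    h ((jetmx del N A)`_(l - l') a b) * jet_coord (Some (l', b, j)) else 0).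
  by apply: eq_bigr => l' _; case: ifP => // _; rewrite big1.
rewrite pair_bigA; apply: eq_bigr => -[l' b] _.
rewrite (bigD1 j) //= eqxx /= big1 ?addr0 => [|j' jj].
  by case: ifP => // _; rewrite rmorph0 mul0r.
by rewrite eq_sym (negbTE jj) /= rmorph0 mul0r.
Qed.

Variable PP : B -> Prop.
Hypothesis PP0 : PP 0.
Hypothesis PPD : forall x y, PP x -> PP y -> PP (x + y).
Hypothesis PPZ : forall a x, PP x -> PP (h a * x).
Hypothesis PPs : forall x, PP x -> PP (sB x).
(** This is [polarization] for plain derivatives; the quotient of factorials comes from the passage
    to divided derivatives and back. *)
Lemma companion_polarization mu (v : 'I_mu -> nat * 'I_n.+1 * 'I_c) (p : mpoly mu K) L a b :
  let y x := iter (v x).1.1 dB (U (v x).1.2 (v x).2) in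
  PP (mmap h y p) -> PP (\sum_x mmap h y (mderiv x p) *
    (if ((v x).1.2 == a) && (L <= (v x).1.1)%N
     then h ((v x).1.1`!%:R / ((v x).1.1 - L)`!%:R) * iter ((v x).1.1 - L) dB (U b (v x).2) else 0)).
Proof.
move=> y Pp.
pose N := maxn L (\max_x (v x).1.1)%N.
have vN x : ((v x).1.1 <= N)%N by rewrite leq_max (leq_bigmax x) orbT.
have LN : (L <= N)%N by rewrite leq_maxl.
have f0 l : (l`!)%:R != 0 :> K := K_fact iota char0 l.
pose idx x : jidx N n c := Some (inord (v x).1.1, (v x).1.2, (v x).2).
pose kap x : K := ((v x).1.1)`!%:R.
have AA' := comp_mulV iota_inj q0 q_not_root1 lam0 sP P00 Q00.
have JJ' : jagree N (jetmx del N A * jetmx del N A') 1.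
  by apply: jagree_trans (jetmxM iota char0 delP A A') _; rewrite AA'; apply: jetmx1.
have yE x : h (kap x) * jet_coord (idx x) = y x.
  by rewrite /jet_coord /= inordK ?ltnS ?vN // mulrA -rmorphM mulfV ?f0 // rmorph1 mul1r.
have Pp' : PP (mmap h (fun x => h (kap x) * jet_coord (idx x)) p).
  by move: Pp; congr PP; apply: eq_bigr => m _; congr (_ * _); apply: eq_bigr => x _; rewrite yE.
have := polarization JJ' (@companion_full N c) sBh (erefl : @jet_coord N None = 1)
  (@jet_coord_sig N) PP0 PPD PPZ PPs a b LN Pp'.
congr PP; apply: eq_bigr => x _; congr (_ * _).
  by apply: eq_bigr => m _; congr (_ * _); apply: eq_bigr => x' _; rewrite yE.
rewrite /idx inordK ?ltnS ?vN //; case: ifP => [/andP[_ Lv]|]; last by rewrite mulr0.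
rewrite /jet_coord inordK; last by rewrite ltnS (leq_trans (leq_subr _ _)).
by rewrite mulrA -rmorphM.
Qed.

Hypothesis PPU : forall t : 'I_c -> B,
  (forall b, PP (\sum_j U b j * t j)) -> forall j, PP (t j).

Theorem companion_no_relation mu (v : 'I_mu -> nat * 'I_n.+1 * 'I_c) (p : mpoly mu K) :
  injective v -> p != 0 ->
  PP (mmap h (fun x => iter (v x).1.1 dB (U (v x).1.2 (v x).2)) p) -> PP 1.
Proof.
move=> v_inj p0 Pp.
pose N := (\max_x (v x).1.1)%N.
have vN x : ((v x).1.1 <= N)%N by apply: (leq_bigmax x).
have f0 l : (l`!)%:R != 0 :> K := K_fact iota char0 l.
pose idx x : jidx N n c := Some (inord (v x).1.1, (v x).1.2, (v x).2).
pose kap x : K := ((v x).1.1)`!%:R.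
have AA' := comp_mulV iota_inj q0 q_not_root1 lam0 sP P00 Q00.
have JJ' : jagree N (jetmx del N A * jetmx del N A') 1.
  by apply: jagree_trans (jetmxM iota char0 delP A A') _; rewrite AA'; apply: jetmx1.
apply: (no_relation JJ' (@companion_full N c) sBh (Y := @jet_coord N) _ (@jet_coord_sig N) PP0 PPD PPZ PPs
  (idx := idx) (kap := kap) _ _ _ _ _ p0) => //.
- by move=> l; rewrite -(rmorph_nat kC) fmorph_eq0.
- move=> x y [E1 E2 E3]; apply: v_inj; move: E1 E2 E3.
  case: (v x) (vN x) => [[l a] j] /= lN; case: (v y) (vN y) => [[l' a'] j'] /= lN'.
  by move=> /(congr1 (@nat_of_ord _)); rewrite !inordK // => -> -> ->.
- by move=> x; exact: f0.
- move=> t Ht j; apply: PPU => b; have := Ht b; congr PP; apply: eq_bigr => j' _.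
  by rewrite /jet_coord inordK // fact0 invr1 rmorph1 mul1r.
- move: Pp; congr PP; apply: eq_bigr => m _; congr (_ * _); apply: eq_bigr => x _; congr (_ ^+ _).
  by rewrite /jet_coord /= inordK ?ltnS ?vN // mulrA -rmorphM mulfV ?f0 // rmorph1 mul1r.
Qed.

End CompanionFull.

(** * The parameters *)

Section TorsionCharacters.
Variables (F : fieldType) (n : nat) (d : 'rV[F]_n).
Hypothesis d0 : forall i, d 0 i != 0.
Hypothesis conn : connected (generated_algebraic_group (diag_mx d)).

Lemma closed_GLn_zeros (I : set (mpoly (n * n) F)) : closed (GLn_zeros I).
Proof. by rewrite -openC; exists I. Qed.

Lemma generated_group_sub (C : set (GLn F n)) : closed C ->
  generated_group (diag_mx d) `<=` C -> generated_algebraic_group (diag_mx d) `<=` C.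
Proof.
by move=> Cc SC; rewrite (closure_id C).1 //; apply: closure_subset.
Qed.

Let var i j : mpoly (n * n) F := mpolyX F (mnm1 (mxvec_index i j)).
Let varE i j (M : 'M[F]_n) : meval (mxvec M 0) (var i j) = M i j.
Proof. by rewrite /var mevalXU mxvecE. Qed.

Lemma generated_group_diag M : generated_group (diag_mx d) M ->
  exists e : 'rV[F]_n, GLn_val M = diag_mx e /\
    exists j : nat, (forall i, e 0 i = d 0 i ^+ j) \/ (forall i, e 0 i = d 0 i ^- j).
Proof.
have pw (f : 'rV[F]_n) j : diag_mx f ^+ j = diag_mx (\row_i f 0 i ^+ j).
  elim: j => [|j IH].
    rewrite expr0 -[LHS]/(1%:M) -diag_const_mx; congr diag_mx; apply/rowP => i.
    by rewrite !mxE expr0.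
  rewrite exprS IH -[LHS]/(_ *m _) mulmx_diag; congr diag_mx; apply/rowP => i.
  by rewrite !mxE exprS.
have dV : invmx (diag_mx d) = diag_mx (\row_i (d 0 i)^-1).
  have H : diag_mx d *m diag_mx (\row_i (d 0 i)^-1) = 1%:M.
    rewrite mulmx_diag -diag_const_mx; congr diag_mx; apply/rowP => i.
    by rewrite !mxE mulfV.
  have [dU _] := mulmx1_unit H.
  by rewrite -[RHS]mul1mx -(mulVmx dU) -mulmxA H mulmx1.
move=> [j [->|->]].
  by rewrite pw; eexists; split; first reflexivity; exists j; left => i; rewrite mxE.
rewrite dV pw; eexists; split; first reflexivity.
by exists j; right => i; rewrite !mxE exprVn.
Qed.

(* The characters [x_k / x_i] of finite order are constant on a connected group. *)
Lemma connected_torsion i k N : N.+1%:R != 0 :> F -> d 0 k ^+ N.+1 = d 0 i ^+ N.+1 -> d 0 k = d 0 i.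
Proof.
move=> N0 dN; pose G := generated_algebraic_group (diag_mx d).
(* The product p1 p2 is x_k^(N+1) - x_i^(N+1), which vanishes on the group, and where p1 vanishes p2
   equals (N+1) x_i^N, which does not. So the zeros of p1 are open and closed in the group, and 1 is
   one of them. *)
pose p1 := var k k - var i i.
pose p2 := \sum_(t < N.+1) var k k ^+ (N - t) * var i i ^+ t.
pose off := [set p | exists a b, a != b /\ p = var a b].
have Goff M : G M -> forall a b, a != b -> GLn_val M a b = 0.
  move=> GM a b ab; rewrite -varE.
  have : GLn_zeros off M.
    have S : generated_algebraic_group (diag_mx d) `<=` GLn_zeros off.
      apply: generated_group_sub; first exact: closed_GLn_zeros.
      move=> M' /generated_group_diag[e [ME _]] p [a' [b' [ab' ->]]].
      by rewrite varE ME mxE (negbTE ab') mulr0n.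
    exact: S.
  by apply; exists a, b.
have Gprod M : G M -> meval (mxvec (GLn_val M) 0) (p1 * p2) = 0.
  move=> GM; have : GLn_zeros [set p1 * p2] M; last by apply.
  have S : generated_algebraic_group (diag_mx d) `<=` GLn_zeros [set p1 * p2]; last exact: S.
  apply: generated_group_sub; first exact: closed_GLn_zeros.
  move=> M' /generated_group_diag[e [ME [j je]]] p ->.
  rewrite /p1 /p2 -subrXX rmorphB !rmorphXn /= !varE ME !mxE !eqxx !mulr1n.
  have -> : e 0 k ^+ N.+1 = e 0 i ^+ N.+1; last by rewrite subrr.
  by case: je => H; rewrite !H ?exprVn -!exprM mulnC !exprM dN.
have Gdiag M : G M -> forall a, GLn_val M a a != 0.
  move=> GM a; apply/eqP => Ma.
  have : GLn_val M \in unitmx by case: M GM Ma.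
  rewrite unitmxE (expand_det_row _ a) big1 ?unitr0 // => b _.
  by have [<-|ab] := eqVneq a b; [rewrite Ma mul0r | rewrite Goff ?mul0r].
pose B := G `&` GLn_zeros [set p1].
have := conn (B := B); rewrite -/G.
have S1 : generated_group (diag_mx d) `<=` G by apply: subset_closure.
have H1 : B !=set0.
  have U1 : (1%:M : 'M[F]_n) \in unitmx by rewrite unitmx1.
  exists (GLnMx U1); split.
    by apply: S1; exists 0%N; left; rewrite expr0.
  by move=> p ->; rewrite /p1 rmorphB /= !varE !mxE !eqxx subrr.
have H2 : exists2 C, open C & B = G `&` C.
  exists (~` GLn_zeros [set p2]); first by rewrite openC; apply: closed_GLn_zeros.
  apply/seteqP; split=> M [GM H]; split=> //.
    move=> /(_ p2 erefl); have := H p1 erefl.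
    rewrite /p1 rmorphB /= !varE => /eqP; rewrite subr_eq0 => /eqP E.
    have -> : meval (mxvec (GLn_val M) 0) p2 = \sum_(t < N.+1) GLn_val M i i ^+ N.
      rewrite /p2 rmorph_sum; apply: eq_bigr => t _.
      have tN : (t <= N)%N by rewrite -ltnS.
      by rewrite rmorphM rmorphXn [X in _ * X]rmorphXn /= !varE E -exprD subnK.
    rewrite sumr_const card_ord -[_ *+ _]mulr_natr => /eqP; rewrite mulf_eq0 (negbTE N0) orbF.
    by rewrite expf_eq0 (negbTE (Gdiag M GM i)) andbF.
  move=> p ->; have := Gprod M GM; rewrite rmorphM /= => /eqP; rewrite mulf_eq0.
  case/orP => /eqP // p20; case: H => p' ->; exact: p20.
have H3 : exists2 C, closed C & B = G `&` C by exists (GLn_zeros [set p1]) => //; apply: closed_GLn_zeros.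
move=> /(_ H1 H2 H3) BG.
have dU : diag_mx d \in unitmx.
  rewrite unitmxE det_diag unitfE; apply/prodf_neq0 => a _; exact: d0.
have : B (GLnMx dU) by rewrite BG; apply: S1; exists 1%N; left; rewrite expr1.
case=> _ /(_ p1 erefl); rewrite /p1 rmorphB /= !varE !mxE !eqxx !mulr1n => /eqP.
by rewrite subr_eq0 => /eqP.
Qed.

End TorsionCharacters.

(** * The exponential and the real powers of q *)

Section ComplexExponential.
Variable R : realType.
Implicit Types (w l : R[i]) (x y : R).

Lemma cexpD w w' : cexp (w + w') = cexp w * cexp w'.
Proof.
case: w w' => a b [a' b']; rewrite /cexp /= expRD cosD sinD.
by apply/eqP; rewrite eq_complex /=; apply/andP; split; apply/eqP; ring.
Qed.

Lemma norm_cexp w : `|cexp w| = (expR (complex.Re w))%:C%C.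
Proof.
rewrite normc_def /= !exprMn -mulrDr cos2Dsin2 mulr1 sqrtr_sqr ger0_norm //.
exact: expR_ge0.
Qed.

Lemma cexp0 : cexp (0 : R[i]) = 1.
Proof. by rewrite /cexp /= expR0 cos0 sin0 mulr1 mulr0. Qed.

Lemma cexp_neq0 w : cexp w != 0.
Proof. by rewrite -normr_eq0 norm_cexp eq_complex /= eqxx andbT gt_eqF // expR_gt0. Qed.

Lemma qpowerD l x y : qpower l (x + y) = qpower l x * qpower l y.
Proof.
rewrite /qpower -cexpD -mulrDr; congr (cexp (_ * _)).
by apply/eqP; rewrite eq_complex /= addr0 !eqxx.
Qed.

Lemma qpower_nat l m : qpower l m%:R = cexp l ^+ m.
Proof.
elim: m => [|m IH].
  rewrite /qpower (_ : Complex _ _ = 0); first by rewrite mulr0 cexp0.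
  by apply/eqP; rewrite eq_complex /= !eqxx.
rewrite -natr1 qpowerD IH exprSr; congr (_ * _); rewrite /qpower.
rewrite (_ : Complex _ _ = 1) ?mulr1 //.
Qed.

Lemma qpower_neq0 l x : qpower l x != 0. Proof. exact: cexp_neq0. Qed.

(** For real x the modulus of q^x is exp (x Re (log q)), strictly monotone because Re (log q) <
    0. *)
Lemma qpower_inj l : `|cexp l| < 1 -> injective (qpower l).
Proof.
move=> l1; have l0 : complex.Re l < 0.
  by move: l1; rewrite norm_cexp -[1]/(1%:C%C) ltcR -expR0 ltr_expR.
move=> x y /(congr1 Num.norm); rewrite !norm_cexp => /eqP; rewrite eq_complex /= => /andP[/eqP + _].
move/expR_inj; case: l l0 {l1} => a b /= a0; rewrite !mulr0 !subr0.
by apply: mulfI; rewrite lt_eqF.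
Qed.

(** The cosine of the difference of the angles is 1, so sin (pi (x - y)) = 0. Removing the integer
    part leaves a point of [0, 1), where sin (pi t) vanishes only at t = 0. *)
Lemma cexp_2pi_eq x y : cexp (Complex 0 (2 * pi * x)) = cexp (Complex 0 (2 * pi * y)) ->
  x - y \is a Num.int.
Proof.
move=> /eqP; rewrite eq_complex /= expR0 !mul1r => /andP[/eqP Ec /eqP Es].
pose e := x - y.
have s0 : sin (pi * e) = 0.
  have : cos ((pi * e) *+ 2) = 1.
    have -> : (pi * e) *+ 2 = 2 * pi * x - 2 * pi * y :> R by rewrite /e; ring.
    by rewrite cosB Ec Es -!expr2 cos2Dsin2.
  rewrite cos_mulr2n cos2sin2 => H.
  have /eqP : sin (pi * e) ^+ 2 = 0 by move: H; rewrite mulr2n; lra.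
  by rewrite expf_eq0 => /andP[_ /eqP].
have shift (k : nat) (t : R) : (sin (pi * (t + k%:R)) == 0) = (sin (pi * t) == 0).
  elim: k => [|k IH]; first by rewrite addr0.
  by rewrite -natr1 addrA mulrDr mulr1 sinDpi oppr_eq0.
pose m := Num.floor e; pose t := e - m%:~R.
have t0 : 0 <= t by rewrite subr_ge0 Num.Theory.floor_le.
have t1 : t < 1 by rewrite ltrBlDl; have := Num.Theory.floorD1_gt e; rewrite intrD.
have st : sin (pi * t) == 0.
  rewrite /t; case: (m) => k /=.
    by rewrite -(shift k) subrK s0.
  by rewrite NegzE mulrNz opprK; rewrite -[_%:~R]/(k.+1%:R) shift s0.
have -> : x - y = m%:~R.
  apply/eqP; rewrite -subr_eq0 -/e -/t; apply: contraLR st => tn.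
  have tp : 0 < t by rewrite lt_def tn.
  rewrite gt_eqF // sin_gt0_pi // mulr_gt0 ?pi_gt0 //=.
  by rewrite -[X in _ < X]mulr1 ltr_pM2l ?pi_gt0.
exact: intr_int.
Qed.

End ComplexExponential.

Section Exponents.
Variables (R : realType) (logq q : R[i]) (n s : nat).
Variables (a : 'I_n -> R[i]) (b : 'I_s -> R[i]) (alpha : 'I_n -> R) (beta : 'I_s -> R).
Hypotheses (q_log : cexp logq = q) (q_lt1 : `|q| < 1).
Hypothesis a_alpha : forall i, a i = qpower logq (alpha i).
Hypothesis b_beta : forall j, b j = qpower logq (beta j).

Let qp_inj : injective (qpower logq).
Proof. by apply: qpower_inj; rewrite q_log. Qed.

Let qpn x m : qpower logq x * q ^+ m = qpower logq (x + m%:R).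
Proof. by rewrite qpowerD qpower_nat q_log. Qed.

Lemma not_root1 m : q ^+ m.+1 != 1.
Proof.
apply/eqP => /(congr1 Num.norm); rewrite normrX normr1 => /eqP.
by rewrite lt_eqF // exprn_ilt1.
Qed.

Lemma nonresonant : (forall i j, alpha i - beta j \isn't a Num.int) ->
  forall i j m1 m2, a i * q ^+ m1 <> b j * q ^+ m2.
Proof.
move=> H i j m1 m2; rewrite a_alpha b_beta !qpn => /qp_inj E.
case/negP: (H i j); have -> : alpha i - beta j = m2%:R - m1%:R by lra.
by rewrite rpredB // intr_nat.
Qed.

(** The equality means that (N + 1)(alpha_k - alpha_i) is an integer, so that the exponentials of
    alpha_k and alpha_i have the same power N + 1. By [connected_torsion] they are equal, which
    makes alpha_k - alpha_i itself an integer. *)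
Lemma connected_ratio :
  connected (generated_algebraic_group (diag_mx (\row_i cexp (Complex 0 (2 * pi * alpha i))))) ->
  forall i k N m1 m2, a k ^+ N.+1 * q ^+ m1 = a i ^+ N.+1 * q ^+ m2 ->
  exists m m', a k * q ^+ m = a i * q ^+ m'.
Proof.
move=> conn i k N m1 m2.
have apow l : a l ^+ N.+1 = qpower logq (alpha l *+ N.+1).
  rewrite a_alpha; elim: N => [|M IH]; first by rewrite expr1.
  by rewrite exprS IH -qpowerD -mulrS.
rewrite !apow !qpn => /qp_inj E.
have cN l : cexp (Complex 0 (2 * pi * alpha l)) ^+ N.+1 =
    cexp (Complex 0 (2 * pi * (alpha l *+ N.+1))).
  elim: N {apow E} => [|M IH]; first by rewrite expr1.
  rewrite exprS IH -cexpD; congr cexp.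
  by apply/eqP; rewrite eq_complex /= addr0 eqxx /=; apply/eqP; rewrite [in RHS]mulrS; ring.
have c2 (m : nat) : cexp (Complex 0 (2 * pi * m%:R)) = 1 :> R[i].
  elim: m => [|m IH]; first by rewrite mulr0; exact: cexp0.
  have -> : Complex 0 (2 * pi * m.+1%:R) = Complex 0 (2 * pi * m%:R) + Complex 0 (pi *+ 2) :> R[i].
    by apply/eqP; rewrite eq_complex /= addr0 eqxx /=; apply/eqP; rewrite -natr1; ring.
  by rewrite cexpD IH mul1r /cexp /= expR0 cos2pi sin2pi mul1r mulr0.
have /(cexp_2pi_eq (x := alpha k)) : cexp (Complex 0 (2 * pi * alpha k)) = cexp (Complex 0 (2 * pi * alpha i)).
  have := @connected_torsion _ _ (\row_i cexp (Complex 0 (2 * pi * alpha i))) _ conn i k N.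
  rewrite !mxE; apply; first by move=> l; rewrite mxE; apply: cexp_neq0.
    by rewrite pnatr_eq0.
  rewrite !cN -[LHS]mulr1 -(c2 m1) -[RHS]mulr1 -(c2 m2) -!cexpD; congr cexp.
  by apply/eqP; rewrite eq_complex /= addr0 eqxx /= -!mulrDr E.
rewrite !a_alpha => /intrP[[] m mE].
  exists 0%N, m; rewrite !qpn; congr qpower; rewrite addr0.
  by have : alpha k - alpha i = m%:R by []; lra.
exists m.+1, 0%N; rewrite !qpn; congr qpower; rewrite addr0.
have : alpha k - alpha i = - m.+1%:R by rewrite mE NegzE mulrNz.
lra.
Qed.
End Exponents.

(** * Products of linear factors and their roots *)

Section LinearFactors.
Variables (k : fieldType).

Definition lin_prod n (a : 'I_n -> k) : {poly k} := \prod_i (a i *: 'X - 1).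

Lemma lin_prodE n (a : 'I_n -> k) : (forall i, a i != 0) ->
  lin_prod a = (\prod_i a i) *: \prod_i ('X - ((a i)^-1)%:P).
Proof.
move=> a0; rewrite /lin_prod -scaler_prod; apply: eq_bigr => i _.
by rewrite scalerBr; congr (_ - _); rewrite -mul_polyC -polyCM mulfV.
Qed.

Lemma size_lin_prod n (a : 'I_n -> k) : (forall i, a i != 0) -> size (lin_prod a) = n.+1.
Proof.
move=> a0; rewrite lin_prodE // size_scale; last exact/prodf_neq0.
by rewrite size_prod_XsubC /index_enum -enumT size_enum_ord.
Qed.

Lemma root_lin_prod n (a : 'I_n -> k) x : (forall i, a i != 0) ->
  root (lin_prod a) x -> exists i, x = (a i)^-1.
Proof.
move=> a0; rewrite /lin_prod rootE horner_prod prodf_seq_eq0 => /hasP[i _] /=.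
rewrite !hornerE subr_eq0 => /eqP E; exists i.
by apply: (mulfI (a0 i)); rewrite E mulfV.
Qed.

Lemma lin_prod_coef0 n (a : 'I_n -> k) : (lin_prod a)`_0 != 0.
Proof.
rewrite -horner_coef0 /lin_prod horner_prod; apply/prodf_neq0 => i _.
by rewrite !hornerE ?mulr0 ?sub0r ?oppr_eq0 ?oner_neq0.
Qed.

Lemma map_lin_prod (k' : fieldType) (f : {rmorphism k -> k'}) n (a : 'I_n -> k) :
  map_poly f (lin_prod a) = \prod_i (f (a i) *: 'X - 1).
Proof.
rewrite rmorph_prod; apply: eq_bigr => i _.
by rewrite rmorphB rmorph1 -!mul_polyC rmorphM /= map_polyC map_polyX.
Qed.

Variables (q : k) (n s : nat) (a : 'I_n -> k) (b : 'I_s -> k).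
Hypotheses (q0 : q != 0) (a0 : forall i, a i != 0) (b0 : forall j, b j != 0).
Hypothesis ab : forall i j m1 m2, a i * q ^+ m1 <> b j * q ^+ m2.
Notation P := (lin_prod a).
Notation Q := (lin_prod (fun j => b j / q)).

Let bq0 j : b j / q != 0. Proof. by rewrite mulf_neq0 ?invr_eq0. Qed.

Lemma lin_prod_PQ x y m : root P x -> root Q y -> x <> q ^+ m * y.
Proof.
move=> /(root_lin_prod a0)[i ->] /(root_lin_prod bq0)[j ->] E; apply: (@ab i j m.+1 0).
rewrite expr0 mulr1; apply: (mulIf (invr_neq0 (b0 j))); rewrite mulfV //.
have -> : a i * q ^+ m.+1 / b j = a i * (q ^+ m * (b j / q)^-1).
  by rewrite exprS invf_div; field; rewrite b0.
by rewrite -E mulfV.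
Qed.

Lemma lin_prod_QP x y m : root P x -> root Q y -> y <> q ^+ m * x.
Proof.
move=> /(root_lin_prod a0)[i ->] /(root_lin_prod bq0)[j ->] E; apply: (@ab i j 1 m).
apply: (mulIf (invr_neq0 (b0 j))); rewrite expr1.
have -> : a i * q / b j = a i * (b j / q)^-1 by rewrite invf_div mulrA.
by rewrite E; field; rewrite ?a0 ?b0.
Qed.

Lemma lin_prod_ratio N : (forall i l m1 m2, a l ^+ N.+1 * q ^+ m1 = a i ^+ N.+1 * q ^+ m2 ->
    exists m m', a l * q ^+ m = a i * q ^+ m') ->
  forall x y i j, root P x -> root P y ->
  x ^+ N.+1 * q ^+ i = y ^+ N.+1 * q ^+ j -> exists i j, x * q ^+ i = y * q ^+ j.
Proof.
move=> H x y i j /(root_lin_prod a0)[l ->] /(root_lin_prod a0)[l' ->] E.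
have [m [m' mE]] : exists m m', a l' * q ^+ m = a l * q ^+ m'.
  apply: (H l l' i j); move: E; rewrite !exprVn => E.
  have := congr1 (fun t => t * (a l ^+ N.+1 * a l' ^+ N.+1)) E.
  have an r : a r ^+ N.+1 != 0 by rewrite expf_neq0.
  by rewrite mulrAC mulKf // mulrC [X in _ = X]mulrAC [a l ^+ _ * _]mulrC mulKf // mulrC.
exists m, m'; apply: (mulfI (a0 l)); rewrite mulrA mulfV // mul1r.
apply: (mulfI (a0 l')); rewrite mE; field.
by rewrite a0.
Qed.
End LinearFactors.

Lemma tofrac_inj (T : idomainType) : injective (@FracField.tofrac T).
Proof. by move=> x y /eqP; rewrite tofrac_eq => /eqP. Qed.

Lemma fracP (T : idomainType) (f : {fraction T}) :
  exists x y : T, y != 0 /\ f = FracField.tofrac x / FracField.tofrac y.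
Proof.
exists \n_(repr f), \d_(repr f); split; first exact: denom_ratioP.
have df : FracField.tofrac \d_(repr f) != 0 by rewrite tofrac_eq0 denom_ratioP.
apply: (mulIf df); rewrite divfK // -{1}[f]reprK; move: (repr f) => y.
rewrite /FracField.tofrac; unlock; rewrite -[LHS]FracField.pi_mul; apply/eqmodP => /=.
by rewrite FracField.equivfE /FracField.mulf !numden_Ratio ?mulr1 ?oner_neq0 // 1?mulrC ?denom_ratioP.
Qed.

Lemma meval_map_mpoly (K B : comNzRingType) mu (g : {rmorphism K -> B}) (v : 'I_mu -> B) p :
  meval v (map_mpoly g p) = mmap g v p.
Proof.
rewrite /map_mpoly {1}/mmap rmorph_sum; apply: eq_bigr => m _.
rewrite rmorphM /= mevalC /mmap1 rmorph_prod; congr (_ * _); apply: eq_bigr => i _.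
by rewrite rmorphXn /= mevalXU.
Qed.

Lemma mmap_eq_vals (K B : comNzRingType) mu (g : {rmorphism K -> B}) (v w : 'I_mu -> B) p :
  v =1 w -> mmap g v p = mmap g w p.
Proof. by move=> vw; apply: eq_bigr => m _; congr (_ * _); apply: mmap1_eq. Qed.

(** * Independence of the hypergeometric series *)

Section ScalarSolutions.
Variables (k K : fieldType) (iota : {rmorphism {poly k} -> K}).
Hypothesis iota_inj : injective iota.
Notation kC := (kC iota).
Variables (n : nat) (P Q : {poly k}) (lam : k).
Hypothesis lam0 : lam != 0.
Hypothesis sP : size P = n.+2.
Hypothesis sQ : (size Q <= n.+1)%N.

Let p0 : P`_n.+1 != 0.
Proof.
by rewrite -[n.+1]/(n.+2.-1) -sP -/(lead_coef P) lead_coef_eq0 -size_poly_eq0 sP.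
Qed.

Lemma companion_scalar_solution (B : comNzRingType) (h : {rmorphism K -> B}) (sB : B -> B) (F : nat -> B) :
  (forall j, sB (F j) = F j.+1) ->
  h (iota 'X * kC lam) * \sum_(j < n.+2) h (kC P`_j) * F j = \sum_(j < n.+1) h (kC Q`_j) * F j ->
  forall a : 'I_n.+1, sB (F a) = \sum_b h (comp_mx iota n P Q lam a b) * F b.
Proof.
move=> sF rel a; rewrite sF.
have [->|am] := eqVneq a ord_max; last first.
  have aN : (a.+1 < n.+1)%N.
    by rewrite ltnS ltn_neqAle -ltnS ltn_ord andbT; apply: contra am => /eqP E; apply/eqP/val_inj.
  rewrite (bigD1 (Ordinal aN)) //= comp_mxE (negbTE am) eqxx rmorph1 mul1r big1 ?addr0 // => b ba.
  rewrite comp_mxE (negbTE am) (_ : (b == a.+1 :> nat) = false) ?rmorph0 ?mul0r //.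
  by apply: contraNF ba => /eqP E; apply/eqP/val_inj.
have z0 : iota 'X != 0 by rewrite (iota_eq0 iota_inj) polyX_eq0.
have zl : iota 'X * kC lam != 0 by rewrite mulf_neq0 // fmorph_eq0.
move: rel; rewrite big_ord_recr /= => /(congr1 (fun x => h (iota 'X * kC lam)^-1 * x)).
rewrite mulrA -rmorphM mulVf // rmorph1 mul1r => rel.
have {rel} : h (kC P`_n.+1) * F n.+1 =
    h (iota 'X * kC lam)^-1 * (\sum_(j < n.+1) h (kC Q`_j) * F j) - \sum_(j < n.+1) h (kC P`_j) * F j.
  by rewrite -rel addrAC subrr add0r.
move=> /(congr1 (fun x => h (kC P`_n.+1)^-1 * x)).
rewrite mulrA -rmorphM mulVf ?fmorph_eq0 // rmorph1 mul1r => ->.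
rewrite !mulr_sumr -sumrB mulr_sumr; apply: eq_bigr => b _; rewrite comp_mxE eqxx.
rewrite !mulrA -!rmorphM -mulrBl -rmorphB mulrA -rmorphM; congr (h _ * _).
rewrite !rmorphM rmorphN !fmorphV rmorphM; field.
rewrite z0; have pk : kC P`_n.+1 != 0 by rewrite fmorph_eq0.
have lk : kC lam != 0 by rewrite fmorph_eq0.
by apply/and3P; split.
Qed.

End ScalarSolutions.

Lemma der_ratfun_eq (k K : fieldType) (iota : {rmorphism {poly k} -> K}) (B : fieldType)
  (h : {rmorphism K -> B}) (D1 D2 : K -> B) : injective iota ->
  (forall f : K, exists p d, d != 0 /\ f = iota p / iota d) ->
  (forall x y, D1 (x * y) = D1 x * h y + h x * D1 y) ->
  (forall x y, D2 (x * y) = D2 x * h y + h x * D2 y) ->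
  (forall p, D1 (iota p) = D2 (iota p)) -> D1 =1 D2.
Proof.
move=> iota_inj ratfunP M1 M2 E x; have [p [d [d0 xE]]] := ratfunP x.
have dK : iota d != 0 by rewrite (iota_eq0 iota_inj).
have xd : x * iota d = iota p by rewrite xE divfK.
have hd : h (iota d) != 0 by rewrite fmorph_eq0.
by have := M1 x (iota d); rewrite xd E -xd M2 E => /addIr /(mulIf hd).
Qed.

Lemma ratfun_derivation (k K : fieldType) (iota : {rmorphism {poly k} -> K}) :
  injective iota -> (forall l, l.+1%:R != 0 :> k) ->
  exists del : K -> K, derivation del /\ forall p, del (iota p) = iota ('X * p^`()).
Proof.
move=> iota_inj char0.
have [|||D DP] := @derivation_extend {poly k} K iota (fun p => iota ('X * p^`())) _ iota_inj.
- by move=> l; rewrite -(rmorph_nat (kC iota)) fmorph_eq0.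
- by move=> x y; rewrite poly.derivD mulrDr rmorphD.
- by move=> x y; rewrite derivM -!rmorphM -rmorphD; congr (iota _); ring.
by exists D.
Qed.

(** * The hypergeometric series among the Puiseux series *)

Section PuiseuxHypergeometric.
Variables (R : realType).
Notation C := R[i].
Notation "x %:F" := (@FracField.tofrac {poly C} x).

Lemma complex_char0 l : l.+1%:R != 0 :> C.
Proof. by rewrite pnatr_eq0. Qed.

Lemma complex_closed (p : {poly C}) : size p != 1%N -> exists x, root p x.
Proof. by move=> /closed_rootP. Qed.

Lemma powserE (u : nat -> C) (m : nat) : powser u m%:R = u m.
Proof. by rewrite /= Num.Theory.natr_nat Num.Theory.natrK. Qed.

Lemma powser_notnat (u : nat -> C) r : r \isn't a Num.nat -> powser u r = 0.
Proof. by move=> /negbTE rn; rewrite /= rn. Qed.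

Variables (logq q : C).
Hypotheses (q_log : cexp logq = q) (q0 : q != 0).

(** A compatible system of roots makes [psigma] an automorphism of the Puiseux series. Its choice is
    immaterial for power series, where only integral exponents occur. *)
Definition qroot (j : nat) : C := qpower logq (j%:R^-1).

Lemma qroot_system : root_system q qroot.
Proof.
have pw x m : qpower logq x ^+ m = qpower logq (x * m%:R).
  elim: m => [|m IH]; first by rewrite expr0 mulr0 -[0]/(0%:R) qpower_nat expr0.
  by rewrite exprSr IH -qpowerD -natr1 mulrDr mulr1.
split=> [j j0|j l k l0 k0 ->]; rewrite pw.
  by rewrite mulVf ?pnatr_eq0 -?lt0n // -[1]/(1%:R) qpower_nat expr1.
congr qpower; rewrite natrM; field.
by rewrite !pnatr_eq0 -!lt0n l0 k0.
Qed.

Let sB : {rmorphism puiseux C -> puiseux C} := HB.pack (psigma qroot)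
  (GRing.isZmodMorphism.Build _ _ _ (psigma_zmod qroot))
  (GRing.isMonoidMorphism.Build _ _ _ (psigma_monoid q0 qroot_system)).

Lemma psigma_powser u : psigma qroot (powser u) = powser (powser_sigma q u).
Proof.
apply/puiseux_eqP => r; rewrite psigmaE.
have [rn|rn] := boolP (r \is a Num.nat); last by rewrite !powser_notnat ?mulr0.
move: rn => /natrP[m ->]; rewrite !powserE /powser_sigma /rat_root.
have [-> ->] : numq m%:R = m /\ denq m%:R = 1 by rewrite -[m%:R]/(m%:Z%:~R) numq_int denq_int.
by rewrite /qroot invr1 -[1]/(1%:R) qpower_nat q_log expr1.
Qed.

Lemma pder_derivation : derivation (@pder C).
Proof. by split; [exact: raddfD | exact: pderM]. Qed.

Lemma pder_psigma f : psigma qroot (pder f) = pder (psigma qroot f).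
Proof. by apply/puiseux_eqP => r; rewrite !(psigmaE, pderE) mulrCA. Qed.

Lemma pder_ratfun (del : ratfun C -> ratfun C) : derivation del ->
  (forall p : {poly C}, del p%:F = ('X * p^`())%:F) ->
  forall a, pder (ratfun_puiseux a) = ratfun_puiseux (del a).
Proof.
move=> delP delF.
apply: (@der_ratfun_eq _ _ (@FracField.tofrac {poly C}) _ (@ratfun_puiseux C) _ _ (@tofrac_inj {poly C}) (@fracP {poly C})).
- by move=> x y; rewrite rmorphM pderM.
- by move=> x y; rewrite (derM delP) rmorphD !rmorphM.
move=> p; rewrite delF !ratfun_puiseux_poly; elim/poly_ind: p => [|p c IH].
  by rewrite derivC mulr0 !rmorph0 raddf0.
rewrite poly.derivD derivM derivX derivC addr0 mulr1 rmorphD rmorphM /= raddfD /= pderM IH.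
have zE : poly_puiseux 'X = pmono (1 : C) 1 by rewrite /poly_puiseux map_polyX hornerX.
have cE : poly_puiseux c%:P = pconst c by rewrite /poly_puiseux map_polyC hornerC.
rewrite cE pder_const zE pder_z addr0 mulrDr rmorphD !rmorphM /= zE.
by ring.
Qed.

Lemma psigma_ratfun (sig : {rmorphism ratfun C -> ratfun C}) :
  (forall p : {poly C}, sig p%:F = (p \Po (q *: 'X))%:F) ->
  forall a, psigma qroot (ratfun_puiseux a) = ratfun_puiseux (sig a).
Proof.
move=> sigP.
have zE : ratfun_puiseux 'X%:F = pmono (1 : C) 1.
  by rewrite ratfun_puiseux_poly /poly_puiseux map_polyX hornerX.
have cE c : ratfun_puiseux (kC (@FracField.tofrac {poly C}) c) = pconst c.
  by rewrite ratfun_puiseux_poly /poly_puiseux map_polyC hornerC.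
apply: (@ratfun_morph_eq _ _ (@FracField.tofrac {poly C}) (@fracP {poly C}) _
  (GRing.RMorphism.clone _ _ (sB \o @ratfun_puiseux C) _)
  (GRing.RMorphism.clone _ _ (@ratfun_puiseux C \o sig) _)) => [c|] /=.
  by rewrite (sigC sigP) cE psigma_const.
rewrite zE (sigX sigP) (psigma_z qroot_system) -cE -zE.
exact/esym/(rmorphM (@ratfun_puiseux C)).
Qed.

Lemma powser_operator (u : nat -> C) (P : {poly C}) m : (size P <= m)%N ->
  \sum_(j < m) pconst P`_j * powser (iter j (powser_sigma q) u) =
  powser (fun l => P.[q ^+ l] * u l).
Proof.
move=> sP; have itE j l : iter j (powser_sigma q) u l = (q ^+ l) ^+ j * u l.
  by elim: j => [|j IH] /=; rewrite ?mul1r // /powser_sigma IH exprS mulrA.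
apply/puiseux_eqP => r; rewrite pcoef_sum.
have cM c (f : puiseux C) : (pconst c * f) r = c * f r by rewrite pcoef_monoM subr0.
have [/natrP[l ->{r cM}]|rn] := boolP (r \is a Num.nat); last first.
  by rewrite powser_notnat // big1 // => j _; rewrite cM powser_notnat // mulr0.
rewrite powserE (horner_coef_wide _ sP) mulr_suml; apply: eq_bigr => j _.
by rewrite pcoef_monoM subr0 powserE itE mulrA.
Qed.

Variables (n s : nat) (a : 'I_n.+1 -> C) (b : 'I_s -> C) (lam : C).
Hypothesis s_le_n : (s <= n)%N.
Hypothesis lam0 : lam != 0.
Hypotheses (a0 : forall i, a i != 0) (b0 : forall j, b j != 0).
Hypothesis b_qN : forall j (m : nat), b j != q ^- m.
Hypothesis b_q : exists j, b j = q.

Let u := hypergeometric q a b lam.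
Notation P := (lin_prod a).
Notation Q := (lin_prod (fun j => b j / q)).
(** The operator has the factors a sigma_q - 1 while the series has the factors 1 - a q^m. The sign
    absorbs the difference; apart from the equation itself, only the nonvanishing of [lam'] matters
    afterwards. *)
Let lam' := (-1) ^+ n.+1 * (-1) ^+ s * lam.

Lemma hypergeometric_rec m : u m.+1 * \prod_j (1 - b j * q ^+ m) =
  lam * \prod_i (1 - a i * q ^+ m) * u m.
Proof.
have b1 j l : 1 - b j * q ^+ l != 0.
  rewrite subr_eq0; apply: contra (b_qN j l) => /eqP E; apply/eqP.
  by apply: (mulIf (expf_neq0 l q0)); rewrite -E mulVf ?expf_neq0.
rewrite /u /hypergeometric.
have prS k' (c : 'I_k' -> C) : \prod_i qpoch q (c i) m.+1 =
    \prod_i qpoch q (c i) m * \prod_i (1 - c i * q ^+ m).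
  by rewrite -big_split; apply: eq_bigr => i _; rewrite /qpoch big_ord_recr.
rewrite !prS exprS.
have B0 : \prod_j qpoch q (b j) m != 0 by apply/prodf_neq0 => j _; apply/prodf_neq0.
have B1 : \prod_j (1 - b j * q ^+ m) != 0 by apply/prodf_neq0.
by field; rewrite B0 B1.
Qed.

Lemma hypergeometric_equation :
  pmono 1 1 * pconst lam' * (\sum_(j < n.+2) pconst P`_j * powser (iter j (powser_sigma q) u)) =
  \sum_(j < n.+1) pconst Q`_j * powser (iter j (powser_sigma q) u).
Proof.
rewrite !powser_operator ?size_lin_prod //; last by move=> j; rewrite mulf_neq0 ?invr_eq0.
apply/puiseux_eqP => r; rewrite -mulrA pcoef_monoM pcoef_monoM subr0 mul1r.
have shift : (r - 1 \is a Num.nat) -> r \is a Num.nat.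
  by move=> /natrP[l /eqP]; rewrite subr_eq => /eqP ->; rewrite rpredD ?natr_nat ?rpred1.
have [rn|rn] := boolP (r \is a Num.nat); last first.
  by rewrite !powser_notnat ?mulr0 //; apply: contra rn.
case/natrP: rn => -[|m] ->{r shift}; rewrite powserE.
  rewrite powser_notnat ?mulr0 ?expr0; last by rewrite sub0r natrEint oppr_ge0 ler10 andbF.
  (* In degree 0 the right side is Q(1) u_0, and Q(1) contains the factor b_j / q - 1 with b_j = q.
     This is where the assumption on b enters. *)
  have -> : Q.[1] = 0; last by rewrite mul0r.
  have [j bj] := b_q; rewrite /lin_prod horner_prod (bigD1 j) //= !hornerE bj mulfV //.
  by rewrite ?mulr1 subrr !mul0r.
rewrite -natr1 addrK powserE.
have sgn k' (c : 'I_k' -> C) : \prod_i (c i - 1) = (-1) ^+ k' * \prod_i (1 - c i).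
  by rewrite (eq_bigr (fun i => - (1 - c i))) ?prodrN ?card_ord // => i _; rewrite opprB.
have PE : P.[q ^+ m] = (-1) ^+ n.+1 * \prod_i (1 - a i * q ^+ m).
  by rewrite -sgn /lin_prod horner_prod; apply: eq_bigr => i _; rewrite !hornerE.
have QE : Q.[q ^+ m.+1] = (-1) ^+ s * \prod_j (1 - b j * q ^+ m).
  rewrite -sgn /lin_prod horner_prod; apply: eq_bigr => j _.
  by rewrite !hornerE exprS mulrA divfK.
rewrite PE QE -[RHS]mulrA [X in _ = _ * X]mulrC hypergeometric_rec /lam'.
have s2 : (-1) ^+ n.+1 * (-1) ^+ n.+1 = 1 :> C by rewrite -exprMn mulrNN mulr1 expr1n.
transitivity (((-1) ^+ n.+1 * (-1) ^+ n.+1) * ((-1) ^+ s * (lam * \prod_i (1 - a i * q ^+ m) * u m))).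
  by ring.
by rewrite s2 mul1r.
Qed.

Hypothesis q_not_root1 : forall m, q ^+ m.+1 != 1.
Hypothesis ab : forall i j m1 m2, a i * q ^+ m1 <> b j * q ^+ m2.
Hypothesis a_ratio : forall i l m1 m2, a l ^+ n.+1 * q ^+ m1 = a i ^+ n.+1 * q ^+ m2 ->
  exists m m', a l * q ^+ m = a i * q ^+ m'.

(** The series gives a solution with a single column. Puiseux series form a field, so the
    cancellation asked of [PP] only needs a nonzero entry: the series itself, with constant term
    1. *)
Theorem hypergeometric_independent :
  diff_alg_independent (@ratfun_puiseux C) (@pder C)
    (fun k : 'I_n.+1 => powser (iter k (powser_sigma q) u)).
Proof.
move=> N p; apply: contra_eq => p0.
have [del [delP delF]] := ratfun_derivation (@tofrac_inj {poly C}) complex_char0.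
have [sig sigP] := ratfun_scaling (@tofrac_inj {poly C}) (@fracP {poly C}) q0.
have bq0 j : b j / q != 0 by rewrite mulf_neq0 ?invr_eq0.
have lam'0 : lam' != 0 by rewrite !mulf_neq0 // signr_eq0.
have sP : size P = n.+2 by rewrite size_lin_prod.
have sQ : (size Q <= n.+1)%N by rewrite size_lin_prod.
have /choice[v vP] (e : 'I_(n.+1 * N)) : exists v : 'I_n.+1 * 'I_N, e = mxvec_index v.1 v.2.
  by case/mxvec_indexP: e => i j; exists (i, j).
pose U (i : 'I_n.+1) (j : 'I_1) : puiseux C := powser (iter i (powser_sigma q) u).
have cE c : ratfun_puiseux (kC (@FracField.tofrac {poly C}) c) = pconst c.
  by rewrite ratfun_puiseux_poly /poly_puiseux map_polyC hornerC.
have zE : ratfun_puiseux 'X%:F = pmono (1 : C) 1.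
  by rewrite ratfun_puiseux_poly /poly_puiseux map_polyX hornerX.
have sU (i : 'I_n.+1) (j : 'I_1) : sB (U i j) = \sum_l ratfun_puiseux (comp_mx (@FracField.tofrac {poly C}) n P Q lam' i l) * U l j.
  have sF l : sB (powser (iter l (powser_sigma q) u)) = powser (iter l.+1 (powser_sigma q) u).
    exact: psigma_powser.
  have rel : ratfun_puiseux ('X%:F * kC (@FracField.tofrac {poly C}) lam') *
      (\sum_(l < n.+2) ratfun_puiseux (kC (@FracField.tofrac {poly C}) P`_l) * powser (iter l (powser_sigma q) u)) =
      \sum_(l < n.+1) ratfun_puiseux (kC (@FracField.tofrac {poly C}) Q`_l) * powser (iter l (powser_sigma q) u).
    have -> : ratfun_puiseux ('X%:F * kC (@FracField.tofrac {poly C}) lam') = pmono 1 1 * pconst lam'.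
      by rewrite -zE -cE; exact: (rmorphM (@ratfun_puiseux C)).
    under eq_bigr => l _ do rewrite cE.
    under [RHS]eq_bigr => l _ do rewrite cE.
    exact: hypergeometric_equation.
  have H := @companion_scalar_solution _ _ _ (@tofrac_inj {poly C}) _ _ _ _ lam'0 sP _ (@ratfun_puiseux C) sB
    (fun l => powser (iter l (powser_sigma q) u)) sF rel i.
  exact: H.
apply/negP => /eqP pE.
have u00 : powser u 0 = 1.
  rewrite -[0]/(0%:R) powserE /u /hypergeometric expr0 mulr1 !big1 ?divr1 // => i _;
  by rewrite /qpoch big_ord0.
have : (1 : puiseux C) = 0; last by apply/eqP/oner_neq0.
pose zero (x : puiseux C) := x = 0; change (zero 1).
apply: (companion_no_relation (B := puiseux C) (sB := sB) (dB := @pder C) (h := @ratfun_puiseux C) (@tofrac_inj {poly C}) (@fracP {poly C}) complex_closed complex_char0 q0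
  q_not_root1 sigP delP delF lam'0 sP sQ (lin_prod_coef0 _) (lin_prod_coef0 _)
  (lin_prod_PQ q0 a0 b0 ab) (lin_prod_QP q0 a0 b0 ab) (lin_prod_ratio a0 a_ratio)
  (psigma_ratfun sigP) pder_derivation (fun l a b => pder_ratfun delP delF _) pder_psigma sU
  (PP := zero) _ _ _ _ _ (v := fun e => (nat_of_ord (v e).2, (v e).1, ord0)) _ p0) => //.
- by rewrite /zero => x y -> ->; rewrite addr0.
- by rewrite /zero => x y ->; rewrite mulr0.
- by rewrite /zero => x ->; rewrite rmorph0.
- rewrite /zero => t H j; have := H ord0; rewrite big_ord1 (ord1 j) => /eqP; rewrite mulf_eq0 => /orP[/eqP U0|/eqP //].
  by move: u00; rewrite -[powser u]/(U ord0 ord0) U0 pcoef0 => /esym/eqP; rewrite oner_eq0.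
- move=> e e' [E1 E2]; rewrite (vP e) (vP e') E2; congr mxvec_index.
  exact/val_inj.
rewrite /zero -pE meval_map_mpoly; apply: mmap_eq_vals => e.
rewrite [in RHS](vP e) /dvals mxvecE mxE.
by [].
Qed.

End PuiseuxHypergeometric.

(** Adjoin a root of an irreducible factor and extend the derivation to the larger field; the
    equation, seen as a differential system of order 0, then has a solution in k. *)
Lemma differentially_closed_alg (k : fieldType) (d : k -> k) :
  (forall l, l.+1%:R != 0 :> k) -> differentially_closed d ->
  forall p : {poly k}, size p != 1%N -> exists x, root p x.
Proof.
move=> char0 [dP dcl] p p1; have [->|p0] := eqVneq p 0.
  by exists 0; rewrite root0.
pose S m := `[< exists r : {poly k}, [/\ r %| p, (1 < size r)%N & size r = m] >].
have exS : exists m, S m.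
  exists (size p); apply/asboolP; exists p; split=> //.
  by rewrite ltn_neqAle eq_sym p1 size_poly_gt0.
case: (ex_minnP exS) => m /asboolP[r [rp r1 rm]] mmin.
have r_irr : irreducible_poly r.
  split=> // g g1 gr.
  have g0 : g != 0.
    by apply: contraTneq gr => ->; rewrite dvd0p -size_poly_gt0 (ltn_trans _ r1).
  rewrite -(dvdp_size_eqp gr) eqn_leq dvdp_leq -?size_poly_gt0 ?(ltn_trans _ r1) //= rm.
  apply: mmin; apply/asboolP; exists g; split=> //; first exact: dvdp_trans rp.
  by rewrite ltn_neqAle eq_sym g1 size_poly_gt0.
have [E _ [z rz _]] := irredp_FAdjoin r_irr.
pose h : {rmorphism k -> E} := in_alg E.
have [|||D [DP Dh]] := @derivation_extend k E h (fun x => h (d x)) _ (fmorph_inj h).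
- by move=> l; rewrite -(rmorph_nat h) fmorph_eq0.
- by move=> x y; rewrite (derivD dP) rmorphD.
- by move=> x y; rewrite (derM dP) rmorphD !rmorphM.
(* A system is a family indexed by the bound N on the order. The unknown itself is the variable with
   l = 0, and for N = 0 there is no equation. *)
pose Sys N : set (mpoly (1 * N) k) :=
  [set P | exists i (l : 'I_N), l = 0 :> nat /\
     P = (map_poly (@mpolyC (1 * N) k) r).[mpolyX k (mnm1 (mxvec_index i l))]].
have ev (B : comNzRingType) (f : {rmorphism k -> B}) N (v : 'I_(1 * N) -> B) e :
    meval v (map_mpoly f (map_poly (@mpolyC (1 * N) k) r).[mpolyX k (mnm1 e)]) =
    (map_poly f r).[v e].
  rewrite -!horner_map /= map_mpolyX mevalXU -!map_poly_comp; congr (_.[_]).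
  by apply: eq_map_poly => x /=; rewrite map_mpolyC mevalC.
have vals (B : comNzRingType) (dB : B -> B) N (y : 'I_1 -> B) i (l : 'I_N) :
    l = 0 :> nat -> dvals dB y (mxvec_index i l) = y 0.
  by move=> l0; rewrite /dvals mxvecE mxE l0 /= (ord1 i).
have [|y ySys] := dcl 1%N Sys.
  exists E, D, h, (fun=> z); split=> // N _ [_ [i [l [l0 ->]]] <-].
  by rewrite ev vals //; exact/rootP.
exists (y 0); rewrite -dvdp_XsubCl; apply: (dvdp_trans _ rp); rewrite dvdp_XsubCl; apply/rootP.
have := ySys 1%N _ (ex_intro _ 0 (ex_intro _ 0 (conj erefl erefl))).
rewrite -horner_map /= mevalXU vals // -map_poly_comp => r0.
rewrite -[RHS]r0; congr (_.[_]); apply/polyP => m'.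
by rewrite coef_map /= mevalC.
Qed.

(** * The base field *)

Section SubringGeneration.
Variables (T : comNzRingType) (G : set T).
Hypotheses (G1 : G 1) (GB : forall x y, G x -> G y -> G (x - y))
  (GM : forall x y, G x -> G y -> G (x * y)).

Definition subring_pred : {pred T} := fun x => `[< G x >].

Lemma subring_pred_closed : subring_closed subring_pred.
Proof.
split; first exact/asboolP.
- by move=> x y /asboolP Gx /asboolP Gy; apply/asboolP; apply: GB.
by move=> x y /asboolP Gx /asboolP Gy; apply/asboolP; apply: GM.
Qed.

HB.instance Definition _ := GRing.isSubringClosed.Build T subring_pred subring_pred_closed.

Record subring_type := SubringType { subring_val :> T; _ : subring_val \in subring_pred }.
HB.instance Definition _ := [isSub for subring_val].
HB.instance Definition _ := [Choice of subring_type by <:].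
HB.instance Definition _ := [SubChoice_isSubComNzRing of subring_type by <:].

(** The universal property gives a morphism from T to the subring; followed by the inclusion it is
    an endomorphism of T compatible with both factors, hence the identity. *)
Lemma tensor_product_generated (C A B : comNzRingType) (a : {rmorphism C -> A})
    (b : {rmorphism C -> B}) (i : {rmorphism A -> T}) (j : {rmorphism B -> T}) :
  is_tensor_product a b i j -> (forall x, G (i x)) -> (forall y, G (j y)) -> forall x, G x.
Proof.
move=> [ab univ] Gi Gj.
pose f x := SubringType (introT (asboolP _) (Gi x)).
pose g y := SubringType (introT (asboolP _) (Gj y)).
have fz : zmod_morphism f by move=> x y; apply: val_inj; rewrite /= rmorphB.
have fm : monoid_morphism f.
  by split=> [|x y]; apply: val_inj; rewrite /= ?rmorph1 ?rmorphM.
have gz : zmod_morphism g by move=> x y; apply: val_inj; rewrite /= rmorphB.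
have gm : monoid_morphism g.
  by split=> [|x y]; apply: val_inj; rewrite /= ?rmorph1 ?rmorphM.
pose F : {rmorphism A -> subring_type} := HB.pack f
  (GRing.isZmodMorphism.Build _ _ _ fz) (GRing.isMonoidMorphism.Build _ _ _ fm).
pose H : {rmorphism B -> subring_type} := HB.pack g
  (GRing.isZmodMorphism.Build _ _ _ gz) (GRing.isMonoidMorphism.Build _ _ _ gm).
have [|h [hi hj _]] := univ subring_type F H.
  by move=> c; apply: val_inj; rewrite /= ab.
have [h0 [_ _ uniq_h]] := univ T i j ab.
pose h' : {rmorphism T -> T} := GRing.RMorphism.clone _ _ (val \o h) _.
have E1 := uniq_h h' (fun x => congr1 val (hi x)) (fun y => congr1 val (hj y)).
have E2 := uniq_h idfun (fun x => erefl) (fun y => erefl).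
by move=> x; have := valP (h x); rewrite -[val (h x)]/(h' x) E1 -E2 => /asboolP.
Qed.

End SubringGeneration.

(** * Change of coefficients in Puiseux series *)

Section PuiseuxMap.
Variables (F E : fieldType) (c : {rmorphism F -> E}).

Lemma puiseux_map_subproof (f : puiseux F) : (fun r => c (f r)) \in @puiseux_pred E.
Proof.
have [m [N [m0 fP]]] := puiseuxP f; apply/puiseux_predP; exists m, N; split=> // r.
by rewrite fmorph_eq0; apply: fP.
Qed.

Definition puiseux_map f : puiseux E := Puiseux (puiseux_map_subproof f).

Lemma puiseux_map_zmod : zmod_morphism puiseux_map.
Proof. by move=> f g; apply/puiseux_eqP => r; rewrite /= rmorphB. Qed.

Lemma puiseux_map_mono x r : puiseux_map (pmono x r) = pmono (c x) r.
Proof. by apply/puiseux_eqP => t; rewrite /= /pmono_fun; case: eqP; rewrite ?rmorph0. Qed.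

Lemma puiseux_map_monoid : monoid_morphism puiseux_map.
Proof.
split; first by rewrite -[1]/(pmono 1 0) puiseux_map_mono rmorph1.
move=> f g; apply/puiseux_eqP => r; rewrite pcoefM /=.
have [W [uW HW]] := pconv_window f g r.
rewrite (pconv_seq uW HW) (@pconv_seq _ _ _ _ W) // => [|s].
  by rewrite rmorph_sum; apply: eq_bigr => s _; rewrite rmorphM.
by rewrite !fmorph_eq0; exact: HW.
Qed.

HB.instance Definition _ := GRing.isZmodMorphism.Build (puiseux F) (puiseux E) puiseux_map puiseux_map_zmod.
HB.instance Definition _ := GRing.isMonoidMorphism.Build (puiseux F) (puiseux E) puiseux_map puiseux_map_monoid.
End PuiseuxMap.

Section TensorField.
Variables (F : fieldType) (Ct : fieldType) (c : {rmorphism F -> Ct}).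
Variables (T : idomainType) (i : {rmorphism Ct -> T}) (j : {rmorphism palg F -> T}).
Hypothesis T_tensor : is_tensor_product c (@palg_const F) i j.
Notation "x %:F" := (@FracField.tofrac T x).
Notation K := (ratfun Ct).
Notation L := {fraction T}.
Notation iotaF := (@FracField.tofrac {poly F}).
Notation iota := (@FracField.tofrac {poly Ct}).

Let iF_inj : injective iotaF. Proof. exact: tofrac_inj. Qed.
Let iK_inj : injective iota. Proof. exact: tofrac_inj. Qed.
Let F_frac (f : ratfun F) : exists p d : {poly F}, d != 0 /\ f = iotaF p / iotaF d.
Proof. exact: fracP. Qed.
Let K_frac (f : K) : exists p d : {poly Ct}, d != 0 /\ f = iota p / iota d.
Proof. exact: fracP. Qed.

Lemma ratfun_map : exists cK : {rmorphism ratfun F -> K},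
  forall p, cK (iotaF p) = iota (map_poly c p).
Proof.
pose h : {rmorphism {poly F} -> K} := GRing.RMorphism.clone _ _ (iota \o map_poly c) _.
have hi : injective h by move=> x y /iK_inj /(map_poly_inj c).
by have [g gP] := ratfun_lift iF_inj F_frac hi; exists g => p; rewrite gP.
Qed.

Lemma palg_const_val x : val (@palg_const F x) = pconst x.
Proof.
rewrite /palg_const /ratfun_palg /= /ratC ratfun_puiseux_poly.
by rewrite /poly_puiseux map_polyC hornerC.
Qed.

(** The universal property maps T to the Puiseux series over [Ct], where z is visibly transcendental
    over [Ct]. *)
Lemma tensor_poly_injective (p : {poly Ct}) :
  (map_poly i p).[j (ratfun_palg (ratX F))] = 0 -> p = 0.
Proof.
have [_ univ] := T_tensor.
have [|h [hi hj _]] := univ (puiseux Ct) (@pconst Ct)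
    (GRing.RMorphism.clone _ _ (puiseux_map c \o val) _).
  move=> x; change (pconst (c x) = puiseux_map c (val (@palg_const F x))).
  by rewrite palg_const_val puiseux_map_mono.
move=> /(congr1 h); rewrite rmorph0 -horner_map /= hj /= -map_poly_comp.
rewrite ratfun_puiseux_poly /poly_puiseux map_polyX hornerX puiseux_map_mono rmorph1.
rewrite (eq_map_poly hi) => /eqP; rewrite -[_.[_]]/(poly_puiseux p) poly_puiseux_eq0.
by move=> /eqP.
Qed.

Lemma tensor_ratfun : exists h : {rmorphism K -> L},
  forall p, h (iota p) = ((map_poly i p).[j (ratfun_palg (ratX F))])%:F.
Proof.
pose h : {rmorphism {poly Ct} -> L} := GRing.RMorphism.clone _ _
  (@FracField.tofrac T \o (horner_eval (j (ratfun_palg (ratX F))) \o map_poly i)) _.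
have hi : injective h.
  by apply: raddf_inj => p /(@tofrac_inj T) /tensor_poly_injective.
by have [g gP] := ratfun_lift iK_inj K_frac hi; exists g => p; rewrite gP.
Qed.

Section Embeddings.
Variables (cK : {rmorphism ratfun F -> K}) (h : {rmorphism K -> L}).
Hypothesis cKP : forall p, cK (iotaF p) = iota (map_poly c p).
Hypothesis hP : forall p, h (iota p) = ((map_poly i p).[j (ratfun_palg (ratX F))])%:F.

Lemma tensor_ratfunC x : h (kC iota x) = (i x)%:F.
Proof. by rewrite /kC hP map_polyC hornerC. Qed.

Lemma tensor_ratfunX : h (iota 'X) = (j (ratfun_palg (ratX F)))%:F.
Proof. by rewrite hP map_polyX hornerX. Qed.

Lemma tensor_ratfun_map x : h (cK x) = (j (ratfun_palg x))%:F.
Proof.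
apply: (ratfun_morph_eq F_frac (f := GRing.RMorphism.clone _ _ (h \o cK) _)
  (g := GRing.RMorphism.clone _ _ ((@FracField.tofrac T \o j) \o @ratfun_palg F) _)) => [x'|] /=.
  by rewrite cKP map_polyC tensor_ratfunC T_tensor.1.
by rewrite cKP map_polyX tensor_ratfunX.
Qed.

(** T is generated by [Ct], which comes from [K], and by algebraic functions, integral over C(z),
    which maps to [K]. *)
Lemma tensor_integral (l : L) : integralOver h l.
Proof.
have [x [y [_ ->]]] := fracP l; suff H t : integralOver h t%:F by apply: integral_div.
apply: (tensor_product_generated (G := fun t => integralOver h t%:F) _ _ _ T_tensor).
- by rewrite rmorph1; exact: integral1.
- by move=> u v Hu Hv; rewrite (rmorphB (@FracField.tofrac T)); exact: (integral_sub Hu Hv).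
- by move=> u v Hu Hv; rewrite (rmorphM (@FracField.tofrac T)); exact: (integral_mul Hu Hv).
- by move=> u; rewrite -tensor_ratfunC; exact: integral_id.
move=> u; have /integral_algebraic[p pm pu] := palgP u.
exists (map_poly cK p); first by rewrite monic_map.
have -> : map_poly h (map_poly cK p) = map_poly (@FracField.tofrac T \o j) (map_poly (@ratfun_palg F) p).
  by rewrite -!map_poly_comp; apply: eq_map_poly => a /=; rewrite tensor_ratfun_map.
rewrite /root (horner_map (GRing.RMorphism.clone _ _ (@FracField.tofrac T \o j) _)) /=.
suff -> : (map_poly (@ratfun_palg F) p).[u] = 0 by rewrite !rmorph0.
apply: val_inj; rewrite -[val _]/((\val : {rmorphism palg F -> puiseux F}) _) -horner_map -map_poly_comp.
exact/rootP.
Qed.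

End Embeddings.
End TensorField.

(** * Differential relations of a solution *)

(* Differential polynomials in the entries of an n * n matrix; [DVar l a j] is the
   derivative of order [l] of the entry [(a, j)]. *)
Inductive dterm (F : Type) (n : nat) : Type :=
  | DCst of F
  | DVar of nat & 'I_n & 'I_n
  | DAdd of dterm F n & dterm F n
  | DMul of dterm F n & dterm F n.
Arguments DCst {F n}. Arguments DVar {F n}. Arguments DAdd {F n}. Arguments DMul {F n}.

Section DifferentialTerms.
Variables (F : comNzRingType) (n : nat).
Notation dterm := (dterm F n).
Implicit Types t : dterm.

Fixpoint dt (dF : F -> F) t : dterm := match t with
  | DCst x => DCst (dF x)
  | DVar l a j => DVar l.+1 a j
  | DAdd t u => DAdd (dt dF t) (dt dF u)
  | DMul t u => DAdd (DMul (dt dF t) u) (DMul t (dt dF u)) end.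

Definition dsum (f : 'I_n -> dterm) : dterm := foldr (fun b t => DAdd (f b) t) (DCst 0) (enum 'I_n).

(** The effect of sigma on the values at any solution of sigma(W) = A W. Working with terms rather
    than values allows the same expression to be evaluated at several solutions. *)
Fixpoint dsigma (dF sF : F -> F) (A : 'M[F]_n) t : dterm := match t with
  | DCst x => DCst (sF x)
  | DVar l a j => iter l (dt dF) (dsum (fun b => DMul (DCst (A a b)) (DVar 0 b j)))
  | DAdd t u => DAdd (dsigma dF sF A t) (dsigma dF sF A u)
  | DMul t u => DMul (dsigma dF sF A t) (dsigma dF sF A u) end.

Fixpoint dlevel t : nat := match t with
  | DCst _ => 0
  | DVar l _ _ => l.+1
  | DAdd t u | DMul t u => maxn (dlevel t) (dlevel u) end.

Definition dindex (N : nat) (e : 'I_#|{: 'I_N * 'I_n * 'I_n}|) : nat * 'I_n * 'I_n :=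
  (nat_of_ord (enum_val e).1.1, (enum_val e).1.2, (enum_val e).2).

Lemma dindex_inj N : injective (@dindex N).
Proof.
move=> e e' [El Ea Ej]; apply: enum_val_inj; apply: injective_projections => //.
by apply: injective_projections => //; apply: val_inj.
Qed.

Fixpoint dpoly N t : mpoly #|{: 'I_N * 'I_n * 'I_n}| F := match t with
  | DCst x => mpolyC _ x
  | DVar l a j => if insub l is Some l' then mpolyX F (mnm1 (enum_rank (l' : 'I_N, a, j))) else 0
  | DAdd t u => dpoly N t + dpoly N u
  | DMul t u => dpoly N t * dpoly N u end.

Section Evaluation.
Variables (B : comNzRingType) (g : {rmorphism F -> B}) (dB : B -> B).

Fixpoint dev (W : 'M[B]_n) t : B := match t with
  | DCst x => g x
  | DVar l a j => iter l dB (W a j)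
  | DAdd t u => dev W t + dev W u
  | DMul t u => dev W t * dev W u end.

Definition dval (W : 'M[B]_n) N (e : 'I_#|{: 'I_N * 'I_n * 'I_n}|) : B :=
  iter (dindex e).1.1 dB (W (dindex e).1.2 (dindex e).2).

Lemma mmapXU mu (h : 'I_mu -> B) x : mmap g h (mpolyX F (mnm1 x)) = h x.
Proof. by rewrite mmapX mmap1U. Qed.

Lemma dev_dpoly W N t : (dlevel t <= N)%N -> dev W t = mmap g (dval W (N := N)) (dpoly N t).
Proof.
elim: t => [x|l a j|t IHt u IHu|t IHt u IHu] /=.
- by rewrite mmapC.
- by move=> lN; rewrite insubT mmapXU /dval /dindex enum_rankK.
- by rewrite geq_max => /andP[/IHt -> /IHu ->]; rewrite mmapD.
by rewrite geq_max => /andP[/IHt -> /IHu ->]; rewrite rmorphM.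
Qed.

Lemma dev_sum W f : dev W (dsum f) = \sum_b dev W (f b).
Proof.
rewrite /dsum -big_enum /=; elim: (enum _) => [|b s IH] /=; first by rewrite big_nil rmorph0.
by rewrite big_cons IH.
Qed.

Variable dF : F -> F.
Hypothesis dBP : derivation dB.

(** The coefficients of t must be such that the derivations of [B] and [F] agree on them at all
    orders. Over Ct(z) with z d/dz this may fail for coefficients that do not come from C(z). *)
Fixpoint dgood t : Prop := match t with
  | DCst x => forall l, dB (g (iter l dF x)) = g (iter l.+1 dF x)
  | DVar _ _ _ => True
  | DAdd t u | DMul t u => dgood t /\ dgood u end.

Lemma dgood_dt t : dgood t -> dgood (dt dF t).
Proof.
elim: t => [x|//|t IHt u IHu|t IHt u IHu] //=; last by move=> [] gt gu; do ?split; auto.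
- by move=> H l; rewrite -iterSr H.
by move=> [/IHt ? /IHu ?].
Qed.

Lemma dev_dt W t : dgood t -> dev W (dt dF t) = dB (dev W t).
Proof.
elim: t => [x|//|t IHt u IHu|t IHt u IHu] /=.
- by move=> /(_ 0%N) /= ->.
- by move=> [/IHt -> /IHu ->]; rewrite (derivD dBP).
by move=> [/IHt -> /IHu ->]; rewrite (derM dBP).
Qed.

Lemma dev_iter_dt W t l : dgood t -> dev W (iter l (dt dF) t) = iter l dB (dev W t).
Proof.
move=> tP; suff [-> //] : dev W (iter l (dt dF) t) = iter l dB (dev W t) /\ dgood (iter l (dt dF) t).
elim: l => [//|l [E G]] /=; split; last exact: dgood_dt.
by rewrite dev_dt // E.
Qed.

Variables (sF : F -> F) (sB : {rmorphism B -> B}) (A : 'M[F]_n) (W : 'M[B]_n).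
Hypothesis dF0 : dF 0 = 0.
Hypothesis sBg : forall x, sB (g x) = g (sF x).
Hypothesis sdB : forall x, sB (dB x) = dB (sB x).
Hypothesis sW : map_mx sB W = map_mx g A *m W.
Hypothesis gA : forall a b l, dB (g (iter l dF (A a b))) = g (iter l.+1 dF (A a b)).

(** Only sums of entries of A times entries of W get differentiated on the left, so [gA] suffices
    and the coefficients of t are arbitrary. *)
Lemma dev_dsigma t : dev W (dsigma dF sF A t) = sB (dev W t).
Proof.
elim: t => [x|l a j|t IHt u IHu|t IHt u IHu] /=; last 2 first.
- by rewrite IHt IHu rmorphD.
- by rewrite IHt IHu rmorphM.
- by rewrite sBg.
have z m : iter m dF 0 = 0 by elim: m => //= m ->.
rewrite dev_iter_dt; last first.
  by rewrite /dsum; elim: (enum _) => [m|b s IH] //=; rewrite z dF0 rmorph0 (der0 dBP).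
rewrite dev_sum; have -> : \sum_b dev W (DMul (DCst (A a b)) (DVar 0 b j)) = sB (W a j).
  move/matrixP: sW => /(_ a j); rewrite [LHS]mxE [RHS]mxE => ->.
  by apply: eq_bigr => b _; rewrite /= [in RHS]mxE.
by elim: l => //= l ->; rewrite sdB.
Qed.

Definition dvalued (W : 'M[B]_n) (x : B) := exists t, x = dev W t.

Lemma dvalued_cst V x : dvalued V (g x). Proof. by exists (DCst x). Qed.
Lemma dvalued_var V a j : dvalued V (V a j). Proof. by exists (DVar 0 a j). Qed.
Lemma dvaluedD V x y : dvalued V x -> dvalued V y -> dvalued V (x + y).
Proof. by move=> [t ->] [u ->]; exists (DAdd t u). Qed.
Lemma dvaluedM V x y : dvalued V x -> dvalued V y -> dvalued V (x * y).
Proof. by move=> [t ->] [u ->]; exists (DMul t u). Qed.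
Lemma dvalued0 V : dvalued V 0. Proof. by rewrite -(rmorph0 g); exact: dvalued_cst. Qed.
Lemma dvalued1 V : dvalued V 1. Proof. by rewrite -(rmorph1 g); exact: dvalued_cst. Qed.
Lemma dvaluedN V x : dvalued V x -> dvalued V (- x).
Proof.
by move=> Hx; rewrite -mulN1r -(rmorphN1 g); apply: dvaluedM => //; exact: dvalued_cst.
Qed.
Lemma dvaluedX V x m : dvalued V x -> dvalued V (x ^+ m).
Proof.
by move=> Hx; elim: m => [|m IH]; rewrite ?expr0 ?exprS; [exact: dvalued1 | exact: dvaluedM].
Qed.
Lemma dvalued_sum V (I : Type) (r : seq I) (P : pred I) f :
  (forall i, dvalued V (f i)) -> dvalued V (\sum_(i <- r | P i) f i).
Proof. by move=> H; apply: big_ind => //; [exact: dvalued0 | exact: dvaluedD]. Qed.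
Lemma dvalued_prod V (I : Type) (r : seq I) (P : pred I) f :
  (forall i, dvalued V (f i)) -> dvalued V (\prod_(i <- r | P i) f i).
Proof. by move=> H; apply: big_ind => //; [exact: dvalued1 | exact: dvaluedM]. Qed.
Lemma dvalued_iter V l a j : dvalued V (iter l dB (V a j)). Proof. by exists (DVar l a j). Qed.

Lemma dvalued_det V m (M : 'M[B]_m) : (forall i j, dvalued V (M i j)) -> dvalued V (\det M).
Proof.
move=> H; apply: dvalued_sum => s; apply: dvaluedM; last exact: dvalued_prod.
by apply: dvaluedX; apply: dvaluedN; exact: dvalued1.
Qed.

Lemma dvalued_mmap V N p : dvalued V (mmap g (dval V (N := N)) p).
Proof.
apply: dvalued_sum => m; apply: dvaluedM; first exact: dvalued_cst.
by apply: dvalued_prod => x; apply: dvaluedX; exact: dvalued_iter.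
Qed.

End Evaluation.
End DifferentialTerms.

Lemma dev_comp (F : comNzRingType) n (B B' : comNzRingType) (g : {rmorphism F -> B}) (dB : B -> B)
    (g' : {rmorphism F -> B'}) (dB' : B' -> B') (f : {rmorphism B -> B'}) W (t : dterm F n) :
  (forall x, f (g x) = g' x) -> (forall x, f (dB x) = dB' (f x)) ->
  f (dev g dB W t) = dev g' dB' (map_mx f W) t.
Proof.
move=> fg fd; elim: t => [x|l a j|t IHt u IHu|t IHt u IHu] //=.
- by rewrite mxE; elim: l => //= l <-.
- by rewrite rmorphD IHt IHu.
by rewrite rmorphM IHt IHu.
Qed.

Lemma integral_comp (R S B : comNzRingType) (f : {rmorphism R -> S}) (g : {rmorphism R -> B})
    (h : {rmorphism S -> B}) x :
  (forall r, h (f r) = g r) -> integralOver f x -> integralOver g (h x).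
Proof.
move=> hf [p pm px]; exists p => //.
rewrite -(eq_map_poly hf) (map_poly_comp h f) /root horner_map.
by rewrite (rootP px) rmorph0.
Qed.

Lemma integral_mpoly (K L : fieldType) (h : {rmorphism K -> L}) mu (p : mpoly mu L) :
  (forall l, integralOver h l) -> integralOver (map_mpoly (n := mu) h) p.
Proof.
move=> h_int; rewrite (mpolywE (leqnn (msize p))).
apply: (big_ind (integralOver (map_mpoly (n := mu) h))).
- exact: integral0.
- exact: integral_add.
move=> m _; rewrite -mul_mpolyC; apply: integral_mul; last first.
  have -> : mpolyX L m = map_mpoly h (mpolyX K m) by rewrite map_mpolyX.
  exact: integral_id.
have [P Pm /rootP Pr] := h_int (mcoeff m p).
have cinj : injective (@mpolyC mu K).
  by move=> x y /(congr1 (mcoeff mnm0)); rewrite !mcoeffC eqxx !mulr1.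
exists (map_poly (@mpolyC mu K) P).
  by rewrite monicE (lead_coef_map_inj cinj) ?mpolyC0 // (monicP Pm) mpolyC1.
have -> : map_poly (map_mpoly (n := mu) h) (map_poly (@mpolyC mu K) P) = map_poly (@mpolyC mu L) (map_poly h P).
  by rewrite -!map_poly_comp; apply: eq_map_poly => x /=; rewrite map_mpolyC.
by rewrite /root horner_map /= Pr rmorph0.
Qed.

(* Divide the monic equation of [x] by the largest possible power of the
   variable: its constant term is then a nonzero multiple of [x]. *)
Lemma integral_multiple (R : idomainType) (S : idomainType) (f : {rmorphism R -> S}) x :
  injective f -> integralOver f x -> x != 0 -> exists r y, r != 0 /\ f r = x * y.
Proof.
move=> f_inj [p pm /rootP px] x0.
have : exists m, exists p : {poly R}, [/\ p != 0, (map_poly f p).[x] = 0 & size p = m].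
  by exists (size p), p; split=> //; exact: monic_neq0.
move=> exm; have {}exm : exists m, `[< exists p : {poly R}, [/\ p != 0, (map_poly f p).[x] = 0 & size p = m] >].
  by case: exm => m H; exists m; apply/asboolP.
case: (ex_minnP exm) => m /asboolP[r [r0 rx rm]] mmin.
have [s [a rE]] : exists s a, r = s * 'X + a%:P.
  by elim/poly_ind: r {r0 rx rm} => [|s a _]; [exists 0, 0; rewrite mul0r addr0 | exists s, a].
move: rx; rewrite rE rmorphD rmorphM /= map_polyX map_polyC hornerD hornerMX hornerC => /eqP.
rewrite addrC addr_eq0 -mulNr => /eqP E; exists a, (- (map_poly f s).[x]); split; last by rewrite E mulrC.
apply/eqP => a0; have /eqP : (- (map_poly f s).[x]) * x = 0 by rewrite -E a0; exact: (rmorph0 f).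
rewrite mulf_eq0 (negbTE x0) orbF oppr_eq0 => /eqP sx.
have s0 : s != 0 by apply: contraNneq r0 => s0; rewrite rE s0 a0 mul0r addr0.
have := mmin (size s) (introT (asboolP _) (ex_intro _ s (And3 s0 sx erefl))).
by rewrite -rm rE a0 addr0 size_mulX // ltnn.
Qed.

(** * Relations with coefficients in the algebraic extension L *)

Section CompanionExtension.
Variables (k K : fieldType) (iota : {rmorphism {poly k} -> K}).
Hypothesis iota_inj : injective iota.
Hypothesis ratfunP : forall f : K, exists p d, d != 0 /\ f = iota p / iota d.
Hypothesis closed_k : forall p : {poly k}, size p != 1%N -> exists x, root p x.
Hypothesis char0 : forall l, l.+1%:R != 0 :> k.
Variables (q : k) (sig : {rmorphism K -> K}) (del : K -> K).
Hypothesis q0 : q != 0.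
Hypothesis q_not_root1 : forall m, q ^+ m.+1 != 1.
Hypothesis sigP : forall p, sig (iota p) = iota (p \Po (q *: 'X)).
Hypothesis delP : derivation del.
Hypothesis delF : forall p, del (iota p) = iota ('X * p^`()).
Variables (n : nat) (P Q : {poly k}) (lam : k).
Hypothesis lam0 : lam != 0.
Hypothesis sP : size P = n.+2.
Hypothesis sQ : (size Q <= n.+1)%N.
Hypotheses (P00 : P`_0 != 0) (Q00 : Q`_0 != 0).
Hypothesis PQ : forall x y m, root P x -> root Q y -> x <> q ^+ m * y.
Hypothesis QP : forall x y m, root P x -> root Q y -> y <> q ^+ m * x.
Hypothesis PP_ratio : forall x y i j, root P x -> root P y ->
  x ^+ n.+1 * q ^+ i = y ^+ n.+1 * q ^+ j -> exists i j, x * q ^+ i = y * q ^+ j.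
Notation A := (comp_mx iota n P Q lam).

Variables (L : fieldType) (h : {rmorphism K -> L}).
Hypothesis h_int : forall l : L, integralOver h l.
Variables (sL : {rmorphism L -> L}) (dL : L -> L).
Hypothesis dLP : derivation dL.
Hypothesis sLh : forall x, sL (h x) = h (sig x).
Hypothesis dLA : forall a b l, dL (h (iter l del (A a b))) = h (iter l.+1 del (A a b)).

Section Solution.
Variables (B : comUnitRingType) (g : {rmorphism L -> B}) (sB : {rmorphism B -> B}) (dB : B -> B).
Hypothesis dBP : derivation dB.
Hypothesis sdB : forall x, sB (dB x) = dB (sB x).
Hypothesis sBg : forall x, sB (g x) = g (sL x).
Hypothesis dBg : forall x, dB (g x) = g (dL x).
Variable W : 'M[B]_n.+1.
Hypothesis W_unit : W \in unitmx.
Hypothesis sW : map_mx sB W = map_mx (g \o h) A *m W.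

Definition embK : {rmorphism K -> B} := GRing.RMorphism.clone _ _ (g \o h) _.

Lemma sB_embK x : sB (embK x) = embK (sig x).
Proof. by rewrite /= sBg sLh. Qed.

Lemma dB_embK l a b : dB (embK (iter l del (A a b))) = embK (iter l.+1 del (A a b)).
Proof. by rewrite [embK _]/= dBg dLA. Qed.

Lemma sB_solution (a j : 'I_n.+1) : sB (W a j) = \sum_b embK (A a b) * W b j.
Proof.
move/matrixP: sW => /(_ a j); rewrite [LHS]mxE [RHS]mxE => ->.
by apply: eq_bigr => b _; rewrite [in LHS]mxE.
Qed.

(** Here the space [PP] is 0, and the cancellation asked of it is the invertibility of W. *)
Lemma kvalue_neq0 N (p : mpoly #|{: 'I_N * 'I_n.+1 * 'I_n.+1}| K) :
  p != 0 -> mmap embK (dval dB W (N := N)) p != 0.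
Proof.
move=> p0; apply/eqP => pE; have : (1 : B) = 0; last by apply/eqP/oner_neq0.
pose zero (x : B) := x = 0; change (zero 1).
apply: (companion_no_relation (B := B) (sB := sB) (dB := dB) (h := embK) iota_inj ratfunP closed_k char0 q0
  q_not_root1 sigP delP delF lam0 sP sQ P00 Q00 PQ QP PP_ratio
  sB_embK dBP dB_embK sdB sB_solution
  (PP := zero) _ _ _ _ _ (v := @dindex n.+1 N) _ p0) => //.
- by rewrite /zero => x y -> ->; rewrite addr0.
- by rewrite /zero => x y ->; rewrite mulr0.
- by rewrite /zero => x ->; rewrite rmorph0.
- rewrite /zero => t H j; have : W *m (\col_j t j) = 0.
    apply/matrixP => b z; rewrite [LHS]mxE [RHS]mxE -[RHS](H b).
    by apply: eq_bigr => j' _; rewrite [in LHS]mxE.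
  move=> /(congr1 (fun M => invmx W *m M)); rewrite mulKmx // mulmx0 => /matrixP /(_ j 0).
  by rewrite !mxE.
exact: dindex_inj.
Qed.

(** As L is algebraic over K, a nonzero polynomial over L divides a nonzero polynomial over K, to
    which [kvalue_neq0] applies. *)
Lemma lvalue_neq0 N (p : mpoly #|{: 'I_N * 'I_n.+1 * 'I_n.+1}| L) :
  p != 0 -> mmap g (dval dB W (N := N)) p != 0.
Proof.
move=> p0; pose mu := #|{: 'I_N * 'I_n.+1 * 'I_n.+1}|.
have hi : injective (map_mpoly (n := mu) h).
  move=> x y E; apply/mpolyP => m; apply: (fmorph_inj h).
  by rewrite -!mcoeff_map_mpoly E.
have [r [y [r0 E]]] := integral_multiple hi (integral_mpoly p h_int) p0.
apply: contraTneq (kvalue_neq0 r0) => pE.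
have -> : mmap embK (dval dB W (N := N)) r = mmap g (dval dB W (N := N)) (map_mpoly h r).
  rewrite /map_mpoly [X in mmap g _ X]/mmap rmorph_sum; apply: eq_bigr => m _.
  rewrite rmorphM /= mmapC /mmap1 rmorph_prod; congr (_ * _); apply: eq_bigr => i _.
  by rewrite rmorphXn /= mmapXU.
by rewrite E rmorphM /= pE mul0r eqxx.
Qed.

(** The right side does not mention W: all invertible solutions satisfy the same differential
    relations, the source of the automorphisms later on. *)
Lemma dev_eq0 t : dev g dB W t = 0 <-> dpoly (dlevel t) t = 0.
Proof.
rewrite (dev_dpoly g dB W (leqnn _)); split=> [E|->]; last by rewrite rmorph0.
by apply/eqP; apply: contraT => /lvalue_neq0; rewrite E eqxx.
Qed.

Lemma dev_mul_eq0 t u : dev g dB W t * dev g dB W u = 0 -> dev g dB W t = 0 \/ dev g dB W u = 0.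
Proof.
have lt := leq_maxl (dlevel t) (dlevel u); have lu := leq_maxr (dlevel t) (dlevel u).
rewrite (dev_dpoly g dB W lt) (dev_dpoly g dB W lu) -rmorphM => E.
have : dpoly (maxn (dlevel t) (dlevel u)) t * dpoly (maxn (dlevel t) (dlevel u)) u = 0.
  by apply/eqP; apply: contraT => /lvalue_neq0 /negP[]; exact/eqP/E.
by move=> /eqP; rewrite mulf_eq0 => /orP[] /eqP ->; rewrite rmorph0; [left | right].
Qed.

End Solution.
End CompanionExtension.

(** * The total ring of quotients of a Picard-Vessiot ring *)

Section PicardVessiotQuotient.
Variables (L : fieldType) (sL : {rmorphism L -> L}) (dL : L -> L) (n : nat) (A : 'M[L]_n).
Hypothesis dLP : derivation dL.
Variables (S : comUnitAlgType L) (sS : {rmorphism S -> S}) (dS : S -> S) (U : 'M[S]_n).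
Hypothesis S_PV : is_PV_ring sL dL A sS dS U.
Variables (Q : comUnitAlgType L) (e : {lrmorphism S -> Q}).
Hypothesis Q_quot : is_total_quotient_ring e.
Variables (sQ : {rmorphism Q -> Q}) (dQ : Q -> Q).
Hypothesis dQP : derivation dQ.
Hypothesis sdQ : sd_extension e sS dS sQ dQ.
Notation gQ := (in_alg Q).
Notation devQ W := (dev gQ dQ W).

Definition solution (W : 'M[Q]_n) := W \in unitmx /\ map_mx sQ W = map_mx gQ A *m W.

Hypothesis dev_eq0 : forall W, solution W -> forall t, devQ W t = 0 <-> dpoly (dlevel t) t = 0.
Hypothesis dev_mul_eq0 : forall W, solution W -> forall t u,
  devQ W t * devQ W u = 0 -> devQ W t = 0 \/ devQ W u = 0.

Let e_inj : injective e. Proof. by case: Q_quot. Qed.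
Let e_alg x : e x%:A = x%:A. Proof. by rewrite linearZ rmorph1. Qed.
Let e_eq0 x : (e x == 0) = (x == 0).
Proof. by rewrite -(inj_eq e_inj) rmorph0. Qed.

Lemma sQ_alg x : sQ x%:A = (sL x)%:A.
Proof. by rewrite -e_alg sdQ.1 (PV_ext S_PV).1 e_alg. Qed.

Lemma dQ_alg x : dQ x%:A = (dL x)%:A.
Proof. by rewrite -e_alg sdQ.2 (PV_ext S_PV).2 e_alg. Qed.

Lemma dev_image t : e (dev (in_alg S) dS U t) = devQ (map_mx e U) t.
Proof. by apply: dev_comp => x; [rewrite /= e_alg | rewrite sdQ.2]. Qed.

Lemma dgood_alg (t : dterm L n) : dgood gQ dQ dL t.
Proof. by elim: t => [x l|l a j|t IHt u IHu|t IHt u IHu] //=; rewrite dQ_alg. Qed.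

Lemma image_solution : solution (map_mx e U).
Proof.
split; first by rewrite unitmxE det_map_mx rmorph_unit // -unitmxE (PV_unit S_PV).
have := congr1 (map_mx e) (PV_sol S_PV); rewrite map_mxM => E.
transitivity (map_mx e (map_mx sS U)).
  by apply/matrixP => i j; rewrite !mxE sdQ.1.
rewrite E; congr (_ *m _); apply/matrixP => i j; rewrite !mxE.
exact: e_alg.
Qed.

Lemma det_image_valued : dvalued gQ dQ (map_mx e U) (\det (map_mx e U)).
Proof. by apply: dvalued_det => i j; exact: dvalued_var. Qed.

(** Such quotients contain the generators of S and are closed under sums, products and the
    derivation; [PV_gen] concludes. *)
Lemma image_quotient s : exists t d, devQ (map_mx e U) d \is a GRing.unit /\
  e s * devQ (map_mx e U) d = devQ (map_mx e U) t.
Proof.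
pose G : set S := [set s | exists t d, devQ (map_mx e U) d \is a GRing.unit /\
  e s * devQ (map_mx e U) d = devQ (map_mx e U) t].
have one : devQ (map_mx e U) (DCst 1) = 1 by rewrite /= scale1r.
suff GT : G = setT by have : setT s by []; rewrite -GT.
apply: (PV_gen S_PV).
- by move=> x; exists (DCst x), (DCst 1); rewrite one unitr1 mulr1 e_alg.
- move=> x y [t [d [du E]]] [t' [d' [d'u E']]].
  exists (DAdd (DMul t d') (DMul t' d)), (DMul d d'); rewrite /= unitrM du d'u; split=> //.
  by rewrite -E -E' rmorphD; ring.
- move=> x y [t [d [du E]]] [t' [d' [d'u E']]].
  exists (DMul t t'), (DMul d d'); rewrite /= unitrM du d'u; split=> //.
  by rewrite -E -E' rmorphM; ring.
- move=> x [t [d [du E]]].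
  exists (DAdd (DMul (dt dL t) d) (DMul (DCst (-1)) (DMul t (dt dL d)))), (DMul d d).
  rewrite /= !(dev_dt dQP) ?unitrM ?du; [split=> //| exact: dgood_alg | exact: dgood_alg].
  by rewrite -E (derM dQP) -sdQ.2 scaleN1r; ring.
- by move=> i j; exists (DVar 0 i j), (DCst 1); rewrite one unitr1 mulr1 /= mxE.
have [d dE] := det_image_valued; exists (DCst 1), d; rewrite one -dE.
have du : \det (map_mx e U) \is a GRing.unit by have [] := image_solution.
split=> //; rewrite det_map_mx -rmorphM mulVr ?rmorph1 //.
exact: (PV_unit S_PV).
Qed.

(** S consists of quotients of values, among which products vanish only trivially; so a nonzero
    value comes from a nonzerodivisor of S, and these become invertible in Q. *)
Lemma value_unit t : devQ (map_mx e U) t != 0 -> devQ (map_mx e U) t \is a GRing.unit.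
Proof.
have [_ e_unit _] := Q_quot => t0; rewrite -dev_image; apply: e_unit; rewrite /GRing.lreg.
move=> s1 s2 /= E; apply/eqP; rewrite -subr_eq0; apply/eqP.
have {E} : devQ (map_mx e U) t * e (s1 - s2) = 0.
  by rewrite -dev_image -rmorphM mulrBr E subrr rmorph0.
move: (s1 - s2) => s E.
have [u [d [du Es]]] := image_quotient s.
have := dev_mul_eq0 image_solution (t := t) (u := u).
rewrite -Es mulrA E mul0r => /(_ erefl) [/eqP|/eqP]; first by rewrite (negbTE t0).
by rewrite (mulIr_eq0 _ (mulIr du)) e_eq0 => /eqP.
Qed.

Lemma quotient_value (x : Q) : exists t d, devQ (map_mx e U) d \is a GRing.unit /\
  x * devQ (map_mx e U) d = devQ (map_mx e U) t.
Proof.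
have [_ e_unit frac] := Q_quot; have [u [v [v_reg ->]]] := frac x.
have vu := e_unit _ v_reg.
have [t [d [du E]]] := image_quotient u; have [t' [d' [d'u E']]] := image_quotient v.
exists (DMul t d'), (DMul t' d) => /=; rewrite -E -E' !unitrM vu du d'u; split=> //.
by rewrite -!mulrA mulKr //; ring.
Qed.

Lemma quotient_unit (x : Q) : x != 0 -> x \is a GRing.unit.
Proof.
move=> x0; have [t [d [du E]]] := quotient_value x.
suff : x * devQ (map_mx e U) d \is a GRing.unit by rewrite unitrMl.
rewrite E; apply: value_unit; rewrite -E; apply: contraNneq x0 => xd0.
by rewrite -(mulrK du x) xd0 mul0r.
Qed.

End PicardVessiotQuotient.

(** * Polynomials with the same logarithmic derivatives *)

Section ProportionalMpoly.
Variables (K : fieldType) (mu : nat).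
Hypothesis char0 : forall l, l.+1%:R != 0 :> K.
Implicit Types p d : mpoly mu K.

(** Unlike a partial derivative, the Euler operator does not move monomials: it multiplies each
    coefficient by the exponent of x, so leading monomials can be compared. *)
Let euler (x : 'I_mu) p := mpolyX K (mnm1 x) * mderiv x p.

Let mcoeff_euler x p m : mcoeff m (euler x p) = mcoeff m p * (m x)%:R.
Proof.
rewrite {1 2}(mpolywE (leqnn (msize p))) /euler !raddf_sum mulr_sumr /= raddf_sum mulr_suml.
apply: eq_bigr => m' _; rewrite /= mderivZ mderivX -!scalerAr !mcoeffZ -mpolyXD !mcoeffX.
rewrite -[RHS]mulrA; congr (_ * _).
have [m0|m0] := posnP (bmnm m' x).
  rewrite m0 mul0r; case: eqP => [<-|_]; first by rewrite m0 mulr0.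
  by rewrite mul0r.
have -> : mnm_add (mnm1 x) (mnm_sub m' (mnm1 x)) = m'.
  apply/mnmP => y; rewrite mnmDE mnmBE mnm1E; case: eqP => [<-|_]; last by rewrite subn0.
  by rewrite subnKC.
by case: eqP => [->|_]; rewrite ?mul1r ?mul0r ?mulr1 ?mulr0.
Qed.

Let mlead_euler x p : (mlead (euler x p) <= mlead p)%O.
Proof.
have [e0|e0] := eqVneq (euler x p) 0; first by rewrite e0 mlead0 le0x.
apply: msupp_le_mlead; rewrite mcoeff_msupp; have := mlead_supp e0.
by rewrite mcoeff_msupp mcoeff_euler mulf_eq0 negb_or => /andP[].
Qed.

Let mlead_proportional p d : p != 0 -> d != 0 ->
  (forall x, d * mderiv x p = p * mderiv x d) -> mlead p = mlead d.
Proof.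
move=> p0 d0 E; apply/mnmP => x; apply/eqP.
have : mcoeff (mnm_add (mlead d) (mlead p)) (d * euler x p) =
       mcoeff (mnm_add (mlead d) (mlead p)) (euler x d * p).
  by congr mcoeff; rewrite /euler mulrCA E; ring.
rewrite !mleadcMW ?mlead_euler // !mcoeff_euler => H.
have {}H : (mlead p x)%:R = (mlead d x)%:R :> K.
  have c0 : mcoeff (mlead d) d * mcoeff (mlead p) p != 0.
    by rewrite mulf_neq0 // mleadc_eq0.
  by apply: (mulfI c0); rewrite -mulrA H; ring.
wlog le : p d p0 d0 E H / (mlead p x <= mlead d x)%N => [W|].
  by case/orP: (leq_total (mlead p x) (mlead d x)) => le; [exact: (W p d) | rewrite eq_sym; exact: (W d p)].
rewrite eqn_leq le -subn_eq0 /=; apply: contraT; rewrite -lt0n => s0.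
have := char0 (mlead d x - mlead p x).-1; rewrite prednK // natrB // H subrr eqxx.
by [].
Qed.

(** Comparing leading coefficients for the Euler operators shows, in characteristic 0, that p and d
    have the same leading monomial. The same applies to p - c d if it is nonzero, but c is chosen so
    that this monomial cancels. *)
Lemma mpoly_proportional p d : d != 0 ->
  (forall x, d * mderiv x p = p * mderiv x d) -> exists c, p = mpolyC mu c * d.
Proof.
move=> d0 E; have [->|p0] := eqVneq p 0; first by exists 0; rewrite mpolyC0 mul0r.
have pd := mlead_proportional p0 d0 E.
pose c := mcoeff (mlead p) p / mcoeff (mlead d) d; exists c; apply/eqP; rewrite -subr_eq0.
apply: contraT => r0; have /mlead_proportional : forall x, d * mderiv x (p - mpolyC mu c * d) = (p - mpolyC mu c * d) * mderiv x d.
  move=> x; rewrite mul_mpolyC mderivB mderivZ mulrBr mulrBl E; congr (_ - _).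
  by rewrite -scalerAr -scalerAl.
move=> /(_ r0 d0) rd; move: r0; rewrite -mleadc_eq0 rd mcoeffB mcoeffCM -pd /c pd.
by rewrite divfK ?subrr ?eqxx // mleadc_eq0.
Qed.

End ProportionalMpoly.

Lemma leq_sub_step N m L l : (L <= l)%N -> l != L -> (N - L <= m.+1)%N -> (N - l <= m)%N.
Proof. by lia. Qed.

(** * Constants and automorphisms *)

Section SigmaConstants.
Variables (k K : fieldType) (iota : {rmorphism {poly k} -> K}).
Hypothesis iota_inj : injective iota.
Hypothesis ratfunP : forall f : K, exists p d, d != 0 /\ f = iota p / iota d.
Hypothesis closed_k : forall p : {poly k}, size p != 1%N -> exists x, root p x.
Hypothesis char0 : forall l, l.+1%:R != 0 :> k.
Variables (q : k) (sig : {rmorphism K -> K}) (del : K -> K).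
Hypothesis q0 : q != 0.
Hypothesis q_not_root1 : forall m, q ^+ m.+1 != 1.
Hypothesis sigP : forall p, sig (iota p) = iota (p \Po (q *: 'X)).
Hypothesis delP : derivation del.
Hypothesis delF : forall p, del (iota p) = iota ('X * p^`()).
Variables (n : nat) (P Q : {poly k}) (lam : k).
Hypothesis lam0 : lam != 0.
Hypothesis sP : size P = n.+2.
Hypothesis sQ : (size Q <= n.+1)%N.
Hypotheses (P00 : P`_0 != 0) (Q00 : Q`_0 != 0).
Hypothesis PQ : forall x y m, root P x -> root Q y -> x <> q ^+ m * y.
Hypothesis QP : forall x y m, root P x -> root Q y -> y <> q ^+ m * x.
Hypothesis PP_ratio : forall x y i j, root P x -> root P y ->
  x ^+ n.+1 * q ^+ i = y ^+ n.+1 * q ^+ j -> exists i j, x * q ^+ i = y * q ^+ j.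
Notation A := (comp_mx iota n P Q lam).

Variables (B : comUnitRingType) (g : {rmorphism K -> B}) (sB : {rmorphism B -> B}) (dB : B -> B).
Hypothesis dBP : derivation dB.
Hypothesis sdB : forall x, sB (dB x) = dB (sB x).
Hypothesis sBg : forall x, sB (g x) = g (sig x).
Hypothesis dBA : forall l a b, dB (g (iter l del (A a b))) = g (iter l.+1 del (A a b)).
Hypothesis B_unit : forall x : B, x != 0 -> x \is a GRing.unit.
Variable W : 'M[B]_n.+1.
Hypothesis W_unit : W \in unitmx.
Hypothesis sW : map_mx sB W = map_mx g A *m W.
Hypothesis kvalue_neq0 : forall N (p : mpoly #|{: 'I_N * 'I_n.+1 * 'I_n.+1}| K),
  p != 0 -> mmap g (dval dB W (N := N)) p != 0.
Notation KV := (dvalued g dB W).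
Notation W_det := (\det W).

Let solU (a j : 'I_n.+1) : sB (W a j) = \sum_b g (A a b) * W b j.
Proof.
move/matrixP: sW => /(_ a j); rewrite [LHS]mxE [RHS]mxE => ->.
by apply: eq_bigr => b _; rewrite [in LHS]mxE.
Qed.

Let KV_sigma x : KV x -> KV (sB x).
Proof.
move=> [t ->]; exists (dsigma del sig A t).
by rewrite (dev_dsigma (sF := sig) (sB := sB) dBP (der0 delP) sBg sdB sW) // => a b l; apply: dBA.
Qed.

Let det_unit : W_det \is a GRing.unit. Proof. exact: W_unit. Qed.

Let KV_det : KV W_det.
Proof. by apply: dvalued_det => i j; exact: dvalued_var. Qed.

Let detA0 : \det A != 0.
Proof.
have /(congr1 determinant) := comp_mulV iota_inj q0 q_not_root1 lam0 sP P00 Q00.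
rewrite det_mulmx det1 => E; apply/eqP => A0; move: E; rewrite A0 mul0r => /eqP.
by rewrite eq_sym oner_eq0.
Qed.

Let s_det : sB W_det = g (\det A) * W_det.
Proof. by rewrite -det_map_mx sW det_mulmx det_map_mx. Qed.

(** The ring of values with the determinant inverted: it contains the entries of the inverse of W,
    which the cancellation asked of [PP] requires. *)
Let LV x := exists r, KV (x * W_det ^+ r).

Let LV_KV x : KV x -> LV x. Proof. by move=> Hx; exists 0%N; rewrite expr0 mulr1. Qed.
Let LVD x y : LV x -> LV y -> LV (x + y).
Proof.
move=> [r Hx] [s Hy]; exists (r + s)%N.
have -> : (x + y) * W_det ^+ (r + s) = x * W_det ^+ r * W_det ^+ s + y * W_det ^+ s * W_det ^+ r.
  by rewrite exprD; ring.
by apply: dvaluedD; apply: dvaluedM => //; exact: dvaluedX.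
Qed.
Let LVM x y : LV x -> LV y -> LV (x * y).
Proof.
move=> [r Hx] [s Hy]; exists (r + s)%N.
have -> : (x * y) * W_det ^+ (r + s) = x * W_det ^+ r * (y * W_det ^+ s).
  by rewrite exprD; ring.
exact: dvaluedM.
Qed.
Let LV_sum (I : finType) (f : I -> B) : (forall i, LV (f i)) -> LV (\sum_i f i).
Proof. by move=> H; apply: (big_ind LV) => //; apply: LV_KV; exact: dvalued0. Qed.
Let LV_sigma x : LV x -> LV (sB x).
Proof.
move=> [r Hx]; exists r.
have u0 : g (\det A) ^+ r \is a GRing.unit by rewrite unitrX // rmorph_unit // unitfE.
have -> : sB x * W_det ^+ r = g (\det A ^- r) * sB (x * W_det ^+ r).
  have E : g (\det A ^- r) * g (\det A) ^+ r = 1.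
    by rewrite -(rmorphXn g) -(rmorphM g) mulVf ?expf_neq0 // (rmorph1 g).
  by rewrite (rmorphM sB) (rmorphXn sB) s_det exprMn mulrCA (mulrA (g _)) E mul1r.
by apply: dvaluedM; [exact: dvalued_cst | exact: KV_sigma].
Qed.
Let LV_inv i j : LV (invmx W i j).
Proof.
rewrite /invmx W_unit; exists 1%N; rewrite mxE mulrAC expr1 mulVr // mul1r mxE /cofactor.
apply: dvaluedM; first by apply/dvaluedX/dvaluedN; exact: dvalued1.
by apply: dvalued_det => a b; rewrite !mxE; exact: dvalued_var.
Qed.

(* The denominators of a constant form a sigma-stable ideal, which contains a
   power of the determinant. *)
Lemma constant_det_denominator f t d : sB f = f ->
  f * dev g dB W d = dev g dB W t -> dev g dB W d != 0 -> exists r, KV (f * W_det ^+ r).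
Proof.
move=> sf ft d0; pose PP x := LV (x * f); suff : PP 1 by rewrite /PP mul1r.
have p0 : dpoly (dlevel d) d != 0.
  by apply: contraNneq d0 => p0; rewrite (dev_dpoly g dB W (leqnn _)) p0 rmorph0.
apply: (companion_no_relation (B := B) (sB := sB) (dB := dB) (h := g) (PP := PP) iota_inj ratfunP closed_k char0 q0
  q_not_root1 sigP delP delF lam0 sP sQ P00 Q00 PQ QP PP_ratio
  sBg dBP dBA sdB solU _ _ _ _ _ (@dindex_inj n.+1 (dlevel d)) p0).
- by rewrite /PP mul0r; apply: LV_KV; exact: dvalued0.
- by move=> x y; rewrite /PP mulrDl; exact: LVD.
- by move=> a x Hx; rewrite /PP -mulrA; apply: LVM => //; apply: LV_KV; exact: dvalued_cst.
- by move=> x /LV_sigma; rewrite rmorphM /= sf.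
- move=> s Hs j; have -> : s j = \sum_b invmx W j b * (\sum_l W b l * s l).
    have := mulKmx W_unit (\col_l s l) => /matrixP /(_ j 0); rewrite [RHS]mxE => <-.
    rewrite mxE; apply: eq_bigr => b _; congr (_ * _); rewrite mxE.
    by apply: eq_bigr => l _; rewrite mxE.
  rewrite /PP mulr_suml; apply: LV_sum => b; rewrite -mulrA; apply: LVM => //.
  exact: Hs.
have := dev_dpoly g dB W (leqnn (dlevel d)); rewrite /PP => E.
suff : LV (dev g dB W d * f) by rewrite E.
by rewrite mulrC ft; apply: LV_KV; exists t.
Qed.

Let fixed_base f x : sB f = f -> f = g x -> exists c, f = g (kC iota c).
Proof.
move=> sf fx; have /(sig_fixed iota_inj ratfunP q0 sigP q_not_root1)[c xc] : sig x = x.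
  by apply: (fmorph_inj g); rewrite -sBg -fx.
by exists c; rewrite fx xc.
Qed.

(* If [f = p1 / p2] is not in [K], the lines spanned by [p1], [p2] and [p1 + p2]
   are sigma-stable, hence stable under polarization, which forces [p1] and [p2] to have
   the same logarithmic derivatives. *)
Lemma constant_ratio f t d : sB f = f ->
  f * dev g dB W d = dev g dB W t -> dev g dB W d != 0 -> exists c, f = g (kC iota c).
Proof.
move=> sf ft d0; have [r [t1 Et]] := constant_det_denominator sf ft d0.
have [t2 Ed] : KV (W_det ^+ r) by exact: dvaluedX.
pose N := maxn (dlevel t1) (dlevel t2).
pose val p := mmap g (dval dB W (N := N)) p.
pose p1 := dpoly N t1; pose p2 := dpoly N t2.
have v1 : val p1 = f * W_det ^+ r by rewrite Et /val -dev_dpoly // leq_maxl.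
have v2 : val p2 = W_det ^+ r by rewrite Ed /val -dev_dpoly // leq_maxr.
have val_inj p p' : val p = val p' -> p = p'.
  move=> E; apply/eqP; rewrite -subr_eq0; apply: contraT => /kvalue_neq0 /negP[].
  by apply/eqP; rewrite -[mmap _ _ _]/(val (p - p')) /val mmapB -!/(val _) E subrr.
have v2u : val p2 \is a GRing.unit by rewrite v2 unitrX.
have p20 : p2 != 0 by apply: contraTneq v2u => ->; rewrite /val mmap0 unitr0.
have ratio x p p' : val p' \is a GRing.unit -> p = mpolyC _ x * p' -> val p = f * val p' -> exists c, f = g (kC iota c).
  move=> u -> E; apply: (fixed_base (x := x)) => //; apply: (mulIr u).
  by rewrite -E /val rmorphM /= mmapC.
have [//|nof] := pselect (exists c, f = g (kC iota c)).
have nof' x : f <> g x by move=> /(fixed_base sf).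
pose a0 := \det A ^+ r.
have s2 : sB (val p2) = g a0 * val p2 by rewrite v2 rmorphXn s_det exprMn -rmorphXn.
have v12 : val p1 = f * val p2 by rewrite v1 v2.
have s1 : sB (val p1) = g a0 * val p1 by rewrite v12 rmorphM /= sf s2 mulrCA.
pose co L (a b : 'I_n.+1) (x : 'I_#|{: 'I_N * 'I_n.+1 * 'I_n.+1}|) : B := (if ((dindex (n := n.+1) x).1.2 == a) && (L <= (dindex x).1.1)%N
     then g ((dindex x).1.1`!%:R / ((dindex x).1.1 - L)`!%:R) * iter ((dindex x).1.1 - L) dB (W b (dindex x).2) else 0).
pose Z L a b p := \sum_x val (mderiv x p) * co L a b x.
have line p L a b : sB (val p) = g a0 * val p -> exists al, Z L a b p = g al * val p.
  move=> sp; pose PP x := exists al, x = g al * val p; change (PP (Z L a b p)).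
  have PP0 : PP 0 by exists 0; rewrite rmorph0 mul0r.
  have PPD x y : PP x -> PP y -> PP (x + y).
    by move=> [al ->] [be ->]; exists (al + be); rewrite rmorphD mulrDl.
  have PPZ c x : PP x -> PP (g c * x) by move=> [al ->]; exists (c * al); rewrite rmorphM mulrA.
  have PPs x : PP x -> PP (sB x).
    by move=> [al ->]; exists (sig al * a0); rewrite rmorphM /= sBg sp rmorphM mulrA.
  have Pp : PP (val p) by exists 1; rewrite rmorph1 mul1r.
  exact: (companion_polarization iota_inj ratfunP closed_k char0 q0 q_not_root1 sigP delP delF lam0 sP sQ P00 Q00 PQ QP PP_ratio
    sBg dBP dBA sdB solU PP0 PPD PPZ PPs (v := @dindex n.+1 N) L a b Pp).
have ZD L a b : Z L a b (p1 + p2) = Z L a b p1 + Z L a b p2.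
  rewrite -big_split; apply: eq_bigr => x _ /=.
  by rewrite mderivD /val mmapD mulrDl.
have ZE L a b : val p2 * Z L a b p1 = val p1 * Z L a b p2.
  have [al E1] := line p1 L a b s1; have [be E2] := line p2 L a b s2.
  have [|ga E3] := line (p1 + p2) L a b.
    by rewrite /val mmapD -!/(val _) rmorphD /= s1 s2 mulrDr.
  (* [al], [be] and [ga] are the multipliers of the lines of p1, p2 and p1 + p2. As f is not in K,
     this relation forces all three to be equal. *)
  have E : g (al - ga) * f = g (ga - be).
    apply: (mulIr v2u); rewrite -mulrA -v12 !rmorphB !mulrBl.
    move: E3; rewrite ZD E1 E2 /val mmapD -!/(val _) mulrDr => E3.
    by apply/eqP; rewrite subr_eq addrAC -subr_eq opprK E3 addrC.
  have [ag|ag] := eqVneq (al - ga) 0; last first.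
    case: (nof' ((al - ga)^-1 * (ga - be))).
    by rewrite rmorphM -E mulrA -rmorphM mulVf // rmorph1 mul1r.
  move: E; rewrite ag rmorph0 mul0r => /esym/eqP; rewrite fmorph_eq0 subr_eq0 => /eqP gb.
  rewrite E1 E2 -gb -(subr0 ga) -ag; have -> : ga - (al - ga) = ga + ga - al by ring.
  have -> : ga = al by apply/esym/eqP; rewrite -subr_eq0 ag.
  by rewrite addrK; ring.
pose F x := val p2 * val (mderiv x p1) - val p1 * val (mderiv x p2).
(* Descending induction on the order of x: in [Z L a b] only orders at least L contribute, those
   above L are already known to give 0, and the matrix W in front of those of order L is
   cancelled. *)
have F0 m x : (N - (dindex (n := n.+1) (N := N) x).1.1 <= m)%N -> F x = 0.
  elim: m x => [|m IH] x; first by rewrite leqn0 subn_eq0 /dindex /= leqNgt ltn_ord.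
  move=> xm; set L := (dindex x).1.1; set a := (dindex x).1.2.
  have lN : (L < N)%N by exact: ltn_ord (enum_val x).1.1.
  pose e j : 'I_#|{: 'I_N * 'I_n.+1 * 'I_n.+1}| := enum_rank (Ordinal lN, a, j).
  pose T j := g L`!%:R * F (e j).
  have ex : x = e (dindex x).2.
    apply: enum_val_inj; rewrite /e enum_rankK; apply: injective_projections => //.
    apply: injective_projections; last by [].
    by apply: ord_inj; rewrite /L /dindex.
  have HT b : \sum_j W b j * T j = 0.
    transitivity (val p2 * Z L a b p1 - val p1 * Z L a b p2); last by rewrite ZE subrr.
    rewrite /Z !mulr_sumr -sumrB.
    rewrite [RHS](eq_bigr (fun y => F y * co L a b y)) => [|y _]; last by rewrite /F; ring.
    rewrite [RHS](reindex (@enum_rank ('I_N * 'I_n.+1 * 'I_n.+1)%type)) /=; last exact/onW_bij/enum_rank_bij.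
    transitivity (\sum_(la : 'I_N * 'I_n.+1) \sum_(j : 'I_n.+1)
        F (enum_rank (la, j)) * co L a b (enum_rank (la, j))); last first.
      by rewrite pair_bigA; apply: eq_bigr => -[].
    rewrite (bigD1 (Ordinal lN, a)) //= [X in _ + X]big1 ?addr0 => [|[l' a'] la].
      apply: eq_bigr => j _; rewrite /co /dindex enum_rankK /= eqxx leqnn subnn /= fact0 divr1 /T.
      by rewrite mulrA mulrC (mulrC (W b j)).
    rewrite big1 // => j _; rewrite /co; case: ifP => [/andP[/eqP ya Ly]|_]; last by rewrite mulr0.
    rewrite IH ?mul0r //.
    have : nat_of_ord l' != L.
      apply: contraNneq la => lL; move: ya; rewrite /dindex enum_rankK /= => ->.
      by apply/eqP; congr (_, _); apply: ord_inj.
    move=> lL; apply: (leq_sub_step Ly) xm.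
    by rewrite /dindex enum_rankK.
  have T0 : T (dindex x).2 = 0.
    have : W *m (\col_j T j) = 0.
      apply/matrixP => b z; rewrite [LHS]mxE [RHS]mxE -[RHS](HT b).
      by apply: eq_bigr => j _; rewrite [in LHS]mxE.
    move=> /(congr1 (fun M => invmx W *m M)); rewrite mulKmx // mulmx0 => /matrixP /(_ (dindex x).2 0).
    by rewrite !mxE.
  rewrite ex; apply: (@mulrI _ (g L`!%:R)); last by rewrite mulr0.
  by rewrite rmorph_unit // unitfE; exact: K_fact iota char0 L.
have charK l : l.+1%:R != 0 :> K by rewrite -(rmorph_nat (kC iota)) fmorph_eq0.
have [|x px] := mpoly_proportional charK (p := p1) p20; last exact: ratio px v12.
by move=> x; apply: val_inj; apply/eqP; rewrite /val !rmorphM -subr_eq0; apply/eqP/(F0 _ x (leqnn _)).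
Qed.

Let root_constant f (p : {poly k}) : p != 0 -> (map_poly (g \o kC iota) p).[f] = 0 ->
  exists c, f = g (kC iota c).
Proof.
have [m sm] := ubnP (size p); elim: m p sm => // m IH p sm p0 pf.
have [s1|s1] := eqVneq (size p) 1%N.
  move/size_poly1P: (introT eqP s1) pf => [a a0 ->]; rewrite map_polyC hornerC /=.
  by move=> /eqP; rewrite !fmorph_eq0 (negbTE a0).
have [c /factor_theorem[r rE]] := closed_k s1.
have r0 : r != 0 by apply: contraNneq p0 => r0; rewrite rE r0 mul0r.
have [fc|fc] := eqVneq (f - g (kC iota c)) 0; first by exists c; apply/eqP; rewrite -subr_eq0 fc.
apply: (IH r) => //.
  by move: sm; rewrite rE size_Mmonic ?monicXsubC // size_XsubC addn2.
apply: (mulIr (B_unit fc)); rewrite mul0r -[RHS]pf rE rmorphM /= hornerM map_polyXsubC.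
by rewrite hornerXsubC.
Qed.

Hypothesis algebraic_values : forall f, exists p : {poly B},
  [/\ p != 0, forall i, KV p`_i & p.[f] = 0].

(* The ratios of the coefficients of a minimal relation are constants too. *)
Lemma sigma_constant f : sB f = f -> exists c, f = g (kC iota c).
Proof.
move=> sf.
pose S m := `[< exists p : {poly B}, [/\ p != 0, forall i, KV p`_i, p.[f] = 0 & size p = m] >].
have exS : exists m, S m.
  by have [p [p0 pK pf]] := algebraic_values f; exists (size p); apply/asboolP; exists p.
case: (ex_minnP exS) => m /asboolP[p [p0 pK pf pm]] mmin.
have lu : lead_coef p \is a GRing.unit by apply: B_unit; rewrite lead_coef_eq0.
have slu : sB (lead_coef p) \is a GRing.unit by exact: rmorph_unit.
(* As sigma fixes f, the transform of the relation is again a relation for f. In this combination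
   the leading terms cancel, so minimality makes it 0. *)
pose r := sB (lead_coef p) *: p - lead_coef p *: map_poly sB p.
have rK i : KV r`_i.
  rewrite /r coefB !coefZ coef_map; apply: dvaluedD; first by apply: dvaluedM => //; apply: KV_sigma; exact: pK.
  by apply/dvaluedN/dvaluedM; [exact: pK | exact/KV_sigma/pK].
have rf : r.[f] = 0.
  have E : (map_poly sB p).[f] = 0 by rewrite -{1}sf horner_map /= pf rmorph0.
  by rewrite /r hornerD hornerN !hornerZ pf E !mulr0 subr0.
have r0 : r = 0.
  apply/eqP; apply: contraT => r0.
  have /mmin : S (size r) by apply/asboolP; exists r.
  have m0 : (0 < m)%N by rewrite -pm size_poly_gt0.
  suff : (size r <= m.-1)%N by move=> le /leq_trans /(_ le); rewrite -{1}(prednK m0) ltnn.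
  apply/leq_sizeP => l lm; rewrite /r coefB !coefZ coef_map /=.
  have [ml|ml] := leqP m l; first by rewrite nth_default ?pm // rmorph0 !mulr0 subr0.
  have -> : l = (size p).-1 by apply/eqP; rewrite pm eqn_leq lm andbT -ltnS prednK.
  by rewrite -/(lead_coef p) mulrC subrr.
have ratio_const l : exists c, p`_l / lead_coef p = g (kC iota c).
  have [t Et] := pK l; have [d Ed] := pK (size p).-1.
  apply: (constant_ratio (t := t) (d := d)).
  - rewrite rmorphM rmorphV //; apply: (mulIr lu); apply: (mulIr slu).
    have := congr1 (fun u : {poly B} => u`_l) r0; rewrite coef0 /r coefB !coefZ coef_map /=.
    move=> /eqP; rewrite subr_eq0 => /eqP E.
    by rewrite divrK // mulrAC divrK // mulrC -E mulrC.
  - by rewrite -Ed -Et divrK.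
  by rewrite -Ed -/(lead_coef p) lead_coef_eq0.
have [c cP] := choice ratio_const.
pose P1 := \poly_(l < size p) c l.
have PE : p = lead_coef p *: map_poly (g \o kC iota) P1.
  apply/polyP => l; rewrite coefZ coef_map coef_poly /=; case: ltnP => pl.
    by rewrite -cP mulrC divrK.
  by rewrite !rmorph0 mulr0 nth_default.
apply: (root_constant (p := P1)).
  by apply: contraNneq p0 => P10; rewrite PE P10 rmorph0 scaler0.
by apply: (mulrI lu); rewrite mulr0 -hornerZ -PE.
Qed.

End SigmaConstants.

(** * Automorphisms and the Galois group *)

Section PicardVessiotGalois.
Variables (L : fieldType) (sL : {rmorphism L -> L}) (dL : L -> L) (n : nat) (A : 'M[L]_n).
Hypothesis dLP : derivation dL.
Variables (S : comUnitAlgType L) (sS : {rmorphism S -> S}) (dS : S -> S) (U : 'M[S]_n).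
Hypothesis S_PV : is_PV_ring sL dL A sS dS U.
Variables (Q : comUnitAlgType L) (e : {lrmorphism S -> Q}).
Hypothesis Q_quot : is_total_quotient_ring e.
Variables (sQ : {rmorphism Q -> Q}) (dQ : Q -> Q).
Hypothesis dQP : derivation dQ.
Hypothesis sdQ : sd_extension e sS dS sQ dQ.
Notation gQ := (in_alg Q).
Notation devQ W := (dev gQ dQ W).
Notation solution := (solution A sQ).
Hypothesis dev_eq0 : forall W, solution W -> forall t, devQ W t = 0 <-> dpoly (dlevel t) t = 0.
Hypothesis dev_mul_eq0 : forall W, solution W -> forall t u,
  devQ W t * devQ W u = 0 -> devQ W t = 0 \/ devQ W u = 0.
Notation V := (map_mx e U).

Let V_sol : solution V. Proof. exact: (image_solution S_PV sdQ). Qed.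
Let Q_value x : exists t d, devQ V d \is a GRing.unit /\ x * devQ V d = devQ V t.
Proof. exact: (quotient_value S_PV Q_quot dQP sdQ). Qed.
Let Q_unit (x : Q) : x != 0 -> x \is a GRing.unit.
Proof. exact: (quotient_unit S_PV Q_quot dQP sdQ dev_mul_eq0). Qed.
Let sQa x : sQ x%:A = (sL x)%:A. Proof. exact: (sQ_alg S_PV sdQ). Qed.
Let dQa x : dQ x%:A = (dL x)%:A. Proof. exact: (dQ_alg S_PV sdQ). Qed.
Let good (t : dterm L n) : dgood gQ dQ dL t. Proof. exact: (dgood_alg S_PV sdQ). Qed.
Lemma quotient_sd x : sQ (dQ x) = dQ (sQ x).
Proof.
have [_ _ frac] := Q_quot; have e_unit : forall t : S, GRing.lreg t -> e t \is a GRing.unit by case: Q_quot.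
have [_ _ sdS] := PV_sd S_PV; have H s : sQ (dQ (e s)) = dQ (sQ (e s)) by rewrite !(sdQ.1, sdQ.2) sdS.
have [u [t [t_reg E]]] := frac x; have tu := e_unit _ t_reg.
have xt : x * e t = e u by rewrite E divrK.
have := H u; rewrite -xt (derM dQP) rmorphD !rmorphM (derM dQP) /= H => /addIr.
by apply: mulIr; rewrite rmorph_unit.
Qed.

Lemma dev_dsigma_solution W t : solution W -> devQ W (dsigma dL sL A t) = sQ (devQ W t).
Proof.
move=> [_ sW]; apply: (dev_dsigma (sB := sQ) dQP (der0 dLP) _ quotient_sd sW) => [x|a b l] /=.
  exact: sQa.
exact: dQa.
Qed.

Lemma automorphism_to W : solution W -> exists phi : {lrmorphism Q -> Q},
  [/\ forall t, phi (devQ V t) = devQ W t, forall x, phi (sQ x) = sQ (phi x) &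
      forall x, phi (dQ x) = dQ (phi x)].
Proof.
move=> W_sol; have transfer t : devQ V t = 0 <-> devQ W t = 0 by rewrite !dev_eq0.
have W_unit d : devQ V d \is a GRing.unit -> devQ W d \is a GRing.unit.
  by move=> du; apply: Q_unit; apply: contraTneq du => /transfer ->; rewrite unitr0.
pose neg t : dterm L n := DMul (DCst (-1)) t.
have /choice[F FP] x : exists y, forall t d, devQ V d \is a GRing.unit ->
    x * devQ V d = devQ V t -> y * devQ W d = devQ W t.
  have [t0 [d0 [d0u E0]]] := Q_value x; exists (devQ W t0 / devQ W d0) => t d du E.
  have /transfer : devQ V (DAdd (DMul t0 d) (neg (DMul t d0))) = 0.
    by rewrite /= -E -E0 scaleN1r mulN1r; ring.
  rewrite /= scaleN1r mulN1r => /eqP; rewrite subr_eq0 => /eqP EW.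
  by apply: (mulIr (W_unit _ d0u)); rewrite mulrAC divrK ?W_unit // EW.
have FE x t d : devQ V d \is a GRing.unit -> x * devQ V d = devQ V t ->
    forall y, y * devQ W d = devQ W t -> F x = y.
  by move=> du E y Ey; apply: (mulIr (W_unit _ du)); rewrite Ey; apply: FP.
have Fz : zmod_morphism F.
  move=> x y; have [t [d [du E]]] := Q_value x; have [t' [d' [d'u E']]] := Q_value y.
  apply: (FE _ (DAdd (DMul t d') (neg (DMul t' d))) (DMul d d')) => /=.
  - by rewrite unitrM du d'u.
  - by rewrite -E -E' scaleN1r mulN1r; ring.
  by rewrite -(FP _ _ _ du E) -(FP _ _ _ d'u E') scaleN1r mulN1r; ring.
have F1 t : F (devQ V t) = devQ W t.
  apply: (FE _ t (DCst 1)); rewrite /= scale1r ?unitr1 ?mulr1 //.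
have Fm : monoid_morphism F.
  split; first by have := F1 (DCst 1); rewrite /= !scale1r.
  move=> x y; have [t [d [du E]]] := Q_value x; have [t' [d' [d'u E']]] := Q_value y.
  apply: (FE _ (DMul t t') (DMul d d')) => /=.
  - by rewrite unitrM du d'u.
  - by rewrite -E -E'; ring.
  by rewrite -(FP _ _ _ du E) -(FP _ _ _ d'u E'); ring.
have Fs : scalable F.
  move=> a x; have [t [d [du E]]] := Q_value x.
  apply: (FE _ (DMul (DCst a) t) d) => //=.
    by rewrite mulr_algl -E scalerAl.
  by rewrite mulr_algl -(FP _ _ _ du E) scalerAl.
pose phi : {lrmorphism Q -> Q} := HB.pack F (GRing.isZmodMorphism.Build _ _ _ Fz)
  (GRing.isMonoidMorphism.Build _ _ _ Fm) (GRing.isScalable.Build _ _ _ _ _ Fs).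
exists phi; split=> //= x; have [t [d [du E]]] := Q_value x.
  apply: (FE _ (dsigma dL sL A t) (dsigma dL sL A d)); rewrite !dev_dsigma_solution //.
  - exact: rmorph_unit.
  - by rewrite -rmorphM E.
  by rewrite -rmorphM (FP _ _ _ du E).
apply: (FE _ (DAdd (DMul (dt dL t) d) (neg (DMul t (dt dL d)))) (DMul d d)) => /=.
- by rewrite unitrM du.
- by rewrite !(dev_dt dQP) // -E (derM dQP) scaleN1r mulN1r; ring.
by rewrite !(dev_dt dQP) // -(FP _ _ _ du E) (derM dQP) scaleN1r mulN1r; ring.
Qed.

Variables (Ct : fieldType) (i : {rmorphism Ct -> L}).
Hypothesis sL_i : forall c, sL (i c) = i c.
Hypothesis constants : forall x : Q, sQ x = x -> exists c, x = (i c)%:A.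
Notation emb M := (map_mx (fun c => (i c)%:A : Q) M).

Let iA : {rmorphism Ct -> Q} := GRing.RMorphism.clone _ _ (in_alg Q \o i) _.
Let embE m (M : 'M[Ct]_m) : emb M = map_mx iA M.
Proof. by apply/matrixP => a b; rewrite !mxE. Qed.

Lemma solution_mul (M : 'M[Ct]_n) : M \in unitmx -> solution (V *m emb M).
Proof.
move=> Mu; have [Vu sV] := V_sol; split.
  by rewrite unitmx_mul Vu embE unitmxE det_map_mx rmorph_unit.
rewrite map_mxM sV -mulmxA; congr (_ *m (_ *m _)).
by apply/matrixP => a b; rewrite !mxE sQa sL_i.
Qed.

Let automorphism_value (phi : {lrmorphism Q -> Q}) (W : 'M[Q]_n) (t : dterm L n) : (forall x, phi (dQ x) = dQ (phi x)) ->
  phi (devQ W t) = devQ (map_mx phi W) t.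
Proof. by move=> dphi; apply: dev_comp => // x; rewrite /= linearZ rmorph1. Qed.

Let automorphism_cancel (M N : 'M[Ct]_n) (phi psi : {lrmorphism Q -> Q}) :
  (forall x, phi (dQ x) = dQ (phi x)) ->
  (forall t, phi (devQ V t) = devQ (V *m emb M) t) ->
  (forall t, psi (devQ V t) = devQ (V *m emb N) t) -> M *m N = 1%:M -> cancel psi phi.
Proof.
move=> dphi phiV psiV MN x; have [t [d [du E]]] := Q_value x.
have K u : phi (psi (devQ V u)) = devQ V u.
  rewrite psiV automorphism_value //; congr (dev _ _ _ _).
  have -> : map_mx phi (V *m emb N) = V *m emb M *m emb N.
    rewrite map_mxM; congr (_ *m _); apply/matrixP => a b; rewrite ?mxE.
      by have := phiV (DVar 0 a b); rewrite /= !mxE.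
    have phiA x' : phi x'%:A = x'%:A by rewrite linearZ rmorph1.
    exact: phiA.
  by rewrite -mulmxA !embE -map_mxM MN map_mx1 mulmx1.
have := K t; rewrite -E (rmorphM psi) (rmorphM phi) /= => Kt.
by apply: (mulIr du); rewrite -Kt; congr (_ * _); rewrite K.
Qed.

(** For phi in the group, V^-1 phi(V) is fixed by sigma, hence has entries in [Ct] by [constants].
    Conversely V M is a solution for every invertible M, and the endomorphisms attached to M and to
    its inverse are inverse to each other. *)
Lemma galois_imageE : sd_galois_image sQ dQ V = (fun M : 'M[Ct]_n => emb M) @` [set M | M \in unitmx].
Proof.
have [Vu sV] := V_sol; apply/seteqP; split=> [_ [phi [_ sphi dphi] <-]|_ [M Mu <-]]; last first.
  have Mu' : invmx M \in unitmx by rewrite unitmx_inv.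
  have [phi [phiV sphi dphi]] := automorphism_to (solution_mul Mu).
  have [psi [psiV spsi dpsi]] := automorphism_to (solution_mul Mu').
  exists phi.
    split=> //; exists psi.
      exact: (automorphism_cancel dpsi psiV phiV (mulVmx Mu)).
    exact: (automorphism_cancel dphi phiV psiV (mulmxV Mu)).
  have -> : map_mx phi V = V *m emb M by apply/matrixP => a b; have := phiV (DVar 0 a b); rewrite /= !mxE.
  by rewrite mulKmx.
pose N := invmx V *m map_mx phi V.
have sN : map_mx sQ N = N.
  have sphiV : map_mx sQ (map_mx phi V) = map_mx gQ A *m map_mx phi V.
    transitivity (map_mx phi (map_mx sQ V)); first by apply/matrixP => a b; rewrite !mxE sphi.
    rewrite sV map_mxM; congr (_ *m _); apply/matrixP => a b; rewrite !mxE /=.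
    by rewrite linearZ rmorph1.
  have Au : map_mx gQ A \in unitmx.
    have : map_mx sQ V \in unitmx by rewrite unitmxE det_map_mx rmorph_unit.
    by rewrite sV unitmx_mul => /andP[].
  have Vsu : map_mx sQ V \in unitmx by rewrite sV unitmx_mul Au.
  apply: (can_inj (mulKmx Vsu)); rewrite -map_mxM {1}/N mulKVmx // sphiV sV -mulmxA mulKVmx //.
have /choice[c cP] (ab : 'I_n * 'I_n) : exists c, N ab.1 ab.2 = (i c)%:A.
  by apply: constants; have /matrixP /(_ ab.1 ab.2) := sN; rewrite mxE.
have NE : N = emb (\matrix_(a, b) c (a, b)).
  by apply/matrixP => a b; rewrite [RHS]mxE [in RHS]mxE -cP.
exists (\matrix_(a, b) c (a, b)) => //=.
have : N \in unitmx by rewrite unitmx_mul unitmx_inv Vu unitmxE det_map_mx rmorph_unit.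
rewrite NE embE !unitmxE det_map_mx; apply: contraLR.
by rewrite !unitfE negbK => /eqP ->; rewrite rmorph0 unitr0.
Qed.

End PicardVessiotGalois.

(** Replace the denominator of f by a multiple [rho] with coefficients in K. The new numerator f rho
    is integral over the values of polynomials over K; moving the powers of rho into the
    coefficients of its monic equation gives an equation for f. *)
Lemma value_algebraic (K L : fieldType) (h : {rmorphism K -> L}) n (B : comUnitRingType)
    (g : {rmorphism L -> B}) (gK : {rmorphism K -> B}) (dB : B -> B) (W : 'M[B]_n) :
  (forall l, integralOver h l) -> (forall x, g (h x) = gK x) ->
  (forall x : B, x != 0 -> x \is a GRing.unit) ->
  (forall N (p : mpoly #|{: 'I_N * 'I_n * 'I_n}| K), p != 0 -> mmap gK (dval dB W (N := N)) p != 0) ->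
  forall f t d, dev g dB W d != 0 -> f * dev g dB W d = dev g dB W t ->
  exists p : {poly B}, [/\ p != 0, forall i, dvalued gK dB W p`_i & p.[f] = 0].
Proof.
move=> h_int gh B_unit neq0 f t d d0 ft; pose N := maxn (dlevel t) (dlevel d).
move: d0 ft; rewrite (dev_dpoly g dB W (leq_maxr (dlevel t) (dlevel d) : (_ <= N)%N)).
rewrite (dev_dpoly g dB W (leq_maxl (dlevel t) (dlevel d) : (_ <= N)%N)).
pose mu := #|{: 'I_N * 'I_n * 'I_n}|; set v := dval dB W (N := N).
move: (dpoly N t) (dpoly N d) => pt pd d0 ft.
have hi : injective (map_mpoly (n := mu) h).
  by move=> x y E; apply/mpolyP => m; apply: (fmorph_inj h); rewrite -!mcoeff_map_mpoly E.
have pd0 : pd != 0 by apply: contraNneq d0 => ->; rewrite mmap0.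
have [r [y [r0 E]]] := integral_multiple hi (integral_mpoly pd h_int) pd0.
have gE p : mmap g v (map_mpoly h p) = mmap gK v p.
  rewrite /map_mpoly [X in mmap g _ X]/mmap rmorph_sum; apply: eq_bigr => m _.
  rewrite rmorphM /= mmapC; congr (_ * _); first exact: gh.
  rewrite /mmap1 rmorph_prod; apply: eq_bigr => i _.
  by rewrite rmorphXn /= mmapXU.
pose G : {rmorphism mpoly mu K -> B} := GRing.RMorphism.clone _ _ (mmap gK v) _.
pose rho := G r; have rho_u : rho \is a GRing.unit by apply/B_unit/neq0.
have fr : f * rho = mmap g v (pt * y).
  by rewrite /rho /= -gE E !rmorphM /= mulrA ft.
have [p pm /rootP pw] : integralOver G (mmap g v (pt * y)).
  by apply: (integral_comp (f := map_mpoly (n := mu) h)) => [x|]; [exact: gE | exact: integral_mpoly].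
have sp : (0 < size p)%N by rewrite size_poly_gt0 monic_neq0.
exists (\poly_(i < size p) (G p`_i * rho ^+ i)); split.
- apply/eqP => /(congr1 (fun u : {poly B} => u`_(size p).-1)).
  rewrite coef0 coef_poly prednK // leqnn -/(lead_coef p) (monicP pm) rmorph1 mul1r => rho0.
  have := unitrX (size p).-1 rho_u; rewrite rho0 unitr0.
  by [].
- move=> i; rewrite coef_poly; case: ifP => _; last exact: dvalued0.
  by apply: dvaluedM; [exact: dvalued_mmap | apply: dvaluedX; exact: dvalued_mmap].
rewrite horner_poly -[RHS]pw -fr (horner_coef_wide _ (size_poly _ _ : (size (map_poly G p) <= size p)%N)).
by apply: eq_bigr => i _; rewrite coef_map exprMn mulrA mulrAC -!mulrA.
Qed.

(** As s <= n, the coefficient of sigma^(n+1) comes from z lam P alone, and dividing by it leaves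
    polynomials of degree at most 1 in 1/z. *)
Lemma companion_hyp_op (F : fieldType) (q lam : F) n s (a : 'I_n.+1 -> F) (b : 'I_s -> F) :
  (s <= n)%N -> lam != 0 -> (forall i, a i != 0) -> (forall j, b j / q != 0) ->
  companion_system n.+1 (hyp_op q a b lam) =
  comp_mx (@FracField.tofrac {poly F}) n (lin_prod a) (lin_prod (fun j => b j / q)) lam.
Proof.
move=> sn lam0 a0 b0; set P := lin_prod a; set Q := lin_prod _.
have cE l : (hyp_op q a b lam)`_l = ratX F * ratC lam * ratC P`_l - ratC Q`_l.
  by rewrite /hyp_op -!(map_lin_prod (@ratC F)) coefB coefZ !coef_map.
have Qn : Q`_n.+1 = 0 by rewrite nth_default // size_lin_prod.
have p0 : P`_n.+1 != 0.
  have := size_lin_prod a0; rewrite -/P => sP.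
  by rewrite -[n.+1]/(n.+2.-1) -sP -/(lead_coef P) lead_coef_eq0 -size_poly_eq0 sP.
apply/matrixP => i j; rewrite comp_mxE mxE eqSS.
have -> : (i == n :> nat) = (i == ord_max) by rewrite -val_eqE.
case: eqP => // _; rewrite !cE Qn rmorph0 subr0.
pose kF : {rmorphism F -> ratfun F} := @ratC F.
change (- (ratX F * kF lam * kF P`_j - kF Q`_j) / (ratX F * kF lam * kF P`_n.+1) =
  kF (- P`_j / P`_n.+1) + (ratX F)^-1 * kF (Q`_j / (lam * P`_n.+1))).
have [pk lk] : kF P`_n.+1 != 0 /\ kF lam != 0 by rewrite !fmorph_eq0.
have zk : ratX F != 0 by rewrite tofrac_eq0 polyX_eq0.
rewrite (rmorphM kF) (rmorphN kF) (rmorphM kF Q`_j) !(fmorphV kF) (rmorphM kF lam).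
have E (M : fieldType) (l p x y z : M) : l != 0 -> p != 0 -> z != 0 ->
    - (z * l * x - y) / (z * l * p) = - x / p + z^-1 * (y / (l * p)).
  by move=> l0 p1 z0; field; rewrite ?l0 ?p1 ?z0.
move: (kF lam) (kF _`_n.+1) (kF P`_j) (kF Q`_j) (ratX F) lk pk zk => l p x y z.
exact: (E (ratfun F) l p x y z).
Qed.

Lemma comp_mx_map (F k : fieldType) (c : {rmorphism F -> k}) (cK : {rmorphism ratfun F -> ratfun k})
    n (P Q : {poly F}) (lam : F) :
  (forall p, cK (FracField.tofrac p) = FracField.tofrac (map_poly c p)) ->
  map_mx cK (comp_mx (@FracField.tofrac {poly F}) n P Q lam) =
  comp_mx (@FracField.tofrac {poly k}) n (map_poly c P) (map_poly c Q) (c lam).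
Proof.
move=> cKP; have cKC x : cK (kC (@FracField.tofrac {poly F}) x) = kC (@FracField.tofrac {poly k}) (c x).
  by rewrite /kC cKP map_polyC.
have cKX : cK (FracField.tofrac 'X) = FracField.tofrac 'X.
  by rewrite cKP; congr FracField.tofrac; exact: (map_polyX c).
apply/matrixP => i j; rewrite [LHS]mxE !comp_mxE; case: eqP => _; last by rewrite rmorph_nat.
rewrite (rmorphD cK) (rmorphM cK) (fmorphV cK) cKX !cKC !coef_map.
by rewrite !(rmorphM c) (rmorphN c) !(fmorphV c) (rmorphM c).
Qed.

(** * The hypergeometric Galois group *)

Section HypergeometricGaloisGroup.
Variables (R : realType).
Notation C := R[i].
Variables (q : C) (n s : nat) (a : 'I_n.+1 -> C) (b : 'I_s -> C) (lam : C).
Hypotheses (q0 : q != 0) (q_not_root1 : forall m, q ^+ m.+1 != 1).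
Hypothesis s_le_n : (s <= n)%N.
Hypothesis lam0 : lam != 0.
Hypotheses (a0 : forall i, a i != 0) (b0 : forall j, b j != 0).
Hypothesis ab : forall i j m1 m2, a i * q ^+ m1 <> b j * q ^+ m2.
Hypothesis a_ratio : forall i l m1 m2, a l ^+ n.+1 * q ^+ m1 = a i ^+ n.+1 * q ^+ m2 ->
  exists m m', a l * q ^+ m = a i * q ^+ m'.
Variables (qr : nat -> C) (Ct : fieldType) (dC : Ct -> Ct) (c : {rmorphism C -> Ct}).
Hypotheses (qr_root : root_system q qr) (Ct_closed : differentially_closed dC).
Variables (T : idomainType) (i : {rmorphism Ct -> T}) (j : {rmorphism palg C -> T}).
Hypothesis T_tensor : is_tensor_product c (@palg_const C) i j.
Notation L := {fraction T}.
Notation "x %:F" := (@FracField.tofrac T x).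
Variables (sL : {rmorphism L -> L}) (dL : L -> L).
Hypothesis dL_der : derivation dL.
Hypothesis sdL_Ct : sd_extension (fun x => (i x)%:F) id dC sL dL.
Hypothesis sdL_palg : sd_extension (fun x => (j x)%:F) (palg_sigma qr) (@palg_der C) sL dL.
Notation AL := (map_mx (fun x => (j (ratfun_palg x))%:F) (companion_system n.+1 (hyp_op q a b lam))).
Variables (S : comUnitAlgType L) (sS : {rmorphism S -> S}) (dS : S -> S) (U : 'M[S]_n.+1).
Hypothesis S_PV : is_PV_ring sL dL AL sS dS U.
Variables (Q : comUnitAlgType L) (e : {lrmorphism S -> Q}).
Hypothesis Q_quot : is_total_quotient_ring e.
Variables (sQ : {rmorphism Q -> Q}) (dQ : Q -> Q).
Hypotheses (dQ_der : derivation dQ) (sdQ : sd_extension e sS dS sQ dQ).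
Notation K := (ratfun Ct).
Notation iotaF := (@FracField.tofrac {poly C}).
Notation iota := (@FracField.tofrac {poly Ct}).

(** The parameters are transported by c to the algebraically closed field [Ct], and the results on
    the companion system are applied over K = Ct(z), over which L is algebraic through [h]. *)
Lemma hypergeometric_galois_group : sd_galois_image sQ dQ (map_mx e U) =
  (fun M : 'M[Ct]_n.+1 => map_mx (fun x => (i x)%:F%:A) M) @` [set M | M \in unitmx].
Proof.
have charC := @complex_char0 R.
have charCt l : l.+1%:R != 0 :> Ct by rewrite -(rmorph_nat c) fmorph_eq0.
have Ct_alg := differentially_closed_alg charCt Ct_closed.
have iF_inj := @tofrac_inj {poly C}; have iK_inj := @tofrac_inj {poly Ct}.
have F_frac := @fracP {poly C}; have K_frac := @fracP {poly Ct}.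
pose q' := c q; have q'0 : q' != 0 by rewrite fmorph_eq0.
have q'1 m : q' ^+ m.+1 != 1 by rewrite -rmorphXn fmorph_eq1.
have [sig sigP] := ratfun_scaling iK_inj K_frac q'0.
have [del [delP delF]] := ratfun_derivation iK_inj charCt.
have [delC [delCP delCF]] := ratfun_derivation iF_inj charC.
have [cK cKP] := ratfun_map c; have [h hP] := tensor_ratfun T_tensor.
pose a' x := c (a x); pose b' x := c (b x).
have a'0 x : a' x != 0 by rewrite fmorph_eq0.
have b'0 x : b' x != 0 by rewrite fmorph_eq0.
have bq'0 x : b' x / q' != 0 by rewrite mulf_neq0 ?invr_neq0.
have bq0 x : b x / q != 0 by rewrite mulf_neq0 ?invr_neq0.
have ab' x y m1 m2 : a' x * q' ^+ m1 <> b' y * q' ^+ m2.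
  by rewrite -!rmorphXn -!rmorphM => /fmorph_inj; exact: ab.
have a'_ratio x l m1 m2 : a' l ^+ n.+1 * q' ^+ m1 = a' x ^+ n.+1 * q' ^+ m2 ->
    exists m m', a' l * q' ^+ m = a' x * q' ^+ m'.
  rewrite -!rmorphXn -!rmorphM => /fmorph_inj /a_ratio [m [m' E]]; exists m, m'.
  by rewrite -!rmorphXn -!rmorphM E.
pose P' := lin_prod a'; pose Q' := lin_prod (fun x => b' x / q').
have lam'0 : c lam != 0 by rewrite fmorph_eq0.
pose AF := comp_mx iotaF n (lin_prod a) (lin_prod (fun x => b x / q)) lam.
pose A := comp_mx iota n P' Q' (c lam).
have AE : A = map_mx cK AF.
  have Pc : map_poly c (lin_prod a) = P' by rewrite map_lin_prod.
  have Qc : map_poly c (lin_prod (fun x => b x / q)) = Q'.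
    by rewrite map_lin_prod; apply: eq_bigr => x _; rewrite /= fmorph_div.
  by rewrite /A -Pc -Qc /AF (comp_mx_map n _ _ lam cKP).
have ALE : AL = map_mx h A.
  rewrite (companion_hyp_op s_le_n lam0 a0 bq0) AE.
  apply/matrixP => x y; rewrite [LHS]mxE [RHS]mxE [in RHS]mxE.
  by rewrite (tensor_ratfun_map T_tensor cKP hP).
have h_int := tensor_integral T_tensor cKP hP.
have zE : psigma qr (pmono 1 1) = pconst q * pmono 1 1 :> puiseux C := psigma_z qr_root.
have sLh x : sL (h x) = h (sig x).
  apply: (ratfun_morph_eq K_frac (f := GRing.RMorphism.clone _ _ (sL \o h) _)
    (g := GRing.RMorphism.clone _ _ (h \o sig) _)) => [x'|] /=.
    by rewrite (sigC sigP) (tensor_ratfunC hP) sdL_Ct.1.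
  have E : palg_sigma qr (ratfun_palg (ratX C)) = palg_const q * ratfun_palg (ratX C).
    apply: val_inj; rewrite (palg_sigmaE _ q0 qr_root).
    have vz : val (ratfun_palg (ratX C)) = pmono 1 1.
      by rewrite /= ratfun_puiseux_poly /poly_puiseux map_polyX hornerX.
    by rewrite vz zE -(palg_const_val q) -vz.
  rewrite (sigX sigP) (rmorphM h) (tensor_ratfunC hP) (tensor_ratfunX hP) sdL_palg.1 E T_tensor.1.
  by rewrite (rmorphM j) (rmorphM (@FracField.tofrac T)).
have delcK x : cK (delC x) = del (cK x).
  apply: (der_ratfun_eq (h := cK) (D1 := cK \o delC) (D2 := del \o cK) iF_inj F_frac) => [x' y|x' y|p] /=.
  - by rewrite (derM delCP) rmorphD !rmorphM.
  - by rewrite rmorphM (derM delP).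
  by rewrite delCF !cKP delF rmorphM /= map_polyX deriv_map.
have dLh x : dL (h (cK x)) = h (cK (delC x)).
  rewrite !(tensor_ratfun_map T_tensor cKP hP) sdL_palg.2; congr (_ (j _)).
  by apply: val_inj; rewrite palg_derE; exact: (pder_ratfun delCP delCF).
(* The entries of A come from C(z) through [cK], where [dL], [del] and [delC] agree. On [Ct] the
   derivation [del] is 0 whereas [dL] extends [dC]. *)
have dLA x y l : dL (h (iter l del (A x y))) = h (iter l.+1 del (A x y)).
  have it m z : iter m del (cK z) = cK (iter m delC z) by elim: m => //= m ->; rewrite delcK.
  by rewrite AE mxE !it dLh -iterS.
have sP := size_lin_prod a'0; have sQ' : (size Q' <= n.+1)%N by rewrite size_lin_prod.
have P00 := lin_prod_coef0 a'; have Q00 := lin_prod_coef0 (fun x => b' x / q').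
have PQ := lin_prod_PQ q'0 a'0 b'0 ab'; have QP := lin_prod_QP q'0 a'0 b'0 ab'.
have PP_ratio := lin_prod_ratio a'0 a'_ratio.
have sQa x : sQ (in_alg Q x) = in_alg Q (sL x) by exact: (sQ_alg S_PV sdQ).
have dQa x : dQ (in_alg Q x) = in_alg Q (dL x) by exact: (dQ_alg S_PV sdQ).
have sdQC := quotient_sd S_PV Q_quot dQ_der sdQ.
have sol W : solution AL sQ W -> map_mx sQ W = map_mx (in_alg Q \o h) A *m W.
  by move=> [_ ->]; rewrite ALE -map_mx_comp.
have dev_eq0' W : solution AL sQ W -> forall t, dev (in_alg Q) dQ W t = 0 <-> dpoly (dlevel t) t = 0.
  move=> W_sol; exact: (dev_eq0 iK_inj K_frac Ct_alg charCt q'0 q'1 sigP delP delF lam'0 sP sQ' P00 Q00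
    PQ QP PP_ratio h_int sLh dLA dQ_der sdQC sQa dQa W_sol.1 (sol _ W_sol)).
have dev_mul_eq0' W : solution AL sQ W -> forall t u,
    dev (in_alg Q) dQ W t * dev (in_alg Q) dQ W u = 0 -> dev (in_alg Q) dQ W t = 0 \/ dev (in_alg Q) dQ W u = 0.
  move=> W_sol t u; exact: (dev_mul_eq0 iK_inj K_frac Ct_alg charCt q'0 q'1 sigP delP delF lam'0 sP sQ' P00 Q00
    PQ QP PP_ratio h_int sLh dLA dQ_der sdQC sQa dQa W_sol.1 (sol _ W_sol)).
have V_sol : solution AL sQ (map_mx e U) := image_solution S_PV sdQ.
have Q_unit (x : Q) : x != 0 -> x \is a GRing.unit.
  exact: (quotient_unit S_PV Q_quot dQ_der sdQ dev_mul_eq0').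
pose gK : {rmorphism K -> Q} := embK h (in_alg Q).
have neq0 N (p : mpoly #|{: 'I_N * 'I_n.+1 * 'I_n.+1}| K) :
    p != 0 -> mmap gK (dval dQ (map_mx e U) (N := N)) p != 0.
  exact: (kvalue_neq0 iK_inj K_frac Ct_alg charCt q'0 q'1 sigP delP delF lam'0 sP sQ' P00 Q00
    PQ QP PP_ratio sLh dLA dQ_der sdQC sQa dQa V_sol.1 (sol _ V_sol)).
apply: (galois_imageE dL_der S_PV Q_quot dQ_der sdQ dev_eq0' dev_mul_eq0'
  (i := GRing.RMorphism.clone _ _ (@FracField.tofrac T \o i) _)) => [x|f sf] /=.
  exact: sdL_Ct.1.
have := sigma_constant iK_inj K_frac Ct_alg charCt q'0 q'1 sigP delP delF lam'0 sP sQ' P00 Q00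
  PQ QP PP_ratio (g := gK) (sB := sQ) dQ_der sdQC _ _ Q_unit V_sol.1 (sol _ V_sol) neq0 _ sf.
case=> [x|l x y|f'|x ->].
- by rewrite /= sQa sLh.
- by rewrite /= dQa dLA.
- have [t [d [du E]]] := quotient_value S_PV Q_quot dQ_der sdQ f'.
  have d0 : dev (in_alg Q) dQ (map_mx e U) d != 0 by apply: contraTneq du => ->; rewrite unitr0.
  exact: (@value_algebraic K L h n.+1 Q (in_alg Q) gK dQ (map_mx e U) h_int (fun=> erefl) Q_unit neq0 f' t d d0 E).
by exists x; rewrite /= (tensor_ratfunC hP).
Qed.

End HypergeometricGaloisGroup.

Theorem corollary3p6 (R : realType) (logq q : R[i]) (n s : nat)
    (a : 'I_n -> R[i]) (b : 'I_s -> R[i]) (lam : R[i])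
    (alpha : 'I_n -> R) (beta : 'I_s -> R)
    (q_log : cexp logq = q) (q_gt0 : 0 < `|q|) (q_lt1 : `|q| < 1)
    (n_ge2 : (2 <= n)%N) (s_ge1 : (0 < s)%N) (s_lt_n : (s < n)%N)
    (a_alpha : forall i, a i = qpower logq (alpha i))
    (b_beta : forall j, b j = qpower logq (beta j))
    (b_qN : forall j (m : nat), b j != q ^- m)
    (lam_neq0 : lam != 0)
    (alpha_beta : forall i j, alpha i - beta j \isn't a Num.int)
    (gen_connected : connected (generated_algebraic_group
       (diag_mx (\row_i cexp (Complex 0 (2 * pi * alpha i)))))) :
  (forall (qr : nat -> R[i]) (qr_root : root_system q qr)
     (Ct : fieldType) (dC : Ct -> Ct) (c : {rmorphism R[i] -> Ct})
     (Ct_closed : differentially_closed dC) (c_const : forall x, dC (c x) = 0)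
     (T : idomainType)
     (i : {rmorphism Ct -> T}) (j : {rmorphism palg R[i] -> T})
     (T_tensor : is_tensor_product c (@palg_const R[i]) i j)
     (sL : {rmorphism {fraction T} -> {fraction T}})
     (dL : {fraction T} -> {fraction T})
     (dL_der : derivation dL)
     (sdL_Ct : sd_extension (fun x => FracField.tofrac (i x)) id dC sL dL)
     (sdL_palg : sd_extension (fun x => FracField.tofrac (j x))
                   (palg_sigma qr) (@palg_der R[i]) sL dL)
     (S : comUnitAlgType {fraction T}) (sS : {rmorphism S -> S}) (dS : S -> S)
     (U : 'M[S]_n)
     (S_PV : is_PV_ring sL dL
        (map_mx (fun x => FracField.tofrac (j (ratfun_palg x)))
           (companion_system n (hyp_op q a b lam))) sS dS U)
     (Q : comUnitAlgType {fraction T}) (e : {lrmorphism S -> Q})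
     (Q_quot : is_total_quotient_ring e)
     (sQ : {rmorphism Q -> Q}) (dQ : Q -> Q)
     (dQ_der : derivation dQ) (sdQ : sd_extension e sS dS sQ dQ),
     sd_galois_image sQ dQ (map_mx e U) =
     (fun M : 'M[Ct]_n => map_mx (fun x => (FracField.tofrac (i x))%:A) M)
       @` [set M | M \in unitmx])
  /\
  (b (Ordinal s_ge1) = q ->
   diff_alg_independent (@ratfun_puiseux R[i]) (@pder R[i])
     (fun k : 'I_n =>
        powser (iter k (powser_sigma q) (hypergeometric q a b lam)))).
Proof.
have q0 : q != 0 by rewrite -normr_gt0.
have q1 := not_root1 q_lt1.
have ab := nonresonant q_log q_lt1 a_alpha b_beta alpha_beta.
have ratio := connected_ratio q_log q_lt1 a_alpha gen_connected.
have a0 i : a i != 0 by rewrite a_alpha qpower_neq0.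
have b0 j : b j != 0 by rewrite b_beta qpower_neq0.
case: n n_ge2 s_lt_n a alpha a_alpha alpha_beta gen_connected ab ratio a0 =>
  // n' _; rewrite ltnS => s_le a' alpha' _ _ _ ab ratio a0.
split=> [qr qr_root Ct dC c Ct_closed c_const T i j T_tensor sL dL dL_der sdL_Ct sdL_palg S sS dS U S_PV
         Q e Q_quot sQ dQ dQ_der sdQ|b_q].
  (* [ratio] is used with the power n'.+1, the size of the system: this power comes from the
     determinant taken in [comp_scalar_commutants]. *)
  exact: (hypergeometric_galois_group q0 q1 s_le lam_neq0 a0 b0 ab (fun i l => ratio i l n') qr_root Ct_closed
    T_tensor dL_der sdL_Ct sdL_palg S_PV Q_quot dQ_der sdQ).
exact: (hypergeometric_independent q_log q0 s_le lam_neq0 a0 b0 b_qN (ex_intro _ _ b_q) q1 ab (fun i l => ratio i l n')).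
Qed.
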